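(* Let $0<p,q,s,t<\infty$ and $\alpha,\beta>-n-1$, and let $\varphi:\mathbb{C}\to\mathbb{C}$ be a function. Then the superposition operator $S_{\varphi}$ maps $\mathcal{HT}^{p}_{q,\alpha}$ into $\mathcal{HT}^{t}_{s,\beta}$ if and only if $\varphi$ is a polynomial of degree $N$, where $N$ satisfies (i) $N\leq\frac{pq(t(n+1+\beta)+ns)}{st(p(n+1+\alpha)+nq)}$ in the case of $p(n+1+\alpha)/q<t(n+1+\beta)/s$; (ii) $N\leq\frac{q(n+1+\beta)}{s(n+1+\alpha)}$ in the case of $p(n+1+\alpha)/q\geq t(n+1+\beta)/s$ and $\alpha\leq\beta$; (iii) $N<\frac{q(n+1+\beta)}{s(n+1+\alpha)}$ in the case of $p(n+1+\alpha)/q\geq t(n+1+\beta)/s$ and $\alpha>\beta$. Moreover, if $S_{\varphi}$ maps $\mathcal{HT}^{p}_{q,\alpha}$ into $\mathcal{HT}^{t}_{s,\beta}$, then it is bounded and continuous.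
   Context: $n\ge 1$ is an integer, $\mathbb{B}_n$ is the open unit ball of $\mathbb{C}^n$, $\mathbb{S}_n=\partial\mathbb{B}_n$, $\langle z,w\rangle=\sum_j z_j\overline{w_j}$, $d\sigma$ is the normalized area measure on $\mathbb{S}_n$, $dv$ is the normalized Lebesgue measure on $\mathbb{B}_n$, and $\mathcal{H}(\mathbb{B}_n)$ is the set of holomorphic functions on $\mathbb{B}_n$. For $\xi\in\mathbb{S}_n$, $\Gamma(\xi)=\{z\in\mathbb{B}_n:|1-\langle z,\xi\rangle|<1-|z|^2\}$. For $0<p,q<\infty$ and $\alpha>-n-1$, the Hardy type tent space $\mathcal{HT}^p_{q,\alpha}$ consists of the $f\in\mathcal{H}(\mathbb{B}_n)$ with $$\|f\|_{\mathcal{HT}^p_{q,\alpha}}=\left(\int_{\mathbb{S}_n}\left(\int_{\Gamma(\xi)}|f(z)|^q(1-|z|^2)^{\alpha}dv(z)\right)^{p/q}d\sigma(\xi)\right)^{1/p}<\infty.$$ For a function $\varphi$ on $\mathbb{C}$, the superposition operator is $S_\varphi f=\varphi\circ f$. It maps $X$ into $Y$ if $\varphi\circ f\in Y$ for every $f\in X$. A (nonlinear) operator between quasi-normed spaces is bounded if it maps bounded sets to bounded sets, and continuous if it is continuous for the quasi-norm topologies. Constant functions (including $0$) are regarded as polynomials of degree $0$. *)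

(* Defs.v *)
From HB Require Import structures.
From mathcomp Require Import all_boot all_order all_algebra.
From mathcomp Require Import complex lra.
From mathcomp Require Import all_classical all_reals all_analysis.
From mathcomp Require Import measurable_realfun.

Set Implicit Arguments.
Unset Strict Implicit.
Unset Printing Implicit Defensive.

Import Order.TTheory GRing.Theory Num.Theory.
Import numFieldNormedType.Exports.

Local Open Scope classical_set_scope.
Local Open Scope ring_scope.

Section image_measure.
Local Open Scope ereal_scope.
Context d d' (T : measurableType d) (T' : measurableType d') (R : realType).
Variables (m : {measure set T -> \bar R}) (f : {mfun T >-> T'}).

Definition image_measure : set T' -> \bar R := pushforward m f.

Let image_measure0 : image_measure set0 = 0.
Proof. by rewrite /image_measure /pushforward preimage_set0 measure0. Qed.

Let image_measure_ge0 A : 0 <= image_measure A.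
Proof. by rewrite /image_measure /pushforward. Qed.

Let image_measure_sigma_additive : semi_sigma_additive image_measure.
Proof.
move=> F mF tF mUF; rewrite /image_measure /pushforward preimage_bigcup.
have mfF A : measurable A -> measurable (f @^-1` A).
  by move=> mA; rewrite -[X in measurable X]setTI; exact: measurable_funPT.
apply: measure_semi_sigma_additive => [i||].
- exact: mfF.
- apply/trivIsetP => /= i j _ _ ij; rewrite -preimage_setI.
  by move/trivIsetP : tF => /(_ _ _ _ _ ij) ->//; rewrite preimage_set0.
- by rewrite -preimage_bigcup; exact: mfF.
Qed.

HB.instance Definition _ := isMeasure.Build _ _ _ image_measure
  image_measure0 image_measure_ge0 image_measure_sigma_additive.

End image_measure.

Section tuple_measure.
Local Open Scope ereal_scope.
Context d (T : measurableType d) (R : realType).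

Definition tuple_cons n (x : (T * n.-tuple T)%type) : n.+1.-tuple T :=
  [the n.+1.-tuple T of x.1 :: x.2].

Let measurable_tuple_cons n :
  measurable_fun [set: (T * n.-tuple T)%type] (@tuple_cons n).
Proof. exact: measurable_cons. Qed.

HB.instance Definition _ n := isMeasurableFun.Build _ _ _ _ (@tuple_cons n)
  (@measurable_tuple_cons n).

Section cons_measure.
Variables (mu : {sigma_finite_measure set T -> \bar R}) (n : nat).
Variable m : {sigma_finite_measure set (n.-tuple T) -> \bar R}.

Definition cons_measure : set (n.+1.-tuple T) -> \bar R :=
  image_measure (mu \x m) (@tuple_cons n).

HB.instance Definition _ := Measure.on cons_measure.

Let cons_measure_sigma_finite : sigma_finite [set: n.+1.-tuple T] cons_measure.
Proof.
have /sigma_finiteP[F [TF ndF Foo]] := sigma_finiteT mu.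
have /sigma_finiteP[G [TG ndG Goo]] := sigma_finiteT m.
pose g (y : n.+1.-tuple T) : (T * n.-tuple T)%type :=
  (thead y, [tuple of behead y]).
have mg : measurable_fun [set: n.+1.-tuple T] g.
  apply/measurable_fun_pairP; split => /=.
    exact: measurable_tnth.
  exact: measurable_behead.
have gK x : g (tuple_cons x) = x.
  by case: x => a y; rewrite /g /tuple_cons/=; congr pair; apply: val_inj.
exists (fun i => g @^-1` (F i `*` G i)).
  rewrite -preimage_bigcup -(@preimage_setT _ _ g); congr (_ @^-1` _).
  rewrite -setXTT TF TG predeqE => -[x y]; split.
    move=> [/= [i _ Fnx] [k _ Gky]]; exists (maxn i k) => //; split.
    - by move: x Fnx; exact/subsetPset/ndF/leq_maxl.
    - by move: y Gky; exact/subsetPset/ndG/leq_maxr.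
  by move=> [i _ []/= ? ?]; split; exists i.
move=> i; have [mFi Fioo] := Foo i; have [mGi Gioo] := Goo i; split.
  by rewrite -[X in measurable X]setTI; apply: mg => //; exact: measurableX.
rewrite /cons_measure /image_measure /pushforward -comp_preimage.
rewrite (_ : g \o @tuple_cons n = id); last by apply/funext => x; exact: gK.
rewrite preimage_id.
rewrite [X in X < _](product_measure1E mu m mFi mGi).
by rewrite lte_mul_pinfty// ge0_fin_numE.
Qed.

HB.instance Definition _ := Measure_isSigmaFinite.Build _ _ _ cons_measure
  cons_measure_sigma_finite.

End cons_measure.

(* The n-fold product measure mu \x ... \x mu on T^n. *)
Fixpoint tuple_measure (mu : {sigma_finite_measure set T -> \bar R}) (n : nat) :
    {sigma_finite_measure set (n.-tuple T) -> \bar R} :=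
  match n with
  | 0 => @dirac _ (0.-tuple T) [tuple] R
  | m.+1 => cons_measure mu (tuple_measure mu m)
  end.

End tuple_measure.

(* R[i] as a numClosedFieldType, so that it inherits the topology, the norm and
   the normed module structure (over itself) of numClosedFieldType. *)
Definition cplx (R : realType) : numClosedFieldType := R[i].

(* C^n with its Borel sigma-algebra. *)
Definition Cn (R : realType) (n : nat) :=
  g_sigma_algebraType (@open 'rV[cplx R]_n).

HB.instance Definition _ (R : realType) n := Measurable.on (Cn R n).

Section geometry.
Context (R : realType) (n : nat).
Implicit Types (z w : 'rV[cplx R]_n).

Definition cabs (x : cplx R) : R := complex.Re `|x|.

Definition cdot z w : cplx R := \sum_(j < n) z 0 j * (w 0 j)^*.

(* The Euclidean norm; the library norm of 'rV[cplx R]_n is the sup norm, which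
   is only used through the topology it induces. *)
Definition enorm z : R := Num.sqrt (\sum_(j < n) cabs (z 0 j) ^+ 2).

Definition cball : set (Cn R n) := [set z | enorm z < 1].

Definition csphere : set (Cn R n) := [set z | enorm z = 1].

Definition koranyi (xi : Cn R n) : set (Cn R n) :=
  [set z | cball z /\ cabs (1 - cdot z xi) < 1 - enorm z ^+ 2].

Lemma cabsE (x : cplx R) : `|x| = (cabs x)%:C%C.
Proof. by rewrite /cabs; case: x => a b; rewrite normc_def. Qed.

Lemma cabs_real (a : R) : `|(a%:C%C : cplx R)| = `|a|%:C%C.
Proof.
by apply: etrans (normc_def _) _; rewrite /= expr0n/= addr0 sqrtr_sqr.
Qed.

Lemma cabs_le (a b : R) : cabs (a +i* b)%C <= `|a| + `|b|.
Proof.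
have -> : cabs (a +i* b)%C = Num.sqrt (a ^+ 2 + b ^+ 2).
  by rewrite /cabs normc_def.
rewrite -[leRHS]ger0_norm ?addr_ge0// -sqrtr_sqr ler_wsqrtr//.
rewrite sqrrD !real_normK ?num_real// -addrA lerD2l lerDr.
by rewrite mulrn_wge0// mulr_ge0.
Qed.

Lemma continuous_cabs : continuous cabs.
Proof.
move=> x; apply/(@cvgrPdist_lt R R _ (nbhs x)) => e e0.
have e0C : 0 < (e%:C%C : cplx R) by rewrite ltcR.
apply: filterS (nbhsx_ballx x _ e0C) => y /=.
rewrite /ball/= /ball_/= => xy.
rewrite -ltcR; apply: le_lt_trans xy.
have := ler_dist_dist x y.
by rewrite (cabsE x) (cabsE y) -(rmorphB (real_complex R)) cabs_real.
Qed.

Lemma continuous_enorm : continuous enorm.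
Proof.
move=> z; apply: continuous_comp; last exact: sqrt_continuous.
apply: continuous_big => [|j _ {}z]; first exact: add_continuous.
by apply: (@cvgM R _ (nbhs z)); apply: continuous_comp;
  solve [exact: coord_continuous | exact: continuous_cabs].
Qed.

Lemma measurable_open (A : set (Cn R n)) :
  open (A : set 'rV[cplx R]_n) -> measurable A.
Proof. by move=> oA; exact: sub_sigma_algebra. Qed.

Lemma open_cball : open (cball : set 'rV[cplx R]_n).
Proof.
exact: ((@continuousP _ _ enorm).1 continuous_enorm _ (@open_lt R 1)).
Qed.

Lemma measurable_cball : measurable cball.
Proof. by apply: measurable_open; exact: open_cball. Qed.

(* R^(2n) ~ C^n: the first n coordinates are the real parts, the last n the
   imaginary parts. *)
Definition cvec (t : (n + n).-tuple (measurableTypeR R)) : Cn R n :=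
  \row_j ((tnth t (lshift n j)) +i* (tnth t (rshift n j)))%C.

Let measurable_cvec : measurable_fun setT cvec.
Proof.
apply: (@measurability _ _ _ (Cn R n) setT _ (@open 'rV[cplx R]_n)) => //.
move=> _ [A oA <-]; rewrite setTI.
pose box (q : (n + n).-tuple rat * nat) : set ((n + n).-tuple (measurableTypeR R)) :=
  \bigcap_(i in [set: 'I_(n + n)])
    ((@tnth _ (measurableTypeR R))^~ i @^-1` ball (ratr (tnth q.1 i) : R) q.2.+1%:R^-1).
pose D := [set q | box q `<=` cvec @^-1` A].
have mbox q : measurable (box q).
  apply: fin_bigcap_measurable => // i _; rewrite -[X in measurable X]setTI.
  apply: measurable_tnth => //; exact: measurable_ball.
suff -> : cvec @^-1` A = \bigcup_q (if q \in D then box q else set0).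
  apply: countable_bigcupT_measurable => // q.
  by case: ifP => // _; exact: mbox.
apply/seteqP; split => [t At|t [q _]]; last first.
  by case: ifPn => //; rewrite inE; exact.
have /nbhs_ballP[e e0 eA] : nbhs (cvec t : 'rV[cplx R]_n) A.
  by apply: open_nbhs_nbhs; split.
have [e' e'0 ee] : exists2 e', 0 < e' & e = e'%:C%C.
  exists (complex.Re e).
    by move: e0; case: (e) => a b; rewrite /= ltcE/= => /andP[].
  by move: e0; case: (e) => a b; rewrite /= ltcE/= => /andP[/eqP-> _].
have [k] : exists k, 0 + k.+1%:R^-1 < e' / 4 by apply: ltr_add_invr; rewrite divr_gt0.
rewrite add0r => ke.
have /choice[q Hq] i : exists q : rat, ball (ratr q : R) k.+1%:R^-1 (tnth t i).
  have [|q] := @rat_in_itvoo R (tnth t i - k.+1%:R^-1) (tnth t i + k.+1%:R^-1).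
    by rewrite ltrD2l gtrN// invr_gt0.
  rewrite in_itv/= => /andP[q1 q2]; exists q; rewrite /ball/=.
  by rewrite ltr_distl q1 q2.
exists ([tuple q i | i < n + n], k) => //; rewrite ifT.
  by move=> i _ /=; rewrite tnth_mktuple.
rewrite inE => s bs; apply: eA; split => // i j.
rewrite !mxE ee /ball/= /ball_/= cabsE ltcR.
have H i0 : `|tnth t i0 - tnth s i0| < e' / 2.
  have /lt_trans/(_ ke) h1 := Hq i0.
  have := bs i0 Logic.I; rewrite /ball/= tnth_mktuple => /lt_trans/(_ ke) h2.
  apply: le_lt_trans (ler_distD (ratr (q i0)) _ _) _.
  by rewrite (_ : e' / 2 = e' / 4 + e' / 4) 1?distrC ?ltrD//; lra.
apply: le_lt_trans (cabs_le _ _) _.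
have /= := H (lshift n j); have /= := H (rshift n j); lra.
Qed.

HB.instance Definition _ := isMeasurableFun.Build _ _ _ _ cvec measurable_cvec.

(* z |-> z / |z|, and 0 |-> 0 *)
Definition cproj (z : Cn R n) : Cn R n := ((enorm z)^-1)%:C%C *: z.

Let measurable_cproj : measurable_fun setT cproj.
Proof.
apply: (@measurability _ _ _ (Cn R n) setT _ (@open 'rV[cplx R]_n)) => //.
move=> _ [A oA <-]; rewrite setTI.
pose Z := [set z : Cn R n | enorm z != 0].
have oZ : open (Z : set 'rV[cplx R]_n).
  exact: ((@continuousP _ _ enorm).1 continuous_enorm _ (@open_neq R 0)).
rewrite -(setIT (cproj @^-1` A)) -(setvU Z) setIUr; apply: measurableU.
  have pZ z : (~` Z) z -> cproj z = 0.
    by move=> /negP; rewrite negbK => /eqP z0; rewrite /cproj z0 invr0 scale0r.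
  have [A0|A0] := pselect (A 0).
    suff -> : cproj @^-1` A `&` ~` Z = ~` Z.
      by apply: measurableC; exact: measurable_open.
    by apply/seteqP; split => [z []//|z Zz]; split => //=; rewrite pZ.
  suff -> : cproj @^-1` A `&` ~` Z = set0 by [].
  by apply/seteqP; split => [z [] /= + /pZ z0|//]; rewrite z0.
apply: measurable_open; rewrite openE => z [Az Zz]; apply: filterI; last first.
  by apply: open_nbhs_nbhs; split.
have : nbhs (cproj z : 'rV[cplx R]_n) A by apply: open_nbhs_nbhs; split.
suff : {for z, continuous (cproj : 'rV[cplx R]_n -> 'rV[cplx R]_n)} by exact.
apply: (@cvgZ _ _ _ (nbhs z)); last exact: cvg_id.
apply: (@continuous_comp _ _ _ (fun z => (enorm z)^-1)
  (real_complex R : R -> cplx R)).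
  by apply: (@cvgV R _ (nbhs z)) => //; exact: continuous_enorm.
move=> B /nbhs_ballP[e e0 eB].
have [a0 a1] : 0 < complex.Re e /\ e = (complex.Re e)%:C%C.
  by move: e0; case: (e) => a b; rewrite /= ltcE/= => /andP[/eqP-> ?].
apply/nbhs_ballP; exists (complex.Re e) => //= x xe; apply: eB.
rewrite /ball/= /ball_/= a1 -(rmorphB (real_complex R)) cabs_real ltcR.
exact: xe.
Qed.

HB.instance Definition _ := isMeasurableFun.Build _ _ _ _ cproj measurable_cproj.

End geometry.

Section measures.
Variables (R : realType) (n : nat).

Definition lebesgue_Cn : {measure set (Cn R n) -> \bar R} :=
  image_measure (tuple_measure (@lebesgue_measure R) (n + n)) (@cvec R n).

(* Normalized Lebesgue measure dv on the ball; the second argument of mnormalize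
   is its value when the total mass is 0 or +oo, which does not happen here. *)
Definition ball_measure : probability (Cn R n) R :=
  mnormalize (mrestr lebesgue_Cn (@measurable_cball R n))
    (@dirac _ (Cn R n) 0 R).

(* Normalized area measure d(sigma) on the sphere, defined as usual by polar
   coordinates: the area of a set E of unit vectors is proportional to the volume
   of the cone {r * xi | 0 < r < 1, xi in E}. *)
Definition sphere_measure : probability (Cn R n) R :=
  distribution ball_measure (@cproj R n).

End measures.

Section tent_spaces.
Variables (R : realType) (n : nat).
Implicit Types (p q alpha : R) (f g : 'rV[cplx R]_n -> cplx R).

(* Complex differentiability, 'rV[cplx R]_n being a normed module over cplx R. *)
Definition holomorphic_ball f : Prop :=
  forall z : 'rV[cplx R]_n, @cball R n z -> differentiable f z.

Definition HTnorm p q alpha f : \bar R :=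
  ((\int[@sphere_measure R n]_(xi in @csphere R n)
      (\int[@ball_measure R n]_(z in koranyi xi)
         (cabs (f z) `^ q * (1 - enorm z ^+ 2) `^ alpha)%:E) `^ (p / q))
    `^ p^-1)%E.

(* Elements are represented by functions on C^n, whose values outside the ball
   are irrelevant. *)
Definition HT p q alpha : set ('rV[cplx R]_n -> cplx R) :=
  [set f | holomorphic_ball f /\ (HTnorm p q alpha f < +oo)%E].

Definition HT_bounded p q alpha (A : set ('rV[cplx R]_n -> cplx R)) : Prop :=
  A `<=` HT p q alpha /\
  exists M : R, forall f, A f -> (HTnorm p q alpha f <= M%:E)%E.

Definition superposition (phi : cplx R -> cplx R) f : 'rV[cplx R]_n -> cplx R :=
  phi \o f.

Section operators.
Variables (p q alpha t s beta : R).
Variable S : ('rV[cplx R]_n -> cplx R) -> ('rV[cplx R]_n -> cplx R).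

Definition HT_maps : Prop := forall f, HT p q alpha f -> HT t s beta (S f).

Definition HT_bounded_op : Prop :=
  forall A, HT_bounded p q alpha A -> HT_bounded t s beta (S @` A).

(* Continuity for the quasi-norm topologies of the domain and codomain. *)
Definition HT_continuous_op : Prop :=
  forall f, HT p q alpha f -> forall e : R, 0 < e ->
  exists2 d : R, 0 < d & forall g, HT p q alpha g ->
    (HTnorm p q alpha (g \- f)%R < d%:E)%E ->
    (HTnorm t s beta (S g \- S f)%R < e%:E)%E.

End operators.

End tent_spaces.

(* Main.v *)
(* Write h(z) = 1 - |z|^2 and kappa = (n + 1 + alpha) / q.

   Sufficiency. By subharmonicity and a Vitali covering argument, the maximal function of
   |f| h^kappa over Koranyi regions is in L^p(sigma), and |f| = O(h^-(n/p + kappa)) pointwise.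
   Cutting each region at the height where the two bounds agree bounds the (tN, sN, beta) tent
   norm of f by its (p, q, alpha) norm, and |P(w)| = O(max(1, |w|)^N). The same estimate for
   |P(z + w) - P(z)| <= e max(1, |z|)^N + C |w|^N gives continuity.

   Necessity. Composition with b z_1 shows that phi is entire. The functions w (1 - z_1)^-c,
   with c dyadic so that iterated square roots suffice, are in the domain for
   kappa < c < n/p + kappa and cover a neighbourhood of infinity, so the growth of phi o f makes
   phi a polynomial and bounds its degree by the ratio of the two growth exponents. The other
   bound comes from lacunary series f = sum_k a_k W_k where W_k, a sum of <z, xi>^(M_k) over a
   lattice of unit vectors xi of mesh about M_k^(-1/2), is bounded by exp(- M_k h / 4) and, for
   one of finitely many translates of the lattice, at least 1/2 at a given point of height
   about 1/M_k near e_1. With a_k = M_k^kappa (k + 1)^-g and g q > 1, f is in the domain, while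
   the area integrals of P o f, summed over the translates, diverge near e_1 unless
   N kappa < (n + 1 + beta) / s, or equality holds and q <= N s. *)

Require Import Defs.
From HB Require Import structures.
From mathcomp Require Import all_boot all_order all_algebra.
From mathcomp Require Import complex ring lra zify.
From mathcomp Require Import all_classical all_reals all_analysis.
From mathcomp Require Import measurable_realfun.

Set Implicit Arguments.
Unset Strict Implicit.
Unset Printing Implicit Defensive.

Import Order.TTheory GRing.Theory Num.Theory.
Import numFieldNormedType.Exports.

Local Open Scope classical_set_scope.
Local Open Scope ring_scope.

(** * One complex variable *)

(** Write kappa' = (n + 1 + beta) / s. A polynomial of degree N >= 1 acts as required once f lies in
    the tent space with indices (t N, s N, beta), whose area and growth exponents are kappa' / N and
    (n / t + kappa') / N, against kappa and n / p + kappa for the domain. If p < t N the growth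
    exponents decide, otherwise the area exponents; when the latter agree one also needs q <= s N.
    Since equality reads N s (n + 1 + alpha) = q (n + 1 + beta), this amounts to alpha <= beta:
    hence the split between (ii) and (iii). In degree 0 a small real number replaces N. All function
    theory rests on one inequality: 4 |G(0)| is at most the integral of |G| over the boundary of a
    square. It gives Liouville's theorem and, averaged over complex lines, the submean inequality.
    As no uniform bound on the operator is known beforehand, each use of the hypothesis is confined
    to finitely many test functions. From the geometry of caps on, the dimension is n.+1, so n + 1
    and n appear as n.+2 and n.+1. *)

Section cabs_theory.
Context {R : realType}.
Implicit Types (x y z w : cplx R) (a b : R).

Definition mkc a b : cplx R := (a +i* b)%C.
Definition cre z : R := complex.Re z.
Definition cim z : R := complex.Im z.
Definition cr a : cplx R := (a%:C)%C.

Lemma mkcK z : mkc (cre z) (cim z) = z. Proof. by case: z. Qed.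
Lemma cre_mkc a b : cre (mkc a b) = a. Proof. by []. Qed.
Lemma cim_mkc a b : cim (mkc a b) = b. Proof. by []. Qed.
Lemma creD z w : cre (z + w) = cre z + cre w. Proof. by case: z w => ? ? [? ?]. Qed.
Lemma cimD z w : cim (z + w) = cim z + cim w. Proof. by case: z w => ? ? [? ?]. Qed.
Lemma creN z : cre (- z) = - cre z. Proof. by case: z. Qed.
Lemma cimN z : cim (- z) = - cim z. Proof. by case: z. Qed.
Lemma creB z w : cre (z - w) = cre z - cre w. Proof. by rewrite creD creN. Qed.
Lemma cimB z w : cim (z - w) = cim z - cim w. Proof. by rewrite cimD cimN. Qed.
Lemma creM z w : cre (z * w) = cre z * cre w - cim z * cim w.
Proof. by case: z w => ? ? [? ?]. Qed.
Lemma cimM z w : cim (z * w) = cre z * cim w + cim z * cre w.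
Proof. by case: z w => ? ? [? ?]. Qed.
Lemma creJ z : cre (z^*) = cre z. Proof. by case: z. Qed.
Lemma cimJ z : cim (z^*) = - cim z. Proof. by case: z. Qed.
Lemma cre_cr a : cre (cr a) = a. Proof. by []. Qed.
Lemma cim_cr a : cim (cr a) = 0. Proof. by []. Qed.
Lemma cre0 : cre 0 = 0. Proof. by []. Qed.
Lemma cim0 : cim 0 = 0. Proof. by []. Qed.
Lemma cre1 : cre 1 = 1. Proof. by []. Qed.
Lemma cim1 : cim 1 = 0. Proof. by []. Qed.

Definition cE := (cre_mkc, cim_mkc, creB, cimB, creD, cimD, creN, cimN, creM, cimM, creJ, cimJ,
  cre_cr, cim_cr, cre0, cim0, cre1, cim1).

Lemma ceq z w : cre z = cre w -> cim z = cim w -> z = w.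
Proof. by case: z w => a b [c d] /= -> ->. Qed.

Lemma cr0 : cr 0 = 0. Proof. by []. Qed.
Lemma cr1 : cr 1 = 1. Proof. by []. Qed.
Lemma crD a b : cr (a + b) = cr a + cr b. Proof. by apply: ceq; rewrite !cE ?addr0. Qed.
Lemma crN a : cr (- a) = - cr a. Proof. by apply: ceq; rewrite !cE ?oppr0. Qed.
Lemma crB a b : cr (a - b) = cr a - cr b. Proof. by rewrite crD crN. Qed.
Lemma crM a b : cr (a * b) = cr a * cr b. Proof. by apply: ceq; rewrite !cE; lra. Qed.

Lemma cabs_def z : cabs z = Num.sqrt (cre z ^+ 2 + cim z ^+ 2).
Proof. by case: z => a b; rewrite /cabs normc_def. Qed.

Lemma cabs2 z : cabs z ^+ 2 = cre z ^+ 2 + cim z ^+ 2.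
Proof. by rewrite cabs_def sqr_sqrtr// addr_ge0 ?sqr_ge0. Qed.

Lemma cabs_ge0 z : 0 <= cabs z. Proof. by rewrite cabs_def sqrtr_ge0. Qed.

Lemma cabs0 : cabs (0 : cplx R) = 0. Proof. by rewrite /cabs normr0. Qed.
Lemma cabs1 : cabs (1 : cplx R) = 1. Proof. by rewrite /cabs normr1. Qed.
Lemma cabsN z : cabs (- z) = cabs z. Proof. by rewrite /cabs normrN. Qed.
Lemma cabsB z w : cabs (z - w) = cabs (w - z). Proof. by rewrite /cabs distrC. Qed.
Lemma cabsM z w : cabs (z * w) = cabs z * cabs w.
Proof. by apply: (@complexI R); rewrite rmorphM -!cabsE normrM. Qed.
Lemma cabsJ z : cabs (z^*) = cabs z. Proof. by rewrite !cabs_def !cE sqrrN. Qed.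
Lemma cabs_eq0 z : (cabs z == 0) = (z == 0).
Proof. by rewrite -(inj_eq (@complexI R)) -cabsE rmorph0 normr_eq0. Qed.
Lemma cabs_gt0 z : (0 < cabs z) = (z != 0).
Proof. by rewrite lt_neqAle cabs_ge0 andbT eq_sym cabs_eq0. Qed.
Lemma cabsX z k : cabs (z ^+ k) = cabs z ^+ k.
Proof. by elim: k => [|k IH]; rewrite ?expr0 ?cabs1// !exprS cabsM IH. Qed.
Lemma cabsV z : cabs (z^-1) = (cabs z)^-1.
Proof.
have [->|z0] := eqVneq z 0; first by rewrite invr0 cabs0 invr0.
have cz : cabs z != 0 by rewrite cabs_eq0.
by apply: (mulfI cz); rewrite -cabsM !mulfV// cabs1.
Qed.
Lemma cabs_cr a : cabs (cr a) = `|a|.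
Proof. by rewrite cabs_def !cE expr0n addr0 sqrtr_sqr. Qed.
Lemma cabs_triangle z w : cabs (z + w) <= cabs z + cabs w.
Proof.
by rewrite -lecR rmorphD -!cabsE; exact: ler_normD.
Qed.
Lemma cabs_leD z w : cabs z - cabs w <= cabs (z + w).
Proof. by rewrite lerBlDr -[in leLHS](addrK w z) -(cabsN w) cabs_triangle. Qed.
Lemma cabs_leB z w : cabs z - cabs w <= cabs (z - w).
Proof. by rewrite -(cabsN w) cabs_leD. Qed.
Lemma cre_le z : `|cre z| <= cabs z.
Proof. by rewrite cabs_def -[leLHS]sqrtr_sqr ler_wsqrtr// lerDl sqr_ge0. Qed.
Lemma cim_le z : `|cim z| <= cabs z.
Proof. by rewrite cabs_def -[leLHS]sqrtr_sqr ler_wsqrtr// lerDr sqr_ge0. Qed.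
Lemma cre_le_cabs z : cre z <= cabs z. Proof. exact: le_trans (ler_norm _) (cre_le z). Qed.
Lemma cabs_le_re_im z : cabs z <= `|cre z| + `|cim z|.
Proof. by rewrite -[z in leLHS]mkcK; exact: cabs_le. Qed.
Lemma cabs_sum (I : Type) (r : seq I) (P : pred I) (F : I -> cplx R) :
  cabs (\sum_(i <- r | P i) F i) <= \sum_(i <- r | P i) cabs (F i).
Proof.
elim/big_ind2: _ => [|u a v b ua vb|//]; first by rewrite cabs0.
exact: le_trans (cabs_triangle _ _) (lerD ua vb).
Qed.
Lemma cre_sum (I : Type) (r : seq I) (P : pred I) (F : I -> cplx R) :
  cre (\sum_(i <- r | P i) F i) = \sum_(i <- r | P i) cre (F i).
Proof. by elim/big_ind2: _ => // u a v b <- <-; rewrite creD. Qed.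
Lemma mulJ z : z * z^* = cr (cabs z ^+ 2).
Proof. by apply: ceq; rewrite !cE ?cabs2; lra. Qed.
Lemma mulJ2 z : z^* * z = cr (cabs z ^+ 2). Proof. by rewrite mulrC mulJ. Qed.

Lemma polar z : exists2 u : cplx R, cabs u = 1 & u * z = cr (cabs z).
Proof.
have [->|z0] := eqVneq z 0; first by exists 1; rewrite ?cabs1 // cabs0 mulr0.
have cz : cabs z != 0 by rewrite cabs_eq0.
exists (z^* * cr (cabs z)^-1).
  by rewrite cabsM cabsJ cabs_cr ger0_norm ?invr_ge0 ?cabs_ge0// mulfV.
by rewrite mulrAC mulJ2 -crM expr2 mulfK.
Qed.

(** A ball of [cplx R] has as radius a positive element of [cplx R], hence a real one. Restating
    neighbourhoods with radii in [R] lets all later estimates be made between real numbers. *)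
Lemma cnbhsP z (A : set (cplx R)) :
  nbhs z A <-> exists2 e : R, 0 < e & forall w, cabs (w - z) < e -> A w.
Proof.
split.
  move=> /nbhs_ballP[e e0 eA].
  have [a0 a1] : 0 < complex.Re e /\ e = (complex.Re e)%:C%C.
    by move: e0; case: (e) => a b; rewrite /= ltcE/= => /andP[/eqP-> ?].
  exists (complex.Re e) => // w wz; apply: eA.
  by rewrite /ball/= /ball_/= a1 distrC cabsE ltcR.
move=> [e e0 H]; apply/nbhs_ballP; exists (e%:C)%C; first by rewrite /= ltcR.
by move=> w; rewrite /ball/= /ball_/= distrC cabsE ltcR; exact: H.
Qed.

Lemma rnbhsP a (A : set R) :
  nbhs a A <-> exists2 e : R, 0 < e & forall b, `|b - a| < e -> A b.
Proof.
split => [/nbhs_ballP[e e0 eA]|[e e0 H]].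
  by exists e => // w wz; apply: eA; rewrite /ball/= /ball_/= distrC.
apply/nbhs_ballP; exists e => // w; rewrite /ball/= /ball_/= distrC; exact: H.
Qed.

Lemma ccvgP (T : topologicalType) (F : T -> cplx R) t :
  {for t, continuous F} <->
  forall e : R, 0 < e -> nbhs t [set s | cabs (F s - F t) < e].
Proof.
split => H.
  move=> e e0; apply: (H [set w | cabs (w - F t) < e]).
  by apply/cnbhsP; exists e.
move=> A /cnbhsP[e e0 eA]; apply: filterS (H _ e0) => s; exact: eA.
Qed.

Lemma rcvgP (T : topologicalType) (F : T -> R) t :
  {for t, continuous F} <->
  forall e : R, 0 < e -> nbhs t [set s | `|F s - F t| < e].
Proof.
split => H.
  move=> e e0; apply: (H [set w | `|w - F t| < e]).
  by apply/rnbhsP; exists e.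
move=> A /rnbhsP[e e0 eA]; apply: filterS (H _ e0) => s; exact: eA.
Qed.

Lemma continuous_cre : continuous cre.
Proof.
move=> z; apply/rcvgP => e e0; apply/cnbhsP; exists e => // w we /=.
by rewrite -creB (le_lt_trans (cre_le _)).
Qed.

Lemma continuous_cim : continuous cim.
Proof.
move=> z; apply/rcvgP => e e0; apply/cnbhsP; exists e => // w we /=.
by rewrite -cimB (le_lt_trans (cim_le _)).
Qed.

Lemma continuous_mkcx b : continuous (fun a => mkc a b).
Proof.
move=> z; apply/ccvgP => e e0; apply/rnbhsP; exists e => // w we /=.
have -> : mkc w b - mkc z b = cr (w - z) by apply: ceq; rewrite !cE ?subrr.
by rewrite cabs_cr.
Qed.

Lemma continuous_mkcy a : continuous (mkc a).
Proof.
move=> z; apply/ccvgP => e e0; apply/rnbhsP; exists e => // w we /=.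
have -> : mkc a w - mkc a z = mkc 0 (w - z) by apply: ceq; rewrite !cE ?subrr.
by rewrite cabs_def !cE expr0n add0r sqrtr_sqr.
Qed.

End cabs_theory.
#[global] Hint Extern 0 (is_true (@Order.le _ _ _ (cabs _))) => solve [apply: cabs_ge0] : core.

(** * Integrals of continuous functions over segments *)

Section rint.
Context {R : realType}.
Implicit Types (f g : R -> R) (a b c k : R).

Definition rint a b f : R := \int[lebesgue_measure]_(x in `[a, b]) f x.

Lemma rint_integrable f a b :
  continuous f -> lebesgue_measure.-integrable `[a, b] (EFin \o f).
Proof.
move=> cf; apply: continuous_compact_integrable; first exact: segment_compact.
exact: continuous_subspaceT.
Qed.

Lemma rintD f g a b : continuous f -> continuous g ->
  rint a b (fun x => f x + g x) = rint a b f + rint a b g.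
Proof. by move=> cf cg; rewrite /rint RintegralD//; exact: rint_integrable. Qed.

Lemma rintB f g a b : continuous f -> continuous g ->
  rint a b (fun x => f x - g x) = rint a b f - rint a b g.
Proof. by move=> cf cg; rewrite /rint RintegralB//; exact: rint_integrable. Qed.

Lemma rint_cst k a b : a <= b -> rint a b (fun=> k) = k * (b - a).
Proof.
move=> ab; rewrite /rint Rintegral_cst//= lebesgue_measure_itv/= lte_fin.
case: ltP => //= ba; congr (k * _); lra.
Qed.

Lemma eq_rint f g a b : (forall x, a <= x <= b -> f x = g x) -> rint a b f = rint a b g.
Proof.
by move=> fg; apply: eq_Rintegral => x; rewrite inE/= in_itv/=; exact: fg.
Qed.

Lemma rint_le f g a b : continuous f -> continuous g ->
  (forall x, a <= x <= b -> f x <= g x) -> rint a b f <= rint a b g.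
Proof.
by move=> cf cg fg; apply: le_Rintegral => //; exact: rint_integrable.
Qed.

Lemma rint_norm_le f g a b : continuous f -> continuous g ->
  (forall x, a <= x <= b -> `|f x| <= g x) -> `|rint a b f| <= rint a b g.
Proof.
move=> cf cg fg; apply: (@le_trans _ _ (rint a b (fun x => `|f x|))).
  by apply: le_normr_Rintegral => //; exact: rint_integrable.
apply: rint_le => // x; apply: continuous_comp; [exact: cf|exact: norm_continuous].
Qed.

Lemma rint_split f a b c : continuous f -> a <= b -> b <= c ->
  rint a c f = rint a b f + rint b c f.
Proof.
move=> cf ab bc; rewrite /rint -(@Rintegral_itv_obnd_cbnd _ b)//; last first.
  apply: integrableS (rint_integrable b c cf) => //.
  by apply: subset_itvr; rewrite bnd_simp.
rewrite -(@Rintegral_itvB _ f (BLeft a) (BRight c) b) ?bnd_simp//; last exact: rint_integrable.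
by rewrite addrC subrK.
Qed.

End rint.

(* lra compares its atoms up to conversion, which is slow unless they are variables. *)
Ltac name_atom t := let x := fresh "atom" in set (x := t) in *; clearbody x.

Ltac with_atoms tac :=
  repeat match goal with
  | H : ?T |- _ => lazymatch T with
    | is_true (@Order.le _ _ _ _) => fail
    | is_true (@Order.lt _ _ _ _) => fail
    | is_true (andb _ _) => fail
    | @eq ?U _ _ => lazymatch U with cplx _ => clear H | nat => clear H | bool => clear H | _ => fail end
    | _ => lazymatch type of T with Prop => clear H end
    end
  end;
  repeat match goal with
  | |- context [@cabs ?R ?z] => name_atom (@cabs R z)
  | H : _ |- _ => lazymatch type of H with context [@cabs ?R ?z] => name_atom (@cabs R z) end
  end;
  repeat match goal with
  | |- context [@rint ?R ?a ?b ?f] => name_atom (@rint R a b f)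
  | H : _ |- _ => lazymatch type of H with context [@rint ?R ?a ?b ?f] => name_atom (@rint R a b f) end
  end;
  repeat match goal with x := _ |- _ => clearbody x end; tac.

Ltac atom_lra := first [with_atoms ltac:(lra) | lra].
Ltac atom_nra := first [with_atoms ltac:(nra) | nra].

(** * Goursat's theorem on rectangles *)

Section goursat.
Context {R : realType}.
Implicit Types (F G : cplx R -> cplx R) (a b c d x y : R).

Lemma continuousD_r (f g : R -> R) : continuous f -> continuous g ->
  continuous (fun x => f x + g x).
Proof. by move=> cf cg x; apply: (@continuousD R R R f g x); [exact: cf|exact: cg]. Qed.
Lemma continuousB_r (f g : R -> R) : continuous f -> continuous g ->
  continuous (fun x => f x - g x).
Proof. by move=> cf cg x; apply: (@continuousB R R R f g x); [exact: cf|exact: cg]. Qed.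

Lemma continuous_hre F y : continuous F -> continuous (fun x => cre (F (mkc x y))).
Proof.
move=> cF x; apply: (@continuous_comp _ _ _ (fun x => F (mkc x y)) cre); last exact: continuous_cre.
by apply: (@continuous_comp _ _ _ (fun x => mkc x y) F); [exact: continuous_mkcx|exact: cF].
Qed.
Lemma continuous_vim F x : continuous F -> continuous (fun y => cim (F (mkc x y))).
Proof.
move=> cF y; apply: (@continuous_comp _ _ _ (fun y => F (mkc x y)) cim); last exact: continuous_cim.
by apply: (@continuous_comp _ _ _ (fun y => mkc x y) F); [exact: continuous_mkcy|exact: cF].
Qed.
Lemma continuous_hcabs F y : continuous F -> continuous (fun x => cabs (F (mkc x y))).
Proof.
move=> cF x; apply: (@continuous_comp _ _ _ (fun x => F (mkc x y)) (@cabs R)); last exact: continuous_cabs.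
by apply: (@continuous_comp _ _ _ (fun x => mkc x y) F); [exact: continuous_mkcx|exact: cF].
Qed.
Lemma continuous_vcabs F x : continuous F -> continuous (fun y => cabs (F (mkc x y))).
Proof.
move=> cF y; apply: (@continuous_comp _ _ _ (fun y => F (mkc x y)) (@cabs R)); last exact: continuous_cabs.
by apply: (@continuous_comp _ _ _ (fun y => mkc x y) F); [exact: continuous_mkcy|exact: cF].
Qed.

(* The real part of the integral of F dz along the boundary of [a,b] x [c,d]. *)
Definition rect F a b c d : R :=
  rint a b (fun x => cre (F (mkc x c)) - cre (F (mkc x d))) -
  rint c d (fun y => cim (F (mkc b y)) - cim (F (mkc a y))).

Lemma rectB F G a b c d : continuous F -> continuous G ->
  rect (fun z => F z - G z) a b c d = rect F a b c d - rect G a b c d.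
Proof.
move=> cF cG; rewrite /rect.
have -> : rint a b (fun x => cre (F (mkc x c) - G (mkc x c)) - cre (F (mkc x d) - G (mkc x d)))
  = rint a b (fun x => cre (F (mkc x c)) - cre (F (mkc x d))) -
    rint a b (fun x => cre (G (mkc x c)) - cre (G (mkc x d))).
  rewrite -rintB; try by apply: continuousB_r; exact: continuous_hre.
  by apply: eq_rint => x _; rewrite !creB; lra.
have -> : rint c d (fun x => cim (F (mkc b x) - G (mkc b x)) - cim (F (mkc a x) - G (mkc a x)))
  = rint c d (fun x => cim (F (mkc b x)) - cim (F (mkc a x))) -
    rint c d (fun x => cim (G (mkc b x)) - cim (G (mkc a x))).
  rewrite -rintB; try by apply: continuousB_r; exact: continuous_vim.
  by apply: eq_rint => x _; rewrite !cimB; lra.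
lra.
Qed.

Lemma rect_affine (l m z0 : cplx R) a b c d : a <= b -> c <= d ->
  rect (fun z => l + m * (z - z0)) a b c d = 0.
Proof.
move=> ab cd; rewrite /rect.
rewrite (@eq_rint _ _ (fun=> cim m * (d - c))) ?rint_cst//; last by move=> x _; rewrite !cE; lra.
by rewrite (@eq_rint _ _ (fun=> cim m * (b - a)) c d) ?rint_cst//; last (by move=> x _; rewrite !cE; lra); lra.
Qed.

Lemma rect_le F a b c d M : continuous F -> a <= b -> c <= d ->
  (forall x y, a <= x <= b -> c <= y <= d -> cabs (F (mkc x y)) <= M) ->
  `|rect F a b c d| <= 2 * M * ((b - a) + (d - c)).
Proof.
move=> cF ab cd H; apply: le_trans (ler_normB _ _) _.
rewrite mulrDr; apply: lerD.
  rewrite -(rint_cst (2 * M) ab); apply: rint_norm_le.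
  - by apply: continuousB_r; exact: continuous_hre.
  - by move=> ?; exact: cvg_cst.
  move=> x xab; apply: le_trans (ler_normB _ _) _.
  have := H x c xab; rewrite lexx cd => /(_ isT) h1.
  have := H x d xab; rewrite lexx cd => /(_ isT) h2.
  have := cre_le (F (mkc x c)); have := cre_le (F (mkc x d)); lra.
rewrite -(rint_cst (2 * M) cd); apply: rint_norm_le.
- by apply: continuousB_r; exact: continuous_vim.
- by move=> ?; exact: cvg_cst.
move=> x xab; apply: le_trans (ler_normB _ _) _.
have := H a x; rewrite lexx ab xab => /(_ isT isT) h1.
have := H b x; rewrite lexx ab xab => /(_ isT isT) h2.
have := cim_le (F (mkc a x)); have := cim_le (F (mkc b x)); lra.
Qed.

Lemma rect_splitx F a m b c d : continuous F -> a <= m -> m <= b ->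
  rect F a b c d = rect F a m c d + rect F m b c d.
Proof.
move=> cF am mb; rewrite /rect (rint_split _ am mb); last first.
  by apply: continuousB_r; exact: continuous_hre.
rewrite -addrA -[in RHS]addrA; congr (_ + _).
rewrite addrCA; congr (_ + _); rewrite -opprD; congr (- _).
rewrite -rintD; try by apply: continuousB_r; exact: continuous_vim.
by apply: eq_rint => y _; lra.
Qed.

Lemma rect_splity F a b c m d : continuous F -> c <= m -> m <= d ->
  rect F a b c d = rect F a b c m + rect F a b m d.
Proof.
move=> cF cm md; rewrite /rect (rint_split _ cm md); last first.
  by apply: continuousB_r; exact: continuous_vim.
rewrite [RHS]addrACA -opprD; congr (_ - _).
rewrite -rintD; try by apply: continuousB_r; exact: continuous_hre.
by apply: eq_rint => y _; lra.
Qed.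

(** Complex differentiability at one point, written without a quotient so that w = z needs no
    exception. The derivative stays existentially quantified: only its existence is used. *)
Definition cdiff F z := exists l, forall e : R, 0 < e -> exists2 r : R, 0 < r &
    forall w, cabs (w - z) < r -> cabs (F w - F z - l * (w - z)) <= e * cabs (w - z).

Lemma cdiff_near F G z : nbhs z [set w | F w = G w] -> cdiff F z -> cdiff G z.
Proof.
move=> /cnbhsP[r0 r00 FG] [l Hl]; exists l => e /Hl[r r0' Hr].
exists (Num.min r r0); first by rewrite lt_min r0'.
move=> w; rewrite lt_min => /andP[w1 w2]; rewrite -!FG//; first exact: Hr.
by rewrite subrr cabs0.
Qed.

Lemma cdiff_cst k z : cdiff (fun=> k) z.
Proof. by exists 0 => e e0; exists 1 => // w _; rewrite subrr mul0r subrr cabs0 mulr_ge0// ltW. Qed.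

Lemma cdiff_id z : cdiff id z.
Proof. by exists 1 => e e0; exists 1 => // w _; rewrite mul1r subrr cabs0 mulr_ge0// ltW. Qed.

Lemma cdiffD F G z : cdiff F z -> cdiff G z -> cdiff (fun w => F w + G w) z.
Proof.
move=> [l Hl] [m Hm]; exists (l + m) => e e0; have e2 : 0 < e / 2 by lra.
have [r r0 Hr] := Hl _ e2; have [s s0 Hs] := Hm _ e2.
exists (Num.min r s); first by rewrite lt_min r0.
move=> w; rewrite lt_min => /andP[/Hr w1 /Hs w2].
have -> : F w + G w - (F z + G z) - (l + m) * (w - z) =
  (F w - F z - l * (w - z)) + (G w - G z - m * (w - z)) by ring.
by apply: le_trans (cabs_triangle _ _) _; atom_lra.
Qed.

Lemma cdiff_lip F z : cdiff F z -> exists M r : R, [/\ 0 < M, 0 < r &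
  forall w, cabs (w - z) < r -> cabs (F w - F z) <= M * cabs (w - z)].
Proof.
move=> [l Hl]; have [r r0 Hr] := Hl 1 ltr01.
have l0 := cabs_ge0 l.
exists (cabs l + 1), r; split => //; first by lra.
move=> w /Hr; have := cabs_triangle (F w - F z - l * (w - z)) (l * (w - z)).
rewrite subrK cabsM; lra.
Qed.

(** Dividing by A + 1 instead of A covers A = 0, that is, a factor that vanishes at z. *)
Let third (e A : R) : 0 < e -> 0 <= A -> e / (3 * (A + 1)) * A <= e / 3.
Proof.
move=> e0 A0; rewrite mulrAC ler_pdivrMr; last by lra.
have -> : e / 3 * (3 * (A + 1)) = e * A + e by field.
lra.
Qed.

Lemma cdiffM F G z : cdiff F z -> cdiff G z -> cdiff (fun w => F w * G w) z.
Proof.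
move=> dF dG; have [M [r0 [M0 r00 H0]]] := cdiff_lip dF; have [N [s0 [N0 s00 K0]]] := cdiff_lip dG.
case: dF dG => [l Hl] [m Hm]; exists (l * G z + F z * m) => e e0.
set A := cabs (G z); set B := cabs (F z).
have A0 : 0 <= A by exact: cabs_ge0.
have B0 : 0 <= B by exact: cabs_ge0.
have e1 : 0 < e / (3 * (A + 1)) by rewrite divr_gt0//; atom_lra.
have e2 : 0 < e / (3 * (B + 1)) by rewrite divr_gt0//; atom_lra.
have e3 : 0 < e / (3 * (M * N)) by rewrite divr_gt0// mulr_gt0// mulr_gt0.
have [r r1 Hr] := Hl _ e1; have [s s1 Hs] := Hm _ e2.
exists (Num.min (Num.min r s) (Num.min (Num.min r0 s0) (e / (3 * (M * N))))).
  by rewrite !lt_min r1 s1 r00 s00 e3.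
move=> w; rewrite !lt_min => /andP[/andP[w1 w2] /andP[/andP[w3 w4] w5]].
have -> : F w * G w - F z * G z - (l * G z + F z * m) * (w - z) =
  (F w - F z - l * (w - z)) * G z + F z * (G w - G z - m * (w - z)) + (F w - F z) * (G w - G z) by ring.
apply: le_trans (cabs_triangle _ _) _.
apply: le_trans (lerD (cabs_triangle _ _) (lexx _)) _; rewrite !cabsM.
set d := cabs (w - z) in w1 w2 w3 w4 w5 *; have d0 : 0 <= d by exact: cabs_ge0.
have h1 : cabs (F w - F z - l * (w - z)) * A <= e / 3 * d.
  apply: le_trans (ler_wpM2r A0 (Hr _ w1)) _.
  by rewrite mulrAC ler_wpM2r// third.
have h2 : B * cabs (G w - G z - m * (w - z)) <= e / 3 * d.
  apply: le_trans (ler_wpM2l B0 (Hs _ w2)) _.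
  by rewrite mulrC mulrAC ler_wpM2r// third.
have h3 : cabs (F w - F z) * cabs (G w - G z) <= e / 3 * d.
  apply: le_trans (ler_pM (cabs_ge0 _) (cabs_ge0 _) (H0 _ w3) (K0 _ w4)) _.
  rewrite mulrACA mulrA ler_wpM2r//; move: w5; rewrite ltr_pdivlMr ?mulr_gt0// => w5.
  have -> : M * N * d = (d * (3 * (M * N))) / 3 by field.
  by rewrite ler_wpM2r// ltW.
rewrite (_ : e * d = e / 3 * d + e / 3 * d + e / 3 * d); last by field.
by rewrite !lerD.
Qed.

Lemma cdiffV (a z : cplx R) : z != a -> cdiff (fun w => (w - a)^-1) z.
Proof.
move=> za; exists (- (z - a)^-1 ^+ 2) => e e0.
have za0 : z - a != 0 by rewrite subr_eq0.
set t := cabs (z - a); have t0 : 0 < t by rewrite cabs_gt0.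
exists (Num.min (t / 2) (e * t ^+ 3 / 2)); first by rewrite lt_min !divr_gt0// mulr_gt0// exprn_gt0.
move=> w; rewrite lt_min => /andP[w1 w2].
have w3 : t / 2 <= cabs (w - a).
  have := cabs_leD (z - a) (w - z); rewrite -/t (_ : z - a + (w - z) = w - a); [lra|ring].
have wa0 : w - a != 0 by rewrite -cabs_gt0; lra.
have -> : (w - a)^-1 - (z - a)^-1 - (- (z - a)^-1 ^+ 2 * (w - z)) =
    (w - z) * (w - z) * ((w - a)^-1 * (z - a)^-1 ^+ 2) by field; apply/andP.
have -> : cabs ((w - z) * (w - z) * ((w - a)^-1 * (z - a)^-1 ^+ 2)) =
    cabs (w - z) / (cabs (w - a) * t ^+ 2) * cabs (w - z).
  by rewrite !cabsM !cabsV -/t expr2 !invfM; ring.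
rewrite ler_wpM2r ?cabs_ge0// ler_pdivrMr ?mulr_gt0 ?exprn_gt0 ?cabs_gt0//.
apply: le_trans (ltW w2) _.
have -> : e * t ^+ 3 / 2 = e * (t / 2 * t ^+ 2) by rewrite exprS; field.
by rewrite ler_wpM2l ?(ltW e0)// ler_wpM2r// sqr_ge0.
Qed.

Lemma cdiff_cvg F z : cdiff F z -> {for z, continuous F}.
Proof.
move=> /cdiff_lip[M [r [M0 r0 H]]]; apply/ccvgP => e e0; apply/cnbhsP.
exists (Num.min r (e / M)); first by rewrite lt_min r0 divr_gt0.
move=> w; rewrite lt_min => /andP[/H w1 w2] /=; apply: le_lt_trans w1 _.
by rewrite mulrC -ltr_pdivlMr.
Qed.

End goursat.
Lemma nested_segments {R : realType} (l r : nat -> R) :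
  (forall k, l k <= l k.+1) -> (forall k, r k.+1 <= r k) -> (forall k, l k <= r k) ->
  exists x, forall k, l k <= x <= r k.
Proof.
move=> lS rS lr.
have lm : {homo l : i j / (i <= j)%N >-> i <= j} by apply: homo_leq => //; exact: le_trans.
have rm : {homo r : i j / (i <= j)%N >-> j <= i}.
  by apply: (@homo_leq _ _ (fun x y => y <= x)) => // x y z xy yz; exact: le_trans yz xy.
have ub k : ubound (range l) (r k).
  move=> _ [j _ <-]; have [jk|/ltnW kj] := leqP j k.
    by apply: le_trans (lr k); exact: lm.
  by apply: le_trans (lr j) _; exact: rm.
exists (sup (range l)) => k; apply/andP; split.
  by apply: ub_le_sup; [exists (r k); exact: ub|exists k].
by apply: ge_sup; [exists (l 0%N); exists 0%N|exact: ub].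
Qed.

Section goursat2.
Context {R : realType}.
Implicit Types (F G : cplx R -> cplx R) (a b c d x y : R).

Lemma continuous_affine (l m z0 : cplx R) : continuous (fun z => l + m * (z - z0)).
Proof.
move=> z; apply/ccvgP => e e0; apply/cnbhsP; exists (e / (cabs m + 1)).
  by rewrite divr_gt0// ltr_wpDl// cabs_ge0.
move=> w /=; have -> : l + m * (w - z0) - (l + m * (z - z0)) = m * (w - z) by ring.
rewrite ltr_pdivlMr ?ltr_wpDl ?cabs_ge0// cabsM => H.
have := cabs_ge0 m; have := cabs_ge0 (w - z); nra.
Qed.

(** Quartering: some quarter keeps at least a quarter of the integral, so after k steps at least e0
    4^-k is left on a rectangle of size 2^-k. These rectangles shrink to a point near which F is
    affine up to e |w - z|; affine functions integrate to 0, and the error is at most a small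
    multiple of 4^-k. *)
Lemma goursat F a b c d : continuous F -> a <= b -> c <= d ->
  (forall x y, a <= x <= b -> c <= y <= d -> cdiff F (mkc x y)) ->
  rect F a b c d = 0.
Proof.
move=> cF ab cd dF; apply/eqP/contraT => /eqP rn0.
set e0 := `|rect F a b c d|.
have e00 : 0 < e0 by rewrite normr_gt0; exact/eqP.
set W := b - a; set H := d - c.
have W0 : 0 <= W by rewrite subr_ge0.
have H0 : 0 <= H by rewrite subr_ge0.
pose h k : R := 2^-1 ^+ k.
have h0 k : 0 < h k by rewrite exprn_gt0// invr_gt0.
have hS k : h k = 2 * h k.+1 by rewrite /h exprS mulrA divff ?mul1r.
pose sub k (p : R * R) := rect F p.1 (p.1 + W * h k) p.2 (p.2 + H * h k).
(* The lower bound is a premise inside the existential statement, so that [choice] returns a total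
   selector of quarters; where it fails any corner will do. *)
have step (kp : nat * (R * R)) : exists p' : R * R,
    e0 * h kp.1 * h kp.1 <= `|sub kp.1 kp.2| ->
    [/\ kp.2.1 <= p'.1 <= kp.2.1 + W * h kp.1.+1, kp.2.2 <= p'.2 <= kp.2.2 + H * h kp.1.+1 &
      e0 * h kp.1.+1 * h kp.1.+1 <= `|sub kp.1.+1 p'|].
  case: kp => k [x y] /=.
  have [Hk|Hk] := leP (e0 * h k * h k) `|sub k (x, y)|; last by exists (x, y).
  set w := W * h k.+1; set v := H * h k.+1.
  have w0 : 0 <= w by rewrite mulr_ge0// ltW.
  have v0 : 0 <= v by rewrite mulr_ge0// ltW.
  have eW : W * h k = w + w by rewrite hS /w; lra.
  have eH : H * h k = v + v by rewrite hS /v; lra.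
  have E : sub k (x, y) = sub k.+1 (x, y) + sub k.+1 (x, y + v)
      + (sub k.+1 (x + w, y) + sub k.+1 (x + w, y + v)).
    rewrite /sub /= -/w -/v eW eH !addrA.
    rewrite (@rect_splitx _ _ _ (x + w)) ?lerDl// (@rect_splity _ _ _ _ _ (y + v)) ?lerDl//.
    by rewrite (@rect_splity _ _ (x + w) _ _ (y + v)) ?lerDl// !addrA.
  set t := e0 * h k.+1 * h k.+1.
  have tE : e0 * h k * h k = 4 * t by rewrite hS /t; atom_lra.
  have [h1|h1] := leP t `|sub k.+1 (x, y)|; first by exists (x, y) => _ /=; rewrite ?lexx ?lerDl ?w0 ?v0.
  have [h2|h2] := leP t `|sub k.+1 (x, y + v)|; first by exists (x, y + v) => _ /=; rewrite ?lexx ?lerDl ?w0 ?v0.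
  have [h3|h3] := leP t `|sub k.+1 (x + w, y)|; first by exists (x + w, y) => _ /=; rewrite ?lexx ?lerDl ?w0 ?v0.
  have [h4|h4] := leP t `|sub k.+1 (x + w, y + v)|; first by exists (x + w, y + v) => _ /=; rewrite ?lexx ?lerDl ?w0 ?v0.
  exfalso; move: Hk; rewrite tE E.
  have := ler_normD (sub k.+1 (x, y) + sub k.+1 (x, y + v)) (sub k.+1 (x + w, y) + sub k.+1 (x + w, y + v)).
  have := ler_normD (sub k.+1 (x, y)) (sub k.+1 (x, y + v)).
  have := ler_normD (sub k.+1 (x + w, y)) (sub k.+1 (x + w, y + v)).
  atom_lra.
have [g Hg] := choice step.
pose u := fix u k : R * R := if k is j.+1 then g (j, u j) else (a, c).
have inv k : e0 * h k * h k <= `|sub k (u k)|.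
  elim: k => [|k IH].
    by rewrite /sub /= /h expr0 !mulr1 /W /H !addrA [a + b]addrC addrK [c + d]addrC addrK.
  by have [] := Hg (k, u k) IH.
have st k : [/\ (u k).1 <= (u k.+1).1 <= (u k).1 + W * h k.+1 &
    (u k).2 <= (u k.+1).2 <= (u k).2 + H * h k.+1].
  by have [] := Hg (k, u k) (inv k).
have [x Hx] : exists x, forall k, (u k).1 <= x <= (u k).1 + W * h k.
  apply: nested_segments => k; last by rewrite lerDl mulr_ge0// ltW.
    by have [/andP[]] := st k.
  have [/andP[_ h1] _] := st k; rewrite (hS k); atom_lra.
have [y Hy] : exists x, forall k, (u k).2 <= x <= (u k).2 + H * h k.
  apply: nested_segments => k; last by rewrite lerDl mulr_ge0// ltW.
    by have [_ /andP[]] := st k.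
  have [_ /andP[_ h1]] := st k; rewrite (hS k); atom_lra.
have ac k : a <= (u k).1 /\ (u k).1 + W * h k <= b /\ c <= (u k).2 /\ (u k).2 + H * h k <= d.
  elim: k => [|k [i1 [i2 [i3 i4]]]]; first by rewrite /= /h expr0 !mulr1 /W /H; split; [|split; [|split]]; atom_lra.
  have [/andP[s1 s2] /andP[s3 s4]] := st k; have := hS k => hh.
  by split; [|split; [|split]]; atom_nra.
have dz : cdiff F (mkc x y).
  have [i1 [i2 [i3 i4]]] := ac 0%N; have /andP[j1 j2] := Hx 0%N; have /andP[j3 j4] := Hy 0%N.
  by apply: dF; apply/andP; split; atom_lra.
have [l Hl] := dz.
set S := (W + H) * (W + H).
have S0 : 0 <= S by rewrite mulr_ge0// addr_ge0.
(* With this slope error the integral at level k is at most e0 4^-k S / (2 (S + 1)), below the lower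
   bound e0 4^-k. The 1 in S + 1 covers the degenerate rectangle. *)
have e10 : 0 < e0 / (4 * (S + 1)) by rewrite divr_gt0// mulr_gt0// ltr_wpDl.
have [r r0 Hr] := Hl _ e10.
have [k hk] : exists k, (W + H) * h k < r.
  have h1 : 0 < r / (W + H + 1) by rewrite divr_gt0// ltr_wpDl// addr_ge0.
  have [k Hk] : exists k, 2^-1 ^+ k < r / (W + H + 1).
    have /(@cvgrPdist_lt R R) /(_ _ h1) : (GRing.exp (2^-1 : R)) @ \oo --> (0 : R).
      by apply: cvg_expr; rewrite ger0_norm ?invr_ge0// invf_lt1 ?ltr1n.
    by move=> [k _ /(_ k (leqnn k))] /=; rewrite sub0r normrN => /(le_lt_trans (ler_norm _)) ?; exists k.
  exists k; move: Hk; rewrite ltr_pdivlMr; last by atom_lra.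
  rewrite -/(h k) => Hk.
  have := h0 k; atom_lra.
have hk0 := h0 k.
set z := mkc x y; pose A w := F z + l * (w - z).
have key : `|sub k (u k)| <= 2 * (e0 / (4 * (S + 1)) * ((W + H) * h k)) * ((W + H) * h k).
  have -> : sub k (u k) = rect (fun w => F w - A w) (u k).1 ((u k).1 + W * h k) (u k).2 ((u k).2 + H * h k).
    rewrite rectB; [|exact: cF|exact: continuous_affine].
    by rewrite rect_affine ?subr0 // lerDl mulr_ge0// ltW.
  have -> : (W + H) * h k = ((u k).1 + W * h k - (u k).1) + ((u k).2 + H * h k - (u k).2) by ring.
  apply: rect_le.
  - move=> w; apply: (@continuousB _ _ _ F A w); [exact: cF|exact: continuous_affine].
  - by rewrite lerDl mulr_ge0// ltW.
  - by rewrite lerDl mulr_ge0// ltW.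
  move=> x' y' /andP[x1 x2] /andP[y1 y2].
  have /andP[x3 x4] := Hx k; have /andP[y3 y4] := Hy k.
  have dd : cabs (mkc x' y' - z) <= (W + H) * h k.
    apply: le_trans (cabs_le_re_im _) _; rewrite !cE mulrDl; apply: lerD; rewrite ler_norml; apply/andP; split; atom_lra.
  have := Hr (mkc x' y') (le_lt_trans dd hk); rewrite /A opprD addrA => /le_trans; apply.
  rewrite ler_wpM2l ?(ltW e10)//; apply: le_trans dd _; atom_lra.
have := inv k => /le_trans /(_ key).
have -> : 2 * (e0 / (4 * (S + 1)) * ((W + H) * h k)) * ((W + H) * h k) = (e0 * h k * h k) * (S / (S + 1) / 2).
  by rewrite /S; field; rewrite -/S; apply/eqP; atom_lra.
have : S / (S + 1) <= 1 by rewrite ler_pdivrMr ?ltr_wpDl//; atom_lra.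
have : 0 < e0 * h k * h k by rewrite !mulr_gt0.
move=> h1 h2 h3; exfalso.
have : e0 * h k * h k * (S / (S + 1) / 2) <= e0 * h k * h k * (1 / 2) by rewrite ler_wpM2l ?(ltW h1)//; atom_lra.
atom_lra.
Qed.

(** Continuity suffices at finitely many points. A square of half-side [del] about such a point e is
    cut out; the other pieces avoid e and fall under the induction hypothesis, while the square
    contributes O(del) because F is bounded near e. *)
Lemma goursat_except F (E : seq (cplx R)) a b c d : continuous F -> a <= b -> c <= d ->
  (forall x y, a <= x <= b -> c <= y <= d -> mkc x y \notin E -> cdiff F (mkc x y)) ->
  rect F a b c d = 0.
Proof.
move=> cF; elim: E a b c d => [|e E IH] a b c d ab cd dF.
  by apply: goursat cF ab cd _ => x y xab ycd; exact: (dF x y xab ycd).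
have [e_in|e_out] := boolP ((a <= cre e <= b) && (c <= cim e <= d)); last first.
  apply: IH ab cd _ => x y xab ycd xyE; apply: (dF x y xab ycd); rewrite inE negb_or xyE andbT.
  by apply: contra e_out => /eqP <-; rewrite !cE xab ycd.
case/andP: e_in => /andP[a1 a2] /andP[c1 c2].
have off a' b' c' d' : a <= a' -> a' <= b' -> b' <= b -> c <= c' -> c' <= d' -> d' <= d ->
    ~~ ((a' <= cre e <= b') && (c' <= cim e <= d')) -> rect F a' b' c' d' = 0.
  move=> ? ab' ? ? cd' ? H5; apply: IH ab' cd' _ => x y /andP[? ?] /andP[? ?] xyE; apply: dF.
  - by apply/andP; split; atom_lra.
  - by apply/andP; split; atom_lra.
  rewrite inE negb_or xyE andbT; apply/eqP => xy; move/negP: H5; apply.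
  rewrite -xy !cE; apply/andP; split; apply/andP; split => //.
(* When e is on or near an edge the square is clipped and a neighbouring piece collapses to a
   segment; such pieces contribute 0. *)
have degx a' c' d' : rect F a' a' c' d' = 0.
  rewrite /rect [X in X - _](_ : _ = 0) ?sub0r; last first.
    by rewrite /rint set_itv1 Rintegral_set1.
  rewrite (@eq_rint _ _ (fun=> 0)) ?/rint ?Rintegral_cst ?mul0r ?oppr0// => y _; exact: subrr.
have degy a' b' c' : rect F a' b' c' c' = 0.
  rewrite /rect [X in _ - X](_ : _ = 0) ?subr0; last first.
    by rewrite /rint set_itv1 Rintegral_set1.
  rewrite (@eq_rint _ _ (fun=> 0)) ?/rint ?Rintegral_cst ?mul0r// => y _; exact: subrr.
have [r r0 Hr] := (cnbhsP _ _).1 ((@ccvgP _ _ F e).1 (cF e) 1 ltr01).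
set M := cabs (F e) + 1.
have key del : 0 < del -> del + del < r -> `|rect F a b c d| <= 8 * M * del.
  move=> d0 dr.
  set x1 := Num.max a (cre e - del); set x2 := Num.min b (cre e + del).
  set y1 := Num.max c (cim e - del); set y2 := Num.min d (cim e + del).
  have ax1 : a <= x1 by rewrite le_max lexx.
  have x1e : x1 <= cre e by rewrite ge_max a1 lerBlDr lerDl ltW.
  have ex2 : cre e <= x2 by rewrite le_min a2 lerDl ltW.
  have x2b : x2 <= b by rewrite ge_min lexx.
  have x1d : cre e - del <= x1 by rewrite le_max lexx orbT.
  have x2d : x2 <= cre e + del by rewrite ge_min lexx orbT.
  have cy1 : c <= y1 by rewrite le_max lexx.
  have y1e : y1 <= cim e by rewrite ge_max c1 lerBlDr lerDl ltW.
  have ey2 : cim e <= y2 by rewrite le_min c2 lerDl ltW.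
  have y2d : y2 <= d by rewrite ge_min lexx.
  have y1d : cim e - del <= y1 by rewrite le_max lexx orbT.
  have y2dd : y2 <= cim e + del by rewrite ge_min lexx orbT.
  rewrite (@rect_splitx _ _ _ x1)//; last by atom_lra.
  have -> : rect F a x1 c d = 0.
    rewrite /x1; case: (leP a (cre e - del)) => h; last by rewrite degx.
    apply: off; rewrite ?lexx//; atom_lra.
  rewrite (@rect_splitx _ _ _ x2)//; last by atom_lra.
  have -> : rect F x2 b c d = 0.
    rewrite /x2; case: (leP b (cre e + del)) => h; first by rewrite degx.
    apply: off; rewrite ?lexx//; atom_lra.
  rewrite (@rect_splity _ _ _ _ _ y1)//; last by atom_lra.
  have -> : rect F x1 x2 c y1 = 0.
    rewrite /y1; case: (leP c (cim e - del)) => h; last by rewrite degy.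
    apply: off; rewrite ?lexx//; atom_lra.
  rewrite (@rect_splity _ _ _ _ _ y2)//; last by atom_lra.
  have -> : rect F x1 x2 y2 d = 0.
    rewrite /y2; case: (leP d (cim e + del)) => h; first by rewrite degy.
    apply: off; rewrite ?lexx//; atom_lra.
  rewrite !(addr0, add0r).
  have : `|rect F x1 x2 y1 y2| <= 2 * M * ((x2 - x1) + (y2 - y1)).
    apply: rect_le => //; try atom_lra.
    move=> x y /andP[? ?] /andP[? ?].
    have : cabs (mkc x y - e) < r.
      apply: le_lt_trans (cabs_le_re_im _) _; rewrite !cE; apply: le_lt_trans dr.
      by apply: lerD; rewrite ler_norml; apply/andP; split; atom_lra.
    move=> /Hr /=; have := cabs_leB (F (mkc x y)) (F e); rewrite /M; atom_lra.
  move=> /le_trans; apply.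
  have M0 : 0 <= M by rewrite addr_ge0// cabs_ge0.
  have M20 : 0 <= 2 * M by atom_lra.
  by have := @ler_wpM2l R (2 * M) M20 (x2 - x1 + (y2 - y1)) (4 * del); atom_lra.
have M1 : 1 <= M by rewrite lerDr cabs_ge0.
apply/eqP; rewrite -normr_eq0 eq_le normr_ge0 andbT; apply/ler_addgt0Pr => eps eps0; rewrite add0r.
set del := Num.min (r / 4) (eps / (8 * M)).
have M80 : 0 < 8 * M by atom_lra.
have del0 : 0 < del by rewrite lt_min !divr_gt0.
have := key del del0; have : del <= r / 4 by rewrite ge_min lexx.
have : del <= eps / (8 * M) by rewrite ge_min lexx orbT.
rewrite ler_pdivlMr// => h1 h2 h3; apply: le_trans (h3 _) _; atom_lra.
Qed.

End goursat2.

(** * A Cauchy inequality on the square *)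

Section cauchy.
Context {R : realType}.
Implicit Types (F G : cplx R -> cplx R) (a b c d x y : R).

Lemma creV (z : cplx R) : cre z^-1 = cre z / (cre z ^+ 2 + cim z ^+ 2).
Proof. by case: z. Qed.
Lemma cimV (z : cplx R) : cim z^-1 = - cim z / (cre z ^+ 2 + cim z ^+ 2).
Proof. by case: z => a b /=; rewrite mulNr. Qed.

Definition dslope G (l z0 z : cplx R) : cplx R :=
  if z == z0 then l else (G z - G z0) / (z - z0).

Lemma nearC_neq (z z0 : cplx R) : z != z0 -> nbhs z [set w | w != z0].
Proof.
move=> zz0; apply/cnbhsP; exists (cabs (z - z0)); first by rewrite cabs_gt0 subr_eq0.
by move=> w /= H; apply/eqP => wz; move: H; rewrite wz cabsB ltxx.
Qed.

Lemma dslope_cdiff G l z0 z : z != z0 -> cdiff G z -> cdiff (dslope G l z0) z.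
Proof.
move=> zz0 dG; apply: (@cdiff_near _ (fun w => (G w - G z0) * (w - z0)^-1)).
  by apply: filterS (nearC_neq zz0) => w /= wz0; rewrite /dslope (negbTE wz0).
by apply: cdiffM; [apply: cdiffD => //; exact: cdiff_cst|exact: cdiffV].
Qed.

Lemma dslope_continuous G z0 : continuous G -> cdiff G z0 ->
  exists l, continuous (dslope G l z0).
Proof.
move=> cG [l Hl]; exists l => z.
have [->|zz0] := eqVneq z z0.
  apply/ccvgP => e e0; have [r r0 Hr] := Hl _ (ltac:(lra) : 0 < e / 2).
  apply/cnbhsP; exists r => // w wr /=; rewrite /dslope eqxx.
  case: eqVneq => [_|wz]; first by rewrite subrr cabs0.
  have wz0 : w - z0 != 0 by rewrite subr_eq0.
  have -> : (G w - G z0) / (w - z0) - l = (G w - G z0 - l * (w - z0)) / (w - z0) by field.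
  rewrite cabsM cabsV ltr_pdivrMr ?cabs_gt0//.
  apply: le_lt_trans (Hr w wr) _; rewrite ltr_pM2r ?cabs_gt0//; lra.
apply/ccvgP => e e0.
have dinv := cdiffV zz0.
have c1 : {for z, continuous (fun w => (G w - G z0) * (w - z0)^-1)}.
  apply: (@cvgM _ _ (nbhs z)); last exact: cdiff_cvg dinv.
  by apply: (@cvgB _ _ _ (nbhs z)); [exact: cG|exact: cvg_cst].
have := (@ccvgP _ _ (fun w => (G w - G z0) * (w - z0)^-1) z).1 c1 e e0.
apply: filterS2 (nearC_neq zz0) => w wz0 /=.
by rewrite /dslope (negbTE zz0) (negbTE wz0).
Qed.

(* The boundary integral of (G - G(0))/z vanishes, while that of G(0)/z has
   modulus at least 4 |G(0)|. *)
Lemma cauchy_square G (E : seq (cplx R)) : continuous G -> cdiff G 0 ->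
  (forall x y, -1 <= x <= 1 -> -1 <= y <= 1 -> mkc x y \notin E -> cdiff G (mkc x y)) ->
  4 * cabs (G 0) <= rint (-1) 1 (fun y =>
    cabs (G (mkc 1 y)) + cabs (G (mkc (-1) y)) + cabs (G (mkc y 1)) + cabs (G (mkc y (-1)))).
Proof.
(* After multiplication by a unimodular constant, G(0) is real and nonnegative; all the moduli are
   unchanged. *)
wlog G0 : G / G 0 = cr (cabs (G 0)).
  move=> H cG dG0 dG; have [u u1 uG] := polar (G 0).
  have := H (fun z => u * G z); rewrite uG cabs_cr ger0_norm// => /(_ erefl).
  have dU z : cdiff G z -> cdiff (fun w => u * G w) z.
    by move=> dz; apply: cdiffM => //; exact: cdiff_cst.
  move=> {}H; apply: le_trans (H _ _ _) _.
  - by move=> z; apply: (@cvgM _ _ (nbhs z)); [exact: cvg_cst|exact: cG].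
  - exact: dU.
  - by move=> x y xab yab xE; apply: dU; exact: dG.
  rewrite (_ : rint (-1) 1 _ = rint (-1) 1 (fun y =>
    cabs (G (mkc 1 y)) + cabs (G (mkc (-1) y)) + cabs (G (mkc y 1)) + cabs (G (mkc y (-1))))) //.
  by apply: eq_rint => y _; rewrite !cabsM u1 !mul1r.
move=> cG dG0 dG; have [l cK] := dslope_continuous cG dG0.
set g0 := cabs (G 0) in G0 *.
(* [rect] computes a real part, and the integral of G(0) / z along the boundary is purely imaginary
   when G(0) is real; the factor -i makes it real. *)
pose F z := - 'i * dslope G l 0 z.
have ii : ('i : cplx R) = mkc 0 1 by [].
have cF : continuous F.
  by move=> z; apply: (@cvgM _ _ (nbhs z)); [exact: cvg_cst|exact: cK].
have n11 : -1 <= 1 :> R by lra.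
have : rect F (-1) 1 (-1) 1 = 0.
  apply: (@goursat_except R F (0 :: E)) => // x y xab yab; rewrite inE negb_or => /andP[z0 zE].
  by apply: cdiffM; [exact: cdiff_cst|apply: dslope_cdiff => //; exact: dG].
have Fre (z : cplx R) : 1 <= cabs z ->
    cre (F z) <= cabs (G z) + g0 * cim z / (cre z ^+ 2 + cim z ^+ 2) /\
    - cre (F z) <= cabs (G z) - g0 * cim z / (cre z ^+ 2 + cim z ^+ 2) /\
    cim (F z) <= cabs (G z) + g0 * cre z / (cre z ^+ 2 + cim z ^+ 2) /\
    - cim (F z) <= cabs (G z) - g0 * cre z / (cre z ^+ 2 + cim z ^+ 2).
  move=> z1; have z0 : z != 0 by rewrite -cabs_gt0; exact: lt_le_trans ltr01 z1.
  have -> : F z = - 'i * G z / z + cr g0 * ('i / z).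
    by rewrite /F /dslope (negbTE z0) subr0 G0; field.
  have H1 : cabs (- 'i * G z / z) <= cabs (G z).
    rewrite !cabsM cabsN cabsV ii cabs_def !cE expr0n expr1n add0r sqrtr1 mul1r ler_pdivrMr ?cabs_gt0//.
    by rewrite ler_peMr// cabs_ge0.
  have H2 := cre_le (- 'i * G z / z); have H3 := cim_le (- 'i * G z / z).
  have H4 := ler_norm (cre (- 'i * G z / z)); have H5 := ler_norm (cim (- 'i * G z / z)).
  have H6 := ler_norm (- cre (- 'i * G z / z)); have H7 := ler_norm (- cim (- 'i * G z / z)).
  rewrite !normrN in H6 H7.
  rewrite !creD !cimD; set A := cre _ in H2 H4 H6 *; set B := cim _ in H3 H5 H7 *.
  rewrite !creM !cimM creV cimV ii !cE.
  set D := _ + _ ^+ 2; rewrite !mul0r !mul1r !subr0 !add0r ?sub0r ?addr0.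
  split; [|split; [|split]]; atom_lra.
(* On each edge, G(0) / z contributes the density g0 / (1 + y^2), bounded below by g0 / 2. Four
   edges of length 2 then give 4 g0, which replaces the exact value 2 pi g0. *)
have sq1 (y : R) : -1 <= y <= 1 -> g0 / 2 <= g0 / (y ^+ 2 + 1).
  move=> /andP[y1 y2]; rewrite ler_wpM2l ?cabs_ge0// lef_pV2 ?posrE//.
    by nra.
  by rewrite ltr_wpDl// sqr_ge0.
have c1 (z : cplx R) : 1 <= `|cre z| \/ 1 <= `|cim z| -> 1 <= cabs z.
  by case => /le_trans; apply; [exact: cre_le|exact: cim_le].
rewrite /rect => /eqP; rewrite subr_eq0 => /eqP EQ.
have L1 : rint (-1) 1 (fun x => cre (F (mkc x (-1))) - cre (F (mkc x 1))) <=
    rint (-1) 1 (fun x => cabs (G (mkc x 1)) + cabs (G (mkc x (-1))) - g0).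
  apply: rint_le.
  - by apply: continuousB_r; exact: continuous_hre.
  - apply: continuousB_r; last by move=> ?; exact: cvg_cst.
    by apply: continuousD_r; exact: continuous_hcabs.
  move=> x x1.
  have [|h1 [_ _]] := Fre (mkc x (-1)); first by apply: c1; right; rewrite cE normrN normr1.
  have [|_ [h2 [_ _]]] := Fre (mkc x 1); first by apply: c1; right; rewrite cE normr1.
  move: h1 h2; rewrite !cE sqrrN expr1n mulr1 mulrN1 mulNr => h1 h2.
  have := sq1 x x1; atom_lra.
have L2 : - rint (-1) 1 (fun y => cim (F (mkc 1 y)) - cim (F (mkc (-1) y))) <=
    rint (-1) 1 (fun y => cabs (G (mkc 1 y)) + cabs (G (mkc (-1) y)) - g0).
  rewrite -[leLHS]sub0r -(mul0r (1 - (-1))) -(rint_cst 0 n11) -rintB; last 2 first.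
  - by move=> ?; exact: cvg_cst.
  - by apply: continuousB_r; exact: continuous_vim.
  apply: rint_le.
  - apply: continuousB_r; first by move=> ?; exact: cvg_cst.
    by apply: continuousB_r; exact: continuous_vim.
  - apply: continuousB_r; last by move=> ?; exact: cvg_cst.
    by apply: continuousD_r; exact: continuous_vcabs.
  move=> x x1.
  have [|_ [_ [h1 _]]] := Fre (mkc (-1) x); first by apply: c1; left; rewrite cE normrN normr1.
  have [|_ [_ [_ h2]]] := Fre (mkc 1 x); first by apply: c1; left; rewrite cE normr1.
  move: h1 h2; rewrite !cE sqrrN expr1n mulr1 mulrN1 mulNr [1 + _]addrC => h1 h2.
  have := sq1 x x1; atom_lra.
move: L1 L2; rewrite EQ !rintB; try by move=> ?; exact: cvg_cst.
- rewrite !rint_cst// => L1 L2.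
  rewrite (@eq_rint _ _ (fun y => (cabs (G (mkc 1 y)) + cabs (G (mkc (-1) y))) + (cabs (G (mkc y 1)) + cabs (G (mkc y (-1)))))); last by move=> y _; rewrite addrA.
  rewrite rintD; last 2 first.
  + by apply: continuousD_r; exact: continuous_vcabs.
  + by apply: continuousD_r; exact: continuous_hcabs.
  atom_lra.
- by apply: continuousD_r; exact: continuous_vcabs.
- by apply: continuousD_r; exact: continuous_hcabs.
- exact: continuous_vim.
- exact: continuous_vim.
Qed.

End cauchy.

(** * Liouville's theorem and growth of polynomials *)

Section liouville.
Context {R : realType}.
Implicit Types (F G g : cplx R -> cplx R) (a z w : cplx R).

Lemma cdiff_affine_comp G a (k : cplx R) z : cdiff G (a + k * z) -> cdiff (fun w => G (a + k * w)) z.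
Proof.
move=> [l Hl]; exists (l * k) => e e0.
have k0 := cabs_ge0 k.
have e1 : 0 < e / (cabs k + 1) by rewrite divr_gt0//; lra.
have [r r0 Hr] := Hl _ e1; exists (r / (cabs k + 1)); first by rewrite divr_gt0//; lra.
move=> w; rewrite ltr_pdivlMr; last by lra.
move=> wr; have E : a + k * w - (a + k * z) = k * (w - z) by ring.
have wz0 := cabs_ge0 (w - z).
have wr' : cabs (a + k * w - (a + k * z)) < r by rewrite E cabsM; nra.
have := Hr _ wr'; rewrite E mulrA => /le_trans; apply.
rewrite cabsM mulrA ler_wpM2r// mulrAC ler_pdivrMr; atom_nra.
Qed.

(** The square of half-side r about a has its boundary outside the disc of radius r. Rescaled to the
    unit square, the four sides contribute at most 8 M, against 4 |G(a)|. *)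
Lemma cauchy_sup G (E : seq (cplx R)) a (r M : R) : 0 < r -> continuous G ->
  (forall z, z \notin E -> cdiff G z) -> a \notin E ->
  (forall w, r <= cabs (w - a) -> cabs (G w) <= M) -> cabs (G a) <= 2 * M.
Proof.
move=> r0 cG dG aE H; pose F z := G (a + cr r * z).
have cr0' : cr r != 0 by rewrite -cabs_gt0 cabs_cr gtr0_norm.
have cF : continuous F.
  move=> z; apply: (@continuous_comp _ _ _ (fun z => a + cr r * z) G); last exact: cG.
  apply: cdiff_cvg; apply: cdiffD; first exact: cdiff_cst.
  by apply: cdiffM; [exact: cdiff_cst|exact: cdiff_id].
have dF z : a + cr r * z \notin E -> cdiff F z by move=> zE; apply: cdiff_affine_comp; exact: dG.
have := @cauchy_square R F [seq (z - a) / cr r | z <- E] cF.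
have -> : F 0 = G a by rewrite /F mulr0 addr0.
have FM (z : cplx R) : 1 <= cabs z -> cabs (F z) <= M.
  move=> z1; apply: H; rewrite addrC addKr cabsM cabs_cr gtr0_norm//.
  by rewrite ler_peMr// ltW.
have c1 (z : cplx R) : 1 <= `|cre z| \/ 1 <= `|cim z| -> 1 <= cabs z.
  by case => /le_trans; apply; [exact: cre_le|exact: cim_le].
move=> /(_ _ _) H1.
suff : 4 * cabs (G a) <= 8 * M by lra.
apply: le_trans (H1 _ _) _.
- by apply: dF; rewrite mulr0 addr0.
- move=> x y _ _ xyE; apply: dF; apply: contra xyE => xyE; apply/mapP; eexists; first exact: xyE.
  by field.
have -> : 8 * M = rint (-1) 1 (fun=> 4 * M) by rewrite rint_cst; atom_lra.
apply: rint_le => [||y _].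
- apply: continuousD_r; last exact: continuous_hcabs.
  apply: continuousD_r; last exact: continuous_hcabs.
  by apply: continuousD_r; exact: continuous_vcabs.
- by move=> ?; exact: cvg_cst.
have h1 : cabs (F (mkc 1 y)) <= M by apply: FM; apply: c1; left; rewrite cE normr1.
have h2 : cabs (F (mkc (-1) y)) <= M by apply: FM; apply: c1; left; rewrite cE normrN normr1.
have h3 : cabs (F (mkc y 1)) <= M by apply: FM; apply: c1; right; rewrite cE normr1.
have h4 : cabs (F (mkc y (-1))) <= M by apply: FM; apply: c1; right; rewrite cE normrN normr1.
atom_lra.
Qed.

Lemma exists_notin (E : seq (cplx R)) a (r : R) : 0 < r ->
  exists2 w, w \notin E & cabs (w - a) < r.
Proof.
move=> r0; pose pt (k : nat) := a + cr (r / (k.+2)%:R).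
have inj : injective pt.
  move=> i j /addrI/(congr1 cre); rewrite !cE => /(mulfI (lt0r_neq0 r0))/invr_inj/eqP.
  by rewrite eqr_nat => /eqP[].
have : ~~ all (mem E) (map pt (iota 0 (size E).+1)).
  apply/negP => /allP H; have := @uniq_leq_size _ (map pt (iota 0 (size E).+1)) E.
  by rewrite map_inj_uniq// iota_uniq size_map size_iota ltnn => /(_ isT H).
rewrite -has_predC => /hasP[w /mapP[k _ ->] /= kE]; exists (pt k) => //.
rewrite /pt addrC addKr cabs_cr gtr0_norm ?divr_gt0// ltr_pdivrMr// ltr_pMr//.
by rewrite ltr1n.
Qed.

(** Off [E] the value is at most twice the supremum far away, hence 0; on [E] it vanishes by
    continuity, since the complement of a finite set is dense. *)
Lemma liouville_vanish g (E : seq (cplx R)) : continuous g -> (forall z, z \notin E -> cdiff g z) ->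
  (forall e : R, 0 < e -> exists M, forall z, M <= cabs z -> cabs (g z) <= e) ->
  forall z, g z = 0.
Proof.
move=> cg dg H.
have off a : a \notin E -> g a = 0.
  move=> aE; apply/eqP; rewrite -cabs_eq0 eq_le cabs_ge0 andbT.
  apply/ler_addgt0Pr => e e0; rewrite add0r.
  have e2 : 0 < e / 2 by lra.
  have [M HM] := H _ e2; have -> : e = 2 * (e / 2) by lra.
  apply: (@cauchy_sup g E a (`|M| + cabs a + 1)) => //.
    by rewrite ltr_wpDl// addr_ge0// cabs_ge0.
  move=> w wr; apply: HM; have := cabs_triangle (w - a) a; rewrite subrK.
  have := cabs_triangle (w - a) (- a); have := cabs_leB (w - a) (- a).
  rewrite opprK subrK cabsN; have := ler_norm M; atom_lra.
move=> z; apply/eqP; rewrite -cabs_eq0 eq_le cabs_ge0 andbT.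
apply/ler_addgt0Pr => e e0; rewrite add0r.
have [r r0 Hr] := (cnbhsP _ _).1 ((@ccvgP _ _ g z).1 (cg z) e e0).
have [w wE wr] := exists_notin E z r0.
by have := Hr w wr; rewrite /= (off w wE) sub0r cabsN => /ltW.
Qed.

Lemma dslopeK g l a z : g z = g a + (z - a) * dslope g l a z.
Proof.
rewrite /dslope; case: eqVneq => [->|za]; first by rewrite subrr mul0r addr0.
have za0 : z - a != 0 by rewrite subr_eq0.
by field.
Qed.

Lemma dslope_growth g l a z : cabs a + 1 <= cabs z ->
  cabs (dslope g l a z) * (1 + cabs z) <= (cabs (g z) + cabs (g a)) * (2 + cabs a).
Proof.
have a0 := cabs_ge0 a; have ga0 := cabs_ge0 (g a); have z0 := cabs_ge0 z.
move=> za; have za1 : 1 <= cabs (z - a) by have := cabs_leB z a; lra.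
have -> : dslope g l a z = (g z - g a) / (z - a).
  rewrite /dslope; case: eqVneq => // za0; move: za1; by rewrite za0 subrr cabs0 ler10.
rewrite cabsM cabsV mulrAC ler_pdivrMr; last by lra.
have h1 := cabs_triangle (g z) (- g a); rewrite cabsN in h1.
rewrite -mulrA ler_pM ?cabs_ge0//; first lra.
have := cabs_triangle (z - a) a; rewrite subrK; nra.
Qed.

(** Induction on the growth order: the divided difference at a point a outside [E] grows one order
    less, at the price of adding a to the exceptional list. *)
Lemma liouville_poly (K : nat) g (E : seq (cplx R)) : continuous g ->
  (forall z, z \notin E -> cdiff g z) ->
  (exists C M : R, forall z, M <= cabs z -> cabs (g z) <= C * (1 + cabs z) ^+ K) ->
  exists P : {poly cplx R}, forall z, g z = P.[z].
Proof.
elim: K g E => [|K IH] g E cg dg [C [M HM]];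
  have [a aE _] := exists_notin E 0 ltr01;
  have [l ck] := dslope_continuous cg (dg _ aE);
  (have dk z : z \notin a :: E -> cdiff (dslope g l a) z by
    [rewrite inE negb_or => /andP[za zE]; apply: dslope_cdiff => //; exact: dg]);
  have a0 := cabs_ge0 a; have ga0 := cabs_ge0 (g a).
- have k0 : forall z, dslope g l a z = 0.
    apply: (liouville_vanish ck dk) => e e0.
    exists (Num.max M (Num.max (cabs a + 1) ((C + cabs (g a)) * (2 + cabs a) / e))).
    move=> z; rewrite !ge_max => /and3P[z1 z2]; rewrite ler_pdivrMr// => z3.
    have h := dslope_growth g l z2; have h1 := HM z z1; rewrite expr0 mulr1 in h1.
    have z0 := cabs_ge0 z.
    rewrite -(@ler_pM2r _ (1 + cabs z)); last by atom_lra.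
    apply: le_trans h _; atom_nra.
  by exists (g a)%:P => z; rewrite hornerC (dslopeK g l a z) k0 mulr0 addr0.
have [|P HP] := IH (dslope g l a) (a :: E) ck dk; last first.
  exists ((g a)%:P + ('X - a%:P) * P) => z.
  by rewrite (dslopeK g l a z) HP !hornerE.
exists ((C + cabs (g a)) * (2 + cabs a)), (Num.max M (cabs a + 1)).
move=> z; rewrite !ge_max => /andP[z1 z2].
have h := dslope_growth g l z2; have h1 := HM z z1.
have z0 := cabs_ge0 z.
rewrite -(@ler_pM2r _ (1 + cabs z)); last by lra.
apply: le_trans h _; rewrite -[leRHS]mulrA -exprSr mulrAC ler_wpM2r//; first by lra.
have : 1 <= (1 + cabs z) ^+ K.+1 by rewrite exprn_ege1// lerDl.
nra.
Qed.

Lemma horner_le (P : {poly cplx R}) : exists2 C : R, 0 <= C &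
  forall z, cabs P.[z] <= C * (1 + cabs z) ^+ (size P).-1.
Proof.
elim/poly_ind: P => [|P c [C C0 IH]].
  by exists 0 => // z; rewrite horner0 cabs0 mul0r.
exists (C + cabs c); first by rewrite addr_ge0// cabs_ge0.
move=> z; rewrite hornerMXaddC; have z0 := cabs_ge0 z; have c0 := cabs_ge0 c.
have [P0|P0] := eqVneq P 0.
  have -> : (size (P * 'X + c%:P)).-1 = 0%N by rewrite P0 mul0r add0r size_polyC; case: eqP.
  by rewrite P0 horner0 mul0r add0r expr0 mulr1 lerDr.
rewrite size_MXaddC (negbTE P0) /=.
have sP : size P = (size P).-1.+1 by rewrite prednK// size_poly_gt0.
apply: le_trans (cabs_triangle _ _) _; rewrite cabsM mulrDl; apply: lerD.
  rewrite sP exprSr mulrA ler_pM ?cabs_ge0//; lra.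
by rewrite ler_peMr// exprn_ege1// lerDl.
Qed.

Lemma horner_ge (P : {poly cplx R}) : P != 0 -> exists c M : R, [/\ 0 < c, 0 <= M &
  forall z, M <= cabs z -> c * cabs z ^+ (size P).-1 <= cabs P.[z]].
Proof.
elim/poly_ind: P => [|P d IH]; first by rewrite eqxx.
have [P0 Pd|P0 _] := eqVneq P 0.
  move: Pd; rewrite P0 mul0r add0r => /[!polyC_eq0] d0.
  exists (cabs d), 0; split => //; first by rewrite cabs_gt0.
  by move=> z _; rewrite hornerC size_polyC d0 /= expr0 mulr1.
have [c [M [c0 M0 H]]] := IH P0.
have d0 := cabs_ge0 d.
exists (c / 2), (Num.max 1 (Num.max M (2 * cabs d / c))).
split; [lra|by rewrite le_max ler01|].
move=> z; rewrite !ge_max => /and3P[z1 /H zM]; rewrite ler_pdivrMr// => zd.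
rewrite size_MXaddC (negbTE P0) /=.
have sP : size P = (size P).-1.+1 by rewrite prednK// size_poly_gt0.
rewrite hornerMXaddC; apply: le_trans (cabs_leD _ _); rewrite cabsM.
rewrite sP exprSr; set t := cabs z ^+ _ in zM *.
have t1 : 1 <= t by rewrite exprn_ege1.
have : c * t * cabs z <= cabs P.[z] * cabs z by rewrite ler_wpM2r// cabs_ge0.
have : cabs d <= c * t * cabs z / 2.
  have : c * cabs z <= t * (c * cabs z) by rewrite ler_peMl// mulr_ge0// ?cabs_ge0// ltW.
  lra.
atom_lra.
Qed.

(** The factor 1 + |z| + |w| on the left stands for one power less on the right; it avoids a
    truncated exponent when P is constant. *)
Lemma horner_lip (P : {poly cplx R}) : exists2 C : R, 0 <= C &
  forall z w, cabs (P.[w] - P.[z]) * (1 + cabs z + cabs w) <=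
     C * cabs (w - z) * (1 + cabs z + cabs w) ^+ (size P).-1.
Proof.
elim/poly_ind: P => [|P c [C C0 IH]].
  by exists 0 => // z w; rewrite !horner0 subrr cabs0 !mul0r.
have [D D0 HD] := horner_le P.
exists (C + D) => [|z w]; first by rewrite addr_ge0.
have z0 := cabs_ge0 z; have w0 := cabs_ge0 w; set T := 1 + cabs z + cabs w.
have T1 : 1 <= T by rewrite /T; lra.
rewrite !hornerMXaddC.
have [P0|P0] := eqVneq P 0.
  rewrite P0 !horner0 !mul0r !add0r subrr cabs0 mul0r mulr_ge0 ?mulr_ge0 ?addr_ge0 ?cabs_ge0//.
  by rewrite exprn_ge0//; lra.
rewrite size_MXaddC (negbTE P0) /=.
have sP : size P = (size P).-1.+1 by rewrite prednK// size_poly_gt0.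
have -> : P.[w] * w + c - (P.[z] * z + c) = (P.[w] - P.[z]) * w + P.[z] * (w - z) by ring.
apply: le_trans (ler_wpM2r _ (cabs_triangle _ _)) _; first by lra.
have d0 := cabs_ge0 (w - z).
rewrite !cabsM mulrDl mulrDl mulrDl; apply: lerD.
  rewrite mulrAC; apply: le_trans (ler_wpM2r w0 (IH z w)) _; rewrite -/T [in leRHS]sP exprSr mulrA.
  by rewrite ler_wpM2l//; [rewrite !mulr_ge0// exprn_ge0//; atom_lra|rewrite /T; atom_lra].
rewrite [in leRHS]sP exprSr mulrA ler_wpM2r//; first atom_lra.
rewrite mulrAC ler_wpM2r//; apply: le_trans (HD z) _; rewrite ler_wpM2l//.
by rewrite lerXn2r// ?nnegrE /T; atom_lra.
Qed.

End liouville.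

(** * Lebesgue measure on the complex space *)

Definition mkmfun d d' (T : measurableType d) (T' : measurableType d') (f : T -> T')
  (mf : measurable_fun setT f) : {mfun T >-> T'} := mfun_Sub (mem_set mf).

Lemma open_interior (T : topologicalType) (A : set T) : A `<=` interior A -> open A.
Proof. by rewrite openE. Qed.

Section Cn_measurable.
Context {R : realType} {n : nat}.
Notation Cn := (Cn R n).

Lemma measurable_continuous_in (D : set Cn) (f : Cn -> R) :
  open (D : set 'rV[cplx R]_n) ->
  (forall z, D z -> {for z, continuous (f : 'rV[cplx R]_n -> R)}) -> measurable_fun D f.
Proof.
move=> oD cf; apply: (measurability (@RGenOInfty.G R)) => //.
  exact: RGenOInfty.measurableE.
move=> _ [_ [a ->] <-]; apply: measurable_open.
apply: open_interior => z [Dz] /=; rewrite in_itv/= andbT => az.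
apply: filterI; first by apply: open_nbhs_nbhs; split.
apply: (cf z Dz [set x | x \in `]a, +oo[]); rewrite /=.
have : open [set x : R | a < x] by exact: open_gt.
move=> oa; have : nbhs (f z) [set x | a < x] by apply: open_nbhs_nbhs; split.
by apply: filterS => x /=; rewrite in_itv/= andbT.
Qed.

Lemma measurable_continuous (f : Cn -> R) :
  continuous (f : 'rV[cplx R]_n -> R) -> measurable_fun setT f.
Proof. move=> cf; apply: measurable_continuous_in; first exact: (@openT 'rV[cplx R]_n).
by move=> z _; exact: cf. Qed.

Lemma measurable_cre (j : 'I_n) : measurable_fun setT (fun z : Cn => cre (z 0 j)).
Proof.
apply: measurable_continuous => z.
apply: (@continuous_comp _ _ _ (fun z : 'rV[cplx R]_n => z 0 j) cre); last exact: continuous_cre.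
exact: coord_continuous.
Qed.

Lemma measurable_cim (j : 'I_n) : measurable_fun setT (fun z : Cn => cim (z 0 j)).
Proof.
apply: measurable_continuous => z.
apply: (@continuous_comp _ _ _ (fun z : 'rV[cplx R]_n => z 0 j) cim); last exact: continuous_cim.
exact: coord_continuous.
Qed.

Lemma measurable_enorm : measurable_fun setT (fun z : Cn => enorm z).
Proof. by apply: measurable_continuous; exact: continuous_enorm. Qed.

Definition rvec (z : Cn) : (n + n).-tuple (measurableTypeR R) :=
  [tuple match fintype.split i with inl j => cre (z 0 j) | inr j => cim (z 0 j) end | i < n + n].

Lemma rvecK z : cvec (rvec z) = z.
Proof.
apply/rowP => j; rewrite mxE !tnth_mktuple.
rewrite -[lshift n j]/(unsplit (inl j)) unsplitK -[rshift n j]/(unsplit (inr j)) unsplitK.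
exact: mkcK.
Qed.

(** A map into C^n factors through real coordinates and [cvec], which is measurable from R^(2n) to
    the Borel sets of C^n. *)
Lemma measurable_CnP d (T : measurableType d) (g : T -> Cn) :
  (forall j, measurable_fun setT (fun t => cre (g t 0 j))) ->
  (forall j, measurable_fun setT (fun t => cim (g t 0 j))) -> measurable_fun setT g.
Proof.
move=> hr hi; have -> : g = @cvec R n \o (@rvec \o g) by apply/funext => t /=; rewrite rvecK.
apply: measurableT_comp; first exact: measurable_funPT.
apply/measurable_fun_tnthP => i.
have -> : ((@tnth _ _)^~ i \o (rvec \o g)) =
  (fun t => match fintype.split i with inl j => cre (g t 0 j) | inr j => cim (g t 0 j) end).
  by apply/funext => t /=; rewrite tnth_mktuple.
by case: (fintype.split i) => j; [exact: hr|exact: hi].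
Qed.

Section cfun.
Context d (T : measurableType d).
Implicit Types (f g : T -> cplx R).

Definition cmeasurable f := measurable_fun setT (cre \o f) /\ measurable_fun setT (cim \o f).

Lemma cmeasurableD f g : cmeasurable f -> cmeasurable g -> cmeasurable (fun t => f t + g t).
Proof.
move=> [f1 f2] [g1 g2]; split.
  by rewrite (_ : _ \o _ = (cre \o f) \+ (cre \o g)); [exact: measurable_funD|apply/funext => t /=; rewrite creD].
by rewrite (_ : _ \o _ = (cim \o f) \+ (cim \o g)); [exact: measurable_funD|apply/funext => t /=; rewrite cimD].
Qed.

Lemma cmeasurable_cst k : cmeasurable (fun=> k).
Proof. by split; exact: measurable_cst. Qed.

Lemma cmeasurableM f g : cmeasurable f -> cmeasurable g -> cmeasurable (fun t => f t * g t).
Proof.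
move=> [f1 f2] [g1 g2]; split.
  rewrite (_ : _ \o _ = ((cre \o f) \* (cre \o g)) \- ((cim \o f) \* (cim \o g))); last by apply/funext => t /=; rewrite creM.
  by apply: measurable_funB; exact: measurable_funM.
rewrite (_ : _ \o _ = ((cre \o f) \* (cim \o g)) \+ ((cim \o f) \* (cre \o g))); last by apply/funext => t /=; rewrite cimM.
by apply: measurable_funD; exact: measurable_funM.
Qed.

Lemma cmeasurableJ f : cmeasurable f -> cmeasurable (fun t => (f t)^*).
Proof.
move=> [f1 f2]; split.
  by rewrite (_ : _ \o _ = cre \o f)//; apply/funext => t /=; rewrite creJ.
rewrite (_ : _ \o _ = (fun t => - (cim \o f) t)); last by apply/funext => t /=; rewrite cimJ.
by apply: measurableT_comp => //; exact: oppr_measurable.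
Qed.

Lemma cmeasurableB f g : cmeasurable f -> cmeasurable g -> cmeasurable (fun t => f t - g t).
Proof.
move=> mf mg; rewrite (_ : (fun _ => _) = (fun t => f t + (-1) * g t)); last first.
  by apply/funext => t; rewrite mulN1r.
by apply: cmeasurableD => //; apply: cmeasurableM => //; exact: cmeasurable_cst.
Qed.

Lemma cmeasurable_sum (I : Type) (r : seq I) (F : I -> T -> cplx R) :
  (forall i, cmeasurable (F i)) -> cmeasurable (fun t => \sum_(i <- r) F i t).
Proof.
move=> mF; elim: r => [|i r IH].
  by under eq_fun do rewrite big_nil; exact: cmeasurable_cst.
by under eq_fun do rewrite big_cons; exact: cmeasurableD.
Qed.

Lemma cmeasurable_cabs f : cmeasurable f -> measurable_fun setT (fun t => cabs (f t)).
Proof.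
move=> [f1 f2]; rewrite (_ : (fun _ => _) =
  @Num.sqrt R \o (fun t => (cre \o f) t ^+ 2 + (cim \o f) t ^+ 2)); last first.
  by apply/funext => t; rewrite cabs_def.
apply: measurableT_comp.
  by apply: continuous_measurable_fun; exact: sqrt_continuous.
by apply: measurable_funD; exact: measurable_funX.
Qed.

Lemma cmeasurable_coord (g : T -> Cn) j : measurable_fun setT g -> cmeasurable (fun t => g t 0 j).
Proof.
move=> mg; split; first exact: (measurableT_comp (measurable_cre j) mg).
exact: (measurableT_comp (measurable_cim j) mg).
Qed.

Lemma cmeasurable_Cn (g : T -> Cn) : (forall j, cmeasurable (fun t => g t 0 j)) -> measurable_fun setT g.
Proof. by move=> H; apply: measurable_CnP => j; have [] := H j. Qed.

Lemma measurable_CnD (g h : T -> Cn) : measurable_fun setT g -> measurable_fun setT h ->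
  measurable_fun setT (fun t => g t + h t : Cn).
Proof.
move=> mg mh; apply: cmeasurable_Cn => j; under eq_fun do rewrite mxE.
by apply: cmeasurableD; exact: cmeasurable_coord.
Qed.

Lemma measurable_CnZ (f : T -> cplx R) (h : T -> Cn) : cmeasurable f -> measurable_fun setT h ->
  measurable_fun setT (fun t => f t *: h t : Cn).
Proof.
move=> mg mh; apply: cmeasurable_Cn => j; under eq_fun do rewrite mxE.
by apply: cmeasurableM => //; exact: cmeasurable_coord.
Qed.

Lemma cmeasurable_cdot (g h : T -> Cn) : measurable_fun setT g -> measurable_fun setT h ->
  cmeasurable (fun t => cdot (g t) (h t)).
Proof.
move=> mg mh; apply: cmeasurable_sum => j; apply: cmeasurableM; first exact: cmeasurable_coord.
by apply: cmeasurableJ; exact: cmeasurable_coord.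
Qed.

End cfun.

Lemma measurable_csphere : measurable (@csphere R n).
Proof.
have -> : @csphere R n = (fun z : Cn => enorm z) @^-1` [set 1] by [].
by rewrite -[X in measurable X]setTI; apply: measurable_enorm.
Qed.

End Cn_measurable.

(** * Product measures and invariance under coordinatewise maps *)

Section tuple_measure_theory.
Local Open Scope ereal_scope.
Context d (T : measurableType d) (R : realType).
Variable mu : {sigma_finite_measure set T -> \bar R}.

Lemma tuple_measureS m (A : set (m.+1.-tuple T)) :
  tuple_measure mu m.+1 A = (mu \x tuple_measure mu m) (@tuple_cons _ T m @^-1` A).
Proof. by []. Qed.

Lemma tnth_tuple_cons m (x : T) (t : m.-tuple T) j : tnth (tuple_cons (x, t)) (lift ord0 j) = tnth t j.
Proof. by rewrite (tnth_nth x) /= -tnth_nth. Qed.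

Lemma tuple_measure_box m (B : 'I_m -> set T) : (forall i, measurable (B i)) ->
  tuple_measure mu m [set t | forall i, B i (tnth t i)] = \prod_(i < m) mu (B i).
Proof.
elim: m B => [|m IH] B mB.
  rewrite big_ord0 /= (_ : [set t | _] = setT); last by apply/seteqP; split => // t _ [].
  by rewrite diracT.
rewrite tuple_measureS (_ : _ @^-1` _ =
    B ord0 `*` [set t | forall i, B (lift ord0 i) (tnth t i)]).
  rewrite [LHS]product_measure1E//; last first.
    rewrite (_ : [set t | _] = \bigcap_(i in [set: 'I_m]) ((@tnth _ _)^~ i @^-1` B (lift ord0 i))).
      apply: fin_bigcap_measurable => // i _; rewrite -[X in measurable X]setTI.
      exact: measurable_tnth.
    by apply/seteqP; split => [t h i _|t h i]; [exact: h|exact: (h i I)].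
  by rewrite big_ord_recl; congr (_ * _); exact: (IH (fun i => B (lift ord0 i))).
apply/seteqP; split => [[x t] /= h|[x t] [/= h0 h] i].
  split => [|i]; first exact: (h ord0).
  by have := h (lift ord0 i); rewrite (tnth_nth x)/= -tnth_nth.
case: (unliftP ord0 i) => [j ->|->//]; have := h j.
by rewrite (tnth_nth x) [in X in _ -> X](tnth_nth x).
Qed.

(** Induction on the number of factors. The image of the product measure under the map takes the
    right values on rectangles, and the product measure is determined by them. *)
Lemma tuple_measure_map m (phi : 'I_m -> T -> T) :
  (forall i, measurable_fun setT (phi i)) ->
  (forall i A, measurable A -> mu (phi i @^-1` A) = mu A) ->
  forall A, measurable A ->
  tuple_measure mu m ((fun t => [tuple phi i (tnth t i) | i < m]) @^-1` A) = tuple_measure mu m A.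
Proof.
elim: m phi => [|m IH] phi mphi phiE A mA.
  congr (tuple_measure mu 0 _); apply/seteqP.
  have E (t : 0.-tuple T) : [tuple phi i (tnth t i) | i < 0] = t by apply: eq_from_tnth => - [].
  by split => t /=; rewrite E.
rewrite !tuple_measureS.
pose psi i := phi (lift ord0 i).
pose g (t : m.-tuple T) := [tuple psi i (tnth t i) | i < m].
have mg : measurable_fun setT g.
  apply/measurable_fun_tnthP => i.
  rewrite (_ : _ \o _ = psi i \o (@tnth _ _)^~ i); last by apply/funext => t /=; rewrite tnth_mktuple.
  by apply: measurableT_comp; [exact: mphi|exact: measurable_tnth].
pose G (xt : T * m.-tuple T) := (phi ord0 xt.1, g xt.2).
have mG : measurable_fun setT G.
  apply/measurable_fun_pairP; split.
    rewrite (_ : _ \o _ = phi ord0 \o fst)//; apply: measurableT_comp => //; exact: measurable_fst.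
  rewrite (_ : _ \o _ = g \o snd)//; apply: measurableT_comp => //; exact: measurable_snd.
have mA' : measurable (@tuple_cons _ T m @^-1` A).
  by rewrite -[X in measurable X]setTI; apply: (measurable_funPT (@tuple_cons _ T m)).
have -> : @tuple_cons _ T m @^-1` ((fun t => [tuple phi i (tnth t i) | i < m.+1]) @^-1` A) =
    G @^-1` (@tuple_cons _ T m @^-1` A).
  apply/funext => - [x t] /=; congr (A _); apply: eq_from_tnth => i.
  rewrite tnth_mktuple; case: (unliftP ord0 i) => [j ->|->//].
  by rewrite !tnth_tuple_cons tnth_mktuple.
rewrite -[LHS]/(image_measure (mu \x tuple_measure mu m) (mkmfun mG) _).
rewrite -(@product_measure_unique _ _ _ _ _ mu (tuple_measure mu m)
  (image_measure (mu \x tuple_measure mu m) (mkmfun mG)))//.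
move=> B C mB mC; rewrite /image_measure /pushforward /=.
rewrite (_ : _ @^-1` _ = (phi ord0 @^-1` B) `*` (g @^-1` C)); last by apply/seteqP; split => [[]|[]].
rewrite [LHS]product_measure1E.
- by congr (_ * _); [exact: phiE|apply: IH => // i; [exact: mphi|exact: phiE]].
- by rewrite -[X in measurable X]setTI; exact: mphi.
- by rewrite -[X in measurable X]setTI; exact: mg.
Qed.

End tuple_measure_theory.

Section lebesgue_invariance.
Context {R : realType}.
Local Notation leb := (@lebesgue_measure R).

Lemma lebesgue_measure_shift (a : R) (A : set (measurableTypeR R)) : measurable A ->
  leb ((fun x => x + a) @^-1` A) = leb A.
Proof.
move=> mA.
have ms : measurable_fun setT ((fun x => x + a) : measurableTypeR R -> measurableTypeR R).
  by apply: measurable_funD => //; exact: measurable_cst.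
rewrite [RHS](@lebesgue_measure_unique _ (image_measure leb (mkmfun ms)))//.
move=> _ [[x y] xy <-]; rewrite /image_measure /pushforward /=.
rewrite (_ : _ @^-1` _ = `]x - a, y - a]%classic); last first.
  by apply/seteqP; split => z; rewrite /= !in_itv/= ltrBlDr lerBrDr.
rewrite !lebesgue_measure_itv/= !lte_fin ltrD2r.
by case: ifP => // _; congr (_%:E)%E; lra.
Qed.

Lemma lebesgue_measure_opp (A : set (measurableTypeR R)) : measurable A ->
  leb ((fun x => - x) @^-1` A) = leb A.
Proof. exact: lebesgue_measureN. Qed.

End lebesgue_invariance.

Section vol.
Context {R : realType} {n : nat}.
Notation Cn := (Cn R n).
Notation vol := (@lebesgue_Cn R n).
Local Notation leb := (@lebesgue_measure R).
Local Open Scope ereal_scope.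

Lemma volE (A : set Cn) : vol A = tuple_measure leb (n + n) (@cvec R n @^-1` A).
Proof. by []. Qed.

Lemma vol_box (I J : 'I_n -> interval R) :
  vol [set z | forall j, cre (z 0%R j) \in I j /\ cim (z 0%R j) \in J j] =
  \prod_(j < n) (leb [set` I j] * leb [set` J j]).
Proof.
rewrite volE.
pose B (i : 'I_(n + n)) := match fintype.split i with inl j => [set` I j] | inr j => [set` J j] end.
rewrite (_ : _ @^-1` _ = [set t | forall i, B i (tnth t i)]).
  rewrite tuple_measure_box; last first.
    by move=> i; rewrite /B; case: (fintype.split i) => j; exact: measurable_itv.
  rewrite big_split_ord big_split /=; congr (_ * _); apply: eq_bigr => j _.
    by rewrite /B -[lshift n j]/(unsplit (inl j)) unsplitK.
  by rewrite /B -[rshift n j]/(unsplit (inr j)) unsplitK.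
apply/seteqP; split => t /= h.
  move=> i; rewrite /B; case: splitP => j ij; have := h j; rewrite !mxE !cE => - [h1 h2].
    by rewrite (_ : i = lshift n j) //; apply: val_inj.
  by rewrite (_ : i = rshift n j) //; apply: val_inj.
move=> j; rewrite !mxE !cE; have := h (lshift n j); have := h (rshift n j).
by rewrite /B -[lshift n j]/(unsplit (inl j)) -[rshift n j]/(unsplit (inr j)) !unsplitK.
Qed.

Lemma vol_map (phi : 'I_(n + n) -> measurableTypeR R -> measurableTypeR R) (f : Cn -> Cn) :
  (forall i, measurable_fun setT (phi i)) ->
  (forall i (A : set (measurableTypeR R)), measurable A -> leb (phi i @^-1` A) = leb A) ->
  (forall t : (n + n).-tuple R, f (cvec t) = cvec [tuple phi i (tnth t i) | i < n + n]) ->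
  forall A, measurable A -> vol (f @^-1` A) = vol A.
Proof.
move=> mphi phiE fE A mA; rewrite !volE.
rewrite -[RHS](tuple_measure_map mphi phiE); last first.
  by rewrite -[X in measurable X]setTI; apply: (measurable_funPT (@cvec R n)).
congr (tuple_measure leb (n + n) _); apply/funext => t; by rewrite /preimage/= fE.
Qed.

Lemma vol_translate (a : Cn) (A : set Cn) : measurable A ->
  vol ((fun z => z + a)%R @^-1` A) = vol A.
Proof.
apply: (@vol_map (fun i x => x + tnth (rvec a) i)%R).
- by move=> i; apply: measurable_funD => //; exact: measurable_cst.
- by move=> i B mB; exact: lebesgue_measure_shift.
move=> t; rewrite -[in LHS](rvecK a); apply/rowP => j.
by rewrite !mxE !tnth_mktuple; apply: ceq; rewrite !cE.
Qed.

Lemma vol_opp (A : set Cn) : measurable A -> vol ((fun z => - z)%R @^-1` A) = vol A.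
Proof.
apply: (@vol_map (fun i x => - x)%R).
- by move=> i; exact: oppr_measurable.
- by move=> i B mB; exact: lebesgue_measure_opp.
move=> t; apply/rowP => j.
by rewrite !mxE !tnth_mktuple; apply: ceq; rewrite !cE.
Qed.

Definition cube (r : R) : set Cn :=
  [set z | forall j, cre (z 0%R j) \in `[- r, r] /\ cim (z 0%R j) \in `[- r, r]]%R.

Lemma vol_cube (r : R) : (0 <= r)%R -> vol (cube r) = ((2 * r) ^+ (n + n))%:E.
Proof.
move=> r0; rewrite /cube (vol_box (fun=> `[- r, r]%R) (fun=> `[- r, r]%R)).
have -> : leb `[(- r)%R, r]%classic = (2 * r)%:E.
  rewrite lebesgue_measure_itv/= lte_fin; case: ltP => h; first by congr (_%:E); lra.
  by congr (_%:E); lra.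
rewrite (eq_bigr (fun=> ((2 * r) ^+ 2)%:E)) => [|j _]; last by rewrite expr2 EFinM.
by rewrite prodEFin prodr_const card_ord -exprM mul2n addnn.
Qed.

Lemma measurable_boxset (I J : 'I_n -> interval R) :
  measurable [set z : Cn | forall j, cre (z 0%R j) \in I j /\ cim (z 0%R j) \in J j].
Proof.
rewrite (_ : [set z | _] = \bigcap_(j in [set: 'I_n])
   (((fun z : Cn => cre (z 0%R j)) @^-1` [set` I j]) `&` ((fun z : Cn => cim (z 0%R j)) @^-1` [set` J j]))).
  apply: fin_bigcap_measurable => // j _; apply: measurableI; rewrite -[X in measurable X]setTI.
    by apply: measurable_cre => //; exact: measurable_itv.
  by apply: measurable_cim => //; exact: measurable_itv.
by apply/seteqP; split => [z h j _|z h j]; [exact: h|exact: (h j Logic.I)].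
Qed.

Lemma measurable_cube r : measurable (cube r).
Proof. exact: (measurable_boxset (fun=> `[- r, r]%R) (fun=> `[- r, r]%R)). Qed.

Lemma vol_sigma_finite : sigma_finite [set: Cn] vol.
Proof.
exists (fun k => cube k%:R) => [|k]; last first.
  by split; [exact: measurable_cube|rewrite vol_cube ?ltry].
apply/seteqP; split => // z _.
have [k Hk] : exists k : nat, forall j, (cabs (z 0%R j) <= k%:R)%R.
  exists (Num.Def.truncn (\sum_j cabs (z 0%R j))).+1 => j.
  apply: le_trans (ltW (truncnS_gt _)).
  rewrite (bigD1 j)//= lerDl sumr_ge0// => i _; exact: cabs_ge0.
exists k => // j; rewrite !in_itv/= -!ler_norml; split.
  exact: le_trans (cre_le _) (Hk j).
exact: le_trans (cim_le _) (Hk j).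
Qed.

(** A copy of [vol] that carries the sigma-finiteness instance, as Fubini's theorem asks. *)
Definition sfvol : set Cn -> \bar R := vol.
HB.instance Definition _ := Measure.on sfvol.
HB.instance Definition _ := Measure_isSigmaFinite.Build _ _ _ sfvol vol_sigma_finite.

End vol.

Lemma muleI_fin {R : realType} (x y b : \bar R) :
  (b \is a fin_num -> 0 < b -> x * b = y * b -> x = y)%E.
Proof.
case: b => // b _; rewrite lte_fin => b0 /(congr1 (fun z => z * (b^-1)%:E))%E.
by rewrite -!muleA -EFinM mulfV ?gt_eqF// !mule1.
Qed.

(** * Linear changes of variable by uniqueness of Haar measure *)

Section haar.
Context {R : realType} {n : nat}.
Notation Cn := (Cn R n).
Notation vol := (@lebesgue_Cn R n).
Local Open Scope ereal_scope.

Let measurable_fst_Cn : measurable_fun [set: Cn * Cn] (fst : Cn * Cn -> Cn).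
Proof. exact: (@measurable_fst _ _ Cn Cn). Qed.

Let measurable_snd_Cn : measurable_fun [set: Cn * Cn] (snd : Cn * Cn -> Cn).
Proof. exact: (@measurable_snd _ _ Cn Cn). Qed.

(* Both sides are the measure of {(x, y) | T x \in A, T x + y \in B}. *)
Lemma vol_haar (T S : Cn -> Cn) (A B : set Cn) :
  measurable_fun setT T -> (forall x y, T (x + y) = T x + T y)%R -> cancel S T ->
  measurable A -> measurable B ->
  vol (T @^-1` A) * vol B = vol (T @^-1` B) * vol A.
Proof.
move=> mT TD ST mA mB.
have mTp C : measurable C -> measurable (T @^-1` C).
  by move=> mC; rewrite -[X in measurable X]setTI; exact: mT.
pose E : set (Cn * Cn) := [set xy | A (T xy.1) /\ B (T xy.1 + xy.2)%R].
have mE : measurable E.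
  have -> : E = ((fun xy => T xy.1) @^-1` A) `&` ((fun xy => T xy.1 + xy.2)%R @^-1` B) by [].
  have mT1 : measurable_fun [set: Cn * Cn] (fun xy => T xy.1).
    exact: (measurableT_comp mT measurable_fst_Cn).
  apply: measurableI; rewrite -[X in measurable X]setTI; first exact: mT1.
  by apply: measurable_CnD => //; exact: measurable_snd_Cn.
have := indic_fubini_tonelli sfvol sfvol mE.
rewrite indic_fubini_tonelli_FE// indic_fubini_tonelli_GE//.
have -> : sfvol \o xsection E = (fun x => vol B * (\1_(T @^-1` A) x)%:E).
  apply/funext => x; rewrite -[LHS]/(vol (xsection E x)) indicE; case: (boolP (x \in T @^-1` A)) => xA.
    rewrite mule1 -(vol_translate (T x) mB); congr (vol _); apply/seteqP; split => y.
      by rewrite /xsection/= inE => -[_]; rewrite /= addrC.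
    by rewrite /xsection/= inE/= addrC => yB; split => //; move: xA; rewrite inE.
  rewrite mule0 (_ : xsection E x = set0) ?measure0//; apply/seteqP; split => // y.
  by rewrite /xsection/= inE => -[+ _]; move: xA; rewrite notin_setE.
have -> : sfvol \o ysection E = (fun y => vol ([set x | A (T x - y)%R] `&` (T @^-1` B))).
  apply/funext => y; rewrite -[LHS]/(vol (ysection E y)); have mE' : measurable (T @^-1` B `&` [set x | A (T x - y)%R]).
    apply: measurableI; first exact: mTp.
    rewrite -[X in measurable X]setTI.
    have : measurable_fun setT (fun x => T x - y : Cn)%R.
      by apply: measurable_CnD => //; exact: measurable_cst.
    exact.
  (* Substituting x + S y for x replaces T x by T x + y, which exchanges the roles of A and B. *)
  rewrite setIC -(vol_translate (S y) mE'); congr (vol _); apply/seteqP; split => x.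
    by rewrite /ysection/= inE => -[/= xA xB]; rewrite TD ST addrK.
  by rewrite /ysection/= inE /= TD ST addrK => -[].
rewrite ge0_integralZl//; last by apply/measurable_EFinP; apply: measurable_indic; exact: mTp.
rewrite integral_indic ?setIT//; last exact: mTp.
rewrite muleC => ->.
pose F : set (Cn * Cn) := [set yx | A (T yx.2 - yx.1)%R /\ B (T yx.2)].
have mF : measurable F.
  have -> : F = ((fun yx => T yx.2 - yx.1)%R @^-1` A) `&` ((fun yx => T yx.2) @^-1` B) by [].
  have mT1 : measurable_fun [set: Cn * Cn] (fun xy => T xy.2).
    exact: (measurableT_comp mT measurable_snd_Cn).
  apply: measurableI; rewrite -[X in measurable X]setTI; last exact: mT1.
  have H : measurable_fun [set: Cn * Cn] (fun yx => T yx.2 + (-1) *: yx.1 : Cn)%R.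
    apply: measurable_CnD => //; apply: measurable_CnZ; first exact: cmeasurable_cst.
    exact: measurable_fst_Cn.
  rewrite (_ : (fun _ => _) = (fun yx => T yx.2 + (-1) *: yx.1 : Cn)%R); first exact: H.
  by apply/funext => yx; rewrite scaleN1r.
have := indic_fubini_tonelli sfvol sfvol mF.
rewrite indic_fubini_tonelli_FE// indic_fubini_tonelli_GE//.
have -> : sfvol \o xsection F = (fun y => vol ([set x | A (T x - y)%R] `&` (T @^-1` B))).
  apply/funext => y; rewrite -[LHS]/(vol (xsection F y)); congr (vol _); apply/seteqP; split => x.
    by rewrite /xsection/= inE.
  by rewrite /xsection/= inE.
move=> ->.
have -> : sfvol \o ysection F = (fun x => vol A * (\1_(T @^-1` B) x)%:E).
  apply/funext => x; rewrite -[LHS]/(vol (ysection F x)) indicE; case: (boolP (x \in T @^-1` B)) => xB.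
    rewrite mule1 -(vol_opp mA) -(vol_translate (T x)); last first.
      exact: measurable_ysection.
    congr (vol _); apply/seteqP; split => y.
      by rewrite /ysection/= inE => -[/=]; rewrite opprD addrCA subrr addr0.
    move=> yA; rewrite /ysection /= inE; split => /=; last by move: xB; rewrite inE.
    by rewrite opprD addrCA subrr addr0.
  rewrite mule0 (_ : ysection F x = set0) ?measure0//; apply/seteqP; split => // y.
  by rewrite /ysection/= inE => -[_ +]; move: xB; rewrite notin_setE.
rewrite ge0_integralZl//; last by apply/measurable_EFinP; apply: measurable_indic; exact: mTp.
rewrite (integral_indic sfvol measurableT); last exact: mTp.
by rewrite setIT; exact: muleC.
Qed.

Lemma cube_fin (r : R) : (0 <= r)%R -> vol (cube r) \is a fin_num.
Proof. by move=> r0; rewrite vol_cube. Qed.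

Lemma vol_bounded_fin (A : set Cn) (r : R) : (0 <= r)%R -> measurable A -> A `<=` cube r -> vol A \is a fin_num.
Proof.
move=> r0 mA Ar; rewrite ge0_fin_numE//; apply: (@le_lt_trans _ _ (vol (cube r))).
  by apply: le_measure; rewrite ?inE//; exact: measurable_cube.
by rewrite -ge0_fin_numE// cube_fin.
Qed.

(** A single invariant set of positive finite volume fixes the scaling factor of T to be 1; no
    determinant has to be computed. *)
Lemma vol_invariant (T S : Cn -> Cn) (A B : set Cn) :
  measurable_fun setT T -> (forall x y, T (x + y) = T x + T y)%R -> cancel S T ->
  measurable A -> measurable B -> T @^-1` B = B -> vol B \is a fin_num -> 0 < vol B ->
  vol (T @^-1` A) = vol A.
Proof.
move=> mT TD ST mA mB TB Bf B0; have := vol_haar mT TD ST mA mB.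
by rewrite TB [RHS]muleC => /muleI_fin; exact.
Qed.

Lemma measurable_Cn_scale (c : cplx R) : measurable_fun setT (fun z : Cn => c *: z : Cn)%R.
Proof. by apply: measurable_CnZ; [exact: cmeasurable_cst|exact: measurable_id]. Qed.

(** The factor is read off from cubes, whose preimages under the scaling are again cubes. *)
Lemma vol_scale (r : R) (A : set Cn) : (0 < r)%R -> measurable A ->
  vol ((fun z : Cn => cr r *: z : Cn)%R @^-1` A) = (r^-1 ^+ (n + n))%:E * vol A.
Proof.
move=> r0 mA.
have crn : cr r != 0%R by rewrite -cabs_gt0 cabs_cr gtr0_norm.
have := @vol_haar (fun z : Cn => cr r *: z : Cn)%R (fun z : Cn => (cr r)^-1 *: z)%R A (cube 1)
  (measurable_Cn_scale (cr r)) (fun x y => scalerDr _ x y).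
move=> /(_ _ mA (measurable_cube 1)) H.
have {H} := H _; rewrite vol_cube// (_ : _ @^-1` cube 1 = cube r^-1).
  rewrite vol_cube ?invr_ge0 ?(ltW r0)// => H.
  have {H} := H _ => H.
  have E2 : (0 < 2 ^+ (n + n) :> R)%R by rewrite exprn_gt0.
  apply: (@muleI_fin _ _ _ (2 ^+ (n + n))%:E) => //.
  rewrite mulr1 in H; rewrite H; last by move=> z; rewrite scalerA mulfV// scale1r.
  by rewrite exprMn EFinM -muleA [LHS]muleC.
apply/seteqP; split => z /= h j; have := h j; rewrite !in_itv/= -!ler_norml mxE !cE !mul0r subr0 addr0 !normrM gtr0_norm// -!ler_pdivlMl// mulr1.
  by [].
by [].
Qed.

End haar.

(** * Hermitian geometry and unitary maps *)

Section hermitian.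
Context {R : realType} {n : nat}.
Notation Cn := (Cn R n).
Implicit Types (z w x y a b : 'rV[cplx R]_n) (k : cplx R).

Lemma cdotDl x y w : cdot (x + y) w = cdot x w + cdot y w.
Proof. by rewrite /cdot -big_split; apply: eq_bigr => j _; rewrite mxE mulrDl. Qed.
Lemma cdotZl k x w : cdot (k *: x) w = k * cdot x w.
Proof. by rewrite /cdot mulr_sumr; apply: eq_bigr => j _; rewrite mxE mulrA. Qed.
Lemma cdotC x y : cdot y x = (cdot x y)^*.
Proof. by rewrite /cdot rmorph_sum; apply: eq_bigr => j _; rewrite rmorphM /= conjCK mulrC. Qed.
Lemma cdotDr x y w : cdot w (x + y) = cdot w x + cdot w y.
Proof. by rewrite cdotC cdotDl rmorphD /= -!cdotC. Qed.
Lemma cdotZr k x w : cdot w (k *: x) = k^* * cdot w x.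
Proof. by rewrite cdotC cdotZl rmorphM /= -cdotC. Qed.
Lemma cdotNl x w : cdot (- x) w = - cdot x w.
Proof. by rewrite -scaleN1r cdotZl mulN1r. Qed.
Lemma cdotNr x w : cdot w (- x) = - cdot w x.
Proof. by rewrite cdotC cdotNl rmorphN /= -cdotC. Qed.
Lemma cdotBl x y w : cdot (x - y) w = cdot x w - cdot y w.
Proof. by rewrite cdotDl cdotNl. Qed.
Lemma cdotBr x y w : cdot w (x - y) = cdot w x - cdot w y.
Proof. by rewrite cdotDr cdotNr. Qed.
Lemma cdot0l w : cdot 0 w = 0. Proof. by rewrite -(scale0r 0) cdotZl mul0r. Qed.
Lemma cdot0r w : cdot w 0 = 0. Proof. by rewrite cdotC cdot0l rmorph0. Qed.

Lemma enorm_ge0 z : 0 <= enorm z. Proof. exact: sqrtr_ge0. Qed.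
Lemma enorm2 z : enorm z ^+ 2 = \sum_(j < n) cabs (z 0 j) ^+ 2.
Proof. by rewrite /enorm sqr_sqrtr// sumr_ge0// => j _; exact: sqr_ge0. Qed.
Lemma cdotzz z : cdot z z = cr (enorm z ^+ 2).
Proof.
rewrite enorm2 /cdot (eq_bigr (fun j => cr (cabs (z 0 j) ^+ 2))) => [|j _]; last exact: mulJ.
by elim/big_rec2: _ => // j u v _ ->; rewrite crD.
Qed.
Lemma enormZ k z : enorm (k *: z) = cabs k * enorm z.
Proof.
apply/eqP; rewrite -(@eqrXn2 _ 2)// ?mulr_ge0 ?enorm_ge0 ?cabs_ge0//; apply/eqP.
rewrite exprMn !enorm2 mulr_sumr; apply: eq_bigr => j _.
by rewrite mxE cabsM exprMn.
Qed.
Lemma enorm0 : enorm (0 : 'rV[cplx R]_n) = 0.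
Proof. by rewrite -(scale0r 0) enormZ cabs0 mul0r. Qed.
Lemma enorm_eq0 z : (enorm z == 0) = (z == 0).
Proof.
apply/idP/eqP => [/eqP z0|->]; last by rewrite enorm0.
have : enorm z ^+ 2 = 0 by rewrite z0 expr0n.
rewrite enorm2 => /psumr_eq0P H; apply/rowP => j; rewrite mxE.
apply/eqP; rewrite -cabs_eq0 -(sqrf_eq0 (cabs _)); apply/eqP; apply: H => // i _; exact: sqr_ge0.
Qed.
Lemma enormN z : enorm (- z) = enorm z.
Proof. by rewrite -scaleN1r enormZ cabsN cabs1 mul1r. Qed.
Lemma enormD2 z w : enorm (z + w) ^+ 2 = enorm z ^+ 2 + enorm w ^+ 2 + 2 * cre (cdot z w).
Proof.
have := congr1 cre (cdotzz (z + w)); rewrite cdotDl !cdotDr !cdotzz (cdotC z w) !cE => <-; lra.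
Qed.
Lemma enormB2 z w : enorm (z - w) ^+ 2 = enorm z ^+ 2 + enorm w ^+ 2 - 2 * cre (cdot z w).
Proof. by rewrite enormD2 cdotNr enormN creN mulrN. Qed.

(* The squared distance from z to the line spanned by the unit vector e. *)
Lemma enorm_perp z e : enorm e = 1 ->
  enorm (z - cdot z e *: e) ^+ 2 = enorm z ^+ 2 - cabs (cdot z e) ^+ 2.
Proof.
move=> e1; rewrite enormB2 enormZ e1 mulr1 cdotZr mulJ2 cre_cr; lra.
Qed.

(** For a unit vector this is the nonnegativity of the squared distance in [enorm_perp]; the general
    case follows by scaling w. *)
Lemma cauchy_schwarz z w : cabs (cdot z w) <= enorm z * enorm w.
Proof.
have [->|w0] := eqVneq w 0; first by rewrite cdot0r cabs0 enorm0 mulr0.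
have ew : 0 < enorm w by rewrite lt_neqAle eq_sym enorm_eq0 w0 enorm_ge0.
pose e := cr (enorm w)^-1 *: w.
have e1 : enorm e = 1 by rewrite enormZ cabs_cr ger0_norm ?invr_ge0 ?enorm_ge0// mulVf// gt_eqF.
have -> : w = cr (enorm w) *: e by rewrite scalerA -crM mulfV ?gt_eqF// scale1r.
rewrite cdotZr enormZ e1 mulr1 cabsM cabsJ mulrC ler_wpM2r ?cabs_ge0//.
rewrite -(@ler_pXn2r _ 2)// ?nnegrE ?cabs_ge0 ?enorm_ge0// -subr_ge0 -(enorm_perp z e1).
exact: sqr_ge0.
Qed.

Lemma enorm_triangle z w : enorm (z + w) <= enorm z + enorm w.
Proof.
rewrite -(@ler_pXn2r _ 2)// ?nnegrE ?addr_ge0 ?enorm_ge0// enormD2.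
have := cauchy_schwarz z w; have := cre_le_cabs (cdot z w); rewrite sqrrD; lra.
Qed.

Lemma coord_le z j : cabs (z 0 j) <= enorm z.
Proof.
rewrite -(@ler_pXn2r _ 2)// ?nnegrE ?cabs_ge0 ?enorm_ge0// enorm2 (bigD1 j)//= lerDl.
by apply: sumr_ge0 => i _; exact: sqr_ge0.
Qed.

Lemma enorm_le z (r : R) : 0 <= r -> (forall j, cabs (z 0 j) <= r) -> enorm z ^+ 2 <= n%:R * r ^+ 2.
Proof.
move=> r0 H; rewrite enorm2; apply: (@le_trans _ _ (\sum_(j < n) r ^+ 2)).
  by apply: ler_sum => j _; rewrite lerXn2r// nnegrE ?cabs_ge0.
by rewrite sumr_const card_ord mulr_natl.
Qed.

(** The inverse S is part of the data because [vol_haar] takes a right inverse, and maps are used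
    rather than matrices because measurability and preimages are what matter. *)
Definition is_unitary (U S : Cn -> Cn) : Prop :=
  [/\ measurable_fun setT U, (forall k z w, U (k *: z + w) = k *: U z + U w),
   cancel S U, cancel U S & forall z w, cdot (U z) (U w) = cdot z w].

(** The complex reflection z - (<z, w> / c) w with w = a - b and c = <a, w> sends a to a - w = b. It
    is unitary because |w|^2 = c + conj c, and its inverse has conj c in place of c. The usual
    factor 2 / |w|^2 would only do when <a, b> is real. *)
Lemma rotation_exists (a b : Cn) : enorm a = 1 -> enorm b = 1 ->
  exists U S, is_unitary U S /\ U a = b.
Proof.
move=> a1 b1; have [<-|ab] := eqVneq a b.
  exists id, id; split=> //; split => //; exact: measurable_id.
pose w := a - b; pose c := cdot a w.
have cE : c = 1 - cdot a b by rewrite /c /w cdotBr cdotzz a1 expr1n.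
have ww : cdot w w = c + c^*.
  rewrite cE rmorphB rmorph1 /= -cdotC /w cdotBl !cdotBr !cdotzz a1 b1 expr1n; ring.
have w0 : cdot w w != 0.
  by rewrite cdotzz -cabs_eq0 cabs_cr normr_eq0 sqrf_eq0 enorm_eq0 subr_eq0.
have c0 : c != 0 by apply: contra w0 => /eqP c0; rewrite ww c0 rmorph0 addr0.
have cJ0 : c^* != 0 by rewrite conjC_eq0.
pose V k := fun z : Cn => z - (cdot z w / k) *: w : Cn.
have Vlin k m z y : V k (m *: z + y) = m *: V k z + V k y.
  by rewrite /V cdotDl cdotZl; apply/rowP => j; rewrite !mxE; ring.
have key k l z : cdot w w = k + l -> k != 0 -> l != 0 -> V k (V l z) = z.
  move=> E k0 l0; rewrite /V cdotBl cdotZl E; apply/rowP => j; rewrite !mxE; field.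
  by apply/andP.
exists (V c), (V c^*); split; last by rewrite /V -/c divff// scale1r /w subKr.
split.
- have m1 : measurable_fun setT (fun z : Cn => z + (- (cdot z w / c)) *: w : Cn).
    apply: measurable_CnD; first exact: measurable_id.
    apply: measurable_CnZ; last exact: measurable_cst.
    rewrite (_ : (fun _ => _) = (fun z : Cn => cdot z w * - c^-1)); last first.
      by apply/funext => z; rewrite mulrN.
    apply: cmeasurableM; last exact: cmeasurable_cst.
    by apply: cmeasurable_cdot; [exact: measurable_id|exact: measurable_cst].
  rewrite (_ : V c = (fun z : Cn => z + (- (cdot z w / c)) *: w : Cn)); first exact: m1.
  by apply/funext => z; rewrite /V scaleNr.
- exact: Vlin.
- by move=> z; apply: key.
- by move=> z; apply: key => //; rewrite ww addrC.
clear key Vlin; clearbody c w; move=> z y; rewrite /V cdotBl !cdotBr !cdotZl !cdotZr ww (cdotC y w) !rmorphM fmorphV /=.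
by field; apply/andP.
Qed.

End hermitian.
#[global] Hint Extern 0 (is_true (@Order.le _ _ _ (enorm _))) => solve [apply: enorm_ge0] : core.

Lemma mnormalizeE d (T : measurableType d) (R : realType) (mu : {measure set T -> \bar R})
    (P : probability T R) A : (0 < mu setT -> mu setT \is a fin_num ->
  mnormalize mu P A = mu A * ((fine (mu setT))^-1)%:E)%E.
Proof.
move=> m0 mf; rewrite /mnormalize ifF//; apply/negbTE; rewrite negb_or gt_eqF//=.
by apply/eqP => h; move: mf; rewrite h.
Qed.

Section unitary.
Context {R : realType} {n : nat}.
Notation Cn := (Cn R n).
Notation vol := (@lebesgue_Cn R n).
Notation ball := (@cball R n).
Variables (U S : Cn -> Cn).
Hypothesis uU : is_unitary U S.

Lemma unitary_enorm z : enorm (U z) = enorm z.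
Proof.
case: uU => _ _ _ _ H; apply/eqP; rewrite -(@eqrXn2 _ 2)//; apply/eqP.
by have := H z z; rewrite !cdotzz => /(congr1 cre); rewrite !cre_cr.
Qed.

Lemma unitaryD x y : U (x + y) = U x + U y.
Proof. by case: uU => _ H _ _ _; rewrite -[x]scale1r H !scale1r. Qed.

Lemma unitary0 : U 0 = 0.
Proof. by apply: (@addrI _ (U 0)); rewrite -unitaryD !addr0. Qed.

Lemma unitaryZ k x : U (k *: x) = k *: U x.
Proof. by case: uU => _ H _ _ _; rewrite -[k *: x]addr0 H unitary0 !addr0. Qed.

Lemma unitaryB x y : U (x - y) = U x - U y.
Proof. by rewrite unitaryD -scaleN1r unitaryZ scaleN1r. Qed.

End unitary.

(** * Unitary invariance of the measures on the ball and the sphere *)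

Section ball_volume.
Context {R : realType} {n : nat}.
Notation Cn := (Cn R n).
Notation vol := (@lebesgue_Cn R n).
Notation ball := (@cball R n).
Local Open Scope ereal_scope.

Lemma cube_cabs (r : R) (z : Cn) : (cube r z -> forall j, cabs (z 0%R j) <= 2 * r)%R.
Proof.
move=> h j; have [] := h j; rewrite !in_itv/= -!ler_norml => h1 h2.
have := cabs_le_re_im (z 0%R j); lra.
Qed.

Lemma cabs_cube (r : R) (z : Cn) : (forall j, cabs (z 0 j) <= r)%R -> cube r z.
Proof.
move=> h j; rewrite !in_itv/= -!ler_norml; split.
  exact: le_trans (cre_le _) (h j).
exact: le_trans (cim_le _) (h j).
Qed.

Lemma sub_cball_cube : ball `<=` cube 1.
Proof. by move=> z z1; apply: cabs_cube => j; apply: le_trans (coord_le _ _) (ltW z1). Qed.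

Lemma vol_cball_fin : vol ball \is a fin_num.
Proof. by apply: (vol_bounded_fin ler01 _ sub_cball_cube); exact: measurable_cball. Qed.

Lemma small_cube_cball : exists2 r : R, (0 < r)%R & cube r `<=` ball.
Proof.
have h1 : (0 <= n%:R :> R)%R by [].
exists ((2 * (n%:R + 1))^-1)%R; first by rewrite invr_gt0; lra.
move=> z /cube_cabs h; rewrite /cball /=.
have r0 : (0 <= 2 * (2 * (n%:R + 1))^-1 :> R)%R by rewrite mulr_ge0// invr_ge0; lra.
have := enorm_le r0 h; rewrite -(@ltr_pXn2r _ 2)// ?nnegrE// expr1n => /le_lt_trans; apply.
have -> : (2 * (2 * (n%:R + 1))^-1 = (n%:R + 1)^-1 :> R)%R by field; lra.
have t0 : (0 < n%:R + 1 :> R)%R by lra.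
rewrite exprVn ltr_pdivrMr ?exprn_gt0//; nra.
Qed.

Lemma vol_cball_gt0 : 0 < vol ball.
Proof.
have [r r0 rb] := small_cube_cball.
apply: (@lt_le_trans _ _ (vol (cube r))).
  by rewrite vol_cube ?ltW// lte_fin exprn_gt0// mulr_gt0.
by apply: le_measure; rewrite ?inE//; [exact: measurable_cube|exact: measurable_cball].
Qed.

Lemma vol_unitary (U S : Cn -> Cn) (A : set Cn) : is_unitary U S -> measurable A ->
  vol (U @^-1` A) = vol A.
Proof.
move=> uU mA; case: (uU) => mU Ul SU US Ud.
apply: (@vol_invariant _ _ U S A ball) => //.
- exact: unitaryD uU.
- exact: measurable_cball.
- by apply/seteqP; split => z; rewrite /cball/= (unitary_enorm uU).
- exact: vol_cball_fin.
- exact: vol_cball_gt0.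
Qed.

Definition c0 : R := (fine (vol ball))^-1%R.

Lemma c0_gt0 : (0 < c0)%R.
Proof. by rewrite invr_gt0 fine_gt0// vol_cball_gt0/= -ge0_fin_numE// vol_cball_fin. Qed.

Lemma ball_measureE (A : set Cn) : ball_measure R n A = vol (A `&` ball) * c0%:E.
Proof.
pose m : {measure set Cn -> \bar R} := mrestr vol (@measurable_cball R n).
have E : m setT = vol ball by rewrite -[LHS]/(vol (setT `&` ball)) setTI.
apply: etrans (@mnormalizeE _ _ _ m (@dirac _ Cn 0%R R) A _ _) _; rewrite E.
- exact: vol_cball_gt0.
- exact: vol_cball_fin.
- by [].
Qed.

(** On subsets of the ball the normalised measure is [c0] times volume, so estimates may be made for
    [vol] and carried over. *)
Lemma ball_integral (D : set Cn) (f : Cn -> \bar R) : measurable D -> D `<=` ball ->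
  measurable_fun D f -> (forall x, D x -> 0 <= f x) ->
  \int[ball_measure R n]_(x in D) f x = c0%:E * \int[vol]_(x in D) f x.
Proof.
move=> mD Db mf f0.
have c00 : (0 <= c0)%R by exact: ltW c0_gt0.
rewrite -(ge0_integral_mscale vol mD (NngNum c00) mf f0).
apply: eq_measure_integral => A mA AD.
apply: etrans (ball_measureE A) _; rewrite /= /mscale /= muleC; congr (_ * vol _); by apply/setIidl => x /AD /Db.
Qed.

Lemma ball_measure_unitary (U S : Cn -> Cn) (A : set Cn) : is_unitary U S -> measurable A ->
  ball_measure R n (U @^-1` A) = ball_measure R n A.
Proof.
move=> uU mA; rewrite !ball_measureE -(vol_unitary uU (measurableI _ _ mA (@measurable_cball R n))).
congr (vol _ * _); apply/seteqP; split => z [] ? /=; rewrite /cball/= ?(unitary_enorm uU) => ?.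
  by split; rewrite //= (unitary_enorm uU).
by split.
Qed.

Lemma sphere_measureE (A : set Cn) : sphere_measure R n A = ball_measure R n (@cproj R n @^-1` A).
Proof. by []. Qed.

Lemma sphere_measure_unitary (U S : Cn -> Cn) (A : set Cn) : is_unitary U S -> measurable A ->
  sphere_measure R n (U @^-1` A) = sphere_measure R n A.
Proof.
move=> uU mA; rewrite !sphere_measureE -[RHS](ball_measure_unitary uU); last first.
  by rewrite -[X in measurable X]setTI; apply: (measurable_funPT (@cproj R n)).
congr (ball_measure R n _); apply/funext => z; rewrite /preimage /=.
by rewrite /cproj (unitary_enorm uU) (unitaryZ uU).
Qed.

End ball_volume.

(** * Caps, shells and Koranyi regions *)

Section boxes.
Context {R : realType} {n : nat}.
Notation Cn := (Cn R n.+1).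
Notation vol := (@lebesgue_Cn R n.+1).
Notation ball := (@cball R n.+1).
Local Notation leb := (@lebesgue_measure R).

Definition e1 : Cn := delta_mx 0 ord0.

Lemma cdot_e1 (z : Cn) : cdot z e1 = z 0 ord0.
Proof.
rewrite /cdot (bigD1 ord0)//= !mxE eqxx /= rmorph1 mulr1 big1 ?addr0// => j /negbTE j0.
by rewrite !mxE j0 andbF rmorph0 mulr0.
Qed.

Lemma enorm_e1 : enorm e1 = 1.
Proof.
have := congr1 cre (cdotzz e1); rewrite cdot_e1 !mxE !eqxx /= => /esym/eqP.
by rewrite sqrf_eq1 => /orP[/eqP//|/eqP h]; have := enorm_ge0 e1; rewrite h; lra.
Qed.

Lemma enorm2_split (z : Cn) :
  enorm z ^+ 2 = cabs (z 0 ord0) ^+ 2 + \sum_(j < n) cabs (z 0 (lift ord0 j)) ^+ 2.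
Proof. by rewrite enorm2 big_ord_recl. Qed.

(** Boxes adapted to the nonisotropic geometry at [e1]: a cap of size d has extent about d in the
    first complex coordinate and sqrt d in the others. *)
Definition box0 (a1 b1 a2 b2 r : R) : set Cn :=
  [set z | forall j, cre (z 0 j) \in (if j == ord0 then `[a1, b1] else `[- r, r]) /\
     cim (z 0 j) \in (if j == ord0 then `[a2, b2] else `[- r, r])].

Lemma box0P a1 b1 a2 b2 r (z : Cn) : box0 a1 b1 a2 b2 r z <->
  [/\ a1 <= cre (z 0 ord0) <= b1, a2 <= cim (z 0 ord0) <= b2 &
    forall j, `|cre (z 0 (lift ord0 j))| <= r /\ `|cim (z 0 (lift ord0 j))| <= r].
Proof.
split => [h|[h1 h2 h] j].
  split; [by have [] := h ord0; rewrite eqxx !in_itv|by have [] := h ord0; rewrite eqxx !in_itv|].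
  by move=> j; have := h (lift ord0 j); rewrite /= !in_itv/= -!ler_norml.
case: (unliftP ord0 j) => [i ->|->]; last by rewrite eqxx !in_itv.
by rewrite /= !in_itv/= -!ler_norml.
Qed.

Lemma measurable_box0 a1 b1 a2 b2 r : measurable (box0 a1 b1 a2 b2 r).
Proof.
exact: (measurable_boxset (fun j => if j == ord0 then `[a1, b1] else `[- r, r])
  (fun j => if j == ord0 then `[a2, b2] else `[- r, r])).
Qed.

Lemma leb_itv (a b : R) : a <= b -> leb `[a, b]%classic = (b - a)%:E.
Proof.
move=> ab; rewrite lebesgue_measure_itv/= lte_fin; case: ltP => h; first by rewrite -EFinB.
by congr (_%:E); lra.
Qed.

Lemma vol_box0 a1 b1 a2 b2 r : a1 <= b1 -> a2 <= b2 -> 0 <= r ->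
  vol (box0 a1 b1 a2 b2 r) = ((b1 - a1) * (b2 - a2) * ((2 * r) ^+ 2) ^+ n)%:E.
Proof.
move=> h1 h2 r0; rewrite /box0 (vol_box (fun j => if j == ord0 then `[a1, b1] else `[- r, r])
  (fun j => if j == ord0 then `[a2, b2] else `[- r, r])).
rewrite big_ord_recl eqxx !leb_itv// -EFinM.
rewrite (eq_bigr (fun=> ((2 * r) ^+ 2)%:E)) => [|j _].
  by rewrite prodEFin prodr_const card_ord.
by rewrite /= leb_itv; [rewrite -EFinM; congr (_%:E); ring|lra].
Qed.

Lemma ball_measure_le (A B : set Cn) (x : R) : measurable A -> measurable B ->
  A `&` ball `<=` B -> vol B = x%:E -> (ball_measure R n.+1 A <= (x * c0 (R := R) (n := n.+1))%:E)%E.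
Proof.
move=> mA mB AB vB; rewrite ball_measureE EFinM lee_wpmul2r ?lee_fin ?(ltW c0_gt0)// -vB.
apply: le_measure; rewrite ?inE//; apply: measurableI => //; exact: measurable_cball.
Qed.

Lemma ball_measure_ge (A B : set Cn) (x : R) : measurable A -> measurable B ->
  B `<=` A `&` ball -> vol B = x%:E -> ((x * c0 (R := R) (n := n.+1))%:E <= ball_measure R n.+1 A)%E.
Proof.
move=> mA mB AB vB; rewrite ball_measureE EFinM lee_wpmul2r ?lee_fin ?(ltW c0_gt0)// -vB.
apply: le_measure; rewrite ?inE//; apply: measurableI => //; exact: measurable_cball.
Qed.

Lemma cmeasurable_dot_cst (a : Cn) : cmeasurable (fun z : Cn => 1 - cdot z a).
Proof.
apply: cmeasurableB; first exact: cmeasurable_cst.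
by apply: cmeasurable_cdot; [exact: measurable_id|exact: measurable_cst].
Qed.

Lemma measurable_lt_set (f : Cn -> R) d : measurable_fun setT f -> measurable [set z | f z < d].
Proof.
move=> mf; have -> : [set z | f z < d] = f @^-1` `]-oo, d[%classic.
  by apply/seteqP; split => z; rewrite /= in_itv.
by rewrite -[X in measurable X]setTI; apply: mf => //; exact: measurable_itv.
Qed.

(** A subset of the whole space, so that the same sets serve for the ball and, intersected with the
    sphere, for the boundary. *)
Definition cap (xi : Cn) d : set Cn := [set z | cabs (1 - cdot z xi) < d].

Lemma measurable_cap (a : Cn) d : measurable (cap a d).
Proof. by apply: measurable_lt_set; apply: cmeasurable_cabs; exact: cmeasurable_dot_cst. Qed.

Lemma cabs_1dotC (a z : Cn) : cabs (1 - cdot a z) = cabs (1 - cdot z a).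
Proof. by rewrite (cdotC z a) -[in LHS](rmorph1 (@Num.conj_op (cplx R))) -rmorphB cabsJ. Qed.

(** Since |z_1| >= 1 - d and |z| <= 1, at most 2 d of the squared norm is left to the other
    coordinates. *)
Lemma perp_le (z : Cn) d j : enorm z <= 1 -> 0 <= d -> cabs (1 - z 0 ord0) <= d ->
  cabs (z 0 (lift ord0 j)) ^+ 2 <= 2 * d.
Proof.
move=> z1 d0 zd; have := enorm2_split z; rewrite (bigD1 j)//=.
set S := \sum_(_ < _ | _) _; have S0 : 0 <= S by apply: sumr_ge0 => i _; exact: sqr_ge0.
have : enorm z ^+ 2 <= 1 by rewrite expr_le1.
have := cabs_leB 1 (z 0 ord0); rewrite cabs1.
set u := cabs (z 0 ord0); have u0 : 0 <= u by exact: cabs_ge0.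
move: zd; rewrite cabsB; have := cabsB (z 0 ord0) 1; nra.
Qed.

Lemma ball_cap_e1 d : 0 < d -> (ball_measure R n.+1 (cap e1 d) <=
  (4 * d ^+ 2 * (8 * d) ^+ n * c0 (R := R) (n := n.+1))%:E)%E.
Proof.
move=> d0; have s0 : 0 <= Num.sqrt (2 * d) by exact: sqrtr_ge0.
have s2 : Num.sqrt (2 * d) ^+ 2 = 2 * d by rewrite sqr_sqrtr; lra.
apply: (@ball_measure_le _ (box0 (1 - d) (1 + d) (- d) d (Num.sqrt (2 * d)))).
- exact: measurable_cap.
- exact: measurable_box0.
- move=> z [+ zb]; rewrite /cap /= cdot_e1 => zd; apply/box0P.
  have zr := cre_le (1 - z 0 ord0); have zi := cim_le (1 - z 0 ord0).
  rewrite !cE sub0r normrN in zr zi.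
  have zr' := le_lt_trans zr zd; have zi' := le_lt_trans zi zd.
  rewrite ltr_distl in zr'; rewrite ltr_norml in zi'; case/andP: zr' => ? ?; case/andP: zi' => ? ?.
  split; [apply/andP; split; atom_lra|apply/andP; split; atom_lra|].
  move=> j; have h := perp_le j (ltW zb) (ltW d0) (ltW zd).
  have : cabs (z 0 (lift ord0 j)) <= Num.sqrt (2 * d).
    by rewrite -(@ler_pXn2r _ 2)// ?nnegrE// s2.
  by move=> h'; split; [exact: le_trans (cre_le _) h'|exact: le_trans (cim_le _) h'].
rewrite vol_box0; [|lra|lra|exact: s0]; congr EFin.
by rewrite [(2 * _) ^+ 2]exprMn s2; congr (_ * _ ^+ _); ring.
Qed.

(** The constant of the enclosing box, increased by 1 so that [Cup >= 1]; caps of size above 1 are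
    then covered by the total mass of the sphere. *)
Definition Cup : R := 4 * 8 ^+ n * c0 (R := R) (n := n.+1) + 1.

Lemma ball_cap_le (xi : Cn) d : enorm xi = 1 -> 0 < d ->
  (ball_measure R n.+1 (cap xi d) <= (Cup * d ^+ n.+2)%:E)%E.
Proof.
move=> x1 d0; have [U [S [uU Ux]]] := rotation_exists x1 enorm_e1.
rewrite (_ : cap xi d = U @^-1` cap e1 d); last first.
  by apply/seteqP; split => z; rewrite /cap /=; case: uU => _ _ _ _ Ud; rewrite -Ux Ud.
rewrite (ball_measure_unitary uU); last exact: measurable_cap.
apply: le_trans (ball_cap_e1 d0) _; rewrite lee_fin /Cup exprMn !exprS.
have dn : 0 < d ^+ n by rewrite exprn_gt0.
have : 0 <= d * (d * d ^+ n) by rewrite !mulr_ge0// ltW.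
lra.
Qed.

Lemma sphere_measure_le1 (A : set Cn) : measurable A -> (sphere_measure R n.+1 A <= 1)%E.
Proof. by move=> mA; exact: probability_le1. Qed.

Lemma enorm_cproj (z : Cn) : z != 0 -> enorm (cproj z) = 1.
Proof.
move=> z0; rewrite /cproj -[(enorm z)^-1%:C%C]/(cr _) enormZ cabs_cr ger0_norm ?invr_ge0//.
by rewrite mulVf// enorm_eq0.
Qed.

Lemma cproj_coord (z : Cn) j : cproj z 0 j = cr (enorm z)^-1 * z 0 j.
Proof. by rewrite /cproj mxE. Qed.

(** The measure on the sphere is that of the cone over a set. The cone over a cap is unrestricted in
    its first real coordinate, which costs one power of d compared with [ball_cap_le]. *)
Lemma sphere_cap_le (xi : Cn) d : enorm xi = 1 -> 0 < d ->
  (sphere_measure R n.+1 (cap xi d) <= (Cup * d ^+ n.+1)%:E)%E.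
Proof.
move=> x1 d0; have [U [S [uU Ux]]] := rotation_exists x1 enorm_e1.
rewrite (_ : cap xi d = U @^-1` cap e1 d); last first.
  by apply/seteqP; split => z; rewrite /cap /=; case: uU => _ _ _ _ Ud; rewrite -Ux Ud.
rewrite (sphere_measure_unitary uU); last exact: measurable_cap.
have C1 : 1 <= Cup.
  by rewrite lerDr !mulr_ge0// ?exprn_ge0// ltW// c0_gt0.
have [d1|d1] := ltP 1 d.
  apply: le_trans (sphere_measure_le1 (measurable_cap _ _)) _; rewrite lee_fin.
  by rewrite -[leLHS]mulr1 ler_pM// exprn_ege1// ltW.
have s0 : 0 <= Num.sqrt (2 * d) by exact: sqrtr_ge0.
have s2 : Num.sqrt (2 * d) ^+ 2 = 2 * d by rewrite sqr_sqrtr; lra.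
rewrite sphere_measureE.
apply: (@le_trans _ _ (2 * (2 * d) * (8 * d) ^+ n * c0 (R := R) (n := n.+1))%:E).
  apply: (@ball_measure_le _ (box0 (-1) 1 (- d) d (Num.sqrt (2 * d)))).
  - rewrite -[X in measurable X]setTI; apply: (measurable_funPT (@cproj R n.+1)) => //.
    exact: measurable_cap.
  - exact: measurable_box0.
  - move=> z [+ zb]; rewrite /cap /= cdot_e1 => zd.
    have z0 : z != 0.
      apply/eqP => z0; move: zd; rewrite cproj_coord z0 mxE mulr0 subr0 cabs1; lra.
    have pz := enorm_cproj z0.
    have ez : 0 < enorm z by rewrite lt_neqAle eq_sym enorm_eq0 z0 enorm_ge0.
    have zE j : z 0 j = cr (enorm z) * cproj z 0 j.
      by rewrite cproj_coord mulrA -crM mulfV ?gt_eqF// mul1r.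
    have zj j : cabs (z 0 j) <= cabs (cproj z 0 j).
      by rewrite zE cabsM cabs_cr ger0_norm// ler_piMl// ltW.
    have zi := cim_le (1 - cproj z 0 ord0); rewrite !cE sub0r normrN in zi.
    have zi' : `|cim (z 0 ord0)| <= d.
      rewrite zE !cE mul0r addr0 normrM ger0_norm//; have := le_lt_trans zi zd.
      have : enorm z * `|cim (cproj z 0 ord0)| <= 1 * `|cim (cproj z 0 ord0)|.
        by rewrite ler_wpM2r// ltW.
      atom_lra.
    apply/box0P; split.
    + by rewrite -ler_norml; apply: le_trans (cre_le _) _; apply: le_trans (coord_le _ _) (ltW zb).
    + by rewrite -ler_norml.
    move=> j; have p1 : enorm (cproj z) <= 1 by rewrite pz.
    have h := perp_le j p1 (ltW d0) (ltW zd).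
    have : cabs (cproj z 0 (lift ord0 j)) <= Num.sqrt (2 * d).
      by rewrite -(@ler_pXn2r _ 2)// ?nnegrE// s2.
    by move=> /(le_trans (zj _)) h'; split; [exact: le_trans (cre_le _) h'|exact: le_trans (cim_le _) h'].
  rewrite vol_box0; [|lra|lra|exact: s0]; congr EFin.
  by rewrite [(2 * _) ^+ 2]exprMn s2; congr (_ * _ ^+ _); ring.
rewrite lee_fin /Cup exprMn !exprS.
have dn : 0 < d ^+ n by rewrite exprn_gt0.
have : 0 <= d * d ^+ n by rewrite !mulr_ge0// ltW.
lra.
Qed.

Definition hgt (z : Cn) : R := 1 - enorm z ^+ 2.

Lemma measurable_hgt : measurable_fun setT hgt.
Proof. by apply: measurable_funB => //; apply: measurable_funX; exact: measurable_enorm. Qed.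

Lemma hgt_gt0 z : ball z -> 0 < hgt z.
Proof. by move=> z1; rewrite /hgt subr_gt0 expr_lt1. Qed.

Lemma hgt_le1 z : hgt z <= 1.
Proof. by rewrite /hgt lerBlDr lerDl sqr_ge0. Qed.

Lemma hgt_gt0_ball z : 0 < hgt z -> ball z.
Proof. by rewrite /hgt subr_gt0 expr_lt1. Qed.

Lemma koranyiE (xi z : Cn) : koranyi xi z <-> ball z /\ cabs (1 - cdot z xi) < hgt z.
Proof. by []. Qed.

Lemma measurable_koranyi (xi : Cn) : measurable (koranyi xi).
Proof.
have -> : koranyi xi = ball `&` [set z | cabs (1 - cdot z xi) - hgt z < 0].
  by apply/seteqP; split => z [zb]; rewrite /= subr_lt0.
apply: measurableI; first exact: measurable_cball.
apply: measurable_lt_set; apply: measurable_funB; last exact: measurable_hgt.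
by apply: cmeasurable_cabs; exact: cmeasurable_dot_cst.
Qed.

(** Half-side of the box in the orthogonal coordinates: their total squared length is then at most d
    / 32 ([box0_perp]), whatever the dimension. *)
Let rr (d : R) := Num.sqrt (d / (64 * (n%:R + 1))).

Let rr_ge0 d : 0 <= rr d. Proof. exact: sqrtr_ge0. Qed.

Let rr2 d : 0 <= d -> rr d ^+ 2 = d / (64 * (n%:R + 1)).
Proof. by move=> d0; rewrite sqr_sqrtr// divr_ge0// mulr_ge0//; have := ler0n R n; atom_lra. Qed.

Let box0_perp a1 b1 a2 b2 d z : 0 <= d -> box0 a1 b1 a2 b2 (rr d) z ->
  \sum_(j < n) cabs (z 0 (lift ord0 j)) ^+ 2 <= d / 32.
Proof.
move=> d0 /box0P[_ _ H].
have h1 : 0 <= n%:R :> R by [].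
apply: (@le_trans _ _ (\sum_(j < n) (2 * rr d ^+ 2))).
  apply: ler_sum => j _; rewrite cabs2; have [p1 p2] := H j.
  have : cre (z 0 (lift ord0 j)) ^+ 2 <= rr d ^+ 2 by rewrite -(real_normK (num_real _)) lerXn2r// nnegrE.
  have : cim (z 0 (lift ord0 j)) ^+ 2 <= rr d ^+ 2 by rewrite -(real_normK (num_real _)) lerXn2r// nnegrE.
  lra.
rewrite sumr_const card_ord rr2// -[leLHS]mulr_natl.
rewrite (_ : n%:R * (2 * (d / (64 * (n%:R + 1)))) = d / 32 * (n%:R / (n%:R + 1))); last by field; lra.
by rewrite ler_piMr// ?divr_ge0//; rewrite ler_pdivrMr; atom_lra.
Qed.

Definition Clow : R := (64^-1 / (16 * (n%:R + 1)) ^+ n) * c0 (R := R) (n := n.+1).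

Lemma Clow_gt0 : 0 < Clow.
Proof.
by rewrite mulr_gt0 ?c0_gt0// divr_gt0// ?invr_gt0// exprn_gt0// mulr_gt0.
Qed.

Let rr_vol d : 0 <= d -> ((2 * rr d) ^+ 2) ^+ n = d ^+ n / (16 * (n%:R + 1)) ^+ n.
Proof.
move=> d0; rewrite [(2 * _) ^+ 2]exprMn rr2// -exprVn -exprMn; congr (_ ^+ _).
by field; have := ler0n R n; lra.
Qed.

(** The cone over the cap contains a box whose first coordinate has real part in [1/4, 1/2] and
    imaginary part at most d / 32: the modulus exceeds the real part by at most d / 8, and dividing
    by it moves the first coordinate to within d of 1. *)
Lemma sphere_cap_ge (xi : Cn) d : enorm xi = 1 -> 0 < d -> d <= 1 ->
  ((Clow * d ^+ n.+1)%:E <= sphere_measure R n.+1 (cap xi d))%E.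
Proof.
move=> x1 d0 d1; have [U [S [uU Ux]]] := rotation_exists x1 enorm_e1.
rewrite (_ : cap xi d = U @^-1` cap e1 d); last first.
  by apply/seteqP; split => z; rewrite /cap /=; case: uU => _ _ _ _ Ud; rewrite -Ux Ud.
rewrite (sphere_measure_unitary uU); last exact: measurable_cap.
rewrite sphere_measureE.
have d00 := ltW d0.
have V := @vol_box0 (1/4) (1/2) (- (d / 32)) (d / 32) (rr d).
have -> : Clow * d ^+ n.+1 = (1 / 2 - 1 / 4) * (d / 32 - - (d / 32)) * ((2 * rr d) ^+ 2) ^+ n * c0 (R := R) (n := n.+1).
  by rewrite rr_vol// /Clow exprS; set T := (_ ^+ n)^-1; field.
apply: (@ball_measure_ge _ (box0 (1/4) (1/2) (- (d / 32)) (d / 32) (rr d))).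
- rewrite -[X in measurable X]setTI; apply: (measurable_funPT (@cproj R n.+1)) => //.
  exact: measurable_cap.
- exact: measurable_box0.
- move=> z zB; have P := box0_perp d00 zB; move/box0P: zB => [/andP[u1 u2] /andP[v1 v2] _].
  set u := z 0 ord0 in u1 u2 v1 v2; set a := enorm z.
  have E : a ^+ 2 = cre u ^+ 2 + cim u ^+ 2 + \sum_(j < n) cabs (z 0 (lift ord0 j)) ^+ 2.
    by rewrite /a enorm2_split -/u cabs2.
  set P' := \sum_(_ < _) _ in P E.
  have P'0 : 0 <= P' by apply: sumr_ge0 => i _; exact: sqr_ge0.
  have ua : cre u <= a by apply: le_trans (cre_le_cabs _) _; exact: coord_le.
  have im2 : cim u ^+ 2 <= d / 32 by atom_nra.
  have a0 : 0 < a by atom_lra.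
  have ab : (a - cre u) * (1 / 2) <= d / 16.
    apply: (@le_trans _ _ ((a - cre u) * (a + cre u))); first by rewrite ler_wpM2l//; atom_lra.
    have -> : (a - cre u) * (a + cre u) = a ^+ 2 - cre u ^+ 2 by ring.
    atom_lra.
  split; last first.
    rewrite /cball /= -/a -(@ltr_pXn2r _ 2)// ?nnegrE ?(ltW a0)// E expr1n.
    have : cre u ^+ 2 <= 1 / 4 by atom_nra.
    atom_lra.
  rewrite /cap /= cdot_e1 cproj_coord -/u -/a.
  have -> : 1 - cr a^-1 * u = cr a^-1 * (cr a - u).
    by rewrite mulrBr -crM mulVf ?gt_eqF.
  rewrite cabsM cabs_cr gtr0_norm ?invr_gt0// mulrC ltr_pdivrMr//.
  apply: le_lt_trans (cabs_le_re_im _) _; rewrite !cE sub0r normrN.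
  rewrite ger0_norm ?subr_ge0//.
  have : `|cim u| <= d / 32 by rewrite ler_norml v1 v2.
  have : d * (1 / 4) <= d * a by rewrite ler_wpM2l//; atom_lra.
  atom_lra.
- by apply: V => //; atom_lra.
Qed.

Definition shell (a b : R) : set Cn := [set z | a <= hgt z <= b].

Lemma measurable_shell a b : measurable (shell a b).
Proof.
have -> : shell a b = hgt @^-1` `[a, b]%classic.
  by apply/seteqP; split => z; rewrite /shell /= in_itv.
by rewrite -[X in measurable X]setTI; apply: measurable_hgt => //; exact: measurable_itv.
Qed.

(** The part of the region between heights d and 2 d contains a box with real part in
    [1 - d, 1 - 3 d / 4], whose volume is a fixed multiple of d^n.+2. *)
Lemma shell_ge (xi : Cn) d : enorm xi = 1 -> 0 < d -> d <= 1 / 2 ->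
  ((Clow * d ^+ n.+2)%:E <=
    ball_measure R n.+1 (koranyi xi `&` shell d (2 * d)))%E.
Proof.
move=> x1 d0 d1; have [U [S [uU Ux]]] := rotation_exists x1 enorm_e1.
have mA (x : Cn) : measurable (koranyi x `&` shell d (2 * d)).
  by apply: measurableI; [exact: measurable_koranyi|exact: measurable_shell].
rewrite (_ : _ `&` _ = U @^-1` (koranyi e1 `&` shell d (2 * d))); last first.
  case: (uU) => _ _ _ _ Ud.
  by apply/seteqP; split => z; rewrite /shell /koranyi /hgt /cball /= -Ux Ud !(unitary_enorm uU).
rewrite (ball_measure_unitary uU)//.
have d00 := ltW d0.
have V := @vol_box0 (1 - d) (1 - 3 * d / 4) (- (d / 32)) (d / 32) (rr d).
have -> : Clow * d ^+ n.+2 = (1 - 3 * d / 4 - (1 - d)) * (d / 32 - - (d / 32)) * ((2 * rr d) ^+ 2) ^+ n * c0 (R := R) (n := n.+1).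
  by rewrite rr_vol// /Clow !exprS; set T := (_ ^+ n)^-1; field.
apply: (@ball_measure_ge _ (box0 (1 - d) (1 - 3 * d / 4) (- (d / 32)) (d / 32) (rr d))).
- exact: mA.
- exact: measurable_box0.
- move=> z zB; have P := box0_perp d00 zB; move/box0P: zB => [/andP[u1 u2] /andP[v1 v2] _].
  set u := z 0 ord0 in u1 u2 v1 v2; set a := enorm z.
  have E : a ^+ 2 = cre u ^+ 2 + cim u ^+ 2 + \sum_(j < n) cabs (z 0 (lift ord0 j)) ^+ 2.
    by rewrite /a enorm2_split -/u cabs2.
  set P' := \sum_(_ < _) _ in P E.
  have P'0 : 0 <= P' by apply: sumr_ge0 => i _; exact: sqr_ge0.
  have im2 : cim u ^+ 2 <= d / 64 by atom_nra.
  have re1 : cre u ^+ 2 <= 1 - 3 * d / 2 + 9 / 32 * d by atom_nra.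
  have re2 : 1 - 2 * d <= cre u ^+ 2 by atom_nra.
  have hE : hgt z = 1 - a ^+ 2 by [].
  have hlow : d + d / 16 <= hgt z by rewrite hE E; atom_lra.
  have zb : ball z by apply: hgt_gt0_ball; atom_lra.
  have im0 := sqr_ge0 (cim u).
  split; last exact: zb.
  split; last by rewrite /shell /= hE E; apply/andP; split; atom_lra.
  split; first exact: zb.
  apply: (lt_le_trans _ hlow).
  rewrite cdot_e1 -/u; apply: le_lt_trans (cabs_le_re_im _) _; rewrite !cE sub0r normrN.
  have : `|cim u| <= d / 32 by rewrite ler_norml v1 v2.
  have : `|1 - cre u| <= d by rewrite ler_norml; apply/andP; split; atom_lra.
  atom_lra.
- by apply: V => //; atom_lra.
Qed.

End boxes.

(** * Dyadic integration of powers of the height over Koranyi regions *)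

Section series_bounds.
Context {R : realType}.
Local Open Scope ereal_scope.

Lemma nneseries_le_bound (u : nat -> \bar R) (B : \bar R) : (forall k, 0 <= u k) ->
  (forall N, \sum_(0 <= k < N) u k <= B) -> \sum_(0 <= k <oo) u k <= B.
Proof.
move=> u0 H; apply: lime_le; first by apply: is_cvg_nneseries => k _ _; exact: u0.
by apply: nearW => N; exact: H.
Qed.

Lemma telescope_bound (u x : nat -> R) (A : R) : (forall k, 0 <= u k)%R -> (forall k, 0 <= x k)%R ->
  (0 <= A)%R -> (forall k, u k <= A * (x k - x k.+1))%R ->
  \sum_(0 <= k <oo) (u k)%:E <= (A * x 0%N)%:E.
Proof.
move=> u0 x0 A0 H; apply: nneseries_le_bound => [k|N]; first by rewrite lee_fin.
rewrite sumEFin lee_fin.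
suff : (\sum_(0 <= k < N) u k <= A * (x 0%N - x N))%R.
  by move=> /le_trans; apply; rewrite ler_wpM2l// gerBl.
elim: N => [|N IH]; first by rewrite big_nil subrr mulr0.
rewrite big_nat_recr//=; apply: le_trans (lerD IH (H N)) _; rewrite -mulrDr.
by rewrite ler_wpM2l//; lra.
Qed.

(** The hypothesis covers both K > 1 with e > 0 and K < 1 with e < 0, that is, heights tending to 0
    and heights going up. *)
Lemma geometric_bound (a e K : R) : (0 < a)%R -> (0 < K)%R -> (1 < K `^ e)%R ->
  \sum_(0 <= k <oo) ((a * K^-1 ^+ k) `^ e)%:E <= ((1 - (K `^ e)^-1)^-1 * a `^ e)%:E.
Proof.
move=> a0 K0 Ke; have rho0 : (0 < (K `^ e)^-1)%R by rewrite invr_gt0; lra.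
have rho1 : ((K `^ e)^-1 < 1)%R by rewrite invf_lt1//; lra.
set rho := (K `^ e)^-1%R in rho0 rho1 *.
have xS k : ((a * K^-1 ^+ k.+1) `^ e = (a * K^-1 ^+ k) `^ e * rho)%R.
  rewrite exprSr mulrA powRM ?mulr_ge0 ?exprn_ge0 ?invr_ge0 ?ltW//; congr (_ * _)%R.
  by rewrite /rho -[in LHS]powR_inv1 ?ltW// -powRrM mulN1r powRN.
have := @telescope_bound (fun k => (a * K^-1 ^+ k) `^ e)%R (fun k => (a * K^-1 ^+ k) `^ e)%R (1 - rho)^-1%R.
rewrite expr0 mulr1; apply => [k|k||k]; rewrite ?powR_ge0// ?invr_ge0; try atom_lra.
rewrite xS; set X := (_ `^ e)%R; rewrite (_ : (1 - rho)^-1 * (X - X * rho) = X)%R//.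
by field; apply/eqP; lra.
Qed.

End series_bounds.

Section koranyi_integrals.
Context {R : realType} {n : nat}.
Notation Cn := (Cn R n.+1).
Notation v := (@ball_measure R n.+1).
Notation Cup := (@Cup R n).
Local Open Scope ereal_scope.

Lemma ge0_le_integral_dom d (T : measurableType d) (mu : {measure set T -> \bar R})
    (D : set T) (f g : T -> \bar R) : measurable D ->
  measurable_fun D f -> measurable_fun D g -> (forall x, D x -> 0 <= f x) ->
  (forall x, D x -> f x <= g x) -> \int[mu]_(x in D) f x <= \int[mu]_(x in D) g x.
Proof. by move=> mD mf mg f0 fg; apply: ge0_le_integral. Qed.

(** A point of the region at height below r lies in [cap xi r], of measure at most
    [Cup * r ^+ n.+2]. Hence F is dominated by the sum of its bounds over the caps. *)
Lemma koranyi_int_le (xi : Cn) (D : set Cn) (F : Cn -> R) (r B : nat -> R) :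
  enorm xi = 1%R -> measurable D -> D `<=` koranyi xi -> measurable_fun D F ->
  (forall z, D z -> 0 <= F z)%R -> (forall k, 0 < r k)%R -> (forall k, 0 <= B k)%R ->
  (forall z, D z -> exists k, hgt z < r k /\ F z <= B k)%R ->
  \int[v]_(z in D) (F z)%:E <= \sum_(0 <= k <oo) (B k * (Cup * r k ^+ n.+2))%:E.
Proof.
move=> xi1 mD Dk mF F0 r0 B0 H.
pose g k (z : Cn) : \bar R := (B k * \1_(cap xi (r k)) z)%:E.
have mg k : measurable_fun D (g k).
  apply/measurable_EFinP; apply: measurable_funM; first exact: measurable_cst.
  by apply: measurable_indic; exact: measurable_cap.
have g0 k z : 0 <= g k z by rewrite lee_fin mulr_ge0.
apply: (@le_trans _ _ (\int[v]_(z in D) \sum_(0 <= k <oo) g k z)).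
  apply: ge0_le_integral_dom => //.
  - exact/measurable_EFinP.
  - by apply: ge0_emeasurable_sum => // k z _ _; exact: g0.
  move=> z Dz; have [k [k1 k2]] := H z Dz.
  apply: (@le_trans _ _ (g k z)).
    rewrite /g lee_fin indicE mem_set ?mulr1//.
    by have /koranyiE[_ h] := Dk z Dz; rewrite /cap /=; exact: lt_trans h k1.
  have := @nneseries_lim_ge R (g ^~ z) xpredT 0%N k.+1 (fun j _ _ => g0 j z).
  apply: le_trans; rewrite big_nat_recr//= leeDr// sume_ge0// => j _; exact: g0.
rewrite integral_nneseries//.
apply: lee_nneseries => [k _ _|k _].
  by apply: integral_ge0 => z _; exact: g0.
rewrite /g; under eq_integral do rewrite EFinM.
rewrite ge0_integralZl//; last 2 first.
- by apply/measurable_EFinP; apply: measurable_indic; exact: measurable_cap.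
- by rewrite lee_fin.
rewrite EFinM lee_wpmul2l ?lee_fin// integral_indic//; last exact: measurable_cap.
apply: le_trans (ball_cap_le xi1 (r0 k)).
by apply: le_measure; rewrite ?inE; [apply: measurableI => //; exact: measurable_cap|exact: measurable_cap|exact: subIsetl].
Qed.

Lemma measurable_hgt_pow (D : set Cn) (g : R) : measurable_fun D (fun z => hgt z `^ g)%R.
Proof.
apply: measurable_funTS.
by apply: (measurableT_comp (measurable_powR g)); exact: measurable_hgt.
Qed.

Lemma small_pow (e : R) : (0 < e -> exists k, 2^-1 ^+ k < e)%R.
Proof.
move=> e0; have /(@cvgrPdist_lt R R) /(_ _ e0) : (GRing.exp (2^-1 : R)) @ \oo --> (0 : R)%R.
  by apply: cvg_expr; rewrite ger0_norm ?invr_ge0// invf_lt1 ?ltr1n.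
by move=> [k _ /(_ k (leqnn k))] /=; rewrite sub0r normrN => /(le_lt_trans (ler_norm _)) ?; exists k.
Qed.

Lemma dyadic_down (h d : R) : (0 < h -> h < d -> exists k, d * 2^-1 ^+ k / 2 <= h < d * 2^-1 ^+ k)%R.
Proof.
move=> h0 hd; have d0 : (0 < d)%R by exact: lt_trans hd.
have [k Hk] := small_pow (divr_gt0 h0 d0).
have ex : exists k, (d * 2^-1 ^+ k <= h)%R.
  by exists k; move: Hk; rewrite ltr_pdivlMr// mulrC => /ltW.
have := ex_minnP ex; case: ex_minnP => -[|m] Hm Hmin _.
  by move: Hm; rewrite expr0 mulr1 leNgt hd.
exists m; rewrite -mulrA -exprSr Hm/= ltNge; apply/negP => /Hmin.
by rewrite ltnn.
Qed.

Lemma dyadic_up (h d : R) : (0 < d -> d <= h -> exists k, d * 2 ^+ k <= h < 2 * d * 2 ^+ k)%R.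
Proof.
move=> d0 dh; have h0 : (0 < h)%R by exact: lt_le_trans dh.
have [k Hk] := small_pow (divr_gt0 d0 h0).
have ex : exists k, (h < 2 * d * 2 ^+ k)%R.
  exists k; move: Hk; rewrite ltr_pdivlMr// exprVn ltr_pdivrMl ?exprn_gt0// => H.
  have : (0 < 2 ^+ k * d)%R by rewrite mulr_gt0// exprn_gt0.
  lra.
have := ex_minnP ex; case: ex_minnP => -[|m] Hm Hmin _.
  by exists 0%N; rewrite Hm andbT expr0 mulr1.
exists m.+1; rewrite Hm andbT leNgt; apply/negP => H.
have /Hmin : (h < 2 * d * 2 ^+ m)%R by apply: lt_le_trans H _; rewrite exprS mulrA [(2 * d)%R]mulrC.
by rewrite ltnn.
Qed.

(** The constant 2^|g| serves both signs of the exponent. *)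
Lemma powR_comparable (h r g : R) : (0 < r -> r / 2 <= h -> h <= r -> h `^ g <= 2 `^ `|g| * r `^ g)%R.
Proof.
move=> r0 h1 h2; have h0 : (0 < h)%R by lra.
have [g0|g0] := leP 0%R g.
  apply: (@le_trans _ _ (r `^ g)%R); first by apply: ge0_ler_powR => //; rewrite nnegrE; lra.
  by rewrite ler_peMl ?powR_ge0// -[leLHS](powRr0 2) ler_powR ?ler1n.
rewrite ltr0_norm// -[in leLHS](opprK g) powRN -[in X in (_ * X)%R](opprK g) [(r `^ _)%R]powRN.
rewrite ler_pdivlMr ?powR_gt0// mulrC ler_pdivrMr ?powR_gt0// -powRM//; last exact: ltW.
by apply: ge0_ler_powR; rewrite ?nnegrE; lra.
Qed.

Lemma powR_gt1_base (e : R) : (0 < e -> 1 < 2 `^ e)%R.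
Proof.
move=> e0; have := @gt0_ltr_powR R e e0 1%R 2%R.
by rewrite powR1; apply; rewrite ?nnegrE ?ltr1n.
Qed.

Lemma powR_natD (r g : R) k : (0 < r -> r `^ g * r ^+ k = r `^ (g + k%:R))%R.
Proof. by move=> r0; rewrite -powR_mulrn ?ltW// -powRD ?(gt_eqF r0) ?implybT. Qed.

(** Constants of the geometric sums over dyadic heights below and above d. The exponent g + n.+2,
    height power plus measure of the cap, must be positive in the first case and negative in the
    second. *)
Definition Ksmall (g : R) : R :=
  (2 `^ `|g| * Cup * (1 - (2 `^ (g + n.+2%:R))^-1)^-1)%R.
Definition Klarge (g : R) : R :=
  (2 `^ `|g| * Cup * (1 - (2^-1 `^ (g + n.+2%:R))^-1)^-1 * 2 `^ (g + n.+2%:R))%R.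

Lemma Cup_ge1 : (1 <= Cup)%R.
Proof. by rewrite lerDr !mulr_ge0// ?exprn_ge0// ltW// c0_gt0. Qed.

Lemma koranyi_int_small (xi : Cn) (g d : R) (D : set Cn) : enorm xi = 1%R -> (0 < d)%R ->
  (0 < g + n.+2%:R)%R -> measurable D -> D `<=` koranyi xi -> (forall z, D z -> hgt z < d)%R ->
  \int[v]_(z in D) (hgt z `^ g)%:E <= (Ksmall g * d `^ (g + n.+2%:R))%:E.
Proof.
move=> x1 d0 g0 mD Dk Dd; have C1 := Cup_ge1.
pose r k : R := (d * 2^-1 ^+ k)%R.
have r0 k : (0 < r k)%R by rewrite mulr_gt0// exprn_gt0.
pose B k : R := (2 `^ `|g| * r k `^ g)%R.
have B0 k : (0 <= B k)%R by rewrite mulr_ge0 ?powR_ge0.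
apply: (@le_trans _ _ (\sum_(0 <= k <oo) (B k * (Cup * r k ^+ n.+2))%:E)).
  apply: (@koranyi_int_le xi D (fun z => hgt z `^ g)%R r B) => //; [exact: measurable_hgt_pow|by move=> z _; exact: powR_ge0|].
  move=> z Dz; have [zb _] := Dk z Dz.
  have [k /andP[k1 k2]] := dyadic_down (hgt_gt0 zb) (Dd z Dz).
  by exists k; split => //; apply: powR_comparable => //; exact: ltW.
rewrite (eq_eseriesr (g := fun k => (2 `^ `|g| * Cup)%:E * ((d * 2^-1 ^+ k) `^ (g + n.+2%:R))%:E)); last first.
  by move=> k _; rewrite -EFinM; congr EFin; rewrite /B mulrACA powR_natD.
rewrite nneseriesZl; last by move=> k _; rewrite lee_fin powR_ge0.
rewrite /Ksmall -mulrA [in leRHS]EFinM; apply: lee_wpmul2l.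
  by rewrite lee_fin mulr_ge0 ?powR_ge0//; lra.
apply: geometric_bound => //.
exact: powR_gt1_base.
Qed.

Lemma koranyi_int_large (xi : Cn) (g d : R) (D : set Cn) : enorm xi = 1%R -> (0 < d)%R ->
  (g + n.+2%:R < 0)%R -> measurable D -> D `<=` koranyi xi -> (forall z, D z -> d <= hgt z)%R ->
  \int[v]_(z in D) (hgt z `^ g)%:E <= (Klarge g * d `^ (g + n.+2%:R))%:E.
Proof.
move=> x1 d0 g0 mD Dk Dd; have C1 := Cup_ge1.
pose r k : R := (2 * d * 2 ^+ k)%R.
have r0 k : (0 < r k)%R by rewrite !mulr_gt0// exprn_gt0.
pose B k : R := (2 `^ `|g| * r k `^ g)%R.
have B0 k : (0 <= B k)%R by rewrite mulr_ge0 ?powR_ge0.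
apply: (@le_trans _ _ (\sum_(0 <= k <oo) (B k * (Cup * r k ^+ n.+2))%:E)).
  apply: (@koranyi_int_le xi D (fun z => hgt z `^ g)%R r B) => //; [exact: measurable_hgt_pow|by move=> z _; exact: powR_ge0|].
  move=> z Dz; have [zb _] := Dk z Dz.
  have [k /andP[k1 k2]] := dyadic_up d0 (Dd z Dz).
  exists k; split => //; apply: powR_comparable => //; last exact: ltW.
  by rewrite /r (_ : 2 * d * 2 ^+ k / 2 = d * 2 ^+ k)%R//; field.
rewrite (eq_eseriesr (g := fun k => (2 `^ `|g| * Cup)%:E * ((2 * d * (2^-1)^-1 ^+ k) `^ (g + n.+2%:R))%:E)); last first.
  by move=> k _; rewrite -EFinM invrK; congr EFin; rewrite /B mulrACA powR_natD.
rewrite nneseriesZl; last by move=> k _; rewrite lee_fin powR_ge0.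
rewrite /Klarge -2!mulrA [in leRHS]EFinM; apply: lee_wpmul2l.
  by rewrite lee_fin mulr_ge0 ?powR_ge0//; lra.
rewrite -powRM//; last exact: ltW.
apply: geometric_bound => //; first by rewrite mulr_gt0.
by rewrite -powR_inv1 // -powRrM; apply: powR_gt1_base; rewrite mulN1r oppr_gt0.
Qed.

End koranyi_integrals.

(** * Subharmonicity of powers of holomorphic functions *)

Section line_holomorphy.
Context {R : realType} {n : nat}.
Notation Cn := (Cn R n).
Implicit Types (f : 'rV[cplx R]_n -> cplx R) (z u w : 'rV[cplx R]_n).

Lemma enbhsP z (A : set 'rV[cplx R]_n) :
  nbhs z A <-> exists2 e : R, 0 < e & forall w, enorm (w - z) < e -> A w.
Proof.
split.
  move=> /nbhs_ballP[e e0 eA].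
  have [a0 a1] : 0 < complex.Re e /\ e = (complex.Re e)%:C%C.
    by move: e0; case: (e) => a b; rewrite /= ltcE/= => /andP[/eqP-> ?].
  exists (complex.Re e) => // w wz; apply: eA; split=> // i j.
  rewrite (ord1 i) a1 /ball/= /ball_/= distrC cabsE ltcR.
  by have := coord_le (w - z) j; rewrite !mxE => /le_lt_trans; apply.
move=> [e e0 H]; have : {for z, continuous (fun w => enorm (w - z))}.
  apply: (@continuous_comp _ _ _ (fun w => w - z) (@enorm R n)); last exact: continuous_enorm.
  by apply: (@cvgB _ _ _ (nbhs z)); [exact: cvg_id|exact: cvg_cst].
move=> /rcvgP /(_ e e0); apply: filterS => w /=.
by rewrite subrr enorm0 subr0 ger0_norm => // we; exact: H.
Qed.

(** Holomorphy along complex lines is all that the one-variable inequality uses, and it passes to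
    powers and to compositions with affine maps. *)
Definition line_holomorphic (f : 'rV[cplx R]_n -> cplx R) (D : set 'rV[cplx R]_n) :=
  forall z u (k : cplx R), D (z + k *: u) -> cdiff (fun w : cplx R => f (z + w *: u)) k.

Lemma differentiable_line f z u (k : cplx R) : differentiable f (z + k *: u) ->
  cdiff (fun w : cplx R => f (z + w *: u)) k.
Proof.
move=> df; set a := z + k *: u in df *.
exists ('d f a u) => e e0.
have /eqaddoP H := diff_locally df.
have [t t0 tE] : exists2 t : R, 0 <= t & `|u| = cr t.
  exists (cre `|u|); have := normr_ge0 u; case: (`|u|) => x y; rewrite lecE /= => /andP[/eqP y0 x0] //.
  by rewrite y0.
have e1 : 0 < e / (t + 1) by rewrite divr_gt0//; lra.
have e1C : 0 < cr (e / (t + 1)) by rewrite ltcR.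
have [r r0 Hr] := (enbhsP _ _).1 (H _ e1C).
have u0 := enorm_ge0 u.
exists (r / (enorm u + 1)); first by rewrite divr_gt0//; atom_lra.
move=> w; rewrite ltr_pdivlMr; last by atom_lra.
move=> wr; have wk0 := cabs_ge0 (w - k).
have := Hr ((w - k) *: u); rewrite subr0 enormZ => /(_ _).
have wr' : cabs (w - k) * enorm u < r by atom_lra.
move=> /(_ wr') /=; rewrite !fctE /=.
have -> : (w - k) *: u + a = z + w *: u by rewrite /a scalerBl addrC -addrA subrKC.
have -> : 'd f a ((w - k) *: u) = 'd f a u * (w - k) by rewrite linearZ mulrC.
rewrite normrZ tE cabsE (cabsE (w - k)) opprD addrA.
rewrite -[(cabs (w - k))%:C%C]/(cr _) -!crM lecR => /le_trans; apply.
have h : e / (t + 1) * t <= e by rewrite mulrAC ler_pdivrMr; atom_lra.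
by rewrite mulrCA [leRHS]mulrC ler_wpM2l.
Qed.

End line_holomorphy.

(** * The submean inequality on polydiscs *)

Section local_cauchy.
Context {R : realType}.
Local Open Scope ereal_scope.

(** Retraction of the line onto [-3/2, 3/2]. Applied to both coordinates it turns a function given
    near the unit square into one continuous on the whole plane, as [cauchy_square] asks. *)
Definition clamp (x : R) : R := Num.max (- (3 / 2))%R (Num.min (3 / 2)%R x).

Lemma clamp_itv x : (- (3 / 2) <= clamp x <= 3 / 2)%R.
Proof. by rewrite /clamp le_max lexx /= ge_max ge_min lexx /= andbT; lra. Qed.

Lemma clamp_id x : (`|x| <= 3 / 2)%R -> clamp x = x.
Proof.
by rewrite ler_norml => /andP[x1 x2]; rewrite /clamp (min_idPr x2) (max_idPr x1).
Qed.

Lemma clamp_lip x y : (`|clamp x - clamp y| <= `|x - y|)%R.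
Proof.
have h1 := ler_norm (x - y)%R; have h2 := ler_norm (y - x)%R; rewrite distrC in h2.
rewrite ler_norml /clamp /Order.max /Order.min.
case: (ltP (3 / 2)%R x) => hx /=; case: (ltP (3 / 2)%R y) => hy /=; (do ?[case: ifPn => ?]);
apply/andP; split; atom_lra.
Qed.

Definition clampC (z : cplx R) : cplx R := mkc (clamp (cre z)) (clamp (cim z)).

Lemma continuous_clampC : continuous clampC.
Proof.
move=> z; apply/ccvgP => e e0; apply/cnbhsP; exists (e / 2)%R; first by lra.
move=> w /= we; apply: le_lt_trans (cabs_le_re_im _) _; rewrite !cE.
have h1 := clamp_lip (cre w) (cre z); have h2 := clamp_lip (cim w) (cim z).
have h3 := cre_le (w - z); have h4 := cim_le (w - z); rewrite !cE in h3 h4.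
lra.
Qed.

Lemma clampC_id (z : cplx R) : (`|cre z| <= 3 / 2)%R -> (`|cim z| <= 3 / 2)%R -> clampC z = z.
Proof. by move=> h1 h2; rewrite /clampC !clamp_id// mkcK. Qed.

Definition side (i : 'I_4) (y : R) : cplx R :=
  match val i with 0 => mkc 1 y | 1 => mkc (-1) y | 2 => mkc y 1 | _ => mkc y (-1) end.

Lemma side_itv i y : (-1 <= y <= 1)%R -> (-1 <= cre (side i y) <= 1)%R /\ (-1 <= cim (side i y) <= 1)%R.
Proof.
move=> y1; case: i => -[|[|[|[|//]]]] i4; rewrite /side /=; split => //; apply/andP; split; lra.
Qed.

Lemma side_ge1 i y : (1 <= cabs (side i y))%R.
Proof.
case: i => -[|[|[|[|//]]]] i4; rewrite /side /=.
- by apply: le_trans (cre_le _); rewrite cE normr1.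
- by apply: le_trans (cre_le _); rewrite cE normrN normr1.
- by apply: le_trans (cim_le _); rewrite cE normr1.
- by apply: le_trans (cim_le _); rewrite cE normrN normr1.
Qed.

Lemma side_le2 i y : (-1 <= y <= 1)%R -> (cabs (side i y) <= 2)%R.
Proof.
move=> /(side_itv i)[/andP[? ?] /andP[? ?]]; apply: le_trans (cabs_le_re_im _) _.
have : (`|cre (side i y)| <= 1)%R by rewrite ler_norml; apply/andP; split.
have : (`|cim (side i y)| <= 1)%R by rewrite ler_norml; apply/andP; split.
lra.
Qed.

(** G composed with the retraction is continuous everywhere and agrees with G near the closed unit
    square, so it is differentiable there as well. *)
Lemma cauchy_square_local (G : cplx R -> cplx R) :
  (forall z, (`|cre z| < 2)%R -> (`|cim z| < 2)%R -> cdiff G z) ->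
  (4 * cabs (G 0%R))%:E <=
  \int[@lebesgue_measure R]_(y in [set` `[(-1)%R, 1%R]]) (\sum_(i < 4) cabs (G (side i y)))%R%:E.
Proof.
move=> dG; pose F z := G (clampC z).
have cF : continuous F.
  move=> z; apply: (@continuous_comp _ _ _ clampC G); first exact: continuous_clampC.
  apply: cdiff_cvg; apply: dG; apply: le_lt_trans (_ : 3 / 2 < 2)%R; try lra.
    by rewrite ler_norml; exact: clamp_itv.
  by rewrite ler_norml; exact: clamp_itv.
have FE z : (`|cre z| <= 3 / 2)%R -> (`|cim z| <= 3 / 2)%R -> F z = G z.
  by move=> h1 h2; rewrite /F clampC_id.
have dF z : (`|cre z| <= 1)%R -> (`|cim z| <= 1)%R -> cdiff F z.
  move=> z1 z2; apply: (@cdiff_near _ G); last by apply: dG; lra.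
  apply/cnbhsP; exists (1 / 2)%R => [|w w1 /=]; first by lra.
  have h1 := cre_le (w - z); have h2 := cim_le (w - z); rewrite !cE in h1 h2.
  have h3 := ler_normD (cre w - cre z)%R (cre z); have h4 := ler_normD (cim w - cim z)%R (cim z).
  by rewrite !subrK in h3 h4; apply/esym/FE; atom_lra.
have sm (y : R) : (-1 <= y <= 1)%R -> (`|y| <= 1)%R by rewrite ler_norml.
have := @cauchy_square R F [::] cF.
have F0 : F 0%R = G 0%R by apply: FE; rewrite normr0 divr_ge0.
rewrite F0; move=> /(_ _ _)H; rewrite -lee_fin in H.
apply: le_trans (H _ _) _.
- by apply: dF; rewrite normr0.
- by move=> x y x1 y1 _; apply: dF; exact: sm.
set f := (X in rint _ _ X).
have cf : continuous f.
  apply: continuousD_r; last exact: continuous_hcabs.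
  apply: continuousD_r; last exact: continuous_hcabs.
  by apply: continuousD_r; exact: continuous_vcabs.
rewrite /rint /Rintegral fineK; last first.
  by apply: integrable_fin_num => //; exact: rint_integrable.
rewrite le_eqVlt; apply/orP; left; apply/eqP; apply: eq_integral => y; rewrite inE/= in_itv/= => y1.
congr EFin; rewrite /f !big_ord_recl big_ord0 /side/= addr0 !addrA.
by rewrite !FE//= ?normrN ?normr1; try lra; have := sm _ y1; atom_lra.
Qed.

End local_cauchy.

Section polydisc.
Context {R : realType} {n : nat}.
Notation Cn := (Cn R n).
Notation vol := (@lebesgue_Cn R n).
Local Open Scope ereal_scope.

Definition polydisc (r : R) : set Cn := [set u | forall j, (cabs (u 0%R j) < r)%R].

Lemma measurable_polydisc r : measurable (polydisc r).
Proof.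
have -> : polydisc r = \bigcap_(j in [set: 'I_n]) [set u : Cn | (cabs (u 0%R j) < r)%R].
  by apply/seteqP; split => u h j => [_|]; [exact: h|exact: (h j Logic.I)].
apply: fin_bigcap_measurable => // j _.
have mf : measurable_fun setT (fun u : Cn => cabs (u 0%R j)).
  by apply: cmeasurable_cabs; apply: cmeasurable_coord; exact: measurable_id.
have -> : [set u : Cn | (cabs (u 0%R j) < r)%R] = (fun u : Cn => cabs (u 0%R j)) @^-1` `]-oo, r[%classic.
  by apply/seteqP; split => z; rewrite /= in_itv.
by rewrite -[X in measurable X]setTI; apply: mf => //; exact: measurable_itv.
Qed.

Lemma vol_polydisc_fin r : (0 <= r)%R -> vol (polydisc r) \is a fin_num.
Proof.
move=> r0; apply: (vol_bounded_fin r0 (measurable_polydisc r)).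
by move=> u h; apply: cabs_cube => j; exact: ltW.
Qed.

Lemma vol_polydisc_gt0 r : (0 < r)%R -> 0 < vol (polydisc r).
Proof.
move=> r0; have r30 : (0 <= r / 3)%R by rewrite divr_ge0// ltW.
apply: (@lt_le_trans _ _ (vol (cube (r / 3)))).
  by rewrite vol_cube// lte_fin exprn_gt0// mulr_gt0// divr_gt0.
apply: le_measure; rewrite ?inE//; [exact: measurable_cube|exact: measurable_polydisc|].
by move=> u /cube_cabs h j; apply: le_lt_trans (h j) _; lra.
Qed.

Lemma integral_change (T : Cn -> Cn) (k : R) (D : set Cn) (g : Cn -> \bar R) :
  measurable_fun setT T -> (0 <= k)%R ->
  (forall A, measurable A -> vol (T @^-1` A) = k%:E * vol A) ->
  measurable D -> measurable_fun D g -> (forall x, D x -> 0 <= g x) ->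
  \int[vol]_(x in T @^-1` D) g (T x) = k%:E * \int[vol]_(x in D) g x.
Proof.
move=> mT k0 TE mD mg g0.
rewrite -[LHS](ge0_integral_pushforward mT vol mD mg); last by move=> y; rewrite inE; exact: g0.
rewrite -(ge0_integral_mscale vol mD (NngNum k0) mg g0).
by apply: eq_measure_integral => A mA _; exact: TE.
Qed.

(** For |k| >= 1 the preimage of the unit polydisc under z -> k z lies inside it, so by [vol_haar]
    every preimage has at most the original volume. *)
Lemma integral_scale_le (k : cplx R) (g : Cn -> \bar R) : (1 <= cabs k)%R ->
  measurable_fun setT g -> (forall x, 0 <= g x) ->
  \int[vol]_x g (k *: x)%R <= \int[vol]_x g x.
Proof.
move=> k1 mg g0; have mT := @measurable_Cn_scale R n k.
have k0 : k != 0%R by rewrite -cabs_gt0; exact: lt_le_trans k1.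
have H (A : set Cn) : measurable A -> vol ((fun x : Cn => k *: x : Cn)%R @^-1` A) <= vol A.
  move=> mA; have := @vol_haar R n (fun x : Cn => k *: x)%R (fun x : Cn => k^-1 *: x)%R A (polydisc 1) mT
    (fun x y => scalerDr k x y) _ mA (measurable_polydisc 1).
  have c : cancel (fun x : Cn => k^-1 *: x)%R (fun x : Cn => k *: x)%R.
    by move=> x; rewrite scalerA mulfV// scale1r.
  move=> /(_ c) E.
  have f1 := vol_polydisc_fin ler01; have p1 := vol_polydisc_gt0 ltr01.
  have : vol ((fun x : Cn => k *: x : Cn)%R @^-1` polydisc 1) <= vol (polydisc 1).
    apply: le_measure; rewrite ?inE.
    - by rewrite -[X in measurable X]setTI; apply: mT => //; exact: measurable_polydisc.
    - exact: measurable_polydisc.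
    move=> x h j; have := h j; rewrite mxE cabsM; apply: le_lt_trans.
    by rewrite ler_peMl// cabs_ge0.
  move=> h; rewrite -(@lee_pmul2r _ (vol (polydisc 1)))//.
  by rewrite E [X in _ <= X]muleC lee_wpmul2r.
have := @ge0_integral_pushforward _ _ _ _ R _ mT vol setT g measurableT mg (fun y _ => g0 y).
rewrite preimage_setT => <-.
exact: (@ge0_le_measure_integral _ _ _ (image_measure vol (mkmfun mT)) vol H g setT measurableT g0 mg).
Qed.

Lemma vol_polydisc14_gt0 : (0 < fine (vol (polydisc (1 / 4))))%R.
Proof.
rewrite fine_gt0// vol_polydisc_gt0//= -?ge0_fin_numE// ?vol_polydisc_fin//; lra.
Qed.

(** The square inequality for w -> F(w u), integrated over u in the polydisc of radius 1/4: for w in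
    the square of half-side 2 one has |w| < 4, so w u stays in the unit polydisc. On the unit
    square's boundary |w| >= 1, so replacing w u by u loses nothing. Four sides of length 2 give 8
    against 4 |F(0)|. *)
Lemma submean1 (F : 'rV[cplx R]_n -> cplx R) : line_holomorphic F (polydisc 1) ->
  measurable_fun (polydisc 1) (fun u : Cn => cabs (F u)) ->
  (cabs (F 0%R))%:E * vol (polydisc (1 / 4)) <= 2%:E * \int[vol]_(u in polydisc 1) (cabs (F u))%:E.
Proof.
move=> hF mF; pose Fm := (fun u : Cn => (cabs (F u))%:E) \_ (polydisc 1).
have mFm : measurable_fun setT Fm.
  by apply/(measurable_restrictT _ (measurable_polydisc 1)); exact/measurable_EFinP.
have Fm0 u : 0 <= Fm u by rewrite /Fm patchE; case: ifP => // _; rewrite lee_fin.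
have IE : \int[vol]_u Fm u = \int[vol]_(u in polydisc 1) (cabs (F u))%:E.
  by rewrite [RHS]integral_mkcond.
pose H (uy : Cn * measurableTypeR R) : \bar R :=
  \sum_(i < 4) Fm (side i uy.2 *: uy.1)%R * (\1_(`[(-1)%R, 1%R]%classic : set (measurableTypeR R)) uy.2)%:E.
have side_m (i : 'I_4) : cmeasurable (fun uy : Cn * measurableTypeR R => side i uy.2).
  have m2 : measurable_fun setT (snd : Cn * measurableTypeR R -> measurableTypeR R) by exact: measurable_snd.
  by case: i => -[|[|[|[|//]]]] i4; split; rewrite /side /comp /=; exact: measurable_cst || exact: m2.
have mFs (i : 'I_4) : measurable_fun setT (fun uy : Cn * measurableTypeR R => Fm (side i uy.2 *: uy.1)%R).
  have ms : measurable_fun setT (fun uy : Cn * measurableTypeR R => side i uy.2 *: uy.1 : Cn)%R.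
    by apply: measurable_CnZ; [exact: side_m|exact: measurable_fst].
  exact: (measurableT_comp mFm ms).
have mH : measurable_fun setT H.
  apply: emeasurable_sum => i; apply: emeasurable_funM; first exact: mFs.
  apply/measurable_EFinP.
  have mi : measurable_fun setT (\1_(`[(-1)%R, 1%R]%classic : set (measurableTypeR R)) : measurableTypeR R -> R).
    by apply: measurable_indic; exact: measurable_itv.
  exact: (measurableT_comp mi (@measurable_snd _ _ Cn (measurableTypeR R))).
have H0 uy : 0 <= H uy.
  by apply: sume_ge0 => i _; rewrite mule_ge0// lee_fin.
have Lb u : polydisc (1 / 4) u -> (4 * cabs (F 0%R))%:E <= \int[@lebesgue_measure R]_y H (u, y).
  move=> u4.
  have in1 (k : cplx R) : (cabs k <= 4)%R -> polydisc 1 (k *: u)%R.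
    move=> k4 j; rewrite mxE cabsM; have := u4 j; have := cabs_ge0 k; have := cabs_ge0 (u 0%R j); atom_nra.
  have := @cauchy_square_local R (fun w => F (w *: u)%R); rewrite scale0r.
  move=> /(_ _)/le_trans; apply.
    move=> z z1 z2; have := hF 0%R u z; rewrite add0r => /(_ _)[].
      by apply: in1; have := cabs_le_re_im z; lra.
    by move=> l Hl; exists l => e /Hl[r r0 Hr]; exists r => // w /Hr; rewrite !add0r.
  rewrite integral_mkcond le_eqVlt; apply/orP; left; apply/eqP.
  apply: eq_integral => y _; rewrite patchE /H /= indicE; case: ifPn => y1; last first.
    by rewrite big1// => i _; rewrite mule0.
  rewrite -sumEFin; apply: eq_bigr => i _; rewrite mule1.
  move: y1; rewrite inE /= in_itv /= => y1.
  by rewrite /Fm patchE mem_set//; apply: in1; have := side_le2 i y1; lra.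
have f4 : vol (polydisc (1 / 4)) \is a fin_num by apply: vol_polydisc_fin; lra.
suff S8 : (4 * cabs (F 0%R))%:E * vol (polydisc (1 / 4)) <= 8%:E * \int[vol]_u Fm u.
  rewrite -IE -(@lee_pmul2l _ 4%:E)//.
  by rewrite !muleA -!EFinM (_ : (4 * 2 = 8 :> R)%R)//; ring.
apply: (@le_trans _ _ (\int[vol]_(u in polydisc (1 / 4)) \int[@lebesgue_measure R]_y H (u, y))).
  rewrite -integral_cst; last exact: measurable_polydisc.
  apply: ge0_le_integral_dom; [exact: measurable_polydisc|exact: measurable_cst| | |exact: Lb].
    apply: measurable_funTS.
    exact: (@measurable_fun_fubini_tonelli_F _ _ _ _ _ lebesgue_measure H mH H0).
  by move=> x _; rewrite lee_fin mulr_ge0.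
apply: (@le_trans _ _ (\int[vol]_u \int[@lebesgue_measure R]_y H (u, y))).
  apply: ge0_subset_integral => //; first exact: measurable_polydisc.
    exact: (@measurable_fun_fubini_tonelli_F _ _ _ _ _ lebesgue_measure H mH H0).
  by move=> x _; apply: integral_ge0 => y _; exact: H0.
rewrite (@fubini_tonelli _ _ _ _ _ sfvol lebesgue_measure H mH H0).
apply: (@le_trans _ _ (\int[@lebesgue_measure R]_y
    (4%:E * \int[vol]_u Fm u * (\1_(`[(-1)%R, 1%R]%classic : set (measurableTypeR R)) y)%:E))).
  apply: ge0_le_integral_dom => //.
  - exact: (@measurable_fun_fubini_tonelli_G _ _ _ _ _ sfvol H mH H0).
  - apply: emeasurable_funM; first exact: measurable_cst.
    by apply/measurable_EFinP; apply: measurable_indic; exact: measurable_itv.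
  - by move=> y _; apply: integral_ge0 => u _; exact: H0.
  move=> y _; rewrite /H /= indicE; case: (boolP (y \in _)) => y1; last first.
    by rewrite mule0 integral0_eq// => x _; rewrite big1// => i _; rewrite mule0.
  under eq_integral do under eq_bigr do rewrite mule1.
  rewrite mule1 ge0_integral_sum//; last first.
    by move=> i; exact: (measurableT_comp (mFs i) (@measurable_pair2 _ _ _ _ y)).
  rewrite (_ : 4%:E = \sum_(i < 4) 1%:E)%E; last by rewrite sumEFin sumr_const card_ord.
  rewrite ge0_sume_distrl//; apply: lee_sum => i _; rewrite mul1e.
  exact: (integral_scale_le (side_ge1 i y) mFm Fm0).
rewrite ge0_integralZl//; last 2 first.
- by apply/measurable_EFinP; apply: measurable_indic; exact: measurable_itv.
- by rewrite mule_ge0// ?lee_fin// integral_ge0.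
rewrite (@integral_indic _ _ _ lebesgue_measure setT measurableT _ (measurable_itv _)).
have L : (@lebesgue_measure R `[(-1)%R, 1%R]%classic = 2%:E)%E.
  rewrite lebesgue_measure_itv /= lte_fin ifT; last by lra.
  by rewrite -EFinB; congr EFin; ring.
rewrite setIT [X in _ * X <= _](_ : _ = 2%:E); last exact: L.
rewrite muleC muleA -EFinM (_ : (2 * 4 = 8 :> R)%R)//; ring.
Qed.

End polydisc.

Lemma ge0_le_integralZ d (T : measurableType d) (R : realType) (mu : {measure set T -> \bar R})
    (D : set T) (f g : T -> R) (k : R) : measurable D ->
  measurable_fun D f -> measurable_fun D g -> (forall x, D x -> 0 <= f x) ->
  (forall x, D x -> 0 <= g x) -> 0 <= k -> (forall x, D x -> f x <= k * g x) ->
  (\int[mu]_(x in D) (f x)%:E <= k%:E * \int[mu]_(x in D) (g x)%:E)%E.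
Proof.
move=> mD mf mg f0 g0 k0 fg; rewrite -ge0_integralZl//; first last.
- exact/measurable_EFinP.
apply: ge0_le_integral => //; first exact/measurable_EFinP.
by apply: emeasurable_funM => //; exact/measurable_EFinP.
Qed.

Section submean_power.
Context {R : realType} {n : nat}.
Notation Cn := (Cn R n).
Notation vol := (@lebesgue_Cn R n).
Local Open Scope ereal_scope.

Lemma vol_affine (u : Cn) (r : R) (A : set Cn) : (0 < r)%R -> measurable A ->
  vol ((fun x : Cn => u + cr r *: x : Cn)%R @^-1` A) = (r^-1 ^+ (n + n))%:E * vol A.
Proof.
move=> r0 mA; rewrite -(vol_translate u mA).
have mA' : measurable ((fun x : Cn => x + u : Cn)%R @^-1` A).
  rewrite -[X in measurable X]setTI.
  have m1 : measurable_fun setT (fun x : Cn => x + u : Cn)%R.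
    by apply: measurable_CnD; [exact: measurable_id|exact: measurable_cst].
  exact: m1.
rewrite -(vol_scale r0 mA'); congr (vol _); apply/funext => x.
by rewrite /preimage /= addrC.
Qed.

Lemma measurable_affine (u : Cn) (k : cplx R) : measurable_fun setT (fun x : Cn => u + k *: x : Cn)%R.
Proof. by apply: measurable_CnD; [exact: measurable_cst|exact: measurable_Cn_scale]. Qed.

(* The Fefferman-Stein trick: maximise r^m |F(u)| over polydiscs of radius r about u inside the unit one. *)
Lemma submean_small_power (q : R) : (0 < q)%R -> (q <= 1)%R -> exists2 C : R, (0 < C)%R &
  forall F : 'rV[cplx R]_n -> cplx R, line_holomorphic F (polydisc 1) ->
  measurable_fun (polydisc 1) (fun u : Cn => cabs (F u)) ->
  (exists M, forall u, polydisc 1 u -> cabs (F u) <= M)%R ->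
  (cabs (F 0%R) `^ q)%:E <= C%:E * \int[vol]_(u in polydisc 1) (cabs (F u) `^ q)%:E.
Proof.
(* With m q = 2 n the weight r^m compensates exactly the factor r^(-2 n) from rescaling the
   volume. *)
move=> q0 q1; pose m : R := ((n + n)%:R / q)%R.
have m0 : (0 <= m)%R by rewrite divr_ge0// ltW.
pose V := fine (vol (polydisc (1 / 4))); have V0 : (0 < V)%R := vol_polydisc14_gt0.
have VE : vol (polydisc (1 / 4)) = V%:E by rewrite fineK//; apply: vol_polydisc_fin; lra.
pose C1 : R := (2 / V)%R; have C10 : (0 < C1)%R by rewrite divr_gt0.
exists (2 `^ m * C1)%R; first by rewrite mulr_gt0// powR_gt0.
move=> F hF mF [M HM]; set I := \int[vol]_(u in _) _.
have I0 : 0 <= I by apply: integral_ge0 => u _; rewrite lee_fin powR_ge0.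
have [->|Ifin] := eqVneq I +oo.
  by rewrite gt0_muley ?leey// lte_fin mulr_gt0// powR_gt0.
have IE : I = (fine I)%:E by rewrite fineK// ge0_fin_numE// ltey.
set J := fine I in IE; have J0 : (0 <= J)%R by rewrite -lee_fin -IE.
have M0 : (0 <= M)%R by apply: le_trans (HM 0%R _) => // j; rewrite mxE cabs0.
pose E : set R := [set x | exists (u : Cn) (r : R), [/\ (0 < r <= 1)%R, (forall j, cabs (u 0%R j) <= 1 - r)%R &
  x = (r `^ m * cabs (F u))%R]].
have inP (u : Cn) (r s : R) : (0 < s)%R -> (s <= r)%R -> (forall j, cabs (u 0%R j) <= 1 - r)%R ->
    forall x : Cn, polydisc 1 x -> polydisc 1 (u + cr s *: x : Cn)%R.
  move=> s0 sr ur x x1 j; rewrite !mxE; apply: le_lt_trans (cabs_triangle _ _) _.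
  rewrite cabsM cabs_cr gtr0_norm//; have := x1 j; have := ur j; have := cabs_ge0 (x 0%R j); atom_nra.
have uP (u : Cn) (r : R) : (0 < r)%R -> (forall j, cabs (u 0%R j) <= 1 - r)%R -> polydisc 1 u.
  by move=> r0 h j; apply: le_lt_trans (h j) _; atom_lra.
have EM : ubound E M.
  move=> _ [u [r [/andP[r0 r1] ur ->]]].
  apply: (@le_trans _ _ (1 * cabs (F u))%R); last by rewrite mul1r; apply: HM; exact: uP r0 ur.
  rewrite ler_wpM2r//; apply: (@le_trans _ _ (1 `^ m)%R); last by rewrite powR1.
  by apply: ge0_ler_powR => //; rewrite nnegrE; atom_lra.
have E0 : E (cabs (F 0%R)).
  exists 0%R, 1%R; split; [by rewrite ltr01 lexx|by move=> j; rewrite mxE cabs0 subrr|].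
  by rewrite powR1 mul1r.
have supE : has_sup E by split; [exists (cabs (F 0%R))|exists M].
set S := sup E.
have F0S : (cabs (F 0%R) <= S)%R by exact: sup_upper_bound.
have S0 : (0 <= S)%R by apply: le_trans F0S.
have [S00|SN0] := eqVneq S 0%R.
  have -> : cabs (F 0%R) = 0%R by apply/eqP; rewrite eq_le cabs_ge0 andbT -S00.
  by rewrite powR0 ?gt_eqF// mule_ge0// lee_fin mulr_ge0 ?powR_ge0// ltW.
have Sp : (0 < S)%R by rewrite lt_neqAle eq_sym SN0.
(* On a polydisc of half the radius |F| <= S s^-m, so |F| is at most (S s^-m)^(1 - q) |F|^q there.
   The submean inequality then gives S <= const S^(1 - q) J, and S may be cancelled because F is
   bounded. *)
have key : (forall x, E x -> x <= 2 `^ m * C1 * (S `^ (1 - q) * J))%R.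
  move=> _ [u [r [/andP[r0 r1] ur ->]]].
  pose s : R := (r / 2)%R; have s0 : (0 < s)%R by rewrite /s; atom_lra.
  pose T (x : Cn) : Cn := (u + cr s *: x)%R.
  have mT : measurable_fun setT T by exact: measurable_affine.
  have TP : polydisc 1 `<=` T @^-1` polydisc 1.
    by move=> x x1; apply: (inP u r s) => //; rewrite /s; atom_lra.
  have sm : (0 < s `^ m)%R by rewrite powR_gt0.
  have FT x : polydisc 1 x -> (cabs (F (T x)) <= S * (s `^ m)^-1)%R.
    move=> x1; rewrite ler_pdivlMr// mulrC; apply: sup_upper_bound => //.
    exists (T x), s; split => //; first by apply/andP; split; rewrite /s; atom_lra.
    move=> j; rewrite /T !mxE; apply: le_trans (cabs_triangle _ _) _.
    rewrite cabsM cabs_cr gtr0_norm//; have := ltW (x1 j); have := ur j.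
    have := cabs_ge0 (x 0%R j); rewrite /s; atom_nra.
  have hFT : line_holomorphic (fun x => F (T x)) (polydisc 1).
    move=> z w k zk.
    have Ew t : (u + cr s *: z + t *: (cr s *: w) = T (z + t *: w))%R.
      by rewrite /T scalerDr !scalerA [(t * _)%R]mulrC addrA.
    have /hF[l Hl] : polydisc 1 (u + cr s *: z + k *: (cr s *: w))%R by rewrite Ew; exact: TP.
    exists l => e /Hl[d d0 Hd]; exists d => [|t td]; first exact: d0.
    by have := Hd t td; rewrite !Ew.
  have mFT : measurable_fun (polydisc 1) (fun x : Cn => cabs (F (T x))).
    have := @measurable_comp _ _ _ _ _ _ (polydisc 1) (fun x : Cn => cabs (F x)) (polydisc 1) T
      (measurable_polydisc 1).
    apply => //; first by move=> _ [x x1 <-]; exact: TP.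
    exact: (measurable_funS measurableT (@subsetT _ _) mT).
  have mFq (G : Cn -> R) : measurable_fun (polydisc 1) G -> measurable_fun (polydisc 1) (fun x => G x `^ q)%R.
    by move=> mG; apply: (measurableT_comp (measurable_powR q)).
  have := submean1 hFT mFT.
  rewrite /T scaler0 addr0 VE -/(T _) => H.
  set K : R := (S * (s `^ m)^-1)%R in FT.
  have K0 : (0 <= K)%R by rewrite mulr_ge0// invr_ge0 ltW.
  have h1 : \int[vol]_(x in polydisc 1) (cabs (F (T x)))%:E <=
     (K `^ (1 - q))%:E * \int[vol]_(x in polydisc 1) (cabs (F (T x)) `^ q)%:E.
    apply: (@ge0_le_integralZ _ _ _ vol (polydisc 1) (fun x => cabs (F (T x)))
      (fun x => cabs (F (T x)) `^ q)%R (K `^ (1 - q))%R (measurable_polydisc 1) mFT (mFq _ mFT)).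
    - by move=> x _; exact: cabs_ge0.
    - by move=> x _; exact: powR_ge0.
    - exact: powR_ge0.
    move=> x x1.
    have [->|Fx0] := eqVneq (cabs (F (T x))) 0%R; first by rewrite mulr_ge0// powR_ge0.
    have Fxp : (0 < cabs (F (T x)))%R by rewrite lt_neqAle eq_sym Fx0 cabs_ge0.
    rewrite -[leLHS](@powRr1 R)// -{1}(subrK q 1%R) powRD ?(gt_eqF Fxp) ?implybT//.
    rewrite ler_wpM2r ?powR_ge0//; apply: ge0_ler_powR; rewrite ?nnegrE ?subr_ge0//; exact: FT.
  have h2 : \int[vol]_(x in polydisc 1) (cabs (F (T x)) `^ q)%:E <= (s^-1 ^+ (n + n) * J)%:E.
    rewrite EFinM -IE.
    have mq : measurable_fun (polydisc 1) (fun u => (cabs (F u) `^ q)%:E).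
      by apply/measurable_EFinP; exact: mFq.
    have mTP : measurable (T @^-1` polydisc 1).
      by rewrite -[X in measurable X]setTI; apply: mT => //; exact: measurable_polydisc.
    have k0 : (0 <= s^-1 ^+ (n + n))%R by rewrite exprn_ge0// invr_ge0 ltW.
    have ch : \int[vol]_(x in T @^-1` polydisc 1) (cabs (F (T x)) `^ q)%:E = (s^-1 ^+ (n + n))%:E * I.
      apply: (integral_change mT k0 _ (measurable_polydisc 1) mq); first by move=> A mA; exact: vol_affine.
      by move=> x _; rewrite lee_fin powR_ge0.
    rewrite -ch; apply: (@ge0_subset_integral _ _ _ vol _ _ (measurable_polydisc 1) mTP
      (fun x => (cabs (F (T x)) `^ q)%:E) _ _ TP).
      apply: (@measurable_comp _ _ _ _ _ _ (polydisc 1) (fun u => (cabs (F u) `^ q)%:E) _ T).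
      - exact: measurable_polydisc.
      - by move=> _ [x x1 <-].
      - exact: mq.
      - exact: (measurable_funS measurableT (@subsetT _ _) mT).
    by move=> x _; rewrite lee_fin powR_ge0.
  have h3 : (cabs (F u) * V <= 2 * (K `^ (1 - q) * (s^-1 ^+ (n + n) * J)))%R.
    rewrite -lee_fin EFinM; apply: le_trans H _; rewrite EFinM.
    apply: lee_wpmul2l; first by rewrite lee_fin.
    apply: le_trans h1 _; rewrite EFinM; apply: lee_wpmul2l; first by rewrite lee_fin powR_ge0.
    exact: h2.
  have e1 : (K `^ (1 - q) * s^-1 ^+ (n + n) = S `^ (1 - q) * (s `^ m)^-1)%R.
    rewrite /K powRM ?invr_ge0 ?ltW// -mulrA; congr (_ * _)%R.
    rewrite -[((s `^ m)^-1)%R]powR_inv1 ?ltW// exprVn -powR_mulrn ?(ltW s0)// -powRN -!powRrM.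
    rewrite -powRD ?(gt_eqF s0) ?implybT//; congr (_ `^ _)%R.
    have -> : ((n + n)%:R = m * q)%R by rewrite /m mulfVK// gt_eqF.
    ring.
  have h4 : (cabs (F u) <= C1 * (S `^ (1 - q) * (s `^ m)^-1 * J))%R.
    by rewrite -e1 /C1 mulrAC ler_pdivlMr// -mulrA.
  have rs : (r `^ m = 2 `^ m * s `^ m)%R.
    by rewrite -powRM ?(ltW s0)// /s mulrCA divff ?mulr1.
  rewrite rs -[leLHS]mulrA -[leRHS]mulrA ler_wpM2l ?powR_ge0//.
  apply: le_trans (ler_wpM2l (ltW sm) h4) _.
  rewrite le_eqVlt; apply/orP; left; apply/eqP.
  by field; rewrite gt_eqF.
have SJ : (S <= 2 `^ m * C1 * (S `^ (1 - q) * J))%R by apply: ge_sup => //; exists (cabs (F 0%R)).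
rewrite IE -EFinM lee_fin; apply: (@le_trans _ _ (S `^ q)%R).
  by apply: ge0_ler_powR; rewrite ?nnegrE ?cabs_ge0// ltW.
have S1q : (0 < S `^ (1 - q))%R by rewrite powR_gt0.
rewrite -(@ler_pM2l _ (S `^ (1 - q)))// -powRD ?SN0 ?implybT// subrK powRr1//.
by apply: le_trans SJ _; rewrite mulrCA.
Qed.

End submean_power.

Section submean_any_power.
Context {R : realType} {n : nat}.
Notation Cn := (Cn R n).
Notation vol := (@lebesgue_Cn R n).

Lemma line_holomorphicX (f : 'rV[cplx R]_n -> cplx R) D k : line_holomorphic f D -> line_holomorphic (fun z => f z ^+ k) D.
Proof.
move=> hf z u w zD; elim: k => [|k IH].
  by apply: cdiff_near (cdiff_cst 1 w); apply: filterE => t; rewrite /= expr0.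
apply: cdiff_near (cdiffM (hf _ _ _ zD) IH); apply: filterE => t /=; by rewrite exprS.
Qed.

(** For q > 1, apply the previous case to F^k with exponent q / k <= 1. *)
Lemma submean_power (q : R) : (0 < q)%R -> exists2 C : R, (0 < C)%R &
  forall F : 'rV[cplx R]_n -> cplx R, line_holomorphic F (polydisc 1) ->
  measurable_fun (polydisc 1) (fun u : Cn => cabs (F u)) ->
  (exists M, forall u, polydisc 1 u -> cabs (F u) <= M)%R ->
  ((cabs (F 0%R) `^ q)%:E <= C%:E * \int[vol]_(u in polydisc 1) (cabs (F u) `^ q)%:E)%E.
Proof.
move=> q0; pose k := (Num.bound q).
have kq : q < k%:R by exact: archi_boundP (ltW q0).
have k0 : 0 < k%:R :> R by apply: lt_trans kq.
have [||C C0 H] := @submean_small_power R n (q / k%:R).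
- by rewrite divr_gt0.
- by rewrite ler_pdivrMr// mul1r ltW.
exists C => // F hF mF [M HM].
have E (u : Cn) : (cabs (F u) `^ q = cabs (F u ^+ k) `^ (q / k%:R))%R.
  by rewrite cabsX -powR_mulrn ?cabs_ge0// -powRrM mulrCA mulfV ?mulr1// gt_eqF.
rewrite E; under eq_integral do rewrite E.
apply: (H (fun u => F u ^+ k)); first exact: line_holomorphicX.
  under eq_fun do rewrite cabsX; exact: measurable_funX.
exists (M ^+ k) => u u1; rewrite cabsX lerXn2r ?nnegrE ?cabs_ge0//; last exact: HM.
exact: le_trans (cabs_ge0 _) (HM _ u1).
Qed.

End submean_any_power.

(** * Polydiscs fitted into Koranyi regions *)

Section dilation.
Context {R : realType} {n : nat}.
Notation Cn := (Cn R n.+1).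
Notation vol := (@lebesgue_Cn R n.+1).

Definition dil (a b : R) (x : Cn) : Cn := \row_j (cr (if j == ord0 then a else b) * x 0 j).

Lemma measurable_dil a b : measurable_fun setT (dil a b).
Proof.
apply: cmeasurable_Cn => j; under eq_fun do rewrite mxE.
by apply: cmeasurableM; [exact: cmeasurable_cst|exact: (cmeasurable_coord j (@measurable_id _ _ setT))].
Qed.

Lemma dil_ord0 a b x : dil a b x 0 ord0 = cr a * x 0 ord0.
Proof. by rewrite mxE eqxx. Qed.

Lemma dil_lift a b x j : dil a b x 0 (lift ord0 j) = cr b * x 0 (lift ord0 j).
Proof. by rewrite mxE. Qed.

Lemma dilP a b k x y : dil a b (k *: x + y) = k *: dil a b x + dil a b y.
Proof. by apply/rowP => j; rewrite !mxE; ring. Qed.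

Lemma dilK a b : a != 0 -> b != 0 -> cancel (dil a^-1 b^-1) (dil a b).
Proof.
move=> a0 b0 x; apply/rowP => j; rewrite !mxE; case: ifP => _;
  by rewrite mulrA -crM mulfV// mul1r.
Qed.

(** The factor is found on a box whose preimage is again a box, as for [vol_scale]. *)
Lemma vol_dil a b (A : set Cn) : 0 < a -> 0 < b -> measurable A ->
  (vol (dil a b @^-1` A) = (a^-1 ^+ 2 * (b^-1 ^+ 2) ^+ n)%:E * vol A)%E.
Proof.
move=> a0 b0 mA; have dilD x y : dil a b (x + y) = dil a b x + dil a b y.
  by rewrite -{1}[x]scale1r dilP scale1r.
have := vol_haar (measurable_dil a b) dilD (dilK (lt0r_neq0 a0) (lt0r_neq0 b0)) mA
  (measurable_box0 (-1) 1 (-1) 1 1).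
have -> : dil a b @^-1` box0 (-1) 1 (-1) 1 1 = box0 (- a^-1) a^-1 (- a^-1) a^-1 b^-1.
  have ba (c t : R) : 0 < c -> (-1 <= c * t <= 1) = (- c^-1 <= t <= c^-1).
    by move=> c0; rewrite -!ler_norml normrM gtr0_norm// -ler_pdivlMl// mulr1.
  have bb (c t : R) : 0 < c -> (`|c * t| <= 1) = (`|t| <= c^-1).
    by move=> c0; rewrite normrM gtr0_norm// -ler_pdivlMl// mulr1.
  apply/seteqP; split => x /box0P[].
    rewrite dil_ord0 !cE !mul0r subr0 addr0 !ba// => h1 h2 H; apply/box0P; split=> // j.
    by have := H j; rewrite dil_lift !cE !mul0r subr0 addr0 !bb.
  move=> h1 h2 H; apply/box0P; rewrite dil_ord0 !cE !mul0r subr0 addr0 !ba//; split=> // j.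
  by rewrite dil_lift !cE !mul0r subr0 addr0 !bb.
have ai : 0 < a^-1 by rewrite invr_gt0.
have bi : 0 < b^-1 by rewrite invr_gt0.
rewrite !vol_box0; [|atom_lra|atom_lra|atom_lra|atom_lra|atom_lra|atom_lra] => H.
have v0 : 0 < (1 - -1) * (1 - -1) * ((2 * 1) ^+ 2) ^+ n :> R.
  by rewrite !mulr_gt0//; first [lra|rewrite exprn_gt0// exprn_gt0//; lra].
apply: (@muleI_fin _ _ _ ((1 - -1) * (1 - -1) * (2 * 1) ^+ 2 ^+ n)%:E) => //.
rewrite H muleAC -EFinM; congr (_%:E * _)%E.
have -> : (2 / b) ^+ 2 = b^-1 ^+ 2 * (2 * 1) ^+ 2 by rewrite mulr1 exprMn mulrC.
rewrite [in LHS]exprMn; set x := (_ ^+ n); set y := (_ ^+ n); ring.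
Qed.

End dilation.

Section compactness.
Context {R : realType} {n : nat}.

(** The Euclidean ball is a closed subset of a product of closed squares, each a continuous image of
    a real square. *)
Lemma enorm_le_compact (r : R) : 0 <= r -> compact [set w : 'rV[cplx R]_n | enorm w <= r].
Proof.
move=> r0; pose Q : set (cplx R) := (fun ab : R * R => mkc ab.1 ab.2) @` (`[(- r), r] `*` `[(- r), r]).
have cQ : compact Q.
  apply: continuous_compact; last by apply: compact_setX; exact: segment_compact.
  apply: continuous_subspaceT => -[a b]; apply/ccvgP => e e0.
  exists (ball a (e / 2), ball b (e / 2)) => /=.
    by split; apply: nbhsx_ballx; rewrite divr_gt0.
  move=> [x y] [/= xa yb]; rewrite /ball/= in xa yb.
  have -> : mkc x y - mkc a b = mkc (x - a) (y - b) by apply: ceq; rewrite !cE.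
  apply: le_lt_trans (cabs_le_re_im _) _; rewrite !cE distrC (distrC y).
  by rewrite (splitr e) ltrD.
have cQ' := @rV_compact (cplx R) n (fun=> Q) (fun=> cQ).
apply: subclosed_compact cQ' _.
  apply: (@closed_comp _ _ (@enorm R n) [set x | x <= r]); last exact: closed_le.
  by move=> w _; exact: continuous_enorm.
move=> w /= wr j; exists (cre (w 0 j), cim (w 0 j)); last exact: mkcK.
have h := le_trans (coord_le w j) wr.
by split => /=; rewrite in_itv/= -ler_norml; apply: le_trans h; [exact: cre_le|exact: cim_le].
Qed.

Lemma cabs_bounded_ball (f : 'rV[cplx R]_n -> cplx R) (r : R) : 0 <= r -> r < 1 ->
  (forall z, @cball R n z -> {for z, continuous f}) -> exists M, forall w, enorm w <= r -> cabs (f w) <= M.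
Proof.
move=> r0 r1 cf.
have cw : {within [set w : 'rV[cplx R]_n | enorm w <= r], continuous (fun w => cabs (f w))}.
  apply: continuous_in_subspaceT => z; rewrite inE /= => zr.
  apply: (@continuous_comp _ _ _ f (@cabs R)); last exact: continuous_cabs.
  by apply: cf; exact: le_lt_trans r1.
have := compact_bounded (continuous_compact cw (enorm_le_compact r0)).
move=> [M [_ HM]]; exists (M + 1) => w wr.
have := HM (M + 1) (ltr_pwDr ltr01 (lexx _)) (cabs (f w)).
rewrite /= ger0_norm ?cabs_ge0//; apply; by exists w.
Qed.

End compactness.

Section submean_koranyi.
Context {R : realType} {n : nat}.
Notation Cn := (Cn R n.+1).
Notation vol := (@lebesgue_Cn R n.+1).
Notation ball := (@cball R n.+1).

(** Small enough for the displaced points to keep their height within a factor between 49/50 and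
    101/100 and to move 1 - <z, eta> by at most 3/200 of the height; added to 19/20 this stays below
    49/50. *)
Let c : R := (200 * (n%:R + 1))^-1.

Let n0 : 0 <= n%:R :> R. Proof. exact: ler0n. Qed.

Let c_gt0 : 0 < c. Proof. by rewrite invr_gt0 mulr_gt0// ltr_wpDl. Qed.

Let cn : c * (n%:R + 1) = 200^-1.
Proof. by rewrite /c invfM -mulrA mulVf ?mulr1// gt_eqF// ltr_wpDl. Qed.

Let c_le : c <= 200^-1. Proof. by rewrite -cn ler_peMr ?(ltW c_gt0)// lerDr. Qed.

Let n_sqr : 2 * n%:R <= 4 * (n%:R + 1) ^+ 2 :> R.
Proof. move: (n%:R : R) n0 => m m0; nra. Qed.

Let shift_num (h z a y : R) : 0 < h -> h <= 1 -> 0 <= z -> z < 1 -> 0 <= a ->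
  a <= z + h / 200 -> z - h / 200 <= a -> 0 <= y -> y <= h / 200 ->
  z ^+ 2 - h / 100 <= a ^+ 2 + y /\ a ^+ 2 + y <= z ^+ 2 + h * (3 / 200) + h / 200.
Proof.
move=> h0 h1 z0 z1 a0 up low y0 y1; have hh : h ^+ 2 <= h by nra.
have zh : z * h <= h by nra.
have zh0 : 0 <= z * h by atom_nra.
have up2 : a ^+ 2 <= (z + h / 200) ^+ 2 by rewrite ler_sqr ?nnegrE//; atom_lra.
split; last by atom_nra.
case: (leP z (h / 200)) => hz; first by atom_nra.
have : (z - h / 200) ^+ 2 <= a ^+ 2 by rewrite ler_sqr ?nnegrE//; atom_lra.
atom_nra.
Qed.

(* z + U (dil x) stays in the Koranyi region because the component of [eta] orthogonal to z has
   square at most 2 h, and dil moves that component by at most c sqrt(n h). *)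
Lemma polydisc_koranyi (eta z : Cn) (U S : Cn -> Cn) (e : Cn) : enorm eta = 1 -> ball z ->
  cabs (1 - cdot z eta) < 19 / 20 * hgt z -> is_unitary U S -> enorm e = 1 ->
  U e1 = e -> z = cr (enorm z) *: e ->
  forall x : Cn, polydisc 1 x ->
  let w := z + U (dil (c * hgt z) (c * Num.sqrt (hgt z)) x) in
  [/\ koranyi eta w, hgt z / 2 <= hgt w & hgt w <= 2 * hgt z].
Proof.
move=> eta1 zb zeta uU enorme Ue1 ze x x1; set h := hgt z.
have h0 : 0 < h := hgt_gt0 zb.
have h1 : h <= 1 := hgt_le1 z.
set y := dil _ _ x => w.
pose y0 := cr (c * h) * x 0 ord0; pose y' := y - y0 *: e1.
have y0E : cdot y e1 = y0 by rewrite cdot_e1 /y dil_ord0.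
have yE : U y = y0 *: e + U y' by rewrite /y' (unitaryB uU) (unitaryZ uU) Ue1 addrC subrK.
have y0c : cabs y0 <= c * h.
  rewrite /y0 cabsM cabs_cr ger0_norm; last by rewrite mulr_ge0 ?ltW.
  by rewrite ler_piMr ?mulr_ge0 ?ltW.
have y'2 : enorm y' ^+ 2 <= n%:R * (c ^+ 2 * h).
  rewrite enorm2_split (_ : y' 0 ord0 = 0); last first.
    by rewrite !mxE !eqxx /y0 mulr1 subrr.
  rewrite cabs0 expr0n add0r; apply: (@le_trans _ _ (\sum_(j < n) (c ^+ 2 * h))).
    apply: ler_sum => j _; rewrite (_ : y' 0 _ = cr (c * Num.sqrt h) * x 0 (lift ord0 j)); last first.
      by rewrite !mxE /= mulr0 subr0.
    rewrite cabsM exprMn cabs_cr real_normK ?num_real// exprMn sqr_sqrtr ?(ltW h0)//.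
    rewrite ler_piMr ?mulr_ge0 ?sqr_ge0 ?(ltW h0) ?(ltW c_gt0)//.
    by rewrite expr_le1// ?cabs_ge0// ltW.
  by rewrite sumr_const card_ord mulr_natl.
have Uy'e : cdot (U y') e = 0.
  case: (uU) => _ _ _ _ Uc; rewrite -Ue1 Uc /y' cdotBl cdotZl y0E cdotzz enorm_e1.
  by rewrite expr1n mulr1 subrr.
have nU : enorm (U y') = enorm y' := unitary_enorm uU y'.
pose b := cdot eta e.
have etaP : enorm (eta - b *: e) ^+ 2 = 1 - cabs b ^+ 2.
  by rewrite /b enorm_perp// eta1 expr1n.
have bz : cabs (cdot z eta) = enorm z * cabs b.
  by rewrite {1}ze cdotZl cabsM cabs_cr ger0_norm// (cdotC eta e) cabsJ.
rewrite -/h in zeta; have zlt1 : enorm z < 1 := zb.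
have hE : h = 1 - enorm z ^+ 2 by [].
have z0 := enorm_ge0 z.
have b0 : 0 <= cabs b by exact: cabs_ge0.
have b1 : 1 - cabs b ^+ 2 <= 2 * h.
  have := cabs_leB 1 (1 - cdot z eta); rewrite cabs1 opprB addrCA subrr addr0 bz => hb.
  have hb2 : 1 - h <= cabs b.
    have : enorm z * cabs b <= cabs b by rewrite ler_piMl// ltW.
    atom_lra.
  atom_nra.
have ke : cabs (cdot (U y') eta) <= 2 * (n%:R + 1) * c * h.
  have -> : cdot (U y') eta = cdot (U y') (eta - b *: e) by rewrite cdotBr cdotZr Uy'e mulr0 subr0.
  apply: le_trans (cauchy_schwarz _ _) _.
  have r0 : 0 <= 2 * (n%:R + 1) * c * h by rewrite !mulr_ge0 ?(ltW h0) ?(ltW c_gt0)// addr_ge0.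
  suff : (enorm (U y') * enorm (eta - b *: e)) ^+ 2 <= (2 * (n%:R + 1) * c * h) ^+ 2.
    by rewrite ler_sqr ?nnegrE//; exact: mulr_ge0.
  rewrite exprMn etaP nU.
  apply: (@le_trans _ _ (n%:R * (c ^+ 2 * h) * (2 * h))).
    by apply: ler_pM => //; [exact: sqr_ge0|rewrite -etaP sqr_ge0].
  have c2 : 0 <= (c * h) ^+ 2 by exact: sqr_ge0.
  have -> : n%:R * (c ^+ 2 * h) * (2 * h) = 2 * n%:R * (c * h) ^+ 2 by ring.
  have -> : (2 * (n%:R + 1) * c * h) ^+ 2 = 4 * (n%:R + 1) ^+ 2 * (c * h) ^+ 2 by ring.
  by apply: ler_wpM2r => //; exact: n_sqr.
have wE : w = (cr (enorm z) + y0) *: e + U y' by rewrite /w yE addrA {1}ze scalerDl.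
have wn : enorm w ^+ 2 = cabs (cr (enorm z) + y0) ^+ 2 + enorm y' ^+ 2.
  rewrite wE enormD2 enormZ enorme mulr1 nU cdotZl (cdotC (U y') e) Uy'e rmorph0 mulr0 cre0.
  by rewrite mulr0 addr0.
have a1 := cabs_triangle (cr (enorm z)) y0; have a2 := cabs_leD (cr (enorm z)) y0.
rewrite !cabs_cr ger0_norm// in a1 a2.
set a := cabs (_ + y0) in wn a1 a2; have a0 : 0 <= a by exact: cabs_ge0.
have ch : c * h <= h / 200 by rewrite mulrC ler_wpM2l ?(ltW h0).
have nc : n%:R * (c ^+ 2 * h) <= h / 200.
  have -> : n%:R * (c ^+ 2 * h) = (c * n%:R) * (c * h) by ring.
  have cn1 : c * n%:R <= 1 by have := cn; rewrite mulrDr mulr1; have := c_gt0; atom_lra.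
  by rewrite -[leRHS]mul1r; apply: ler_pM => //; rewrite mulr_ge0// ltW.
have y'0 : 0 <= enorm y' ^+ 2 by exact: sqr_ge0.
have [low up] : enorm z ^+ 2 - h / 100 <= enorm w ^+ 2 /\
    enorm w ^+ 2 <= enorm z ^+ 2 + h * (3 / 200) + h / 200.
  rewrite wn; apply: shift_num => //; atom_lra.
have hw : h * (49 / 50) <= hgt w by rewrite /hgt; atom_lra.
split; [apply/koranyiE|atom_lra|by rewrite /hgt; atom_lra].
split; first by apply: hgt_gt0_ball; atom_lra.
have -> : 1 - cdot w eta = (1 - cdot z eta) - y0 * cdot e eta - cdot (U y') eta.
  by rewrite /w yE !cdotDl cdotZl; ring.
have t1 := cabs_triangle (1 - cdot z eta - y0 * cdot e eta) (- cdot (U y') eta).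
have t2 := cabs_triangle (1 - cdot z eta) (- (y0 * cdot e eta)).
have e1' : cabs (cdot e eta) <= 1 by apply: le_trans (cauchy_schwarz _ _) _; rewrite enorme eta1 mulr1.
have t3 : cabs (y0 * cdot e eta) <= c * h.
  rewrite cabsM; apply: le_trans y0c; by rewrite ler_piMr// cabs_ge0.
rewrite !cabsN in t1 t2.
have ke' : cabs (cdot (U y') eta) <= h / 100.
  apply: le_trans ke _; have -> : 2 * (n%:R + 1) * c * h = 2 * (c * (n%:R + 1)) * h by ring.
  by rewrite cn; atom_lra.
atom_lra.
Qed.

Lemma holomorphic_continuous (f : 'rV[cplx R]_n.+1 -> cplx R) : holomorphic_ball f ->
  forall z, ball z -> {for z, continuous f}.
Proof. by move=> hf z zb; apply: differentiable_continuous; exact: hf. Qed.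

Lemma holomorphic_measurable (f : 'rV[cplx R]_n.+1 -> cplx R) : holomorphic_ball f ->
  measurable_fun ball (fun w : Cn => cabs (f w)).
Proof.
move=> hf; apply: measurable_continuous_in; first exact: open_cball.
move=> z zb; apply: (@continuous_comp _ _ _ f (@cabs R)); last exact: continuous_cabs.
exact: holomorphic_continuous.
Qed.

Lemma powR_double (h r g : R) : 0 < r -> r / 2 <= h -> h <= 2 * r -> h `^ g <= 2 `^ `|g| * r `^ g.
Proof.
move=> r0 h1 h2; have h0 : 0 < h by lra.
have [hr|rh] := leP h r; first exact: powR_comparable.
have := @powR_comparable R r h (- g) h0 _ (ltW rh); rewrite normrN !powRN => /(_ _)H.
have {H} : (r `^ g)^-1 <= 2 `^ `|g| * (h `^ g)^-1 by apply: H; lra.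
have hg : 0 < h `^ g by rewrite powR_gt0.
have rg : 0 < r `^ g by rewrite powR_gt0.
by rewrite ler_pdivlMr// mulrC ler_pdivrMr.
Qed.

Lemma powR_double' (h r g : R) : 0 < r -> r / 2 <= h -> h <= 2 * r -> r `^ g <= 2 `^ `|g| * h `^ g.
Proof. by move=> r0 h1 h2; apply: powR_double; lra. Qed.

Definition tent_dens (q alpha : R) (f : 'rV[cplx R]_n.+1 -> cplx R) (w : Cn) : R :=
  cabs (f w) `^ q * hgt w `^ alpha.

Lemma tent_dens_ge0 q alpha f w : 0 <= tent_dens q alpha f w.
Proof. by rewrite mulr_ge0// powR_ge0. Qed.

Lemma measurable_tent_dens q alpha f : holomorphic_ball f ->
  measurable_fun ball (tent_dens q alpha f).
Proof.
move=> hf; apply: measurable_funM.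
  exact: (measurableT_comp (measurable_powR q) (holomorphic_measurable hf)).
apply: measurable_funTS.
exact: (measurableT_comp (measurable_powR alpha) measurable_hgt).
Qed.

(** The submean inequality for f composed with an affine map T that sends 0 to z and the unit
    polydisc into the Koranyi region of eta. T stretches by c h along z and by c sqrt h across, so
    its inverse Jacobian gives h^-(n.+2). The aperture 19/20 leaves room for the polydisc. *)
Lemma submean_point (q alpha : R) : 0 < q -> exists2 C : R, 0 < C &
  forall f : 'rV[cplx R]_n.+1 -> cplx R, holomorphic_ball f -> forall eta z : Cn, enorm eta = 1 ->
  ball z -> cabs (1 - cdot z eta) < 19 / 20 * hgt z ->
  ((cabs (f z) `^ q * hgt z `^ (alpha + n.+2%:R))%:E <=
   C%:E * \int[ball_measure R n.+1]_(w in koranyi eta) (tent_dens q alpha f w)%:E)%E.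
Proof.
move=> q0; have [C C0 H] := @submean_power R n.+1 q q0.
exists (C * (2 `^ `|alpha| * (c^-1 ^+ 2) ^+ n.+1 * (c0 (R := R) (n := n.+1))^-1)).
  have ci : 0 < c^-1 by rewrite invr_gt0.
  have c2 := exprn_gt0 n.+1 (exprn_gt0 2 ci).
  by rewrite mulr_gt0// divr_gt0 ?c0_gt0// mulr_gt0 ?powR_gt0.
move=> f hf eta z eta1 zb zeta; set h := hgt z.
have h0 : 0 < h := hgt_gt0 zb.
have h1 : h <= 1 := hgt_le1 z.
have [e en1 ze] : exists2 e : Cn, enorm e = 1 & z = cr (enorm z) *: e.
  have [z0|z0] := eqVneq z 0; first by exists e1; rewrite ?enorm_e1// z0 enorm0 cr0 scale0r.
  exists (cproj z); first exact: enorm_cproj.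
  rewrite /cproj scalerA -[((enorm z)^-1)%:C%C]/(cr _) -crM mulfV ?cr1 ?scale1r//.
  by rewrite enorm_eq0.
have [U [S [uU Ue]]] := rotation_exists enorm_e1 en1.
have TP := polydisc_koranyi eta1 zb zeta uU en1 Ue ze.
rewrite -/h in TP.
set a := c * h in TP; set b := c * Num.sqrt h in TP.
have a0 : 0 < a by rewrite mulr_gt0.
have b0 : 0 < b by rewrite mulr_gt0// sqrtr_gt0.
pose T (x : Cn) : Cn := z + U (dil a b x).
have mU : measurable_fun setT U by case: uU.
have mT : measurable_fun setT T.
  apply: measurable_CnD; first exact: measurable_cst.
  exact: (measurableT_comp mU (measurable_dil a b)).
pose k : R := a^-1 ^+ 2 * (b^-1 ^+ 2) ^+ n.
have k0 : 0 <= k by rewrite mulr_ge0 ?exprn_ge0 ?sqr_ge0// invr_ge0 ltW.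
have volT A : measurable A -> vol (T @^-1` A) = (k%:E * vol A)%E.
  move=> mA; have mA1 : measurable ((fun y : Cn => y + z : Cn) @^-1` A).
    rewrite -[X in measurable X]setTI.
    have m1 : measurable_fun setT (fun y : Cn => y + z : Cn).
      by apply: measurable_CnD; [exact: measurable_id|exact: measurable_cst].
    exact: m1.
  have mA2 : measurable (U @^-1` ((fun y : Cn => y + z : Cn) @^-1` A)).
    by rewrite -[X in measurable X]setTI; exact: mU.
  rewrite -(vol_translate z mA) -(vol_unitary uU mA1) -(vol_dil a0 b0 mA2); congr (vol _).
  by apply/funext => x; rewrite /preimage /T /= addrC.
have T0 : T 0 = z.
  rewrite /T (_ : dil a b 0 = 0) ?(unitary0 uU) ?addr0//.
  by apply/rowP => j; rewrite !mxE mulr0.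
have Tb x : polydisc 1 x -> ball (T x) by move=> /TP[[]].
have Tline x u t : T (x + t *: u) = T x + t *: U (dil a b u).
  by rewrite /T addrC (addrC x) dilP (unitaryD uU) (unitaryZ uU) addrC -addrA; congr (_ + _); rewrite addrC.
have HF := H (fun x => f (T x)) _ _ _; rewrite T0 in HF.
have mfT : measurable_fun (polydisc 1) (fun x : Cn => cabs (f (T x))).
  apply: (@measurable_comp _ _ _ _ _ _ ball (fun w : Cn => cabs (f w)) (polydisc 1) T).
  - exact: measurable_cball.
  - by move=> _ [x x1 <-]; exact: Tb.
  - exact: holomorphic_measurable.
  - exact: (measurable_funS measurableT (@subsetT _ _) mT).
have {}HF := HF _ mfT _.
have l1 : line_holomorphic (fun x => f (T x)) (polydisc 1).
  move=> x u t xu; apply: (@cdiff_near _ (fun s => f (T x + s *: U (dil a b u)))).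
    by apply: filterE => s /=; rewrite Tline.
  by apply: differentiable_line; rewrite -Tline; apply: hf; exact: Tb.
(* On the image of T heights are at least h / 2, so f is bounded there by compactness; the submean
   inequality needs only that some bound exists. *)
have l2 : exists M, forall u, polydisc 1 u -> cabs (f (T u)) <= M.
  have h20 : 0 <= 1 - h / 2 by atom_lra.
  have [|M HM] := @cabs_bounded_ball R n.+1 f (Num.sqrt (1 - h / 2)) (sqrtr_ge0 _) _
    (holomorphic_continuous hf).
    by rewrite -[ltRHS]sqrtr1 ltr_sqrt//; atom_lra.
  exists M => u /TP[_ hw _]; apply: HM; rewrite -[leLHS]ger0_norm// -sqrtr_sqr ler_wsqrtr//.
  rewrite /hgt in hw; rewrite /T; atom_lra.
have {HF} HF := HF l1 l2.
set I := (\int[_]_(w in _) _)%E.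
pose J : \bar R := (\int[vol]_(w in koranyi eta) (tent_dens q alpha f w)%:E)%E.
have mg : measurable_fun (koranyi eta) (fun w => (tent_dens q alpha f w)%:E).
  apply/measurable_EFinP; apply: measurable_funS (measurable_tent_dens q alpha hf).
    exact: measurable_cball.
  by move=> w [].
have IE : I = ((c0 (R := R) (n := n.+1))%:E * J)%E.
  apply: ball_integral => //; [exact: measurable_koranyi|by move=> w []|].
  by move=> w _; rewrite lee_fin tent_dens_ge0.
have ch : (\int[vol]_(x in T @^-1` koranyi eta) (tent_dens q alpha f (T x))%:E = k%:E * J)%E.
  apply: (integral_change mT k0 volT (measurable_koranyi eta) mg).
  by move=> w _; rewrite lee_fin tent_dens_ge0.
have mTk : measurable (T @^-1` koranyi eta).
  by rewrite -[X in measurable X]setTI; apply: mT => //; exact: measurable_koranyi.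
have mgT : measurable_fun (T @^-1` koranyi eta) (fun x => (tent_dens q alpha f (T x))).
  apply: (@measurable_comp _ _ _ _ _ _ ball (tent_dens q alpha f) _ T).
  - exact: measurable_cball.
  - by move=> _ [x [x1 _] <-].
  - exact: measurable_tent_dens.
  - exact: (measurable_funS measurableT (@subsetT _ _) mT).
have PT : polydisc 1 `<=` T @^-1` koranyi eta by move=> x /TP[].
pose L : R := 2 `^ `|alpha| * h `^ (- alpha).
have L0 : 0 <= L by rewrite mulr_ge0// powR_ge0.
have s1 : (\int[vol]_(x in polydisc 1) (cabs (f (T x)) `^ q)%:E <=
    L%:E * \int[vol]_(x in polydisc 1) (tent_dens q alpha f (T x))%:E)%E.
  apply: (@ge0_le_integralZ _ _ _ vol (polydisc 1) (fun x => cabs (f (T x)) `^ q)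
      (fun x => tent_dens q alpha f (T x)) L (measurable_polydisc 1)).
  - exact: (measurableT_comp (measurable_powR q) mfT).
  - exact: measurable_funS mTk PT mgT.
  - by move=> x _; exact: powR_ge0.
  - by move=> x _; exact: tent_dens_ge0.
  - exact: L0.
  move=> x /TP[_ w1 w2]; rewrite /tent_dens mulrCA -[leLHS]mulr1.
  apply: ler_wpM2l; first exact: powR_ge0.
  rewrite /L powRN mulrAC ler_pdivlMr; last exact: powR_gt0.
  rewrite mul1r; exact: powR_double' h0 w1 w2.
have s2 : (\int[vol]_(x in polydisc 1) (tent_dens q alpha f (T x))%:E <= k%:E * J)%E.
  rewrite -ch; apply: (@ge0_subset_integral _ _ _ vol _ _ (measurable_polydisc 1) mTk
      (fun x => (tent_dens q alpha f (T x))%:E) _ _ PT).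
    exact/measurable_EFinP.
  by move=> x _; rewrite lee_fin tent_dens_ge0.
have P0 : 0 <= h `^ (alpha + n.+2%:R) by exact: powR_ge0.
have J0 : (0 <= J)%E by apply: integral_ge0 => x _; rewrite lee_fin tent_dens_ge0.
have {}HF : ((cabs (f z) `^ q)%:E <= C%:E * (L%:E * (k%:E * J)))%E.
  apply: le_trans HF _; apply: lee_wpmul2l; first by rewrite lee_fin ltW.
  by apply: le_trans s1 _; exact: lee_wpmul2l.
rewrite EFinM IE; apply: le_trans (lee_wpmul2r _ HF) _; first by rewrite lee_fin.
rewrite muleC !muleA -!EFinM; apply: lee_wpmul2r => //; rewrite lee_fin le_eqVlt.
apply/orP; left; apply/eqP.
have sh : (Num.sqrt h) ^+ 2 = h by rewrite sqr_sqrtr// ltW.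
have -> : k = (c^-1 ^+ 2) ^+ n.+1 * h^-1 ^+ n.+2.
  have ea : a^-1 ^+ 2 = c^-1 ^+ 2 * h^-1 ^+ 2 by rewrite /a invfM exprMn.
  have eb : b^-1 ^+ 2 = c^-1 ^+ 2 * h^-1 by rewrite /b invfM exprMn [X in _ * X]exprVn sh.
  rewrite /k ea eb exprMn; set u := c^-1 ^+ 2; set v := h^-1.
  rewrite (exprS u n) (exprS v n.+1) (exprS v n).
  by set u' := (_ ^+ n); set v' := (_ ^+ n); ring.
rewrite -powR_natD// /L powRN; have hn : h ^+ n.+2 != 0 by rewrite expf_neq0// gt_eqF.
have ha : h `^ alpha != 0 by rewrite gt_eqF// powR_gt0.
rewrite (exprVn h n.+2); set u := (_ ^+ n.+1); set v := h ^+ n.+2 in hn *.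
have c00 : c0 (R := R) (n := n.+1) != 0 by rewrite gt_eqF// c0_gt0.
by field; rewrite ?hn ?ha ?c00.
Qed.

End submean_koranyi.

(** * The maximal function and embeddings of tent spaces *)

Section vitali.
Context {R : realType} {n : nat}.
Notation Cn := (Cn R n.+1).
Notation S := (@csphere R n.+1).
Notation sigma := (@sphere_measure R n.+1).

Lemma mulr_le_sqr (x y : R) : x * y <= (x ^+ 2 + y ^+ 2) / 2.
Proof. by have := sqr_ge0 (x - y); nra. Qed.

Lemma one_sub_sqr_le (w : cplx R) : cabs w <= 1 -> 1 - cabs w ^+ 2 <= 2 * cabs (1 - w).
Proof.
move=> w1; have := cabs_leB 1 (1 - w); rewrite cabs1 opprB addrCA subrr addr0.
have := cabs_ge0 w; nra.
Qed.

(** Split a and c into components along b and orthogonal to b. The orthogonal parts have squared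
    norms at most 2 |1 - <a, b>| and 2 |1 - <b, c>|, so their product is absorbed by the sum. *)
Lemma koranyi_quasi_triangle (a b c : Cn) : S a -> S b -> S c ->
  cabs (1 - cdot a c) <= 2 * (cabs (1 - cdot a b) + cabs (1 - cdot b c)).
Proof.
move=> a1 b1 c1; have cs x y : S x -> S y -> cabs (cdot x y) <= 1.
  by move=> x1 y1; apply: le_trans (cauchy_schwarz _ _) _; rewrite [enorm x]x1 [enorm y]y1 mulr1.
pose pa := a - cdot a b *: b; pose pc := c - cdot c b *: b.
have E : 1 - cdot a c = (1 - cdot a b) + cdot a b * (1 - cdot b c) - cdot pa pc.
  rewrite /pa /pc cdotBl !cdotBr !cdotZl !cdotZr cdotzz [enorm b]b1 expr1n cr1 -(cdotC c b).
  ring.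
have pa2 : enorm pa ^+ 2 <= 2 * cabs (1 - cdot a b).
  by rewrite enorm_perp// [enorm a]a1 expr1n; apply: one_sub_sqr_le; exact: cs.
have pc2 : enorm pc ^+ 2 <= 2 * cabs (1 - cdot b c).
  by rewrite enorm_perp// [enorm c]c1 expr1n cabs_1dotC; apply: one_sub_sqr_le; exact: cs.
clearbody pa pc; have h1 := cauchy_schwarz pa pc.
have h2 : enorm pa * enorm pc <= (enorm pa ^+ 2 + enorm pc ^+ 2) / 2.
  exact: mulr_le_sqr.
have h3 : cabs (cdot a b * (1 - cdot b c)) <= cabs (1 - cdot b c).
  by rewrite cabsM ler_piMl// ?cabs_ge0// cs.
rewrite E; apply: le_trans (cabs_triangle _ _) _; rewrite cabsN.
apply: le_trans (lerD (le_trans (cabs_triangle _ _) (lerD (lexx _) h3)) (le_trans h1 h2)) _.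
move: pa2 pc2; clear E h1 h2 h3; move: (enorm pa ^+ 2) (enorm pc ^+ 2) => x y.
by move: (cabs (1 - cdot a b)) (cabs (1 - cdot b c)) => u w; lra.
Qed.

(** The measure is carried by the sphere: [cproj] misses it only at 0, which no cap of size at most
    1 contains. *)
Lemma cap_sphere_ge (e : Cn) d : enorm e = 1 -> 0 < d -> d <= 1 ->
  ((Clow (R := R) (n := n) * d ^+ n.+1)%:E <= sigma (cap e d `&` S))%E.
Proof.
move=> e1 d0 d1; apply: le_trans (sphere_cap_ge e1 d0 d1) _.
rewrite !sphere_measureE le_eqVlt; apply/orP; left; apply/eqP; congr (ball_measure R n.+1 _).
apply/seteqP; split => [z zc|z []//]; split => //=; have [z0|z0] := eqVneq z 0.
  by move: zc; rewrite /cap /= z0 /cproj scaler0 cdot0l subr0 cabs1 ltNge d1.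
exact: enorm_cproj.
Qed.

Lemma measurable_cap_sphere (e : Cn) d : measurable (cap e d `&` S).
Proof. by apply: measurableI; [exact: measurable_cap|exact: measurable_csphere]. Qed.

Lemma seq_argmax (d : nat -> R) (s : seq nat) : s != [::] ->
  exists2 i, i \in s & forall j, j \in s -> d j <= d i.
Proof.
elim: s => // i [|k s] IH _; first by exists i; rewrite ?inE// => j; rewrite inE => /eqP->.
have [j js Hj] := IH isT; have [ij|ji] := leP (d i) (d j).
  exists j; first by rewrite in_cons js orbT.
  by move=> l; rewrite in_cons => /orP[/eqP->//|]; exact: Hj.
exists i; first by rewrite in_cons eqxx.
by move=> l; rewrite in_cons => /orP[/eqP->//|/Hj /le_trans]; apply; exact: ltW.
Qed.

Definition Cvit (K : R) : R := Cup (R := R) (n := n) * (2 * (K + 4)) ^+ n.+1 / Clow (R := R) (n := n).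

(* Induction removing a cap of maximal radius and all caps meeting it. *)
Lemma vitali_finite (K : R) (e : nat -> Cn) (d : nat -> R) : 0 < K -> forall (m : nat) (s : seq nat) (D : set Cn),
  (size s <= m)%N -> measurable D ->
  (forall i, i \in s -> [/\ S (e i), 0 < d i, d i <= 1 & cap (e i) (d i) `&` S `<=` D]) ->
  (sigma (\bigcup_(i in [set` s]) (cap (e i) (K * d i)%R `&` S)) <= (Cvit K)%:E * sigma D)%E.
Proof.
move=> K0; have Cl := @Clow_gt0 R n; have Cu := @Cup_ge1 R n.
have C0 : 0 <= Cvit K by rewrite divr_ge0 ?(ltW Cl)// mulr_ge0 ?exprn_ge0//; lra.
elim=> [|m IH] s D sm mD H.
  move: sm; rewrite leqn0 size_eq0 => /eqP->.
  rewrite (_ : \bigcup_(_ in _) _ = set0) ?measure0 ?mule_ge0//.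
  by apply/seteqP; split=> // a [k]; rewrite /= in_nil.
have [s0|s0] := eqVneq s [::]; first by apply: IH => //; rewrite s0.
have [i0 i0s Hi0] := seq_argmax d s0; have [e0S d00 d01 D0] := H _ i0s.
set B := cap (e i0) (d i0) `&` S in D0; have mB : measurable B := measurable_cap_sphere _ _.
pose s' := [seq j <- s | `[< cap (e j) (d j) `&` S `&` B = set0 >]].
have ei0 i : i \in s -> (cap (e i) (d i) `&` S) (e i).
  move=> /H[Si di _ _]; split => //; rewrite /cap /= cdotzz [enorm _]Si expr1n cr1 subrr cabs0.
  exact: di.
(* The cap of [i0] meets itself, so the filter drops at least [i0]. *)
have s'm : (size s' <= m)%N.
  rewrite -ltnS; apply: leq_trans sm; rewrite /s' size_filter -(count_predT s) -!size_filter.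
  rewrite [X in (_ < size X)%N]filter_predT size_filter ltn_neqAle count_size andbT -all_count.
  apply/negP => /allP /(_ _ i0s) /asboolP E0.
  by have : (set0 : set Cn) (e i0) by rewrite -E0; split; exact: ei0.
have IHs := IH s' (D `\` B) s'm (measurableD mD mB).
have {}IHs : (sigma (\bigcup_(i in [set` s']) (cap (e i) (K * d i)%R `&` S)) <= (Cvit K)%:E * sigma (D `\` B))%E.
  apply: IHs => i; rewrite mem_filter => /andP[/asboolP E0 /H[Si di0 di1 Di]]; split => // a Ba.
  by split; [exact: Di|move=> Ba'; have : (set0 : set Cn) a by rewrite -E0].
have mU (P : set nat) : measurable (\bigcup_(i in P) (cap (e i) (K * d i)%R `&` S)).
  by apply: bigcup_measurable => k _; exact: measurable_cap_sphere.
(* If the caps of i and i0 meet, two quasi-triangle inequalities bound the distance by 2 (K d + 2 (d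
   + d0)) for d <= d0, the radii of i and i0: this is 2 (K + 4) d0. *)
have sub : \bigcup_(i in [set` s]) (cap (e i) (K * d i)%R `&` S) `<=`
    cap (e i0) (2 * (K + 4) * d i0) `|` \bigcup_(i in [set` s']) (cap (e i) (K * d i)%R `&` S).
  move=> a [i /= si [ai Sa]]; have [Si di0 di1 _] := H _ si.
  have [E0|/eqP/set0P[b [[bi Sb] [b0 _]]]] := pselect (cap (e i) (d i) `&` S `&` B = set0).
    right; exists i => //=; by rewrite mem_filter si andbT; apply/asboolP.
  left; rewrite /cap /= in ai bi b0 *.
  have t1 := koranyi_quasi_triangle Sa Si e0S.
  have t2 := koranyi_quasi_triangle Si Sb e0S.
  rewrite (cabs_1dotC (e i) b) in t2.
  have h1 := Hi0 _ si; have h2 : K * d i <= K * d i0 by rewrite ler_wpM2l// ltW.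
  atom_lra.
have d2 : 0 < 2 * (K + 4) * d i0 by rewrite !mulr_gt0//; atom_lra.
apply: le_trans (le_measure _ _ _ sub) _; rewrite ?inE.
- exact: mU.
- by apply: measurableU; [exact: measurable_cap|exact: mU].
apply: le_trans (measureU2 _ _ _) _; [exact: measurable_cap|exact: mU|].
have DE : sigma D = (sigma B + sigma (D `\` B))%E.
  rewrite -measureU//; first by rewrite setDUK.
    exact: measurableD.
  by rewrite setDIK.
rewrite DE ge0_muleDr ?measure_ge0//; apply: leeD; last exact: IHs.
apply: le_trans (sphere_cap_le e0S d2) _.
apply: (@le_trans _ _ ((Cvit K)%:E * (Clow (R := R) (n := n) * d i0 ^+ n.+1)%:E)%E).
  rewrite -EFinM lee_fin /Cvit le_eqVlt; apply/orP; left; apply/eqP.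
  by rewrite exprMn mulrA [in RHS]mulrA divfK// gt_eqF.
by apply: lee_wpmul2l; rewrite ?lee_fin//; exact: cap_sphere_ge.
Qed.

(** The bound for finite subfamilies has a constant independent of their number, so it passes to the
    increasing union. *)
Lemma vitali (K : R) (e : nat -> Cn) (d : nat -> R) (P : set nat) (D : set Cn) : 0 < K ->
  measurable D ->
  (forall i, P i -> [/\ S (e i), 0 < d i, d i <= 1 & cap (e i) (d i) `&` S `<=` D]) ->
  (sigma (\bigcup_(i in P) (cap (e i) (K * d i)%R `&` S)) <= (Cvit K)%:E * sigma D)%E.
Proof.
move=> K0 mD H; pose F i := cap (e i) (K * d i)%R `&` S.
pose s N := [seq i <- iota 0 N | `[< P i >]]; pose G N := \bigcup_(i in [set` s N]) F i.
have mU (Q : set nat) : measurable (\bigcup_(i in Q) F i).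
  by apply: bigcup_measurable => k _; exact: measurable_cap_sphere.
have -> : \bigcup_(i in P) F i = \bigcup_N G N.
  apply/seteqP; split => a [i Pi Fi].
    by exists i.+1 => //; exists i => //=; rewrite mem_filter mem_iota add0n ltnSn leq0n !andbT; exact/asboolP.
  by case: Fi => j /=; rewrite mem_filter => /andP[/asboolP Pj _] Fj; exists j.
have ndG : nondecreasing_seq G.
  apply/nondecreasing_seqP => N; apply/subsetPset => a [i /= si Fi]; exists i => //=.
  move: si; rewrite !mem_filter !mem_iota !add0n => /andP[-> /andP[_ iN]] /=.
  exact: ltn_trans iN _.
have cv := nondecreasing_cvg_mu (mu := sigma) (fun N => mU _) (bigcupT_measurable _ (fun N => mU _)) ndG.
rewrite -(cvg_lim _ cv)//; apply: lime_le; first by apply/cvg_ex; eexists; exact: cv.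
apply: nearW => N; apply: (vitali_finite K0 (leqnn _) mD) => i.
by rewrite mem_filter => /andP[/asboolP /H].
Qed.

Lemma vitali_exists (K : R) : 0 < K -> exists2 V : R, 0 <= V &
  forall (e : nat -> Cn) (d : nat -> R) (P : set nat) (D : set Cn), measurable D ->
  (forall i, P i -> [/\ S (e i), 0 < d i, d i <= 1 & cap (e i) (d i) `&` S `<=` D]) ->
  (sigma (\bigcup_(i in P) (cap (e i) (K * d i)%R `&` S)) <= V%:E * sigma D)%E.
Proof.
move=> K0; exists (Cvit K) => [|e d P D]; last exact: vitali.
have Cl := @Clow_gt0 R n; have Cu := @Cup_ge1 R n.
apply: divr_ge0; last exact: ltW.
by apply: mulr_ge0; [lra|apply: exprn_ge0; lra].
Qed.

End vitali.

Lemma powR_le_root (R : realType) (x y p : R) : 0 <= x -> 0 < p -> x `^ p <= y -> x <= y `^ p^-1.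
Proof.
move=> x0 p0 xy; rewrite -[leLHS](@powRr1 R)// -(mulfV (lt0r_neq0 p0)) powRrM.
apply: ge0_ler_powR; rewrite ?nnegrE ?invr_ge0 ?powR_ge0 ?(ltW p0)//.
exact: le_trans (powR_ge0 _ _) xy.
Qed.

Lemma powR_ge1 (R : realType) (x p : R) : 1 <= x -> 0 <= p -> 1 <= x `^ p.
Proof.
move=> x1 p0; apply: (@le_trans _ _ (1 `^ p)); first by rewrite powR1.
by apply: ge0_ler_powR; rewrite ?nnegrE//; exact: le_trans x1.
Qed.

Lemma powR_le1 (R : realType) (x p : R) : 0 <= x -> x <= 1 -> 0 <= p -> x `^ p <= 1.
Proof.
move=> x0 x1 p0; apply: (@le_trans _ _ (1 `^ p)); last by rewrite powR1.
by apply: ge0_ler_powR; rewrite ?nnegrE.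
Qed.

(** The integral of a nonnegative function is a supremum over the simple functions below it, and
    those below [f] on [D] are below [g] on [E]. *)
Lemma le_ge0_integral d (T : measurableType d) (R : realType) (mu : {measure set T -> \bar R})
    (D E : set T) (f g : T -> \bar R) : D `<=` E -> (forall x, D x -> 0 <= f x)%E ->
  (forall x, D x -> f x <= g x)%E -> (forall x, E x -> 0 <= g x)%E ->
  (\int[mu]_(x in D) f x <= \int[mu]_(x in E) g x)%E.
Proof.
move=> DE f0 fg g0; rewrite !ge0_integralE//; apply: le_ereal_sup => _ /= [h Hh <-].
exists h => // x; apply: le_trans (Hh x) _; rewrite !patchE.
case: ifPn => xD; last by case: ifPn => // xE; apply: g0; rewrite -inE.
by rewrite mem_set; [apply: fg; rewrite -inE|apply: DE; rewrite -inE].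
Qed.

Lemma integralZ_ge0 d (T : measurableType d) (R : realType) (mu : {measure set T -> \bar R})
    (D : set T) (f : T -> \bar R) (k : R) : measurable D -> measurable_fun D f ->
  (forall x, D x -> 0 <= f x)%E -> 0 <= k ->
  (\int[mu]_(x in D) (k%:E * f x) = k%:E * \int[mu]_(x in D) f x)%E.
Proof. by move=> mD mf f0 k0; rewrite ge0_integralZl. Qed.

Lemma le_poweR (R : realType) (x y : \bar R) (r : R) : 0 <= r -> (0 <= x)%E -> (x <= y)%E ->
  (x `^ r <= y `^ r)%E.
Proof.
move=> r0 x0 xy; apply: gt0_ler_poweR => //; rewrite in_itv /= leey andbT//.
exact: le_trans xy.
Qed.

(** * Area integrals and pointwise growth *)

Section tent.
Context {R : realType} {n : nat}.
Notation Cn := (Cn R n.+1).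
Notation ball := (@cball R n.+1).
Notation S := (@csphere R n.+1).
Notation sigma := (@sphere_measure R n.+1).
Notation v := (@ball_measure R n.+1).

Definition tent (u : Cn -> R) (xi : Cn) : \bar R := (\int[v]_(z in koranyi xi) (u z)%:E)%E.

Lemma tent_ge0 (u : Cn -> R) xi : (forall z, ball z -> 0 <= u z) -> (0 <= tent u xi)%E.
Proof. by move=> u0; apply: integral_ge0 => z [zb _]; rewrite lee_fin u0. Qed.

(** Tonelli's theorem for the indicator of the pairs (xi, z) with z in the region of xi, a
    measurable set since it is cut out by a measurable inequality. *)
Lemma measurable_tent (u : Cn -> R) : measurable_fun ball u -> (forall z, ball z -> 0 <= u z) ->
  measurable_fun setT (tent u).
Proof.
move=> mu u0; pose ub := (fun z => (u z)%:E) \_ ball.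
have ub0 z : (0 <= ub z)%E.
  by rewrite /ub patchE; case: ifPn => // zb; rewrite lee_fin u0// -inE.
have mub : measurable_fun setT ub.
  by apply/(measurable_restrictT _ (@measurable_cball R n.+1)); exact/measurable_EFinP.
pose g (xz : Cn * Cn) : R := cabs (1 - cdot xz.2 xz.1) - hgt xz.2.
have mg : measurable_fun setT g.
  apply: measurable_funB.
    apply: cmeasurable_cabs; apply: cmeasurableB; first exact: cmeasurable_cst.
    exact: (cmeasurable_cdot measurable_snd measurable_fst).
  exact: (measurableT_comp measurable_hgt measurable_snd).
pose E : set (Cn * Cn) := g @^-1` `]-oo, 0[%classic.
have mE : measurable E by rewrite -[E]setTI; apply: mg => //; exact: measurable_itv.
pose H (xz : Cn * Cn) : \bar R := (ub xz.2 * (\1_E xz)%:E)%E.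
have mH : measurable_fun setT H.
  apply: emeasurable_funM; first exact: (measurableT_comp mub measurable_snd).
  by apply/measurable_EFinP; exact: measurable_indic.
have H0 xz : (0 <= H xz)%E by rewrite mule_ge0// lee_fin.
have -> : tent u = (fun xi => \int[v]_z H (xi, z))%E.
  apply/funext => xi; rewrite /tent integral_mkcond; apply: eq_integral => z _.
  rewrite /H /= patchE /ub patchE indicE; case: (boolP (z \in koranyi xi)) => [|zk].
    rewrite inE => -[zb zx]; rewrite !mem_set// ?mule1//.
    by rewrite /E /g /= in_itv /= subr_lt0.
  case: (boolP (z \in ball)) => zb; last by rewrite mul0e.
  rewrite memNset ?mule0// /E /g /= in_itv /= subr_lt0 => zx; move/negP: zk; apply.
  by rewrite inE; split => //; rewrite -inE.
exact: (@measurable_fun_fubini_tonelli_F _ _ _ _ _ v H mH H0).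
Qed.

End tent.

Section growth.
Context {R : realType} {n : nat}.
Notation Cn := (Cn R n.+1).
Notation ball := (@cball R n.+1).
Notation S := (@csphere R n.+1).
Notation sigma := (@sphere_measure R n.+1).
Notation v := (@ball_measure R n.+1).
Implicit Types f : 'rV[cplx R]_n.+1 -> cplx R.

Definition amp (k : R) f (z : Cn) : R := cabs (f z) * hgt z `^ k.

Lemma amp_ge0 k f z : 0 <= amp k f z.
Proof. by rewrite mulr_ge0 ?cabs_ge0 ?powR_ge0. Qed.

Let dot_proj (z eta : Cn) : z != 0 -> cdot z eta = cr (enorm z) * cdot (cproj z) eta.
Proof.
move=> z0; rewrite /cproj cdotZl mulrA -[((enorm z)^-1)%:C%C]/(cr _) -crM mulfV ?cr1 ?mul1r//.
by rewrite enorm_eq0.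
Qed.

Let znz (z : Cn) : 10^-1 <= enorm z -> z != 0.
Proof. by move=> z1; rewrite -enorm_eq0 gt_eqF//; apply: lt_le_trans z1; rewrite invr_gt0. Qed.

(** With the next lemma, the boundary points whose region contains z are compared with caps about z
    / |z|: radius h / 25 guarantees the smaller aperture 19/20, and radius 500 h / 25 contains them
    all. Away from the origin the projection is harmless, hence |z| >= 1/10. *)
Lemma cap_sub_koranyi (z eta : Cn) : ball z -> 10^-1 <= enorm z ->
  cabs (1 - cdot (cproj z) eta) < hgt z / 25 -> cabs (1 - cdot z eta) < 19 / 20 * hgt z.
Proof.
move=> zb z1 H; rewrite (dot_proj _ (znz z1)).
have -> : 1 - cr (enorm z) * cdot (cproj z) eta =
  cr (1 - enorm z) + cr (enorm z) * (1 - cdot (cproj z) eta) by rewrite crB cr1; ring.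
apply: le_lt_trans (cabs_triangle _ _) _; rewrite cabsM !cabs_cr.
have zl : enorm z < 1 := zb.
rewrite ger0_norm ?subr_ge0 ?(ltW zl)// ger0_norm ?enorm_ge0//.
move: H; have := cabs_ge0 (1 - cdot (cproj z) eta); rewrite /hgt.
move: (enorm z) (cabs _) z1 zl => r c z1 zl; nra.
Qed.

Lemma koranyi_sub_cap (z eta : Cn) : koranyi eta z -> 10^-1 <= enorm z ->
  cabs (1 - cdot (cproj z) eta) < 500 * (hgt z / 25).
Proof.
move=> [zb zk] z1; have zl : enorm z < 1 := zb.
have E : cr (enorm z) * (1 - cdot (cproj z) eta) = (1 - cdot z eta) - cr (1 - enorm z).
  by rewrite (dot_proj _ (znz z1)) crB cr1; ring.
have : enorm z * cabs (1 - cdot (cproj z) eta) <= cabs (1 - cdot z eta) + (1 - enorm z).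
  have -> : enorm z * cabs (1 - cdot (cproj z) eta) = cabs (cr (enorm z) * (1 - cdot (cproj z) eta)).
    by rewrite cabsM cabs_cr ger0_norm ?enorm_ge0.
  rewrite E; apply: le_trans (cabs_triangle _ _) _; rewrite cabsN cabs_cr ger0_norm//.
  by rewrite subr_ge0 ltW.
move: zk; have := cabs_ge0 (1 - cdot (cproj z) eta); rewrite /hgt.
move: (enorm z) (cabs (1 - cdot (cproj z) eta)) (cabs _) z1 zl => r c c' z1 zl; nra.
Qed.

Lemma amp_submean (q alpha : R) : 0 < q -> exists2 C : R, 0 < C &
  forall f, holomorphic_ball f -> forall z eta : Cn, S eta -> ball z -> 10^-1 <= enorm z ->
  cabs (1 - cdot (cproj z) eta) < hgt z / 25 ->
  ((amp ((alpha + n.+2%:R) / q) f z `^ q)%:E <= C%:E * tent (tent_dens q alpha f) eta)%E.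
Proof.
move=> q0; have [C C0 H] := @submean_point R n q alpha q0; exists C => // f hf z eta eS zb z1 zc.
apply: le_trans (H f hf eta z eS zb (cap_sub_koranyi zb z1 zc)).
by rewrite lee_fin /amp powRM ?cabs_ge0 ?powR_ge0// -powRrM divfK// gt_eqF.
Qed.

Lemma cproj_sphere (z : Cn) : 10^-1 <= enorm z -> S (cproj z).
Proof. by move=> z1; apply: enorm_cproj; exact: znz. Qed.

(** The submean bound holds for every eta in the cap of radius h / 25 about z / |z|. Integrating its
    p-th power over this cap, of measure at least const h^n.+1, gives the extra power of the
    height. *)
Lemma amp_growth_far (p q alpha : R) : 0 < p -> 0 < q -> exists2 C : R, 0 < C &
  forall f (G : R), holomorphic_ball f ->
  (\int[sigma]_(xi in S) (tent (tent_dens q alpha f) xi `^ (p / q)) <= G%:E)%E ->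
  forall z, ball z -> 10^-1 <= enorm z ->
  amp ((alpha + n.+2%:R) / q) f z `^ p * hgt z ^+ n.+1 <= C * G.
Proof.
move=> p0 q0; have [C C0 H] := amp_submean alpha q0; have Cl := @Clow_gt0 R n.
exists (C `^ (p / q) * 25 ^+ n.+1 / Clow (R := R) (n := n)).
  by rewrite divr_gt0// mulr_gt0 ?powR_gt0// exprn_gt0.
move=> f G hf HG z zb z1; set X := amp _ f z; set A := tent _ in HG *.
have h0 := hgt_gt0 zb; have h1 := hgt_le1 z; have X0 : 0 <= X := amp_ge0 _ _ _.
pose B := cap (cproj z) (hgt z / 25) `&` S.
have A0 xi : (0 <= A xi)%E by apply: tent_ge0 => w _; exact: tent_dens_ge0.
have XA eta : B eta -> (((C^-1 * X `^ q) `^ (p / q))%:E <= A eta `^ (p / q))%E.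
  move=> [eB eS]; rewrite -poweR_EFin; apply: le_poweR; first by rewrite divr_ge0 ?ltW.
    by rewrite lee_fin mulr_ge0 ?powR_ge0// invr_ge0 ltW.
  rewrite -(@lee_pmul2l _ C%:E)// ?lte_fin// -EFinM mulrA mulfV ?gt_eqF// mul1r.
  by apply: H => //; move: eB; rewrite /cap /= cabs_1dotC.
have d0 : 0 < hgt z / 25 by rewrite divr_gt0.
have d1 : hgt z / 25 <= 1 by atom_lra.
have := cap_sphere_ge (cproj_sphere z1) d0 d1; rewrite -/B => HB.
have Y0 : 0 <= (C^-1 * X `^ q) `^ (p / q) by exact: powR_ge0.
have : (((C^-1 * X `^ q) `^ (p / q))%:E * (Clow (R := R) (n := n) * (hgt z / 25) ^+ n.+1)%:E <= G%:E)%E.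
  apply: le_trans HG; apply: (@le_trans _ _ (((C^-1 * X `^ q) `^ (p / q))%:E * sigma B)%E).
    by apply: lee_wpmul2l; rewrite ?lee_fin.
  rewrite -integral_cst; last exact: measurable_cap_sphere.
  apply: le_ge0_integral => [x []//|x _|x xB|x _]; rewrite ?lee_fin//; last exact: poweR_ge0.
  exact: XA.
rewrite -EFinM lee_fin powRM ?invr_ge0 ?(ltW C0) ?powR_ge0// -[X `^ q `^ _]powRrM.
rewrite (_ : q * (p / q) = p); last by rewrite mulrCA mulfV ?mulr1// gt_eqF.
rewrite -powR_inv1 ?(ltW C0)// -powRrM mulN1r powRN expr_div_n.
set a := C `^ _; set b := 25 ^+ _; set c := Clow; set x := X `^ p; set y := _ ^+ n.+1.
have a0 : 0 < a by rewrite powR_gt0.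
have b0 : 0 < b by rewrite exprn_gt0.
move=> HH; rewrite -(@ler_pM2l _ (a^-1 * c / b)).
  rewrite (_ : _ * (x * y) = a^-1 * x * (c * (y / b))); last by ring.
  by rewrite (_ : a^-1 * c / b * _ = G)//; field; rewrite !gt_eqF.
by rewrite divr_gt0// mulr_gt0 ?invr_gt0.
Qed.

(** The square inequality on the complex line through z in direction [e1], with half-side 3/10:
    boundary points lie between 3/10 and 6/10 away from z, hence at norm between 1/5 and 7/10, and
    the square of twice the size is still in the ball. *)
Lemma max_principle f (M : R) (z : Cn) : holomorphic_ball f -> enorm z <= 10^-1 ->
  (forall w : Cn, 5^-1 <= enorm w -> enorm w <= 7 / 10 -> cabs (f w) <= M) -> cabs (f z) <= 2 * M.
Proof.
move=> hf z1 HM; pose G (w : cplx R) := f (z + (cr (3 / 10) * w) *: e1).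
have nrm (w : cplx R) : enorm ((cr (3 / 10) * w) *: e1 : Cn) = 3 / 10 * cabs w.
  rewrite enormZ enorm_e1 mulr1 cabsM cabs_cr ger0_norm//; lra.
have dG w : `|cre w| < 2 -> `|cim w| < 2 -> cdiff G w.
  move=> w1 w2; have w3 : cabs w < 29 / 10.
    have -> : 29 / 10 = `|29 / 10| :> R by rewrite ger0_norm//; lra.
    rewrite -sqrtr_sqr cabs_def ltr_sqrt; last by lra.
    have := real_ltr_normlP; move: w1 w2; rewrite !ltr_norml => /andP[a b] /andP[c d] _; nra.
  have wb : ball (z + w *: (cr (3 / 10) *: e1)).
    rewrite scalerA mulrC; apply: le_lt_trans (enorm_triangle _ _) _; rewrite nrm; lra.
  have := differentiable_line (hf _ wb); apply: cdiff_near; apply: filterE => t /=.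
  by rewrite /G scalerA [t * _]mulrC.
have G0 : G 0 = f z by rewrite /G mulr0 scale0r addr0.
have := cauchy_square_local dG; rewrite G0 => H.
have HS : forall i y, -1 <= y <= 1 -> cabs (G (side i y)) <= M.
  move=> i y y1; have s1 := side_ge1 i y; have s2 := side_le2 i y1.
  have t1 := enorm_triangle z ((cr (3 / 10) * side i y) *: e1).
  have t2 := enorm_triangle (z + (cr (3 / 10) * side i y) *: e1) (- z).
  rewrite [z + _ - z]addrC addKr enormN nrm in t2; rewrite nrm in t1.
  by apply: HM; atom_lra.
have M0 : 0 <= M.
  by apply: le_trans (cabs_ge0 _) (HS 0 0 _); apply/andP; split; atom_lra.
have : ((4 * cabs (f z))%:E <= (4 * M)%:E * (2%:E : \bar R))%E.
  apply: le_trans H _; have <- : (@lebesgue_measure R `[(-1)%R, 1%R]%classic = 2%:E)%E.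
    rewrite lebesgue_measure_itv /= lte_fin ifT; last by lra.
    by rewrite -EFinB; congr EFin; ring.
  rewrite -integral_cst; last exact: measurable_itv.
  apply: le_ge0_integral => // y y1; rewrite lee_fin; last by rewrite mulr_ge0.
    by apply: sumr_ge0 => i _; exact: cabs_ge0.
  have -> : 4 * M = \sum_(i < 4) M by rewrite sumr_const card_ord mulr_natl.
  by apply: ler_sum => i _; apply: HS; move: y1; rewrite /= in_itv.
rewrite -EFinM lee_fin; atom_lra.
Qed.

Lemma amp_growth (p q alpha : R) : 0 < p -> 0 < q -> 0 < alpha + n.+2%:R -> exists2 C : R, 0 < C &
  forall f (G : R), holomorphic_ball f ->
  (\int[sigma]_(xi in S) (tent (tent_dens q alpha f) xi `^ (p / q)) <= G%:E)%E ->
  forall z, ball z -> amp ((alpha + n.+2%:R) / q) f z `^ p * hgt z ^+ n.+1 <= C * G.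
Proof.
move=> p0 q0 a0; have [C C0 H] := amp_growth_far alpha p0 q0; set k := (alpha + _) / q in H *.
have k0 : 0 < k by rewrite divr_gt0.
pose K : R := (2 * 2 `^ k) `^ p * 2 ^+ n.+1.
have K1 : 1 <= K.
  rewrite -[leLHS]mulr1; apply: ler_pM => //; last by rewrite exprn_ege1// ler1n.
  apply: powR_ge1; last exact: ltW.
  by rewrite -[leLHS]mulr1; apply: ler_pM; rewrite ?ler1n//; exact/ltW/powR_gt1_base.
exists (K * C); first by rewrite mulr_gt0//; exact: lt_le_trans K1.
move=> f G hf HG z zb; have G0 : 0 <= G.
  rewrite -lee_fin; apply: le_trans HG; apply: integral_ge0 => x _; exact: poweR_ge0.
have [z1|/ltW z1] := leP 10^-1 (enorm z).
  apply: le_trans (H f G hf HG z zb z1) _; rewrite -mulrA ler_peMl// mulr_ge0// ltW//.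
have CG : 0 <= C * G by rewrite mulr_ge0// ltW.
pose M := 2 `^ k * (2 ^+ n.+1 * (C * G)) `^ p^-1.
have HM (w : Cn) : 5^-1 <= enorm w -> enorm w <= 7 / 10 -> cabs (f w) <= M.
  move=> w1 w2; have wb : ball w by rewrite /cball /=; atom_lra.
  have h0 := hgt_gt0 wb; have hw : 2^-1 <= hgt w.
    by rewrite /hgt; have := enorm_ge0 w; atom_nra.
  have := H f G hf HG w wb _; rewrite /M => Hw.
  have {}Hw : amp k f w `^ p * hgt w ^+ n.+1 <= C * G by apply: Hw; atom_lra.
  have a1 : amp k f w `^ p <= 2 ^+ n.+1 * (C * G).
    rewrite -ler_pdivrMl ?exprn_gt0//; apply: le_trans Hw; rewrite mulrC ler_wpM2l ?powR_ge0//.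
    by rewrite -exprVn lerXn2r ?nnegrE ?invr_ge0// ltW.
  have a2 : amp k f w <= (2 ^+ n.+1 * (C * G)) `^ p^-1.
    by apply: powR_le_root => //; exact: amp_ge0.
  have a3 : (2 `^ k)^-1 <= hgt w `^ k.
    rewrite -powRN -mulN1r powRrM powR_inv1//.
    by apply: ge0_ler_powR; rewrite ?nnegrE ?invr_ge0 ?(ltW k0) ?(ltW h0).
  have t0 : 0 < 2 `^ k by rewrite powR_gt0.
  rewrite -ler_pdivrMl//; apply: le_trans a2; rewrite /amp mulrC.
  by apply: ler_wpM2l => //; exact: cabs_ge0.
have fz := max_principle hf z1 HM.
have h0 := hgt_gt0 zb; have h1 := hgt_le1 z.
have M0 : 0 <= M by rewrite mulr_ge0 ?powR_ge0.
have hk : hgt z `^ k <= 1.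
  by apply: powR_le1 => //; exact: ltW.
have az : amp k f z <= 2 * M.
  by rewrite /amp -[leRHS]mulr1; apply: ler_pM; rewrite ?cabs_ge0 ?powR_ge0.
apply: (@le_trans _ _ ((2 * M) `^ p)).
  rewrite -[leRHS]mulr1; apply: ler_pM; rewrite ?powR_ge0 ?exprn_ge0 ?exprn_ile1 ?(ltW h0)//.
  by apply: ge0_ler_powR => //; rewrite ?nnegrE ?(ltW p0)//; [exact: amp_ge0|exact: mulr_ge0].
rewrite /M mulrA powRM ?mulr_ge0 ?powR_ge0// -[_ `^ p^-1 `^ p]powRrM mulVf ?gt_eqF//.
by rewrite powRr1 ?mulr_ge0 ?exprn_ge0 ?(ltW C0)// /K !mulrA.
Qed.

End growth.

Lemma powR_exprn (R : realType) (a p : R) N : 0 <= a -> (a `^ p) ^+ N = (a ^+ N) `^ p.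
Proof.
by move=> a0; elim: N => [|N IH]; rewrite ?expr0 ?powR1// !exprS powRM ?exprn_ge0// IH.
Qed.

(** * The maximal function over Koranyi regions *)

Section dense_points.
Context {R : realType} {n : nat}.
Notation Cn := (Cn R n.+1).

(** An enumeration of a dense set through [unpickle]; indices that code no vector give 0. *)
Definition rational_point (k : nat) : Cn :=
  if unpickle k is Some M then
    map_mx (fun ab : rat * rat => mkc (ratr ab.1) (ratr ab.2)) (M : 'rV[(rat * rat)%type]_n.+1)
  else 0.

Lemma rational_point_dense (z : Cn) (e : R) : 0 < e -> exists k, enorm (rational_point k - z) < e.
Proof.
move=> e0; have n0 : 0 <= n%:R :> R := ler0n R n.
pose d := e / (4 * (n%:R + 1)); have d0 : 0 < d by rewrite divr_gt0//; lra.
have near_rat (x : R) : exists a : rat, `|ratr a - x| < d.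
  have [|a] := @rat_in_itvoo R (x - d) (x + d); first by lra.
  by rewrite in_itv/= => /andP[? ?]; exists a; rewrite ltr_norml; apply/andP; split; lra.
have /choice[g Hg] (j : 'I_n.+1) : exists ab : rat * rat, cabs (mkc (ratr ab.1) (ratr ab.2) - z 0 j) <= 2 * d.
  have [a Ha] := near_rat (cre (z 0 j)); have [b Hb] := near_rat (cim (z 0 j)).
  exists (a, b); apply: le_trans (cabs_le_re_im _) _; rewrite !cE /=; lra.
exists (pickle (\row_j g j)); rewrite /rational_point pickleK.
have : enorm (map_mx (fun ab : rat * rat => mkc (ratr ab.1) (ratr ab.2)) (\row_j g j) - z) ^+ 2
    <= n.+1%:R * (2 * d) ^+ 2.
  by apply: enorm_le => [|j]; [lra|rewrite !mxE; exact: Hg].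
set x := enorm _; have x0 : 0 <= x := enorm_ge0 _.
move=> H; rewrite -ltr_sqr ?nnegrE ?(ltW e0)//; apply: le_lt_trans H _.
have -> : (2 * d) ^+ 2 = e ^+ 2 / (4 * (n%:R + 1) ^+ 2) by rewrite /d; field; rewrite gt_eqF//; lra.
rewrite mulrA ltr_pdivrMr; last by rewrite mulr_gt0// exprn_gt0//; lra.
rewrite mulrC ltr_pM2l ?exprn_gt0// -natr1; nra.
Qed.

End dense_points.

Section layer_cake.
Context {R : realType}.

Definition Clayer (p : R) : R := (2 `^ p) ^+ 2 / (2 `^ p - 1).

Lemma Clayer_ge0 (p : R) : 0 < p -> 0 <= Clayer p.
Proof. by move=> p0; rewrite divr_ge0 ?sqr_ge0 ?subr_ge0 ?(ltW (powR_gt1_base p0)). Qed.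

(** Only indices with 2^j < a contribute, and the geometric sum is comparable to its last term,
    which is at most a constant times a^p. *)
Lemma layer_cake (p : R) (a : \bar R) : 0 < p -> (0 <= a)%E ->
  (\sum_(0 <= j <oo) (((2 `^ p) ^+ j.+1)%:E * ((2 ^+ j)%:E < a)%E%:R%:E) <= (Clayer p)%:E * a `^ p)%E.
Proof.
move=> p0 a0; have r1 := powR_gt1_base p0; have C0 := Clayer_ge0 p0.
apply: nneseries_le_bound => [k|N]; first by rewrite -EFinM lee_fin mulr_ge0 ?exprn_ge0 ?powR_ge0.
rewrite (eq_bigr (fun j => ((2 `^ p) ^+ j.+1 * ((2 ^+ j)%:E < a)%E%:R)%:E)); last by move=> i _; rewrite -EFinM.
set r := 2 `^ p in r1 *; elim: N => [|N IH].
  by rewrite big_nil mule_ge0 ?poweR_ge0// lee_fin.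
case: (boolP ((2 ^+ N)%:E < a)%E) => Na; last first.
  by rewrite big_nat_recr//= (negbTE Na) mulr0 adde0.
apply: (@le_trans _ _ (Clayer p * r ^+ N)%:E).
  rewrite sumEFin lee_fin; apply: (@le_trans _ _ (\sum_(0 <= j < N.+1) r ^+ j.+1)).
    apply: ler_sum => j _; rewrite ler_piMr ?exprn_ge0//; first by lra.
    by case: (_ < _)%E.
  have -> : Clayer p * r ^+ N = r / (r - 1) * r ^+ N.+1.
    by rewrite /Clayer -/r (exprS r N); ring.
  elim: N {IH Na} => [|N IH].
    rewrite big_nat1 expr1 mulrAC ler_pdivlMr; last by lra.
    by rewrite ler_pM2l; lra.
  rewrite big_nat_recr//=; apply: le_trans (lerD IH (lexx _)) _.
  rewrite (exprS r N.+1) le_eqVlt; apply/orP; left; apply/eqP.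
  by field; apply/eqP; lra.
rewrite EFinM; apply: lee_wpmul2l; first by rewrite lee_fin.
have -> : ((r ^+ N)%:E = (2 ^+ N)%:E `^ p)%E.
  by rewrite poweR_EFin /r powR_exprn.
by apply: le_poweR; [exact: ltW|rewrite lee_fin exprn_ge0|exact: ltW].
Qed.

End layer_cake.

Section maximal.
Context {R : realType} {n : nat}.
Notation Cn := (Cn R n.+1).
Notation ball := (@cball R n.+1).
Notation S := (@csphere R n.+1).
Notation sigma := (@sphere_measure R n.+1).
Notation v := (@ball_measure R n.+1).
Implicit Types f : 'rV[cplx R]_n.+1 -> cplx R.

Lemma continuous_hgt (z : 'rV[cplx R]_n.+1) : {for z, continuous (hgt : 'rV[cplx R]_n.+1 -> R)}.
Proof.
apply: (@cvgB _ _ _ (nbhs z)); first exact: cvg_cst.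
by apply: (@cvgM _ _ (nbhs z)); exact: continuous_enorm.
Qed.

Lemma continuous_powR (k x : R) : 0 < x -> {for x, continuous (fun y : R => y `^ k)}.
Proof.
move=> x0; apply: differentiable_continuous; apply/derivable1_diffP.
by apply: derivable_powR; rewrite in_itv /= x0.
Qed.

Lemma continuous_amp k f z : holomorphic_ball f -> ball z -> {for z, continuous (amp k f : 'rV[cplx R]_n.+1 -> R)}.
Proof.
move=> hf zb; apply: (@cvgM _ _ (nbhs z)).
  apply: (@continuous_comp _ _ _ f (@cabs R)); last exact: continuous_cabs.
  exact: holomorphic_continuous.
apply: (@continuous_comp _ _ _ (hgt : 'rV[cplx R]_n.+1 -> R) (fun y : R => y `^ k)).
  exact: continuous_hgt.
by apply: continuous_powR; exact: hgt_gt0.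
Qed.

Lemma nbhs_gt_cst (F : 'rV[cplx R]_n.+1 -> R) (z : 'rV[cplx R]_n.+1) (a : R) :
  {for z, continuous F} -> a < F z -> nbhs z [set w | a < F w].
Proof. by move=> cF aF; exact: (cF _ (open_nbhs_nbhs (conj (@open_gt R a) aF))). Qed.

Lemma nbhs_koranyi (xi z : Cn) : koranyi xi z -> nbhs (z : 'rV[cplx R]_n.+1) (koranyi xi).
Proof.
move=> [zb zk]; apply: filterI.
  by apply: open_nbhs_nbhs; split => //; exact: open_cball.
pose F (w : 'rV[cplx R]_n.+1) := hgt w - cabs (1 - cdot w xi).
have cF : {for z, continuous F}.
  apply: (@cvgB _ _ _ (nbhs z)); first exact: continuous_hgt.
  apply: (@continuous_comp _ _ _ (fun w => 1 - cdot w xi) (@cabs R)); last exact: continuous_cabs.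
  apply: (@cvgB _ _ _ (nbhs z)); first exact: cvg_cst.
  apply: (@continuous_big _ _ _ _ _ _ _ _ (fun j (w : 'rV[cplx R]_n.+1) => w 0 j * (xi 0 j)^*)).
    exact: add_continuous.
  move=> j _ w; apply: (@cvgM _ _ (nbhs w)); [exact: coord_continuous|exact: cvg_cst].
have : 0 < F z by rewrite subr_gt0.
by move=> /(nbhs_gt_cst cF); apply: filterS => w /=; rewrite /F subr_gt0.
Qed.

Lemma dyadic_above (x : R) : 1 < x -> exists j, 2 ^+ j < x /\ x <= 2 ^+ j.+1.
Proof.
move=> x1; have ex : exists k, x <= 2 ^+ k.
  have x0 : 0 < x by lra.
  have xi : 0 < x^-1 by rewrite invr_gt0.
  have [k Hk] := small_pow xi; exists k; apply: ltW.
  by rewrite -ltf_pV2 ?posrE ?exprn_gt0// -exprVn.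
have := ex_minnP ex; case: ex_minnP => -[|k] Hk Hmin _.
  by move: Hk; rewrite expr0 leNgt x1.
exists k; split => //; rewrite ltNge; apply/negP => /Hmin; by rewrite ltnn.
Qed.

(* The superlevel sets of the maximal function are handled through dyadic levels, so that
   W dominates the p-th power of the maximal function and is visibly measurable. *)
Lemma maximal (p q alpha : R) : 0 < p -> 0 < q -> 0 < alpha + n.+2%:R -> exists2 C : R, 0 < C &
  forall f (G : R), holomorphic_ball f ->
  (\int[sigma]_(xi in S) (tent (tent_dens q alpha f) xi `^ (p / q)) <= G%:E)%E ->
  exists W : Cn -> \bar R, [/\ measurable_fun setT W, forall xi, (1 <= W xi)%E,
    (\int[sigma]_(xi in S) W xi <= (C * (1 + G))%:E)%E &
    forall xi z, S xi -> koranyi xi z ->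
      ((amp ((alpha + n.+2%:R) / q) f z `^ p)%:E <= W xi)%E].
Proof.
move=> p0 q0 a0; have [C1 C10 H1] := amp_growth p0 q0 a0.
have [C2 C20 H2] := @amp_submean R n q alpha q0; set k := (alpha + _) / q in H1 H2 *.
have k0 : 0 < k by rewrite divr_gt0.
(* 500 is the ratio of the radii in [cap_sub_koranyi] and [koranyi_sub_cap]. *)
have [V V0 HV] := @vitali_exists R n 500 (ltr0n R 500).
have L0 := Clayer_ge0 p0.
pose C3 := 2 ^+ n.+1 * C1; pose C4 := V * (Clayer p * C2 `^ (p / q)).
have C30 : 0 < C3 by rewrite mulr_gt0// exprn_gt0.
have C5 : 0 <= Clayer p * C2 `^ (p / q) := mulr_ge0 L0 (powR_ge0 _ _).
have C40 : 0 <= C4 := mulr_ge0 V0 C5.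
exists (1 + C3 + C4) => [|f G hf HG]; first by atom_lra.
have G0 : 0 <= G.
  rewrite -lee_fin; apply: le_trans HG; apply: integral_ge0 => x _; exact: poweR_ge0.
set A := tent (tent_dens q alpha f) in HG.
have A0 xi : (0 <= A xi)%E by apply: tent_ge0 => w _; exact: tent_dens_ge0.
have mA : measurable_fun setT A.
  apply: measurable_tent; first exact: measurable_tent_dens.
  by move=> w _; exact: tent_dens_ge0.
(* By the submean inequality [amp] at z is at most [Y eta] for every eta in the cap of radius h / 25
   about z / |z|. *)
pose Y xi := ((C2%:E * A xi) `^ q^-1)%E.
have mY : measurable_fun setT Y.
  apply: (measurableT_comp (@measurable_poweR R q^-1)).
  by apply: emeasurable_funM => //; exact: measurable_cst.
pose B j : set Cn := [set xi | ((2 ^+ j)%:E < Y xi)%E] `&` S.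
have mB j : measurable (B j).
  apply: measurableI; last exact: measurable_csphere.
  by rewrite -[X in measurable X]setTI; exact: emeasurable_fun_o_infty.
(* As [amp] is continuous, rational points detect every superlevel set, and [E j] becomes a
   countable union of caps, as measurability and the covering lemma require. *)
pose P j : set nat := [set i | [/\ ball (rational_point i), 10^-1 <= enorm (rational_point i : Cn) &
  2 ^+ j < amp k f (rational_point i)]].
pose e i : Cn := cproj (rational_point i); pose d i : R := hgt (rational_point i : Cn) / 25.
pose E j : set Cn := \bigcup_(i in P j) (cap (e i) (500 * d i)%R `&` S).
have mE j : measurable (E j).
  by apply: bigcup_measurable => i _; exact: measurable_cap_sphere.
have EB j : (sigma (E j) <= V%:E * sigma (B j))%E.
  apply: HV => // i [zb z1 zj]; have h0 := hgt_gt0 zb; have h1 := hgt_le1 (rational_point i : Cn).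
  split; [exact: cproj_sphere|by rewrite divr_gt0|by rewrite /d; atom_lra|].
  move=> eta [ec eS]; split => //=.
  have := H2 f hf _ eta eS zb z1; rewrite -/A -cabs_1dotC => /(_ ec).
  rewrite /Y; set a := amp _ _ _ in zj *; move=> Ha; rewrite ltNge; apply/negP => Hn.
  have a00 : 0 <= a := amp_ge0 _ _ _.
  have Y0 : (0 <= (C2%:E * A eta) `^ q^-1)%E by exact: poweR_ge0.
  have := le_poweR (ltW q0) Y0 Hn.
  rewrite -poweRrM mulVf ?gt_eqF// poweRe1 ?mule_ge0// ?lee_fin ?(ltW C20)// poweR_EFin.
  move=> /(le_trans Ha); rewrite lee_fin leNgt => /negP; apply.
  by apply: gt0_ltr_powR => //; rewrite nnegrE.
pose T xi : \bar R := (\sum_(0 <= j <oo) (((2 `^ p) ^+ j.+1)%:E * (\1_(E j) xi)%:E))%E.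
(* The constant dominates the p-th power of [amp] where |z| <= 1/10, by [amp_growth], and where
   [amp] is at most 1; the series handles the dyadic levels above 1. *)
pose W xi : \bar R := ((1 + C3 * G)%:E + T xi)%E.
have T0 xi : (0 <= T xi)%E.
  by apply: nneseries_ge0 => j _ _; rewrite -EFinM lee_fin mulr_ge0// exprn_ge0// powR_ge0.
have mTj j : measurable_fun setT (fun xi => ((2 `^ p) ^+ j.+1)%:E * (\1_(E j) xi)%:E)%E.
  apply: emeasurable_funM; first exact: measurable_cst.
  by apply/measurable_EFinP; exact: measurable_indic.
have CG : 0 <= C3 * G by rewrite mulr_ge0// ltW.
exists W; split.
- apply: emeasurable_funD; first exact: measurable_cst.
  apply: (@ge0_emeasurable_sum _ _ _ _ (fun j xi => ((2 `^ p) ^+ j.+1)%:E * (\1_(E j) xi)%:E)%E xpredT).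
    by move=> j x _ _; rewrite -EFinM lee_fin mulr_ge0// exprn_ge0// powR_ge0.
  by move=> j _; exact: mTj.
- by move=> xi; rewrite -[leLHS]adde0; apply: leeD => //; rewrite lee_fin; atom_lra.
- have mS := @measurable_csphere R n.+1.
  have ES j : E j `&` S = E j by apply/setIidl => x [i _ []].
  have BS j : B j `&` S = B j by apply/setIidl => x [].
  have r0 j : 0 <= (2 `^ p) ^+ j.+1 by rewrite exprn_ge0// powR_ge0.
  have mT : measurable_fun S T.
    apply: measurable_funTS.
    apply: (@ge0_emeasurable_sum _ _ _ _ (fun j xi => ((2 `^ p) ^+ j.+1)%:E * (\1_(E j) xi)%:E)%E xpredT).
      by move=> j x _ _; rewrite -EFinM lee_fin mulr_ge0.
    by move=> j _; exact: mTj.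
  rewrite ge0_integralD//; last first.
  - by move=> x _; rewrite lee_fin; atom_lra.
  rewrite integral_cst//.
  have s1 : ((1 + C3 * G)%:E * sigma S <= (1 + C3 * G)%:E)%E.
    rewrite -[leRHS]mule1; apply: lee_wpmul2l; last exact: sphere_measure_le1.
    by rewrite lee_fin; atom_lra.
  have intI (F : nat -> set Cn) j : measurable (F j) -> F j `&` S = F j ->
      (\int[sigma]_(x in S) (((2 `^ p) ^+ j.+1)%:E * (\1_(F j) x)%:E) = ((2 `^ p) ^+ j.+1)%:E * sigma (F j))%E.
    move=> mF FS; apply: etrans (integralZ_ge0 _ mS _ _ (r0 j)) _.
    - by apply/measurable_EFinP; exact: measurable_indic.
    - by move=> x _; rewrite lee_fin.
    by rewrite integral_indic// FS.
  have s2 : (\int[sigma]_(x in S) T x <= (C4 * G)%:E)%E.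
    rewrite integral_nneseries//; last first.
      by move=> j; exact: (measurable_funS measurableT (@subsetT _ _) (mTj j)).
    have st : (\sum_(0 <= j <oo) \int[sigma]_(x in S) (((2 `^ p) ^+ j.+1)%:E * (\1_(E j) x)%:E) <=
        V%:E * \sum_(0 <= j <oo) \int[sigma]_(x in S) (((2 `^ p) ^+ j.+1)%:E * (\1_(B j) x)%:E))%E.
      rewrite -nneseriesZl; last by move=> j _; apply: integral_ge0 => x _; rewrite -EFinM lee_fin mulr_ge0.
      apply: lee_nneseries => [j _ _|j _].
        by apply: integral_ge0 => x _; rewrite -EFinM lee_fin mulr_ge0.
      rewrite !intI// muleCA; apply: lee_wpmul2l; first by rewrite lee_fin.
      exact: EB.
    apply: le_trans st _; rewrite -integral_nneseries//; last first.
      move=> j; apply: emeasurable_funM; first exact: measurable_cst.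
      by apply/measurable_EFinP; exact: measurable_indic.
    have sl : (\int[sigma]_(x in S) (\sum_(0 <= j <oo) (((2 `^ p) ^+ j.+1)%:E * (\1_(B j) x)%:E)) <=
        \int[sigma]_(x in S) ((Clayer p * C2 `^ (p / q))%:E * A x `^ (p / q)))%E.
      apply: le_ge0_integral => // x Sx.
      - by apply: nneseries_ge0 => j _ _; rewrite -EFinM lee_fin mulr_ge0.
      - have Y0 : (0 <= Y x)%E by exact: poweR_ge0.
        have Yp : (Y x `^ p = (C2 `^ (p / q))%:E * A x `^ (p / q))%E.
          by rewrite /Y -poweRrM (mulrC q^-1) poweRM ?lee_fin ?(ltW C20)// poweR_EFin.
        have := layer_cake p0 Y0; rewrite Yp muleA -EFinM; apply: le_trans.
        apply: lee_nneseries => [j _ _|j _]; first by rewrite -EFinM lee_fin mulr_ge0.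
        rewrite indicE; apply: lee_wpmul2l; rewrite lee_fin//.
        case: (boolP (x \in B j)) => [|//]; rewrite inE => -[/= -> _]; exact: lexx.
      - by rewrite mule_ge0 ?poweR_ge0// lee_fin.
    apply: le_trans (lee_wpmul2l _ sl) _; first by rewrite lee_fin.
    have mAp : measurable_fun S (fun x => (A x `^ (p / q))%E).
      apply: measurable_funTS.
      exact: (measurableT_comp (@measurable_poweR R (p / q)) mA).
    rewrite (integralZ_ge0 _ mS mAp (fun x _ => poweR_ge0 _ _) C5).
    rewrite muleA -EFinM -/C4 [leRHS]EFinM; apply: lee_wpmul2l; last exact: HG.
    by rewrite lee_fin.
  apply: le_trans (leeD s1 s2) _; rewrite -EFinD lee_fin.
  have : 0 <= C4 * G by rewrite mulr_ge0.
  by rewrite !mulrDr !mulrDl; atom_lra.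
move=> xi z xS zk; have [zb _] := zk.
have h0 := hgt_gt0 zb; have a00 : 0 <= amp k f z := amp_ge0 _ _ _.
have [z1|z1] := leP (enorm z) 10^-1.
  apply: (@le_trans _ _ (1 + C3 * G)%:E); last by rewrite leeDl.
  rewrite lee_fin; apply: (@le_trans _ _ (C3 * G)); last by atom_lra.
  rewrite /C3 -mulrA -ler_pdivrMl ?exprn_gt0//; apply: le_trans (H1 f G hf HG z zb).
  rewrite mulrC ler_wpM2l ?powR_ge0// -exprVn lerXn2r ?nnegrE ?invr_ge0 ?(ltW h0)//.
  by rewrite /hgt; have := enorm_ge0 z; atom_nra.
have [a1|a1] := leP (amp k f z) 1.
  apply: (@le_trans _ _ (1 + C3 * G)%:E); last by rewrite leeDl.
  by rewrite lee_fin; have := powR_le1 a00 a1 (ltW p0); atom_lra.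
have [j [j1 j2]] := dyadic_above a1.
have Ej : E j xi.
  have cz := @continuous_amp k f z hf zb.
  have : nbhs (z : 'rV[cplx R]_n.+1) [set w | [/\ koranyi xi w, 10^-1 < enorm w & 2 ^+ j < amp k f w]].
    have /= := @filterI _ _ (nbhs_filter (z : 'rV[cplx R]_n.+1)) _ _ (nbhs_koranyi zk) (@filterI _ _ (nbhs_filter (z : 'rV[cplx R]_n.+1)) _ _ (nbhs_gt_cst (@continuous_enorm R n.+1 z) z1) (nbhs_gt_cst cz j1)).
    by apply: (@filterS _ _ (nbhs_filter (z : 'rV[cplx R]_n.+1))) => w [? []].
  move=> /enbhsP[r r0 Hr]; have [i Hi] := rational_point_dense z r0.
  have [ik i1 ij] := Hr _ Hi; exists i; first by split; [case: ik|exact: ltW|].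
  by split => //; rewrite /cap /= cabs_1dotC; apply: koranyi_sub_cap => //; exact: ltW.
apply: (@le_trans _ _ (T xi)); last by rewrite leeDr// lee_fin; atom_lra.
have tj i : (0 <= ((2 `^ p) ^+ i.+1)%:E * (\1_(E i) xi)%:E)%E.
  by rewrite -EFinM lee_fin mulr_ge0// exprn_ge0// powR_ge0.
apply: le_trans (nneseries_lim_ge j.+1 (fun i _ _ => tj i)).
rewrite big_nat_recr//= indicE mem_set// mule1.
apply: (@le_trans _ _ ((2 `^ p) ^+ j.+1)%:E); last by rewrite leeDr// sume_ge0.
have -> : (2 `^ p) ^+ j.+1 = (2 ^+ j.+1) `^ p by rewrite powR_exprn.
by rewrite lee_fin; apply: ge0_ler_powR => //; rewrite ?nnegrE ?exprn_ge0 ?(ltW p0).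
Qed.

End maximal.

(** * Embeddings between tent spaces *)

Section embedding.
Context {R : realType} {n : nat}.
Notation Cn := (Cn R n.+1).
Notation ball := (@cball R n.+1).
Notation S := (@csphere R n.+1).
Notation sigma := (@sphere_measure R n.+1).
Notation v := (@ball_measure R n.+1).
Implicit Types f : 'rV[cplx R]_n.+1 -> cplx R.

Lemma koranyi_small_dom (xi : Cn) (D : set Cn) (F : Cn -> R) (c g d : R) : enorm xi = 1 -> 0 < d ->
  0 < g + n.+2%:R -> 0 <= c -> measurable D -> D `<=` koranyi xi -> (forall z, D z -> hgt z < d) ->
  (forall z, D z -> 0 <= F z /\ F z <= c * hgt z `^ g) ->
  (\int[v]_(z in D) (F z)%:E <= (c * (Ksmall (R := R) (n := n) g * d `^ (g + n.+2%:R)))%:E)%E.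
Proof.
move=> x1 d0 g0 c0 mD Dk Dd HF; have mh : measurable_fun D (fun z : Cn => (hgt z `^ g)%:E).
  apply: measurable_funTS; apply/measurable_EFinP.
  exact: (measurableT_comp (measurable_powR g) measurable_hgt).
have h0 z : D z -> (0 <= (hgt z `^ g)%:E)%E by move=> _; rewrite lee_fin powR_ge0.
apply: (@le_trans _ _ (c%:E * \int[v]_(z in D) (hgt z `^ g)%:E)%E); last first.
  by rewrite EFinM; apply: lee_wpmul2l; [rewrite lee_fin|exact: koranyi_int_small x1 d0 g0 mD Dk Dd].
rewrite -(integralZ_ge0 _ mD mh h0 c0); apply: le_ge0_integral => // z zD; rewrite -?EFinM lee_fin.
- by case: (HF z zD).
- by case: (HF z zD).
- by rewrite mulr_ge0 ?powR_ge0.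
Qed.

Lemma koranyi_large_dom (xi : Cn) (D : set Cn) (F : Cn -> R) (c g d : R) : enorm xi = 1 -> 0 < d ->
  g + n.+2%:R < 0 -> 0 <= c -> measurable D -> D `<=` koranyi xi -> (forall z, D z -> d <= hgt z) ->
  (forall z, D z -> 0 <= F z /\ F z <= c * hgt z `^ g) ->
  (\int[v]_(z in D) (F z)%:E <= (c * (Klarge (R := R) (n := n) g * d `^ (g + n.+2%:R)))%:E)%E.
Proof.
move=> x1 d0 g0 c0 mD Dk Dd HF; have mh : measurable_fun D (fun z : Cn => (hgt z `^ g)%:E).
  apply: measurable_funTS; apply/measurable_EFinP.
  exact: (measurableT_comp (measurable_powR g) measurable_hgt).
have h0 z : D z -> (0 <= (hgt z `^ g)%:E)%E by move=> _; rewrite lee_fin powR_ge0.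
apply: (@le_trans _ _ (c%:E * \int[v]_(z in D) (hgt z `^ g)%:E)%E); last first.
  by rewrite EFinM; apply: lee_wpmul2l; [rewrite lee_fin|exact: koranyi_int_large x1 d0 g0 mD Dk Dd].
rewrite -(integralZ_ge0 _ mD mh h0 c0); apply: le_ge0_integral => // z zD; rewrite -?EFinM lee_fin.
- by case: (HF z zD).
- by case: (HF z zD).
- by rewrite mulr_ge0 ?powR_ge0.
Qed.

Lemma Ksmall_ge0 (g : R) : 0 < g + n.+2%:R -> 0 <= Ksmall (R := R) (n := n) g.
Proof.
move=> g0; have r1 := powR_gt1_base g0; have C1 := @Cup_ge1 R n.
rewrite /Ksmall !mulr_ge0 ?powR_ge0//; first by lra.
by rewrite invr_ge0 subr_ge0 ltW// invf_lt1//; lra.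
Qed.

Lemma Klarge_ge0 (g : R) : g + n.+2%:R < 0 -> 0 <= Klarge (R := R) (n := n) g.
Proof.
move=> g0; have C1 := @Cup_ge1 R n.
have r1 : 1 < (2^-1 : R) `^ (g + n.+2%:R).
  rewrite -powR_inv1// -powRrM mulN1r; apply: powR_gt1_base; lra.
rewrite /Klarge !mulr_ge0 ?powR_ge0//; first by lra.
by rewrite invr_ge0 subr_ge0 ltW// invf_lt1//; lra.
Qed.

Definition dens (r b : R) (u : Cn -> R) (z : Cn) : R := u z `^ r * hgt z `^ b.

Lemma dens_ge0 r b u z : 0 <= dens r b u z. Proof. by rewrite mulr_ge0 ?powR_ge0. Qed.

Lemma measurable_dens r b u : measurable_fun ball u -> measurable_fun ball (dens r b u).
Proof.
move=> mu; apply: measurable_funM; first exact: (measurableT_comp (measurable_powR r) mu).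
apply: measurable_funTS.
exact: (measurableT_comp (measurable_powR b) measurable_hgt).
Qed.

(** The exponent may be lowered to any g <= b - k r because heights are at most 1; this lets
    inequalities between indices be treated as equalities. *)
Lemma dens_le (r b k g Z : R) (u : Cn -> R) (z : Cn) : 0 <= r -> ball z -> 0 <= u z ->
  u z * hgt z `^ k <= Z -> g <= b - k * r -> dens r b u z <= Z `^ r * hgt z `^ g.
Proof.
move=> r0 zb u0 uZ gb; have h0 := hgt_gt0 zb; have h1 := hgt_le1 z.
have hk : 0 < hgt z `^ k by rewrite powR_gt0.
apply: (@le_trans _ _ ((u z * hgt z `^ k) `^ r * hgt z `^ g)); last first.
  rewrite ler_wpM2r ?powR_ge0//; apply: ge0_ler_powR => //; rewrite nnegrE ?mulr_ge0 ?powR_ge0//.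
  by apply: le_trans uZ; rewrite mulr_ge0 ?powR_ge0.
rewrite powRM ?powR_ge0// -mulrA /dens ler_wpM2l ?powR_ge0// -powRrM -powRD ?(gt_eqF h0) ?implybT//.
have := ger_powR; rewrite /=.
move=> _; rewrite /powR gt_eqF// ler_expR; have l0 : ln (hgt z) <= 0 by apply: ln_le0.
nra.
Qed.

(** If the area exponent improves strictly, inserting u <= X h^-k leaves a power of the height that
    is integrable over the region. *)
Lemma emb_strict (r b k X : R) (u : Cn -> R) (xi : Cn) : 0 < r -> 0 < b + n.+2%:R - k * r -> enorm xi = 1 ->
  (forall z, ball z -> 0 <= u z) -> (forall z, koranyi xi z -> u z * hgt z `^ k <= X) -> 0 <= X ->
  (tent (dens r b u) xi <= (X `^ r * (Ksmall (R := R) (n := n) (b - k * r) *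
     2 `^ (b - k * r + n.+2%:R)))%:E)%E.
Proof.
move=> r0 bk x1 u0 uX X0; apply: (koranyi_small_dom x1) => //.
- lra.
- exact: powR_ge0.
- exact: measurable_koranyi.
- by move=> z _; apply: le_lt_trans (hgt_le1 z) _; lra.
move=> z zk; split; first exact: dens_ge0.
by apply: (dens_le (k := k)); [exact: ltW|case: zk|apply: u0; case: zk|exact: uX|].
Qed.

Lemma emb_critical (p T r b k : R) (L : R) : 0 < p -> p < T -> 0 < r -> 0 <= L ->
  k + n.+1%:R / p <= n.+1%:R / T + (b + n.+2%:R) / r -> exists2 C : R, 0 <= C &
  forall (u : Cn -> R) (xi : Cn) (X : R), enorm xi = 1 ->
  measurable_fun ball u -> (forall z, ball z -> 0 <= u z) -> 1 <= X ->
  (forall z, koranyi xi z -> u z * hgt z `^ k <= X) ->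
  (forall z, ball z -> u z * hgt z `^ (k + n.+1%:R / p) <= L) ->
  (tent (dens r b u) xi <= (C * X `^ (r * p / T))%:E)%E.
Proof.
move=> p0 pT r0 L0 kb; pose m : R := n.+1%:R; have m0 : 0 < m by rewrite ltr0n.
have T0 : 0 < T by lra.
pose de := m / p - m / T; have de0 : 0 < de.
  by rewrite subr_gt0 ltr_pM2l// ltf_pV2.
(* The height exponents in the extremal case of [kb]. Below the cut g1 + n.+2 = r de > 0 because p <
   T; above it g2 + n.+2 = - r m / T < 0, so both pieces converge. *)
pose g1 := r * de - n.+2%:R; pose g2 := - (r * m / T) - n.+2%:R.
have rm : 0 < r * m / T by rewrite divr_gt0// mulr_gt0.
have g10 : 0 < g1 + n.+2%:R by rewrite subrK mulr_gt0.
have g20 : g2 + n.+2%:R < 0 by rewrite subrK oppr_lt0.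
have kb' : (k + m / p) * r <= m / T * r + (b + n.+2%:R).
  by have := ler_wpM2r (ltW r0) kb; rewrite -/m [X in _ <= X -> _]mulrDl divfK ?gt_eqF.
have h1 : g1 <= b - k * r by rewrite /g1 /de; atom_lra.
have h2 : g2 <= b - (k + m / p) * r by rewrite /g2; atom_lra.
have K1 := Ksmall_ge0 g10; have K2 := Klarge_ge0 g20.
exists (Ksmall (R := R) (n := n) g1 + L `^ r * Klarge (R := R) (n := n) g2).
  by rewrite addr_ge0// mulr_ge0// powR_ge0.
move=> u xi X x1 mu u0 X1 uX uL; have X0 : 0 < X by atom_lra.
(* The height at which X h^-k and h^(-k - m/p) coincide, m being the complex dimension. Both pieces
   are then of order X^(r p / T), whose power T / r is X^p. *)
pose d := X `^ (- (p / m)); have d0 : 0 < d by rewrite powR_gt0.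
pose D1 := koranyi xi `&` [set z : Cn | hgt z < d]; pose D2 := koranyi xi `&` [set z : Cn | d <= hgt z].
have mk := @measurable_koranyi R n xi.
have mL : measurable [set z : Cn | hgt z < d] by apply: measurable_lt_set; exact: measurable_hgt.
have mD1 : measurable D1 by exact: measurableI.
have mD2 : measurable D2.
  apply: measurableI => //; rewrite (_ : [set z : Cn | d <= hgt z] = ~` [set z : Cn | hgt z < d]).
    exact: measurableC.
  by apply/seteqP; split => z /=; rewrite leNgt => /negP.
have kE : koranyi xi = D1 `|` D2.
  rewrite -setIUr; apply/esym/setIidl => z _ /=; case: (ltP (hgt z) d) => ?; by [left|right].
have md : measurable_fun (D1 `|` D2) (fun z => (dens r b u z)%:E).
  rewrite -kE; apply/measurable_EFinP; apply: measurable_funS (measurable_dens r b mu).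
    exact: measurable_cball.
  by move=> z [].
rewrite /tent kE ge0_integral_setU//; last 2 first.
- by move=> z _; rewrite lee_fin dens_ge0.
- apply/disj_setPS => z [[_ /= a] [_ /= c]]; by move: c; rewrite leNgt a.
have e1 : X `^ r * d `^ (r * de) = X `^ (r * p / T).
  rewrite /d -powRrM -powRD ?(gt_eqF X0) ?implybT//; congr (_ `^ _); rewrite /de; field.
  by rewrite !gt_eqF.
have e2 : d `^ (- (r * m / T)) = X `^ (r * p / T).
  by rewrite /d -powRrM; congr (_ `^ _); field; rewrite !gt_eqF.
have i1 : (\int[v]_(z in D1) (dens r b u z)%:E <= (Ksmall (R := R) (n := n) g1 * X `^ (r * p / T))%:E)%E.
  apply: (@le_trans _ _ (X `^ r * (Ksmall (R := R) (n := n) g1 * d `^ (g1 + n.+2%:R)))%:E).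
    apply: (koranyi_small_dom x1 d0 g10) => //; first exact: powR_ge0.
    - by move=> z [].
    - by move=> z [].
    move=> z [zk _]; split; first exact: dens_ge0.
    by apply: (dens_le (k := k)) => //; [exact: ltW|case: zk|apply: u0; case: zk|exact: uX].
  by rewrite subrK mulrCA e1.
have i2 : (\int[v]_(z in D2) (dens r b u z)%:E <= (L `^ r * Klarge (R := R) (n := n) g2 * X `^ (r * p / T))%:E)%E.
  apply: (@le_trans _ _ (L `^ r * (Klarge (R := R) (n := n) g2 * d `^ (g2 + n.+2%:R)))%:E).
    apply: (koranyi_large_dom x1 d0 g20) => //; first exact: powR_ge0.
    - by move=> z [].
    - by move=> z [].
    move=> z [[zb zk] _]; split; first exact: dens_ge0.
    by apply: (dens_le (k := k + m / p)) => //; [exact: ltW|exact: u0|exact: uL].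
  by rewrite subrK e2 mulrA.
by apply: le_trans (leeD i1 i2) _; rewrite -EFinD lee_fin mulrDl.
Qed.

End embedding.

Lemma poweRD_le (R : realType) (K s : R) (a : \bar R) : 0 <= K -> 0 <= s -> (0 <= a)%E ->
  ((K%:E + a) `^ s <= (2 `^ s)%:E * ((K `^ s)%:E + a `^ s))%E.
Proof.
move=> K0 s0; case: a => [a| |]; rewrite ?lee_fin => // a0.
  set M := Num.max K a.
  have M0 : 0 <= M by rewrite le_max K0.
  apply: (@le_trans _ _ ((2 * M) `^ s)).
    apply: ge0_ler_powR; rewrite ?nnegrE ?mulr_ge0 ?addr_ge0//.
    have : K <= M by rewrite le_max lexx.
    have : a <= M by rewrite le_max lexx orbT.
    lra.
  rewrite powRM// ler_wpM2l ?powR_ge0// /M; case: (leP K a) => _; rewrite ?lerDl ?lerDr powR_ge0//.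
have [->|sn0] := eqVneq s 0; first by rewrite !poweRe0 !powRr0 mul1e leeDr.
have sp : 0 < s by rewrite lt_neqAle eq_sym sn0.
by rewrite addey// [(+oo `^ s)%E]poweRyr// addey// gt0_muley ?leey// lte_fin powR_gt0.
Qed.

(** * The embedding theorem for the truncated modulus *)

Section embedding_theorem.
Context {R : realType} {n : nat}.
Notation Cn := (Cn R n.+1).
Notation ball := (@cball R n.+1).
Notation S := (@csphere R n.+1).
Notation sigma := (@sphere_measure R n.+1).
Notation v := (@ball_measure R n.+1).
Implicit Types f : 'rV[cplx R]_n.+1 -> cplx R.

(** The modulus truncated below at 1: it absorbs the lower-order terms of a polynomial and makes its
    powers monotone in the exponent. *)
Definition max1 f (z : Cn) : R := Num.max 1 (cabs (f z)).

(** Sufficient conditions for passing from indices (p, q, alpha) to (T, r, beta), in terms of the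
    area exponents k and k'. For a polynomial of degree N they are used with T = t N and r = s N. *)
Definition emb_cond (p q alpha T r beta : R) : Prop :=
  let k := (alpha + n.+2%:R) / q in let k' := (beta + n.+2%:R) / r in
  [\/ p < T /\ k + n.+1%:R / p <= n.+1%:R / T + k', T <= p /\ k < k' | [/\ T <= p, k = k' & q <= r]].

Lemma max1_ge1 f z : 1 <= max1 f z. Proof. by rewrite le_max lexx. Qed.
Lemma max1_ge0 f z : 0 <= max1 f z. Proof. exact: le_trans (max1_ge1 f z). Qed.

Lemma measurable_max1 f : holomorphic_ball f -> measurable_fun ball (max1 f).
Proof. by move=> hf; apply: measurable_maxr => //; exact: holomorphic_measurable. Qed.

Definition Kh (alpha : R) : R := Ksmall (R := R) (n := n) alpha * 2 `^ (alpha + n.+2%:R).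

Lemma Kh_ge0 (alpha : R) : 0 < alpha + n.+2%:R -> 0 <= Kh alpha.
Proof. by move=> a0; apply: mulr_ge0; [exact: Ksmall_ge0|exact: powR_ge0]. Qed.

Lemma max1_tent (q alpha : R) f (xi : Cn) : 0 < q -> 0 < alpha + n.+2%:R -> holomorphic_ball f -> S xi ->
  (tent (dens q alpha (max1 f)) xi <= (Kh alpha)%:E + tent (tent_dens q alpha f) xi)%E.
Proof.
move=> q0 a0 hf xS; have mk := @measurable_koranyi R n xi.
have kb : koranyi xi `<=` ball by move=> z [].
have i1 : (\int[v]_(z in koranyi xi) (hgt z `^ alpha)%:E <= (Kh alpha)%:E)%E.
  by apply: (@koranyi_int_small R n xi alpha 2 (koranyi xi) xS) => // z _; apply: le_lt_trans (hgt_le1 z) _; lra.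
apply: le_trans (leeD i1 (le_refl _)); rewrite -ge0_integralD//.
- apply: le_ge0_integral => // z zk; rewrite -?EFinD lee_fin.
  + exact: dens_ge0.
  + rewrite /dens /tent_dens -[X in X + _]mul1r -mulrDl ler_wpM2r ?powR_ge0//.
    rewrite /max1; case: (leP 1 (cabs (f z))) => _; last by rewrite powR1 lerDl powR_ge0.
    by rewrite lerDr.
  + by rewrite addr_ge0 ?powR_ge0 ?tent_dens_ge0.
- by move=> z _; rewrite lee_fin powR_ge0.
- by apply/measurable_EFinP; exact: measurable_hgt_pow.
- by move=> z _; rewrite lee_fin tent_dens_ge0.
- apply/measurable_EFinP; apply: measurable_funS (measurable_tent_dens q alpha hf) => //.
  exact: measurable_cball.
Qed.

(** Everything happens at one boundary point: w bounds the p-th power of the maximal function there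
    and L the pointwise growth, so only one integration over the sphere remains. *)
Lemma embedding_pointwise (p q alpha T r beta L : R) : 0 < p -> 0 < q -> 0 < T -> 0 < r ->
  0 < alpha + n.+2%:R -> 0 <= L -> emb_cond p q alpha T r beta -> exists2 C : R, 0 < C &
  forall f (xi : Cn) (w : R), holomorphic_ball f -> S xi -> 1 <= w ->
  (forall z, koranyi xi z -> amp ((alpha + n.+2%:R) / q) f z `^ p <= w) ->
  (forall z, ball z -> max1 f z * hgt z `^ ((alpha + n.+2%:R) / q + n.+1%:R / p) <= L) ->
  (tent (dens r beta (max1 f)) xi `^ (T / r) <=
    C%:E * (w%:E + ((Kh alpha)%:E + tent (tent_dens q alpha f) xi) `^ (p / q)))%E.
Proof.
move=> p0 q0 T0 r0 a0 L0; rewrite /emb_cond; set k := (alpha + _) / q; set k' := (beta + _) / r => cond.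
have k0 : 0 < k by rewrite divr_gt0.
have Tr : 0 < T / r by rewrite divr_gt0.
suff [C C0 H] : exists2 C : R, 0 <= C &
  forall f (xi : Cn) (X : R), holomorphic_ball f -> S xi -> 1 <= X ->
  (forall z, koranyi xi z -> max1 f z * hgt z `^ k <= X) ->
  (forall z, ball z -> max1 f z * hgt z `^ (k + n.+1%:R / p) <= L) ->
  (tent (dens r beta (max1 f)) xi `^ (T / r) <=
    C%:E * ((X `^ p)%:E + ((Kh alpha)%:E + tent (tent_dens q alpha f) xi) `^ (p / q)))%E.
  exists (C + 1) => [|f xi w hf xS w1 Hw HL]; first atom_lra.
  have w0 : 0 <= w by atom_lra.
  have Xp : (w `^ p^-1) `^ p = w by rewrite -powRrM mulVf ?gt_eqF// powRr1.
  have X1 : 1 <= w `^ p^-1 by apply: powR_ge1 => //; rewrite invr_ge0 ltW.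
  have := H f xi (w `^ p^-1) hf xS X1 _ HL; rewrite Xp => HH.
  apply: le_trans (HH _) _ => [z zk|].
    have zb : ball z by case: zk.
    have h0 := hgt_gt0 zb; rewrite /max1; case: (leP 1 (cabs (f z))) => _.
      by apply: powR_le_root; [exact: amp_ge0|exact: p0|exact: Hw].
    by rewrite mul1r; apply: le_trans X1; apply: powR_le1; [exact: ltW|exact: hgt_le1|exact: ltW].
  apply: lee_wpmul2r; first by rewrite adde_ge0 ?poweR_ge0.
  by rewrite lee_fin; atom_lra.
have A'0 f xi : (0 <= ((Kh alpha)%:E + tent (tent_dens q alpha f) xi) `^ (p / q))%E by exact: poweR_ge0.
case: cond => [[pT kk]|[Tp kk]|[Tp kk qr]].
- have [C C0 H] := @emb_critical R n p T r beta k L p0 pT r0 L0 kk.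
  exists (C `^ (T / r)) => [|f xi X hf xS X1 HX HL]; first exact: powR_ge0.
  have X0 : 0 < X by atom_lra.
  have := H (max1 f) xi X xS (measurable_max1 hf) (fun z _ => max1_ge0 f z) X1 HX HL.
  move=> /(le_poweR (ltW Tr) (tent_ge0 _ (fun z _ => dens_ge0 _ _ _ z))) => /le_trans; apply.
  rewrite poweR_EFin powRM ?powR_ge0// -powRrM (_ : r * p / T * (T / r) = p); last first.
    by field; rewrite !gt_eqF.
  rewrite EFinM; apply: lee_wpmul2l; first by rewrite lee_fin powR_ge0.
  by rewrite leeDl.
- have bk : 0 < beta + n.+2%:R - k * r by move: kk; rewrite ltr_pdivlMr// subr_gt0.
  pose c := Ksmall (R := R) (n := n) (beta - k * r) * 2 `^ (beta - k * r + n.+2%:R).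
  have c0 : 0 <= c by rewrite mulr_ge0 ?powR_ge0// Ksmall_ge0//; atom_lra.
  exists (c `^ (T / r)) => [|f xi X hf xS X1 HX HL]; first exact: powR_ge0.
  have X0 : 0 <= X by atom_lra.
  have := emb_strict r0 bk xS (fun z _ => max1_ge0 f z) HX X0.
  move=> /(le_poweR (ltW Tr) (tent_ge0 _ (fun z _ => dens_ge0 _ _ _ z))) => /le_trans; apply.
  rewrite -/c poweR_EFin powRM ?powR_ge0// -powRrM (_ : r * (T / r) = T); last first.
    by field; rewrite !gt_eqF.
  rewrite mulrC EFinM; apply: lee_wpmul2l; first by rewrite lee_fin powR_ge0.
  apply: (@le_trans _ _ (X `^ p)%:E); last by rewrite leeDl.
  by rewrite lee_fin; apply: ler_powR.
(* Equal area exponents mean beta = alpha + k (r - q), so u^r h^beta = (u h^k)^(r - q) u^q h^alpha;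
   as q <= r the first factor is at most X^(r - q). *)
exists 1 => // f xi X hf xS X1 HX HL; rewrite mul1e.
have X0 : 0 <= X by atom_lra.
have st : (tent (dens r beta (max1 f)) xi <=
    (X `^ (r - q))%:E * ((Kh alpha)%:E + tent (tent_dens q alpha f) xi))%E.
  apply: le_trans (lee_wpmul2l _ (max1_tent q0 a0 hf xS)); last by rewrite lee_fin powR_ge0.
  have kb : koranyi xi `<=` ball by move=> z [].
  apply: (@ge0_le_integralZ _ _ _ v (koranyi xi) (dens r beta (max1 f)) (dens q alpha (max1 f))).
  - exact: measurable_koranyi.
  - by apply: measurable_funS (measurable_dens _ _ (measurable_max1 hf)) => //; exact: measurable_cball.
  - by apply: measurable_funS (measurable_dens _ _ (measurable_max1 hf)) => //; exact: measurable_cball.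
  - by move=> z _; exact: dens_ge0.
  - by move=> z _; exact: dens_ge0.
  - exact: powR_ge0.
  move=> z zk; have zb : ball z by exact: kb. 
  have h0 := hgt_gt0 zb; have u1 := max1_ge1 f z; have u0 : 0 < max1 f z by atom_lra.
  have bE : beta = alpha + k * (r - q).
    rewrite mulrBr {2}/k divfK ?gt_eqF// kk divfK ?gt_eqF//; ring.
  have e1 : max1 f z `^ r = max1 f z `^ (r - q) * max1 f z `^ q.
    by rewrite -powRD ?(gt_eqF u0) ?implybT// subrK.
  have e2 : hgt z `^ beta = hgt z `^ alpha * (hgt z `^ k) `^ (r - q).
    by rewrite bE powRD ?(gt_eqF h0) ?implybT// -[in RHS]powRrM.
  rewrite /dens e1 e2.
  have := ge0_ler_powR (_ : 0 <= r - q) _ _ (HX z zk); rewrite !nnegrE.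
  move=> /(_ _ _ _)HH.
  have {}HH : (max1 f z * hgt z `^ k) `^ (r - q) <= X `^ (r - q).
    by apply: HH; rewrite ?subr_ge0 ?mulr_ge0 ?powR_ge0 ?(ltW u0).
  rewrite powRM ?powR_ge0 ?(ltW u0)// in HH.
  set a := max1 f z `^ (r - q) in HH *; set b := max1 f z `^ q; set c := hgt z `^ alpha.
  set d := _ `^ (r - q) in HH *.
  have bc : 0 <= b * c by rewrite mulr_ge0 ?powR_ge0.
  by rewrite (_ : a * b * (c * d) = a * d * (b * c)); [rewrite ler_wpM2r|ring].
have T00 : (0 <= tent (dens r beta (max1 f)) xi)%E by apply: tent_ge0 => z _; exact: dens_ge0.
apply: le_trans (le_poweR (ltW Tr) T00 st) _.
have : (0 <= (Kh alpha)%:E + tent (tent_dens q alpha f) xi)%E.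
  apply: adde_ge0; first by rewrite lee_fin; exact: Kh_ge0.
  by apply: tent_ge0 => z _; exact: tent_dens_ge0.
case: (_ + tent _ _)%E => [a| |]; rewrite ?lee_fin => // A0; last first.
  by rewrite [(+oo `^ (p / q))%E]poweRyr ?addey ?leey// gt_eqF// divr_gt0.
(* X and Y are at most Z, so X^(r - q) a <= Z^r; then Z >= 1 and T <= p give Z^T <= Z^p <= X^p +
   Y^p. *)
pose Y := a `^ q^-1; pose Z := Num.max X Y.
have Z1 : 1 <= Z by rewrite le_max X1.
have XZ : X <= Z by rewrite le_max lexx.
have YZ : Y <= Z by rewrite le_max lexx orbT.
have Z0 : 0 < Z by atom_lra.
have aZ : a <= Z `^ q.
  rewrite -[leLHS](@powRr1 R)// -(mulVf (lt0r_neq0 q0)) powRrM.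
  by apply: ge0_ler_powR; rewrite ?nnegrE ?powR_ge0 ?(ltW q0) ?(ltW Z0).
have h1 : X `^ (r - q) * a <= Z `^ r.
  have -> : Z `^ r = Z `^ (r - q) * Z `^ q by rewrite -powRD ?(gt_eqF Z0) ?implybT// subrK.
  apply: ler_pM => //; first exact: powR_ge0.
  by apply: ge0_ler_powR; rewrite ?nnegrE ?subr_ge0 ?(ltW Z0).
apply: (@le_trans _ _ (Z `^ p)).
  apply: (@le_trans _ _ (Z `^ T)); last exact: ler_powR.
  have -> : Z `^ T = (Z `^ r) `^ (T / r) by rewrite -powRrM; congr (_ `^ _); field; rewrite gt_eqF.
  by apply: ge0_ler_powR; rewrite ?(ltW Tr) ?nnegrE ?mulr_ge0 ?powR_ge0.
have -> : a `^ (p / q) = Y `^ p by rewrite /Y -powRrM mulrC.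
by rewrite /Z; case: (leP X Y) => _; rewrite ?lerDl ?lerDr powR_ge0.
Qed.

(** The pointwise bound is integrated with the measurable majorant of the maximal function as w. [C]
    depends on [G], since [max1] is not homogeneous, but not on f. *)
Theorem embedding (p q alpha T r beta G : R) : 0 < p -> 0 < q -> 0 < T -> 0 < r ->
  0 < alpha + n.+2%:R -> emb_cond p q alpha T r beta -> exists2 C : R, 0 <= C &
  forall f, holomorphic_ball f ->
  (\int[sigma]_(xi in S) (tent (tent_dens q alpha f) xi `^ (p / q)) <= G%:E)%E ->
  (\int[sigma]_(xi in S) (tent (dens r beta (max1 f)) xi `^ (T / r)) <= C%:E)%E.
Proof.
move=> p0 q0 T0 r0 a0 cond.
have [C1 C10 H1] := @amp_growth R n p q alpha p0 q0 a0.
have [C2 C20 H2] := @maximal R n p q alpha p0 q0 a0.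
set k := (alpha + _) / q in H1 H2.
have k0 : 0 < k by rewrite divr_gt0.
pose L := 1 + (C1 * `|G|) `^ p^-1; have L0 : 0 <= L by rewrite addr_ge0 ?powR_ge0.
have [C3 C30 H3] := embedding_pointwise p0 q0 T0 r0 a0 L0 cond; rewrite -/k in H3.
have K0 := Kh_ge0 a0.
exists (C3 * (C2 * (1 + `|G|) + 2 `^ (p / q) * (Kh alpha `^ (p / q) + `|G|))).
  by rewrite mulr_ge0 ?(ltW C30)// addr_ge0 ?mulr_ge0 ?addr_ge0 ?powR_ge0 ?(ltW C20).
move=> f hf HG; have G0 : 0 <= G.
  rewrite -lee_fin; apply: le_trans HG; apply: integral_ge0 => x _; exact: poweR_ge0.
have [W [mW W1 IW HW]] := H2 f G hf HG.
set A := tent (tent_dens q alpha f) in HG *.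
have A0 xi : (0 <= A xi)%E by apply: tent_ge0 => w _; exact: tent_dens_ge0.
have mA : measurable_fun setT A.
  apply: measurable_tent; first exact: measurable_tent_dens.
  by move=> w _; exact: tent_dens_ge0.
have HL z : ball z -> max1 f z * hgt z `^ (k + n.+1%:R / p) <= L.
  move=> zb; have h0 := hgt_gt0 zb; have h1 := hgt_le1 z.
  have kp : 0 < k + n.+1%:R / p by rewrite addr_gt0// divr_gt0.
  have l1 : hgt z `^ (k + n.+1%:R / p) <= 1 by apply: powR_le1 => //; exact: ltW.
  rewrite /max1; case: (leP 1 (cabs (f z))) => _.
    apply: (@le_trans _ _ ((C1 * `|G|) `^ p^-1)); last by rewrite lerDr.
    apply: powR_le_root => //; first by rewrite mulr_ge0 ?cabs_ge0 ?powR_ge0.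
    have := H1 f G hf HG z zb; rewrite (ger0_norm G0); apply: le_trans.
    rewrite powRD ?(gt_eqF h0) ?implybT// mulrA [leLHS]powRM ?mulr_ge0 ?cabs_ge0 ?powR_ge0//.
    by rewrite -[_ `^ (_ / p) `^ p]powRrM divfK ?gt_eqF// powR_mulrn ?(ltW h0).
  by rewrite mul1r; apply: le_trans l1 _; rewrite lerDl powR_ge0.
have mS := @measurable_csphere R n.+1.
have mAp : measurable_fun S (fun x => (A x `^ (p / q))%E).
  apply: measurable_funTS.
  exact: (measurableT_comp (@measurable_poweR R (p / q)) mA).
have mWS : measurable_fun S W by exact: (measurable_funS measurableT).
pose c := 2 `^ (p / q); have c0 : 0 <= c by exact: powR_ge0.
pose B x : \bar R := ((Kh alpha `^ (p / q))%:E + A x `^ (p / q))%E.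
have B0 x : S x -> (0 <= B x)%E by move=> _; rewrite adde_ge0 ?poweR_ge0// lee_fin powR_ge0.
have mB : measurable_fun S B by apply: emeasurable_funD => //; exact: measurable_cst.
have W0 x : S x -> (0 <= W x)%E by move=> _; apply: le_trans (W1 x).
pose F x : \bar R := (W x + c%:E * B x)%E.
have mcB : measurable_fun S (fun x => c%:E * B x)%E.
  by apply: emeasurable_funM => //; exact: measurable_cst.
have mF : measurable_fun S F by exact: emeasurable_funD.
have cB0 x : S x -> (0 <= c%:E * B x)%E by move=> xS; rewrite mule_ge0 ?B0.
have F0 x : S x -> (0 <= F x)%E by move=> xS; rewrite adde_ge0 ?W0 ?cB0.
apply: (@le_trans _ _ (\int[sigma]_(xi in S) (C3%:E * F xi))%E).
  apply: le_ge0_integral => // x xS; first exact: poweR_ge0.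
    case E : (W x) => [w| |]; last by have := W1 x; rewrite E.
      have w1 : 1 <= w by rewrite -lee_fin -E.
      apply: le_trans (H3 f x w hf xS w1 _ HL) _.
        by move=> z zk; rewrite -lee_fin -E; exact: HW.
      apply: lee_wpmul2l; first by rewrite lee_fin ltW.
      by rewrite /F E; apply: leeD => //; apply: poweRD_le => //; rewrite divr_ge0 ?ltW.
    rewrite /F E addye ?gt0_muley ?leey ?lte_fin//.
    by rewrite -ltNye; apply: lt_le_trans (cB0 x xS); rewrite ltNyr.
  by rewrite mule_ge0 ?F0// lee_fin ltW.
rewrite (integralZ_ge0 _ mS mF F0 (ltW C30)) EFinM; apply: lee_wpmul2l; first by rewrite lee_fin ltW.
rewrite ge0_integralD// EFinD (ger0_norm G0); apply: leeD; first exact: IW.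
rewrite (integralZ_ge0 _ mS mB B0 c0) EFinM; apply: lee_wpmul2l; first by rewrite lee_fin.
rewrite ge0_integralD//; last 2 first.
- by move=> x _; rewrite lee_fin powR_ge0.
- by move=> x _; exact: poweR_ge0.
rewrite EFinD; apply: leeD => //; rewrite integral_cst//.
rewrite -[leRHS]mule1; apply: lee_wpmul2l; first by rewrite lee_fin powR_ge0.
exact: sphere_measure_le1.
Qed.

End embedding_theorem.

(** * Sufficiency: polynomials act boundedly and continuously *)

Lemma poweRD2_le (R : realType) (s : R) (a b : \bar R) : 0 <= s -> (0 <= a)%E -> (0 <= b)%E ->
  ((a + b) `^ s <= (2 `^ s)%:E * (a `^ s + b `^ s))%E.
Proof.
move=> s0 + b0; case: a => [a| |] // a0.
  by rewrite poweR_EFin; apply: poweRD_le; rewrite -?lee_fin.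
have [->|sn0] := eqVneq s 0; first by rewrite !poweRe0 powRr0 mul1e leeDl.
rewrite addye ?poweRyr// ?addye ?gt0_muley ?leey// ?lte_fin ?powR_gt0//.
  by rewrite -ltNye; apply: lt_le_trans (poweR_ge0 b s); rewrite ltNyr.
by rewrite -ltNye; apply: lt_le_trans b0; rewrite ltNyr.
Qed.

(** With u = max(1, |z|): if |w| <= eta u the Lipschitz bound gives at most e u^N; otherwise u < |w|
    / eta and everything is bounded by a multiple of |w|^N. *)
Lemma horner_diff_le (R : realType) (P : {poly cplx R}) (e : R) : (0 < (size P).-1)%N -> 0 < e ->
  exists2 C : R, 0 <= C & forall z w,
  cabs (P.[z + w] - P.[z]) <= e * (Num.max 1 (cabs z)) ^+ (size P).-1 + C * cabs w ^+ (size P).-1.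
Proof.
have [C C0 HC] := horner_lip P; case: (size P).-1 HC => // N HC _ e0.
pose K := C * 4 ^+ N; have K0 : 0 <= K by rewrite mulr_ge0// exprn_ge0.
(* In the first case 1 + |z| + |z + w| <= 4 u, whence the constant K with K eta <= e. *)
pose eta := Num.min 1 (e / (K + 1)).
have eta0 : 0 < eta by rewrite lt_min ltr01 divr_gt0//; lra.
have eta1 : eta <= 1 by rewrite ge_min lexx.
have etaK : K * eta <= e.
  have : eta <= e / (K + 1) by rewrite ge_min lexx orbT.
  rewrite ler_pdivlMr; last by lra.
  by nra.
exists (C * (3 / eta + 1) ^+ N).
  by rewrite mulr_ge0// exprn_ge0// addr_ge0// divr_ge0// ltW.
have Q0 : 0 <= 3 / eta + 1 by rewrite addr_ge0// divr_ge0// ltW.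
move=> z w; set u := Num.max 1 _; set x := cabs w; set T := 1 + cabs z + cabs (z + w).
have u1 : 1 <= u by rewrite le_max lexx.
have uz : cabs z <= u by rewrite le_max lexx orbT.
have x0 : 0 <= x := cabs_ge0 _.
have z0 := cabs_ge0 z; have zw0 := cabs_ge0 (z + w).
have T3 : T <= 3 * u + x by have := cabs_triangle z w; rewrite /T -/x; atom_lra.
have T0 : 0 < T by rewrite /T; atom_lra.
have H : cabs (P.[z + w] - P.[z]) <= C * x * T ^+ N.
  have := HC z (z + w); rewrite -/T addrAC subrr add0r -/x exprS => H.
  by rewrite -(ler_pM2r T0) -[leRHS]mulrA [_ ^+ N * T]mulrC.
apply: le_trans H _; have [xu|ux] := leP x (eta * u).
  have T4 : T <= 4 * u by atom_nra.
  have Tu : T ^+ N <= 4 ^+ N * u ^+ N.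
    by rewrite -exprMn lerXn2r ?nnegrE ?(ltW T0) ?mulr_ge0//; atom_lra.
  have uN : 0 <= u ^+ N by rewrite exprn_ge0//; atom_lra.
  apply: (@le_trans _ _ (e * u ^+ N.+1)); last first.
    by rewrite lerDl; apply: mulr_ge0; [apply: mulr_ge0 => //|]; exact: exprn_ge0.
  apply: (@le_trans _ _ (C * (eta * u) * (4 ^+ N * u ^+ N))).
    by apply: ler_pM; rewrite ?mulr_ge0 ?exprn_ge0 ?(ltW T0)// ler_wpM2l.
  rewrite (_ : _ * _ = K * eta * u ^+ N.+1); last by rewrite /K exprS; ring.
  by rewrite ler_wpM2r// exprn_ge0//; atom_lra.
have T4 : T <= (3 / eta + 1) * x.
  have h3 : 3 * u <= 3 / eta * x.
    by rewrite mulrAC ler_pdivlMr// -mulrA ler_pM2l// mulrC ltW.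
  by apply: le_trans T3 _; rewrite [leRHS]mulrDl mul1r lerD2r.
apply: (@le_trans _ _ (C * (3 / eta + 1) ^+ N * x ^+ N.+1)); last first.
  by rewrite lerDr mulr_ge0 ?(ltW e0)// exprn_ge0//; atom_lra.
have -> : C * (3 / eta + 1) ^+ N * x ^+ N.+1 = C * x * ((3 / eta + 1) * x) ^+ N.
  by rewrite exprMn exprS; ring.
by rewrite ler_wpM2l ?mulr_ge0// lerXn2r ?nnegrE ?(ltW T0)// (le_trans (ltW T0) T4).
Qed.

Section superposition_sufficient.
Context {R : realType} {n : nat}.
Notation Cn := (Cn R n.+1).
Notation ball := (@cball R n.+1).
Notation S := (@csphere R n.+1).
Notation sigma := (@sphere_measure R n.+1).
Notation v := (@ball_measure R n.+1).
Implicit Types f g : 'rV[cplx R]_n.+1 -> cplx R.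

Lemma holomorphic_horner (P : {poly cplx R}) f : holomorphic_ball f ->
  holomorphic_ball (fun z => P.[f z]).
Proof.
move=> hf z zb; elim/poly_ind: P => [|P c IH].
  rewrite (_ : (fun _ => _) = cst 0); first exact: differentiable_cst.
  by apply/funext => w; rewrite horner0.
rewrite (_ : (fun _ => _) = (((fun w => P.[f w]) : 'rV[cplx R]_n.+1 -> cplx R) * f + cst c)%R).
  by apply: differentiableD; [apply: differentiableM; [exact: IH|exact: hf]|exact: differentiable_cst].
by apply/funext => w; rewrite hornerMXaddC.
Qed.

Lemma holomorphicB f g : holomorphic_ball f -> holomorphic_ball g -> holomorphic_ball (f \- g)%R.
Proof. by move=> hf hg z zb; apply: differentiableB; [exact: hf|exact: hg]. Qed.

Lemma holomorphicZ (c : cplx R) f : holomorphic_ball f -> holomorphic_ball (fun z => c * f z).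
Proof.
move=> hf z zb; rewrite (_ : (fun _ => _) = (c *: f)%R); last by apply/funext => w.
by apply: differentiableZ; exact: hf.
Qed.

(** The t-th power of the quasi-norm, for an arbitrary real density in place of a modulus; it spares
    the outer root and applies to [max1]. *)
Definition tent_int (t s beta : R) (u : Cn -> R) : \bar R :=
  (\int[sigma]_(xi in S) (tent (dens s beta u) xi `^ (t / s)))%E.

Lemma tent_int_ge0 t s beta u : (0 <= tent_int t s beta u)%E.
Proof. by apply: integral_ge0 => x _; exact: poweR_ge0. Qed.

Lemma HTnormE p q alpha f : HTnorm p q alpha f = (tent_int p q alpha (fun z => cabs (f z)) `^ p^-1)%E.
Proof. by []. Qed.

Lemma HTP p q alpha f : 0 < p -> HT p q alpha f <->
  holomorphic_ball f /\ (tent_int p q alpha (fun z => cabs (f z)) < +oo)%E.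
Proof.
move=> p0; split => -[hf If]; split => //.
  by apply: (@lty_poweRy _ _ p^-1); rewrite ?invr_eq0 ?gt_eqF.
by rewrite HTnormE; exact: poweR_lty.
Qed.

Lemma tent_int_le_norm p q alpha f (M : R) : 0 < p -> (HTnorm p q alpha f <= M%:E)%E ->
  (tent_int p q alpha (fun z => cabs (f z)) <= (M `^ p)%:E)%E.
Proof.
move=> p0; rewrite HTnormE => H; have I0 := tent_int_ge0 p q alpha (fun z => cabs (f z)).
have := le_poweR (ltW p0) (poweR_ge0 _ _) H.
by rewrite -poweRrM mulVf ?gt_eqF// poweRe1// poweR_EFin.
Qed.

Lemma norm_lt_tent_int p q alpha f (M : R) : 0 < p -> 0 < M ->
  (tent_int p q alpha (fun z => cabs (f z)) < (M `^ p)%:E)%E -> (HTnorm p q alpha f < M%:E)%E.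
Proof.
move=> p0 M0 H; rewrite ltNge; apply/negP => Mle.
have := le_poweR (ltW p0) (_ : 0 <= M%:E)%E Mle; rewrite lee_fin (ltW M0) => /(_ isT).
rewrite HTnormE -poweRrM mulVf ?gt_eqF// poweRe1 ?tent_int_ge0// poweR_EFin.
by rewrite leNgt H.
Qed.

Lemma norm_le_tent_int p q alpha f (M : R) : 0 < p -> 0 <= M ->
  (tent_int p q alpha (fun z => cabs (f z)) <= M%:E)%E -> (HTnorm p q alpha f <= (M `^ p^-1)%:E)%E.
Proof.
move=> p0 M0 H; rewrite HTnormE -poweR_EFin; apply: le_poweR => //; last exact: tent_int_ge0.
by rewrite invr_ge0 ltW.
Qed.

(** The quasi-triangle inequality in a form that also changes indices: a pointwise power nu turns
    (t, s) into (t nu, s nu) and keeps the ratio t / s. *)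
Lemma tent_int_combine (t s beta nu c1 c2 : R) (a u1 u2 : Cn -> R) : 0 < t -> 0 < s -> 0 < nu ->
  0 <= c1 -> 0 <= c2 -> measurable_fun ball u1 -> measurable_fun ball u2 ->
  (forall z, ball z -> 0 <= u1 z) -> (forall z, ball z -> 0 <= u2 z) ->
  (forall z, ball z -> 0 <= a z /\ a z <= c1 * u1 z `^ nu + c2 * u2 z `^ nu) ->
  (tent_int t s beta a <= (2 `^ (t / s) * 2 `^ t)%:E *
    ((c1 `^ t)%:E * tent_int (t * nu) (s * nu) beta u1 + (c2 `^ t)%:E * tent_int (t * nu) (s * nu) beta u2))%E.
Proof.
move=> t0 s0 nu0 c10 c20 m1 m2 u10 u20 Ha.
have ts0 : 0 < t / s by rewrite divr_gt0.
have tsE : t * nu / (s * nu) = t / s by field; rewrite !gt_eqF.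
pose D1 := dens (s * nu) beta u1; pose D2 := dens (s * nu) beta u2.
have mD1 : measurable_fun ball D1 by exact: measurable_dens.
have mD2 : measurable_fun ball D2 by exact: measurable_dens.
have p1 : 0 <= 2 `^ s * c1 `^ s by rewrite mulr_ge0 ?powR_ge0.
have p2 : 0 <= 2 `^ s * c2 `^ s by rewrite mulr_ge0 ?powR_ge0.
have pt xi : (tent (dens s beta a) xi <= (2 `^ s * c1 `^ s)%:E * tent D1 xi + (2 `^ s * c2 `^ s)%:E * tent D2 xi)%E.
  have mk := @measurable_koranyi R n xi; have kb : koranyi xi `<=` ball by move=> z [].
  have k1 : measurable_fun (koranyi xi) (fun z => (D1 z)%:E).
    by apply/measurable_EFinP; apply: measurable_funS mD1 => //; exact: measurable_cball.
  have k2 : measurable_fun (koranyi xi) (fun z => (D2 z)%:E).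
    by apply/measurable_EFinP; apply: measurable_funS mD2 => //; exact: measurable_cball.
  have q1 z : koranyi xi z -> (0 <= (D1 z)%:E)%E by move=> _; rewrite lee_fin dens_ge0.
  have q2 z : koranyi xi z -> (0 <= (D2 z)%:E)%E by move=> _; rewrite lee_fin dens_ge0.
  rewrite /tent -(integralZ_ge0 _ mk k1 q1 p1) -(integralZ_ge0 _ mk k2 q2 p2) -ge0_integralD//; first last.
  - by apply: emeasurable_funM => //; exact: measurable_cst.
  - by move=> z zk; rewrite mule_ge0 ?q2 ?lee_fin.
  - by apply: emeasurable_funM => //; exact: measurable_cst.
  - by move=> z zk; rewrite mule_ge0 ?q1 ?lee_fin.
  apply: le_ge0_integral => // z zk; rewrite -?EFinM -?EFinD lee_fin; first exact: dens_ge0.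
    have zb := kb z zk; have [a0 az] := Ha z zb.
    rewrite /D1 /D2 /dens !mulrA -mulrDl ler_wpM2r ?powR_ge0//.
    have y1 : 0 <= c1 * u1 z `^ nu by rewrite mulr_ge0 ?powR_ge0.
    have y2 : 0 <= c2 * u2 z `^ nu by rewrite mulr_ge0 ?powR_ge0.
    apply: (@le_trans _ _ ((c1 * u1 z `^ nu + c2 * u2 z `^ nu) `^ s)).
      by apply: ge0_ler_powR; rewrite ?nnegrE ?addr_ge0 ?(ltW s0).
    have := poweRD_le y1 (ltW s0) (_ : 0 <= (c2 * u2 z `^ nu)%:E)%E; rewrite lee_fin => /(_ y2).
    rewrite -EFinD !poweR_EFin -EFinD -EFinM lee_fin => /le_trans; apply.
    by rewrite !powRM ?powR_ge0// -!powRrM (mulrC nu) mulrDr !mulrA.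
  by rewrite addr_ge0// mulr_ge0 ?dens_ge0.
have ta0 xi : (0 <= tent (dens s beta a) xi)%E by apply: tent_ge0 => z _; exact: dens_ge0.
have D10 z : 0 <= D1 z := dens_ge0 _ _ _ z; have D20 z : 0 <= D2 z := dens_ge0 _ _ _ z.
rewrite /tent_int tsE -/D1 -/D2; move: (tent (dens s beta a)) ta0 pt => Ta ta0 pt.
clearbody D1 D2.
have mS := @measurable_csphere R n.+1.
have tm (D : Cn -> R) : measurable_fun ball D -> (forall z, 0 <= D z) -> measurable_fun S (fun x => (tent D x `^ (t / s))%E).
  move=> mD D0; apply: measurable_funTS.
  by apply: (measurableT_comp (@measurable_poweR R (t / s))); apply: measurable_tent.
have mT1 := tm D1 mD1 D10.
have mT2 := tm D2 mD2 D20.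
have t10 x : (0 <= tent D1 x)%E by apply: tent_ge0 => z _; exact: D10.
have t20 x : (0 <= tent D2 x)%E by apply: tent_ge0 => z _; exact: D20.
clear tm; move: (tent D1) (tent D2) pt mT1 mT2 t10 t20 => T1 T2 pt mT1 mT2 t10 t20.
have T10 x : S x -> (0 <= T1 x `^ (t / s))%E by move=> _; exact: poweR_ge0.
have T20 x : S x -> (0 <= T2 x `^ (t / s))%E by move=> _; exact: poweR_ge0.
have K0 : 0 <= 2 `^ (t / s) * 2 `^ t :> R by rewrite mulr_ge0 ?powR_ge0.
have c1t := powR_ge0 c1 t; have c2t := powR_ge0 c2 t.
have mc1 : measurable_fun S (fun x => (c1 `^ t)%:E * T1 x `^ (t / s))%E.
  by apply: emeasurable_funM; [exact: measurable_cst|exact: mT1].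
have mc2 : measurable_fun S (fun x => (c2 `^ t)%:E * T2 x `^ (t / s))%E.
  by apply: emeasurable_funM; [exact: measurable_cst|exact: mT2].
have C10 x : S x -> (0 <= (c1 `^ t)%:E * T1 x `^ (t / s))%E.
  by move=> xS; rewrite mule_ge0 ?T10 ?lee_fin.
have C20 x : S x -> (0 <= (c2 `^ t)%:E * T2 x `^ (t / s))%E.
  by move=> xS; rewrite mule_ge0 ?T20 ?lee_fin.
rewrite -(integralZ_ge0 _ mS mT1 T10 c1t) -(integralZ_ge0 _ mS mT2 T20 c2t).
have mF : measurable_fun S (fun x => (c1 `^ t)%:E * T1 x `^ (t / s) + (c2 `^ t)%:E * T2 x `^ (t / s))%E.
  exact: (emeasurable_funD mc1 mc2).
have F0 x : S x -> (0 <= (c1 `^ t)%:E * T1 x `^ (t / s) + (c2 `^ t)%:E * T2 x `^ (t / s))%E.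
  by move=> xS; rewrite adde_ge0 ?C10 ?C20.
rewrite -(ge0_integralD _ mS C10 mc1 C20 mc2) -(integralZ_ge0 _ mS mF F0 K0).
apply: le_ge0_integral => [//|x _|x xS|x xS]; first exact: poweR_ge0.
  apply: le_trans (le_poweR (ltW ts0) (ta0 x) (pt x)) _.
  have y1 : (0 <= (2 `^ s * c1 `^ s)%:E * T1 x)%E by apply: mule_ge0; [rewrite lee_fin|exact: t10].
  have y2 : (0 <= (2 `^ s * c2 `^ s)%:E * T2 x)%E by apply: mule_ge0; [rewrite lee_fin|exact: t20].
  apply: le_trans (poweRD2_le (ltW ts0) y1 y2) _.
  have e c : 0 <= c -> ((2 `^ s * c `^ s) `^ (t / s) = 2 `^ t * c `^ t :> R).
    move=> c0; rewrite powRM ?powR_ge0// -!powRrM (_ : s * (t / s) = t)//; field; exact: lt0r_neq0.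
  rewrite (poweRM _ _ (t10 x)) ?lee_fin// (poweRM _ _ (t20 x)) ?lee_fin// !poweR_EFin !e//.
  have t2 : 0 <= 2 `^ t :> R by exact: powR_ge0.
  have -> : ((2 `^ t * c1 `^ t)%:E * T1 x `^ (t / s) + (2 `^ t * c2 `^ t)%:E * T2 x `^ (t / s) =
     (2 `^ t)%:E * ((c1 `^ t)%:E * T1 x `^ (t / s) + (c2 `^ t)%:E * T2 x `^ (t / s)))%E.
    by rewrite (ge0_muleDr _ (C10 x xS) (C20 x xS)) !EFinM !muleA.
  by rewrite muleA -EFinM.
by apply: mule_ge0; [rewrite lee_fin|exact: F0].
Qed.

(** Since [max1] is at least 1, any real nu not below the degree may serve as exponent; a constant
    polynomial can thus use a small nu. *)
Lemma poly_superposition_le (p q s t alpha beta nu G : R) (P : {poly cplx R}) :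
  0 < p -> 0 < q -> 0 < s -> 0 < t -> 0 < nu -> 0 < alpha + n.+2%:R ->
  emb_cond (n := n) p q alpha (t * nu) (s * nu) beta -> ((size P).-1)%:R <= nu ->
  exists2 C : R, 0 <= C & forall f, holomorphic_ball f ->
  (tent_int p q alpha (fun z => cabs (f z)) <= G%:E)%E ->
  (tent_int t s beta (fun z => cabs P.[f z]) <= C%:E)%E.
Proof.
move=> p0 q0 s0 t0 nu0 a0 cond Nnu.
have [C1 C10 H1] := @embedding R n p q alpha (t * nu) (s * nu) beta G p0 q0 (mulr_gt0 t0 nu0)
  (mulr_gt0 s0 nu0) a0 cond.
have [C C0 HC] := horner_le P; set N := (size P).-1 in Nnu HC.
pose c := C * 2 ^+ N; have c0 : 0 <= c by rewrite mulr_ge0// exprn_ge0.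
exists (2 `^ (t / s) * 2 `^ t * (c `^ t * C1)) => [|f hf If].
  by rewrite !mulr_ge0 ?powR_ge0.
have mf := measurable_max1 hf; have u1 := max1_ge1 f; have u0 := max1_ge0 f.
apply: le_trans (tent_int_combine (c1 := c) (c2 := 0) (u1 := max1 f) (u2 := max1 f) (nu := nu) _ t0 s0 nu0
  c0 (lexx 0) mf mf (fun z _ => u0 z) (fun z _ => u0 z) _) _.
  move=> z _; split; first exact: cabs_ge0.
  rewrite mul0r addr0; apply: le_trans (HC (f z)) _; rewrite /c -mulrA ler_wpM2l//.
  apply: (@le_trans _ _ ((2 * max1 f z) ^+ N)).
    rewrite lerXn2r ?nnegrE ?mulr_ge0 ?addr_ge0 ?cabs_ge0//.
    have : cabs (f z) <= max1 f z by rewrite le_max lexx orbT.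
    by have := u1 z; atom_lra.
  by rewrite exprMn ler_wpM2l ?exprn_ge0// -powR_mulrn//; apply: ler_powR.
rewrite powR0 ?gt_eqF// mul0e adde0 [leRHS]EFinM; apply: lee_wpmul2l; first by rewrite lee_fin mulr_ge0 ?powR_ge0.
by rewrite EFinM; apply: lee_wpmul2l; [rewrite lee_fin powR_ge0|exact: H1].
Qed.

(** A function of norm at most d becomes bounded by a fixed constant after division by d; this
    supplies the normalisation in the proof of continuity. *)
Lemma tent_int_scale p q alpha (d : R) f : 0 < p -> 0 < q -> 0 < d -> holomorphic_ball f ->
  (tent_int p q alpha (fun z => cabs (f z)) <= (d `^ p)%:E)%E ->
  (tent_int p q alpha (fun z => cabs (cr d^-1 * f z)) <= (2 `^ (p / q) * 2 `^ p)%:E)%E.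
Proof.
move=> p0 q0 d0 hf If; have di : 0 <= d^-1 by rewrite invr_ge0 ltW.
have mf := holomorphic_measurable hf.
apply: le_trans (tent_int_combine (c1 := d^-1) (c2 := 0) (u1 := fun z => cabs (f z))
  (u2 := fun z => cabs (f z)) (nu := 1) _ p0 q0 ltr01 di (lexx 0) mf mf
  (fun z _ => cabs_ge0 _) (fun z _ => cabs_ge0 _) _) _.
  move=> z _; split; first exact: cabs_ge0.
  by rewrite mul0r addr0 powRr1 ?cabs_ge0// cabsM cabs_cr ger0_norm.
rewrite powR0 ?gt_eqF// mul0e adde0 !mulr1 -[leRHS]mule1.
apply: lee_wpmul2l; first by rewrite lee_fin mulr_ge0 ?powR_ge0.
apply: le_trans (lee_wpmul2l _ If) _; first by rewrite lee_fin powR_ge0.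
by rewrite -EFinM lee_fin -powRM ?(ltW d0)// mulVf ?gt_eqF// powR1.
Qed.

Let quarters (E : R) : 0 < E -> E / 4 + E / 4 < E. Proof. by move=> E0; lra. Qed.

(** For continuity at f the embedding, which is not homogeneous, is applied to f and to (g - f) / d;
    both have norms bounded independently of g, and the powers of d make the second term small. A
    constant polynomial has zero difference, so there nu need not be the degree. *)
Theorem poly_superposition (p q s t alpha beta nu : R) (P : {poly cplx R}) :
  0 < p -> 0 < q -> 0 < s -> 0 < t -> 0 < nu -> 0 < alpha + n.+2%:R ->
  emb_cond (n := n) p q alpha (t * nu) (s * nu) beta -> ((size P).-1)%:R <= nu ->
  ((size P).-1 = 0%N \/ ((size P).-1)%:R = nu) ->
  [/\ HT_maps p q alpha t s beta (@superposition R n.+1 (horner P)),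
    HT_bounded_op p q alpha t s beta (@superposition R n.+1 (horner P)) &
    HT_continuous_op p q alpha t s beta (@superposition R n.+1 (horner P))].
Proof.
move=> p0 q0 s0 t0 nu0 a0 cond Nnu Neq.
have maps : HT_maps p q alpha t s beta (@superposition R n.+1 (horner P)).
  move=> f /(HTP _ _ _ p0)[hf If]; apply/(HTP _ _ _ t0); split; first exact: holomorphic_horner.
  have I0 := tent_int_ge0 p q alpha (fun z => cabs (f z)).
  have If' : (tent_int p q alpha (fun z => cabs (f z)) <= (fine (tent_int p q alpha (fun z => cabs (f z))))%:E)%E.
    by rewrite fineK// ge0_fin_numE.
  have [C C0 H] := poly_superposition_le (fine (tent_int p q alpha (fun z => cabs (f z))))
    p0 q0 s0 t0 nu0 a0 cond Nnu.
  by apply: le_lt_trans (H f hf If') _; rewrite ltry.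
split=> //.
  move=> A [AHT [M HM]]; split; first by move=> _ [f Af <-]; apply: maps; exact: AHT.
  have [C C0 H] := poly_superposition_le (M `^ p) p0 q0 s0 t0 nu0 a0 cond Nnu.
  exists (C `^ t^-1) => _ [f Af <-]; apply: norm_le_tent_int => //.
  have [hf _] := AHT f Af; apply: H => //.
  exact: tent_int_le_norm (HM f Af).
move=> f fHT e e0; have [hf If] := (HTP _ _ _ p0).1 fHT.
pose K : R := 2 `^ (t / s) * 2 `^ t; have K0 : 0 < K by rewrite mulr_gt0 ?powR_gt0.
have I0 := tent_int_ge0 p q alpha (fun z => cabs (f z)).
have If' : (tent_int p q alpha (fun z => cabs (f z)) <= (fine (tent_int p q alpha (fun z => cabs (f z))))%:E)%E.
  by rewrite fineK// ge0_fin_numE.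
have tn := mulr_gt0 t0 nu0; have sn := mulr_gt0 s0 nu0.
have [M1 M10 HM1] := @embedding R n p q alpha (t * nu) (s * nu) beta
  (fine (tent_int p q alpha (fun z => cabs (f z)))) p0 q0 tn sn a0 cond.
have [M2 M20 HM2] := @embedding R n p q alpha (t * nu) (s * nu) beta (2 `^ (p / q) * 2 `^ p) p0 q0 tn sn a0 cond.
have et : 0 < e `^ t by rewrite powR_gt0.
(* Chosen so that each of the two terms of the final estimate costs at most a quarter of e^t. *)
pose small M : R := (e `^ t / (4 * K * (M + 1))) `^ t^-1.
have small_gt0 M : 0 <= M -> 0 < small M.
  by move=> M0; rewrite powR_gt0// divr_gt0// !mulr_gt0//; atom_lra.
have smallP M c : 0 <= M -> 0 <= c -> c <= small M -> K * (c `^ t * M) <= e `^ t / 4.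
  move=> M0 c0 cs; have M1' : 0 < M + 1 by atom_lra.
  apply: (@le_trans _ _ (K * ((e `^ t / (4 * K * (M + 1))) * (M + 1)))).
    rewrite ler_wpM2l ?(ltW K0)//; apply: ler_pM; rewrite ?powR_ge0//; last by atom_lra.
    have : c `^ t <= small M `^ t by apply: ge0_ler_powR; rewrite ?nnegrE ?(ltW t0) ?powR_ge0.
    by rewrite /small -powRrM mulVf ?gt_eqF// powRr1// divr_ge0 ?(ltW et)// !mulr_ge0 ?(ltW K0)//; atom_lra.
  by rewrite le_eqVlt; apply/orP; left; apply/eqP; field; rewrite !gt_eqF.
have [C C0 HC] : exists2 C : R, 0 <= C & forall z w,
    cabs (P.[z + w] - P.[z]) <= small M1 * (Num.max 1 (cabs z)) `^ nu + C * cabs w `^ nu.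
  case: Neq => [N0|NE].
    exists 0 => // z w; have [c ->] : exists c, P = c%:P.
      by exists P`_0; apply: size1_polyC; move: N0; case: (size P) => [|[]].
    by rewrite !hornerC subrr cabs0 addr_ge0 ?mulr_ge0 ?powR_ge0 ?(ltW (small_gt0 _ M10)).
  have N0 : (0 < (size P).-1)%N by rewrite -(ltr_nat R) NE.
  have [C C0 HC] := horner_diff_le N0 (small_gt0 _ M10); exists C => // z w.
  have u0 : 0 <= Num.max 1 (cabs z) by rewrite le_max ler01.
  by rewrite -NE (powR_mulrn _ (cabs_ge0 w)) (powR_mulrn _ u0); exact: HC.
(* Then d^nu (C + 1) = small M2, so the coefficient C d^nu of the rescaled difference is at most
   [small M2]. *)
pose d := (small M2 / (C + 1)) `^ nu^-1.
have C1' : 0 < C + 1 by atom_lra.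
have d0 : 0 < d by rewrite powR_gt0// divr_gt0// small_gt0.
have dn : d `^ nu = small M2 / (C + 1).
  by rewrite /d -powRrM mulVf ?gt_eqF// powRr1// divr_ge0 ?(ltW C1')// ltW// small_gt0.
exists d => // g gHT gd; have [hg _] := (HTP _ _ _ p0).1 gHT.
have hb := holomorphicB hg hf.
pose b z := cr d^-1 * (g \- f) z; have hb' : holomorphic_ball b by exact: holomorphicZ.
have Ib : (tent_int p q alpha (fun z => cabs (b z)) <= (2 `^ (p / q) * 2 `^ p)%:E)%E.
  by apply: tent_int_scale => //; apply: tent_int_le_norm => //; exact: ltW.
have J1 := HM1 f hf If'; have J2 := HM2 b hb' Ib.
apply: norm_lt_tent_int => //.
have c20 : 0 <= C * d `^ nu by rewrite mulr_ge0 ?powR_ge0.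
have s1 := ltW (small_gt0 _ M10).
apply: le_lt_trans (tent_int_combine (c1 := small M1) (c2 := C * d `^ nu) (u1 := max1 f) (u2 := max1 b)
  (nu := nu) _ t0 s0 nu0 s1 c20 (measurable_max1 hf) (measurable_max1 hb')
  (fun z _ => max1_ge0 f z) (fun z _ => max1_ge0 b z) _) _.
  move=> z _; split; first exact: cabs_ge0.
  rewrite /superposition /=; have := HC (f z) (g z - f z); rewrite subrKC => /le_trans; apply.
  rewrite lerD2l -mulrA ler_wpM2l// -powRM ?(ltW d0) ?max1_ge0//.
  apply: ge0_ler_powR; rewrite ?nnegrE ?cabs_ge0 ?mulr_ge0 ?max1_ge0 ?(ltW d0) ?(ltW nu0)//.
  have : cabs (b z) <= max1 b z by rewrite le_max lexx orbT.
  rewrite /b cabsM cabs_cr ger0_norm ?invr_ge0 ?(ltW d0)// ler_pdivrMl//.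
rewrite -/K; have sM0 := powR_ge0 (small M1) t; have cM0 := powR_ge0 (C * d `^ nu) t.
apply: (@le_lt_trans _ _ (K%:E * ((small M1 `^ t * M1)%:E + ((C * d `^ nu) `^ t * M2)%:E))%E).
  apply: lee_wpmul2l; first by rewrite lee_fin ltW.
  by rewrite !EFinM; apply: leeD; apply: lee_wpmul2l; rewrite ?lee_fin.
rewrite -EFinD -EFinM lte_fin mulrDr.
have l1 := smallP M1 (small M1) M10 s1 (lexx _).
have cs : C * d `^ nu <= small M2.
  rewrite dn mulrCA; apply: ler_piMr; first exact: ltW (small_gt0 _ M20).
  by rewrite ler_pdivrMr// mul1r lerDl.
have l2 := smallP M2 _ M20 c20 cs.
exact: le_lt_trans (lerD l1 l2) (quarters et).
Qed.

End superposition_sufficient.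

(** * Necessity: test functions with a boundary pole *)

Section frechet.
Context {R : realType} {n : nat}.
Implicit Types (w z a : 'rV[cplx R]_n).

Definition lin_form a (w : 'rV[cplx R]_n) : cplx R := \sum_j w 0 j * a 0 j.

Lemma lin_form_linear a : linear (lin_form a).
Proof.
move=> k u w; rewrite /lin_form scaler_sumr -big_split /=; apply: eq_bigr => j _.
by rewrite !mxE mulrDl -[k *: (u 0 j * _)]/(k * (u 0 j * _)) mulrA.
Qed.

HB.instance Definition _ a := GRing.isLinear.Build (cplx R) 'rV[cplx R]_n (cplx R) *:%R (lin_form a)
  (lin_form_linear a).

Lemma lin_form_continuous a : continuous (lin_form a).
Proof.
apply: (@continuous_big _ _ _ _ _ _ _ _ (fun j (w : 'rV[cplx R]_n) => w 0 j * a 0 j)).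
  exact: add_continuous.
by move=> j _ w; apply: (@cvgM _ _ (nbhs w)); [exact: coord_continuous|exact: cvg_cst].
Qed.

Lemma norm_enorm w : exists2 t : R, `|w| = cr t & 0 <= t /\ enorm w <= (n%:R + 1) * t.
Proof.
have [t t0 tE] : exists2 t : R, 0 <= t & `|w| = cr t.
  exists (cre `|w|); have := normr_ge0 w; case: (`|w|) => x y; rewrite lecE /= => /andP[/eqP y0 x0] //.
  by rewrite y0.
exists t => //; split=> //.
have wt j : cabs (w 0 j) <= t.
  apply/ler_addgt0Pr => e e0.
  have : ball_ (fun x : 'rV[cplx R]_n => `|x|) 0 (cr (t + e)) w.
    by rewrite /ball_ /= sub0r normrN tE ltcR ltrDl.
  rewrite -mx_norm_ball => -[_ /(_ 0 j)]; rewrite mxE /ball /= sub0r normrN cabsE ltcR => /ltW; exact.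
have := enorm_le t0 wt; have n0 : 0 <= n%:R :> R := ler0n R n.
have w0 := enorm_ge0 w; move=> H.
rewrite -ler_sqr ?nnegrE ?mulr_ge0 ?addr_ge0//; apply: le_trans H _.
by rewrite exprMn ler_wpM2r ?sqr_ge0//; nra.
Qed.

(** A criterion in the Euclidean norm with real tolerances; [norm_enorm] compares that norm with the
    sup norm in which differentiability is defined. *)
Lemma frechet_differentiable (f : 'rV[cplx R]_n -> cplx R) z a :
  (forall e : R, 0 < e -> exists2 r : R, 0 < r & forall w, enorm (w - z) < r ->
     cabs (f w - f z - lin_form a (w - z)) <= e * enorm (w - z)) -> differentiable f z.
Proof.
move=> H; have E : f \o shift z = cst (f z) + lin_form a +o_ (0 : 'rV[cplx R]_n) id.
  apply/eqaddoP => e e0; have [e1 e10 eE] : exists2 e1 : R, 0 < e1 & e = cr e1.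
    exists (complex.Re e); move: e0; case: (e) => x y; rewrite ltcE /= => /andP[/eqP y0 x0] //.
    by rewrite y0.
  have n0 : 0 < n%:R + 1 :> R by rewrite ltr_wpDl.
  have [r r0 Hr] := H (e1 / (n%:R + 1)) (divr_gt0 e10 n0).
  apply/enbhsP; exists r => // w; rewrite subr0 => wr /=.
  have [t tE [t0 wt]] := norm_enorm w.
  have := Hr (w + z); rewrite addrK => /(_ wr) H1.
  rewrite !fctE /= tE eE cabsE -crM lecR opprD addrA; apply: le_trans H1 _.
  by rewrite mulrAC ler_pdivrMr// -mulrA ler_pM2l// mulrC.
have dE := diff_unique (lin_form_continuous (a := a)) E.
by apply/diff_locallyP; rewrite dE; split; [exact: lin_form_continuous|exact: E].
Qed.

Lemma cdiff_coord_differentiable (g : cplx R -> cplx R) j z : cdiff g (z 0 j) ->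
  differentiable (fun w : 'rV[cplx R]_n => g (w 0 j)) z.
Proof.
move=> [l Hl]; apply: (@frechet_differentiable _ z (l *: delta_mx 0 j)) => e e0.
have [r r0 Hr] := Hl e e0; exists r => // w wr.
have -> : lin_form (l *: delta_mx 0 j) (w - z) = l * (w 0 j - z 0 j).
  rewrite /lin_form (bigD1 j)//= big1 ?addr0; last first.
    by move=> i ij; rewrite !mxE eqxx (negbTE ij) mulr0 mulr0.
  by rewrite !mxE !eqxx mulr1 mulrC.
have wj : cabs (w 0 j - z 0 j) <= enorm (w - z) by have := coord_le (w - z) j; rewrite !mxE.
apply: le_trans (Hr _ (le_lt_trans wj wr)) _; by rewrite ler_wpM2l// ltW.
Qed.

End frechet.

(** * Holomorphic roots on the right half-plane *)

Section complex_roots.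
Context {R : realType}.

(** The principal square root, from Re sqrt w = sqrt((|w| + Re w) / 2). *)
Definition csqrt (w : cplx R) : cplx R :=
  let x := Num.sqrt ((cabs w + cre w) / 2) in mkc x (cim w / (2 * x)).

Lemma csqrtP (w : cplx R) : 0 < cre w -> csqrt w ^+ 2 = w /\ 0 < cre (csqrt w).
Proof.
move=> w0; rewrite /csqrt; set x := Num.sqrt _; have c0 := cre_le_cabs w.
have x0 : 0 < x by rewrite sqrtr_gt0; lra.
have x2 : x ^+ 2 = (cabs w + cre w) / 2 by rewrite sqr_sqrtr//; lra.
split; last by rewrite cE.
have xn : x != 0 by rewrite gt_eqF.
apply: ceq; rewrite expr2 !cE.
  have h : (cim w / (2 * x)) ^+ 2 = (cabs w - cre w) / 2.
    have cw := cabs2 w; have c2 : cim w ^+ 2 = (cabs w - cre w) * (cabs w + cre w) by lra.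
    rewrite exprMn exprVn exprMn x2 c2; field; apply/eqP; lra.
  by rewrite -!expr2 x2 h; field.
by field.
Qed.

(** With u and s the roots of t and w, (u - s)(u + s) = t - w and |u + s| >= Re s. The remainder of
    the derivative 1 / (2 s) is - (u - s)^2 / (2 s), quadratic in t - w. *)
Lemma cdiff_csqrt (w : cplx R) : 0 < cre w -> cdiff csqrt w.
Proof.
move=> w0; have [s2 s0] := csqrtP w0; set s := csqrt w in s2 s0 *.
have sn : s != 0 by rewrite -cabs_gt0; exact: lt_le_trans (cre_le_cabs s).
have cs : 0 < cabs s by rewrite cabs_gt0.
exists (2 * s)^-1 => e e0.
pose r := Num.min (cre w) (e * (2 * cabs s * cre s ^+ 2)).
have r0 : 0 < r by rewrite lt_min w0 !mulr_gt0// exprn_gt0.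
exists r => // t; rewrite lt_min => /andP[t1 t2].
have t0 : 0 < cre t.
  have := cre_le (t - w); rewrite cE ler_norml => /andP[]; lra.
have [u2 u0] := csqrtP t0; set u := csqrt t in u2 u0 *.
have us : (u - s) * (u + s) = t - w by rewrite -u2 -s2; ring.
have d0 : cre s <= cabs (u + s) by apply: le_trans (cre_le_cabs _); rewrite cE; atom_lra.
have usn : u + s != 0 by rewrite -cabs_gt0; exact: lt_le_trans d0.
have lip : cabs (u - s) * cre s <= cabs (t - w).
  by rewrite -us cabsM ler_wpM2l ?cabs_ge0.
have E : u - s - (2 * s)^-1 * (t - w) = - ((u - s) ^+ 2 / (2 * s)).
  by rewrite -us; field.
rewrite E cabsN cabsM cabsV cabsX cabsM.
have -> : cabs (2 : cplx R) = 2.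
  by have := cabs_cr (2 : R); rewrite ger0_norm// => <-; congr cabs; rewrite -[2]/(1 + 1) crD.
rewrite ler_pdivrMr ?mulr_gt0//.
set a := cabs (u - s) in lip *; set d := cabs (t - w) in t2 lip *.
have a0 : 0 <= a := cabs_ge0 _; have dd0 : 0 <= d := cabs_ge0 _.
have s20 : 0 < cre s ^+ 2 by rewrite exprn_gt0.
rewrite -(ler_pM2r s20) -exprMn; apply: (@le_trans _ _ (d * d)).
  by rewrite expr2; apply: ler_pM => //; rewrite mulr_ge0 ?(ltW s0).
have -> : e * d * (2 * cabs s) * cre s ^+ 2 = d * (e * (2 * cabs s * cre s ^+ 2)) by ring.
by rewrite ler_wpM2l// ltW.
Qed.

(** A 2^m-th root. Each square root stays in the right half-plane, so the next one is again
    holomorphic. *)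
Definition croot (m : nat) : cplx R -> cplx R := iter m csqrt.

Lemma crootP m (w : cplx R) : 0 < cre w -> croot m w ^+ (2 ^ m) = w /\ 0 < cre (croot m w).
Proof.
move=> w0; elim: m => [|m [IH1 IH2]]; first by rewrite expn0 expr1.
have [h1 h2] := csqrtP IH2; split=> //.
by rewrite expnS exprM /croot iterS h1.
Qed.

Lemma cdiff_comp (g h : cplx R -> cplx R) z : cdiff h z -> cdiff g (h z) -> cdiff (g \o h) z.
Proof.
move=> dh [k Hk]; have [M [r1 [M0 r10 HM]]] := cdiff_lip dh; have [l Hl] := dh.
have k1 : 0 < cabs k + 1 by rewrite ltr_wpDl ?cabs_ge0.
exists (k * l) => e e0.
have e1 : 0 < e / (2 * M) by rewrite divr_gt0// mulr_gt0.
have e2 : 0 < e / (2 * (cabs k + 1)) by rewrite divr_gt0// mulr_gt0.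
have [r2 r20 H2] := Hk _ e1; have [r3 r30 H3] := Hl _ e2.
exists (Num.min r1 (Num.min r3 (r2 / M))); first by rewrite !lt_min r10 r30 divr_gt0.
move=> w; rewrite !lt_min ltr_pdivlMr// => /andP[w1 /andP[w3 w2]].
have lip := HM w w1; have d0 := cabs_ge0 (w - z).
have hw : cabs (h w - h z) < r2 by apply: le_lt_trans lip _; rewrite mulrC.
have h2 := H2 _ hw; have h3 := H3 _ w3.
have -> : (g \o h) w - (g \o h) z - k * l * (w - z) =
    (g (h w) - g (h z) - k * (h w - h z)) + k * (h w - h z - l * (w - z)) by rewrite /=; ring.
apply: le_trans (cabs_triangle _ _) _; rewrite cabsM.
have s1 : e / (2 * M) * cabs (h w - h z) <= e / 2 * cabs (w - z).
  apply: le_trans (ler_wpM2l (ltW e1) lip) _.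
  by rewrite le_eqVlt; apply/orP; left; apply/eqP; field; rewrite gt_eqF.
have s2 : cabs k * cabs (h w - h z - l * (w - z)) <= e / 2 * cabs (w - z).
  apply: le_trans (ler_wpM2l (cabs_ge0 k) h3) _.
  rewrite mulrA ler_wpM2r// mulrA ler_pdivrMr ?mulr_gt0//.
  have -> : e / 2 * (2 * (cabs k + 1)) = e * cabs k + e by field.
  by rewrite mulrC lerDl ltW.
have -> : e * cabs (w - z) = e / 2 * cabs (w - z) + e / 2 * cabs (w - z) by field.
by apply: lerD => //; apply: le_trans s1.
Qed.

Lemma cdiff_croot m (w : cplx R) : 0 < cre w -> cdiff (croot m) w.
Proof.
move=> w0; elim: m => [|m IH]; first exact: cdiff_id.
have [_ h] := crootP m w0; exact: cdiff_comp IH (cdiff_csqrt h).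
Qed.

End complex_roots.

(** * Area integrals of functions with a pole at a boundary point *)

Section pole_functions.
Context {R : realType} {n : nat}.
Notation Cn := (Cn R n.+1).
Notation ball := (@cball R n.+1).
Notation S := (@csphere R n.+1).
Notation sigma := (@sphere_measure R n.+1).
Notation v := (@ball_measure R n.+1).

Definition pole (z : Cn) : R := cabs (1 - z 0 ord0).

Lemma pole_cdot (z : Cn) : pole z = cabs (1 - cdot z e1).
Proof. by rewrite cdot_e1. Qed.

Lemma measurable_pole : measurable_fun setT pole.
Proof.
apply: cmeasurable_cabs; apply: cmeasurableB; first exact: cmeasurable_cst.
exact: (cmeasurable_coord ord0 (@measurable_id _ _ setT)).
Qed.

Lemma measurable_pole0 : measurable [set z : Cn | pole z = 0].
Proof.
have -> : [set z : Cn | pole z = 0] = pole @^-1` [set 0] by [].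
by rewrite -[X in measurable X]setTI; apply: measurable_pole => //; exact: measurable_set1.
Qed.

Lemma re_coord_lt1 (z : Cn) : ball z -> 0 < cre (1 - z 0 ord0).
Proof.
move=> zb; rewrite !cE subr_gt0; apply: le_lt_trans (cre_le_cabs _) _.
exact: le_lt_trans (coord_le z ord0) zb.
Qed.

Lemma pole_gt0 (z : Cn) : ball z -> 0 < pole z.
Proof. by move=> zb; apply: lt_le_trans (cre_le_cabs _); exact: re_coord_lt1. Qed.

Lemma hgt_le_pole (z : Cn) : ball z -> hgt z <= 2 * pole z.
Proof.
move=> zb; have zc := coord_le z ord0; have z1 : enorm z < 1 := zb.
have := cabs_leB 1 (1 - z 0 ord0); rewrite cabs1 opprB addrCA subrr addr0 -/(pole z).
rewrite /hgt; have := enorm_ge0 z; nra.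
Qed.

(** The quasi-triangle inequality through z / |z|. Projecting z to the sphere at most doubles each
    distance, and h <= 2 pole z, so 2 (2 h + 2 pole z) <= 12 pole z. *)
Lemma koranyi_pole (xi z : Cn) : S xi -> koranyi xi z -> pole xi <= 12 * pole z.
Proof.
move=> xS [zb zk]; have z1 : enorm z < 1 := zb; have z0 := enorm_ge0 z.
have zn : z != 0.
  apply/eqP => zE; move: zk; rewrite zE cdot0l subr0 cabs1 enorm0 expr0n subr0; lra.
have bS : S (cproj z) by exact: enorm_cproj.
have eS : S e1 := enorm_e1.
have near (a : Cn) : S a -> cabs (1 - cdot (cproj z) a) <= 2 * cabs (1 - cdot z a).
  move=> aS; have zE : cdot z a = cr (enorm z) * cdot (cproj z) a.
    rewrite /cproj cdotZl mulrA -[((enorm z)^-1)%:C%C]/(cr _) -crM mulfV ?cr1 ?mul1r//.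
    by rewrite enorm_eq0.
  have E : 1 - cdot (cproj z) a = (1 - cdot z a) - cdot (cproj z) a * cr (1 - enorm z).
    by rewrite zE crB cr1; ring.
  have b1 : cabs (cdot (cproj z) a) <= 1.
    by apply: le_trans (cauchy_schwarz _ _) _; rewrite [enorm (cproj z)]bS [enorm a]aS mulr1.
  have h1 : cabs (cdot (cproj z) a * cr (1 - enorm z)) <= 1 - enorm z.
    by rewrite cabsM cabs_cr ger0_norm ?subr_ge0 ?(ltW z1)// ler_piMl// subr_ge0 ltW.
  have h2 : 1 - enorm z <= cabs (1 - cdot z a).
    have := cabs_leB 1 (1 - cdot z a); rewrite cabs1 opprB addrCA subrr addr0.
    have := cauchy_schwarz z a; rewrite [enorm a]aS mulr1; atom_lra.
  rewrite E; apply: le_trans (cabs_triangle _ _) _; rewrite cabsN; atom_lra.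
have := koranyi_quasi_triangle xS bS eS; rewrite -pole_cdot.
have nx := near xi xS; have ne := near e1 eS; have hp := hgt_le_pole zb.
rewrite -!pole_cdot in ne *; rewrite (cabs_1dotC xi); move: zk; rewrite -/(hgt z) => zk.
move: nx ne hp zk; move: (cabs (1 - cdot (cproj z) xi)) (cabs _) (pole _) (pole _) (hgt _) (pole _).
by move=> ? ? ? ? ? ?; lra.
Qed.

Lemma tent_split (F : Cn -> R) (xi : Cn) (d x y : R) : measurable_fun ball F ->
  (forall z, ball z -> 0 <= F z) ->
  (\int[v]_(z in koranyi xi `&` [set z : Cn | (hgt z < d)%R]) (F z)%:E <= x%:E)%E ->
  (\int[v]_(z in koranyi xi `&` [set z : Cn | (d <= hgt z)%R]) (F z)%:E <= y%:E)%E ->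
  (tent F xi <= (x + y)%:E)%E.
Proof.
move=> mF F0 ix iy; set D1 := _ `&` _ in ix; set D2 := _ `&` _ in iy.
have mk := @measurable_koranyi R n xi.
have mL : measurable [set z : Cn | hgt z < d] by apply: measurable_lt_set; exact: measurable_hgt.
have mD1 : measurable D1 by exact: measurableI.
have mD2 : measurable D2.
  apply: measurableI => //; rewrite (_ : [set z : Cn | d <= hgt z] = ~` [set z : Cn | hgt z < d]).
    exact: measurableC.
  by apply/seteqP; split => z /=; rewrite leNgt => /negP.
have kE : koranyi xi = D1 `|` D2.
  rewrite -setIUr; apply/esym/setIidl => z _ /=; case: (ltP (hgt z) d) => ?; by [left|right].
have md : measurable_fun (D1 `|` D2) (fun z => (F z)%:E).
  rewrite -kE; apply/measurable_EFinP; apply: measurable_funS mF; first exact: measurable_cball.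
  by move=> z [].
rewrite /tent kE ge0_integral_setU//; last 2 first.
- by move=> z; rewrite -kE => -[zb _]; rewrite lee_fin F0.
- by apply/disj_setPS => z [[_ /= a] [_ /= c]]; move: c; rewrite leNgt a.
by rewrite EFinD; exact: leeD.
Qed.

(** Cut at height d = pole xi. Below it pole z >= d / 12 is a constant bound; above it pole z >= h /
    2 leaves the exponent alpha - c q, summable upwards because c > kappa. Both pieces are of order
    d^(alpha + n.+2 - c q). *)
Lemma tent_pole (q alpha c : R) : 0 < q -> 0 < alpha + n.+2%:R -> (alpha + n.+2%:R) / q < c ->
  exists2 C : R, 0 <= C & forall (u : Cn -> R) (xi : Cn), measurable_fun ball u ->
  (forall z, ball z -> 0 <= u z /\ u z <= (pole z)^-1 `^ c) -> S xi -> 0 < pole xi ->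
  (tent (dens q alpha u) xi <= (C * pole xi `^ (alpha + n.+2%:R - c * q))%:E)%E.
Proof.
move=> q0 a0 kc; have c0 : 0 < c by apply: lt_trans kc; rewrite divr_gt0.
have g2 : alpha - c * q + n.+2%:R < 0 by move: kc; rewrite ltr_pdivrMr//; lra.
have K1 := Ksmall_ge0 a0; have K2 := Klarge_ge0 g2.
exists (12 `^ (c * q) * Ksmall (R := R) (n := n) alpha + 2 `^ (c * q) * Klarge (R := R) (n := n) (alpha - c * q)).
  by rewrite addr_ge0// mulr_ge0// powR_ge0.
move=> u xi mu Hu xS d0; set d := pole xi in d0 *.
have inv (x : R) : 0 < x -> (x^-1 `^ c) `^ q = x `^ (- (c * q)).
  by move=> x0; rewrite -powR_inv1 ?(ltW x0)// -!powRrM; congr (_ `^ _); ring.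
have D0 z : ball z -> 0 <= dens q alpha u z by move=> _; exact: dens_ge0.
rewrite mulrDl; apply: (tent_split (d := d)) => //; first exact: measurable_dens.
  have -> : 12 `^ (c * q) * Ksmall (R := R) (n := n) alpha * d `^ (alpha + n.+2%:R - c * q) =
      (d / 12) `^ (- (c * q)) * (Ksmall (R := R) (n := n) alpha * d `^ (alpha + n.+2%:R)).
    rewrite powRD ?(gt_eqF d0) ?implybT// [(d / 12) `^ _]powRM ?(ltW d0)//.
    rewrite -[12^-1 `^ _](_ : 12 `^ (c * q) = _); first by ring.
    by rewrite -[12^-1]powR_inv1// -powRrM mulN1r opprK.
  have mL : measurable [set z : Cn | hgt z < d] by apply: measurable_lt_set; exact: measurable_hgt.
  apply: (koranyi_small_dom xS d0 a0).
  - exact: powR_ge0.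
  - by apply: measurableI => //; exact: measurable_koranyi.
  - by move=> z [].
  - by move=> z [].
  move=> z [zk _]; have zb : ball z by case: zk. 
  split; first exact: dens_ge0.
  apply: ler_wpM2r; first exact: powR_ge0.
  have [u0 u1] := Hu z zb.
  apply: (@le_trans _ _ (((pole z)^-1 `^ c) `^ q)).
    by apply: ge0_ler_powR; rewrite ?nnegrE ?powR_ge0 ?(ltW q0).
  rewrite -(inv (d / 12)); last by rewrite divr_gt0.
  apply: ge0_ler_powR; rewrite ?nnegrE ?powR_ge0 ?(ltW q0)//.
  have pz := pole_gt0 zb.
  apply: ge0_ler_powR; rewrite ?nnegrE ?invr_ge0 ?divr_ge0 ?(ltW pz) ?(ltW d0) ?(ltW c0)//.
  by rewrite lef_pV2 ?posrE ?divr_gt0// ler_pdivrMr// mulrC; exact: koranyi_pole.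
have -> : 2 `^ (c * q) * Klarge (R := R) (n := n) (alpha - c * q) * d `^ (alpha + n.+2%:R - c * q) =
    2 `^ (c * q) * (Klarge (R := R) (n := n) (alpha - c * q) * d `^ (alpha - c * q + n.+2%:R)).
  by rewrite -mulrA addrAC.
apply: (koranyi_large_dom xS d0 g2).
- exact: powR_ge0.
- apply: measurableI; first exact: measurable_koranyi.
  rewrite (_ : [set z : Cn | d <= hgt z] = ~` [set z : Cn | hgt z < d]).
    by apply: measurableC; apply: measurable_lt_set; exact: measurable_hgt.
  by apply/seteqP; split => z /=; rewrite leNgt => /negP.
- by move=> z [].
- by move=> z [].
move=> z [[zb zk] _]; split; first exact: dens_ge0.
have [u0 u1] := Hu z zb; have h0 := hgt_gt0 zb; have pz := pole_gt0 zb.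
rewrite powRD ?(gt_eqF h0) ?implybT// mulrCA /dens mulrC; apply: ler_wpM2l; first exact: powR_ge0.
apply: (@le_trans _ _ (((pole z)^-1 `^ c) `^ q)).
  by apply: ge0_ler_powR; rewrite ?nnegrE ?powR_ge0 ?(ltW q0).
have -> : 2 `^ (c * q) * hgt z `^ (- (c * q)) = ((hgt z / 2)^-1 `^ c) `^ q.
  rewrite inv ?divr_gt0// [RHS]powRM ?(ltW h0)// mulrC; congr (_ * _).
  by rewrite -[2^-1]powR_inv1// -powRrM mulN1r opprK.
apply: ge0_ler_powR; rewrite ?nnegrE ?powR_ge0 ?(ltW q0)//.
apply: ge0_ler_powR; rewrite ?nnegrE ?invr_ge0 ?divr_ge0 ?(ltW pz) ?(ltW h0) ?(ltW c0)//.
by rewrite lef_pV2 ?posrE ?divr_gt0// ler_pdivrMr// mulrC; exact: hgt_le_pole.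
Qed.

(** The bounds by negative powers of [pole xi] are available only where it is positive; the
    exceptional set lies in arbitrarily small caps. *)
Lemma sphere_pole_null : sigma (S `&` [set xi : Cn | pole xi = 0]) = 0%E.
Proof.
set Z := _ `&` _; have mZ : measurable Z.
  apply: measurableI; first exact: measurable_csphere.
  exact: measurable_pole0.
apply/eqP; rewrite eq_le measure_ge0 andbT; apply/lee_addgt0Pr => e e0; rewrite add0e.
have Cu := @Cup_ge1 R n.
pose d := Num.min 1 (e / Cup (R := R) (n := n)).
have d0 : 0 < d by rewrite lt_min ltr01 divr_gt0//; lra.
have d1 : d <= 1 by rewrite ge_min lexx.
have de : Cup (R := R) (n := n) * d <= e.
  have : d <= e / Cup (R := R) (n := n) by rewrite ge_min lexx orbT.
  by rewrite ler_pdivlMr ?(lt_le_trans _ Cu)// mulrC.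
have sub : Z `<=` cap e1 d by move=> x [_ /= x0]; rewrite /cap /= -pole_cdot x0.
apply: le_trans (le_measure _ _ _ sub) _; rewrite ?inE//; first exact: measurable_cap.
apply: le_trans (sphere_cap_le enorm_e1 d0) _; rewrite lee_fin; apply: le_trans de.
rewrite ler_wpM2l//; first lra.
by rewrite exprS ler_piMr ?(ltW d0)// exprn_ile1// ltW.
Qed.

(** Dyadic caps about [e1], starting from 3 since [pole] is below 3 on the sphere; a cap of size r
    has measure O(r^n.+1) and eta is smaller than n.+1. *)
Lemma sphere_pole_int (eta : R) : 0 < eta -> eta < n.+1%:R -> exists2 C : R, 0 <= C &
  (\int[sigma]_(xi in S `\` [set xi : Cn | pole xi = 0%R]) (pole xi `^ (- eta))%:E <= C%:E)%E.
Proof.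
move=> eta0 eta1; pose g := n.+1%:R - eta; have g0 : 0 < g by rewrite subr_gt0.
have Cu := @Cup_ge1 R n.
pose r k : R := 3 * 2^-1 ^+ k; have r0 k : 0 < r k by rewrite mulr_gt0// exprn_gt0.
pose B k : R := (r k / 2) `^ (- eta).
have B0 k : 0 <= B k by exact: powR_ge0.
exists (2 `^ eta * Cup (R := R) (n := n) * ((1 - (2 `^ g)^-1)^-1 * 3 `^ g)).
  have r1 := powR_gt1_base g0.
  rewrite !mulr_ge0 ?powR_ge0 ?invr_ge0 ?subr_ge0 ?(le_trans ler01 Cu)// ltW// invf_lt1//; lra.
set D := S `\` _; have mD : measurable D.
  apply: measurableD; first exact: measurable_csphere.
  exact: measurable_pole0.
pose F k (x : Cn) : \bar R := ((B k)%:E * (\1_(cap e1 (r k)) x)%:E)%E.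
have mF k : measurable_fun D (F k).
  apply: emeasurable_funM; first exact: measurable_cst.
  by apply/measurable_EFinP; apply: measurable_indic; exact: measurable_cap.
have F0 k x : (0 <= F k x)%E by rewrite /F -EFinM lee_fin mulr_ge0.
apply: (@le_trans _ _ (\int[sigma]_(x in D) \sum_(0 <= k <oo) F k x)%E).
  apply: le_ge0_integral => [//|x _|x [xS x0]|x _]; first by rewrite lee_fin powR_ge0.
    have p0 : 0 < pole x by rewrite lt_neqAle cabs_ge0 andbT eq_sym; apply/eqP.
    have p3 : pole x < 3.
      apply: le_lt_trans (cabs_triangle _ _) _; rewrite cabsN cabs1.
      by have := coord_le x ord0; rewrite [enorm x]xS; lra.
    have [k /andP[k1 k2]] := dyadic_down p0 p3.
    apply: le_trans (nneseries_lim_ge k.+1 (fun j _ _ => F0 j x)).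
    rewrite big_nat_recr//=; apply: (@le_trans _ _ (F k x)); last by rewrite leeDr// sume_ge0.
    rewrite /F indicE mem_set ?mule1; last by rewrite /cap /= -pole_cdot.
    rewrite lee_fin /B !powRN lef_pV2 ?posrE ?powR_gt0 ?divr_gt0//.
    by apply: ge0_ler_powR; rewrite ?nnegrE ?divr_ge0 ?(ltW (r0 k)) ?(ltW p0) ?(ltW eta0).
  by apply: nneseries_ge0 => j _ _.
rewrite integral_nneseries//.
apply: (@le_trans _ _ ((2 `^ eta * Cup (R := R) (n := n))%:E * \sum_(0 <= k <oo) (r k `^ g)%:E)%E).
  have cc : 0 <= 2 `^ eta * Cup (R := R) (n := n) by rewrite mulr_ge0 ?powR_ge0//; lra.
  rewrite -nneseriesZl; last by move=> k _; rewrite lee_fin powR_ge0.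
  apply: lee_nneseries => [k _ _|k _]; first by apply: integral_ge0 => x _; exact: F0.
  have mc : measurable_fun D (fun x : Cn => (\1_(cap e1 (r k)) x : R)%:E).
    by apply/measurable_EFinP; apply: measurable_indic; exact: measurable_cap.
  have c0' x : D x -> (0 <= (\1_(cap e1 (r k)) x : R)%:E)%E by move=> _; rewrite lee_fin.
  rewrite (integralZ_ge0 _ mD mc c0' (B0 k)) integral_indic//; last exact: measurable_cap.
  apply: (@le_trans _ _ ((B k)%:E * (Cup (R := R) (n := n) * r k ^+ n.+1)%:E)%E).
    apply: lee_wpmul2l; first by rewrite lee_fin.
    apply: le_trans (sphere_cap_le enorm_e1 (r0 k)).
    apply: le_measure; rewrite ?inE; [apply: measurableI => //; exact: measurable_cap|exact: measurable_cap|].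
    exact: subIsetl.
  rewrite -!EFinM lee_fin le_eqVlt; apply/orP; left; apply/eqP.
  rewrite /B [_ `^ (- eta)]powRM ?(ltW (r0 k))// -[2^-1]powR_inv1// -powRrM mulN1r opprK.
  have -> : r k `^ g = r k `^ (- eta) * r k ^+ n.+1 by rewrite powR_natD// /g addrC.
  by ring.
rewrite [leRHS]EFinM; apply: lee_wpmul2l; first by rewrite lee_fin mulr_ge0 ?powR_ge0//; lra.
by apply: geometric_bound => //; exact: powR_gt1_base.
Qed.

(** The lower bound on c gives the area integral its power growth near the pole, and the upper bound
    makes the power p / q of that growth integrable on the sphere. *)
Lemma pole_tent_int (p q alpha c : R) : 0 < p -> 0 < q -> 0 < alpha + n.+2%:R ->
  (alpha + n.+2%:R) / q < c -> c < n.+1%:R / p + (alpha + n.+2%:R) / q ->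
  forall u : Cn -> R, measurable_fun ball u ->
  (forall z, ball z -> 0 <= u z /\ u z <= (pole z)^-1 `^ c) -> (tent_int p q alpha u < +oo)%E.
Proof.
move=> p0 q0 a0 kc ck u mu Hu; have [C C0 H] := tent_pole q0 a0 kc.
have pq : 0 < p / q by rewrite divr_gt0.
pose eta := (c * q - (alpha + n.+2%:R)) * (p / q).
have eta0 : 0 < eta by rewrite mulr_gt0// subr_gt0 -ltr_pdivrMr.
have eta1 : eta < n.+1%:R.
  have -> : eta = (c - (alpha + n.+2%:R) / q) * p by rewrite /eta; field; rewrite gt_eqF.
  by rewrite -ltr_pdivlMr// ltrBlDr.
have [C' C'0 H'] := sphere_pole_int eta0 eta1.
have mS := @measurable_csphere R n.+1.
have mZ : measurable [set xi : Cn | pole xi = 0].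
  exact: measurable_pole0.
have mT : measurable_fun S (fun x => (tent (dens q alpha u) x `^ (p / q))%E).
  apply: measurable_funTS; apply: (measurableT_comp (@measurable_poweR R (p / q))).
  by apply: measurable_tent; [exact: measurable_dens|move=> z _; exact: dens_ge0].
have N0 : sigma (S `&` [set xi : Cn | pole xi = 0]) = 0%E := sphere_pole_null.
rewrite /tent_int (ge0_negligible_integral (measurableI _ _ mS mZ) mS mT (fun x _ => poweR_ge0 _ _) N0).
have -> : S `\` (S `&` [set xi : Cn | pole xi = 0]) = S `\` [set xi : Cn | pole xi = 0].
  by rewrite setDIr setDv set0U.
set D := S `\` _; have mD : measurable D by exact: measurableD.
have Cp : 0 <= C `^ (p / q) by exact: powR_ge0.
have mP : measurable_fun D (fun x => (pole x `^ (- eta))%:E).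
  apply/measurable_EFinP; apply: measurable_funTS.
  exact: (measurableT_comp (measurable_powR (- eta)) measurable_pole).
apply: (@le_lt_trans _ _ ((C `^ (p / q))%:E * C'%:E)%E); last by rewrite -EFinM ltry.
apply: le_trans (lee_wpmul2l _ H'); last by rewrite lee_fin.
rewrite -(integralZ_ge0 _ mD mP (fun x _ => _) Cp); last by move=> x _; rewrite lee_fin powR_ge0.
apply: le_ge0_integral => [//|x _|x [xS x0]|x _]; first exact: poweR_ge0.
  have px : 0 < pole x by rewrite lt_neqAle cabs_ge0 andbT eq_sym; apply/eqP.
  have t0 : (0 <= tent (dens q alpha u) x)%E by apply: tent_ge0 => z _; exact: dens_ge0.
  apply: le_trans (le_poweR (ltW pq) t0 (H u x mu Hu xS px)) _.
  rewrite poweR_EFin powRM ?powR_ge0// -EFinM lee_fin -powRrM.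
  by rewrite (_ : (alpha + n.+2%:R - c * q) * (p / q) = - eta)// /eta; ring.
by rewrite mule_ge0 ?lee_fin ?powR_ge0.
Qed.

End pole_functions.

Section test_functions.
Context {R : realType} {n : nat}.
Notation Cn := (Cn R n.+1).
Notation ball := (@cball R n.+1).
Implicit Types (p q alpha t s beta c : R) (f : 'rV[cplx R]_n.+1 -> cplx R).

Lemma pole_HT p q alpha c (M : R) f : 0 < p -> 0 < q -> 0 < alpha + n.+2%:R ->
  (alpha + n.+2%:R) / q < c -> c < n.+1%:R / p + (alpha + n.+2%:R) / q -> 0 <= M ->
  holomorphic_ball f -> (forall z, ball z -> cabs (f z) <= M * (pole z)^-1 `^ c) ->
  HT p q alpha f.
Proof.
move=> p0 q0 a0 kc ck M0 hf Hf; apply/(@HTP R n p q alpha f p0); split => //.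
pose u (z : Cn) : R := (pole z)^-1 `^ c.
have mu : measurable_fun ball u.
  apply: measurable_funTS.
  rewrite (_ : u = fun z => pole z `^ (-1 * c)).
    exact: (measurableT_comp (measurable_powR _) measurable_pole).
  by apply/funext => z; rewrite /u powRrM powR_inv1// cabs_ge0.
have u0 z : ball z -> 0 <= u z by move=> _; exact: powR_ge0.
have fu : (tent_int p q alpha u < +oo)%E.
  by apply: (pole_tent_int p0 q0 a0 kc ck) => // z zb; split; [exact: u0|].
have Hb z : ball z -> 0 <= cabs (f z) /\ cabs (f z) <= M * u z `^ 1 + 0 * u z `^ 1.
  by move=> zb; rewrite cabs_ge0 mul0r addr0 powRr1 ?u0//; split=> //; exact: Hf.
apply: le_lt_trans (tent_int_combine alpha p0 q0 ltr01 M0 (lexx 0) mu mu u0 u0 Hb) _.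
rewrite !mulr1; have := tent_int_ge0 p q alpha u; case: tent_int fu => [r _ _||//]; last by rewrite ltxx.
exact: ltry.
Qed.

Lemma HT_growth t s beta f : 0 < t -> 0 < s -> 0 < beta + n.+2%:R -> HT t s beta f ->
  exists2 C : R, 0 <= C & forall z : Cn, ball z ->
    cabs (f z) <= C * hgt z `^ (- (n.+1%:R / t + (beta + n.+2%:R) / s)).
Proof.
move=> t0 s0 b0 /(@HTP R n t s beta f t0)[hf If]; have [C C0 H] := amp_growth (R := R) (n := n) t0 s0 b0.
have If0 := tent_int_ge0 t s beta (fun z : Cn => cabs (f z)).
pose G := fine (tent_int t s beta (fun z : Cn => cabs (f z))).
have HG : (tent_int t s beta (fun z : Cn => cabs (f z)) <= G%:E)%E by rewrite fineK// ge0_fin_numE.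
exists ((C * G) `^ t^-1) => [|z zb]; first exact: powR_ge0.
have := H f G hf HG z zb; rewrite /amp; set k := _ / s; have h0 := hgt_gt0 zb => Hz.
have a0 : 0 <= cabs (f z) := cabs_ge0 _.
have hk : 0 < hgt z `^ (n.+1%:R / t + k) by rewrite powR_gt0.
rewrite powRN ler_pdivlMr//.
have -> : cabs (f z) * hgt z `^ (n.+1%:R / t + k) =
    ((cabs (f z) * hgt z `^ k) `^ t * hgt z ^+ n.+1) `^ t^-1.
  rewrite powRM ?powR_ge0 ?exprn_ge0 ?(ltW h0)// -powRrM divff ?gt_eqF// powRr1 ?mulr_ge0 ?powR_ge0//.
  rewrite -powR_mulrn ?(ltW h0)// -powRrM -mulrA -powRD ?(gt_eqF h0) ?implybT//.
  by rewrite addrC.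
apply: ge0_ler_powR; rewrite ?invr_ge0 ?nnegrE ?(ltW t0)//.
  by rewrite mulr_ge0 ?powR_ge0 ?exprn_ge0 ?(ltW h0).
by apply: le_trans Hz; rewrite mulr_ge0 ?powR_ge0 ?exprn_ge0 ?(ltW h0).
Qed.

(** The function w (1 - z_1)^(-a / 2^j), written with iterated roots so that its exponent can be any
    nonnegative dyadic number. *)
Definition pole_fun (w : cplx R) (j a : nat) (z : 'rV[cplx R]_n.+1) : cplx R :=
  w * (croot j (1 - z 0 ord0))^-1 ^+ a.

Lemma pole_fun_holomorphic w j a : holomorphic_ball (pole_fun w j a).
Proof.
move=> z zb; have z0 := re_coord_lt1 zb.
apply: (@cdiff_coord_differentiable _ _ (fun x => w * (croot j (1 - x))^-1 ^+ a)).
apply: cdiffM; first exact: cdiff_cst.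
have d1 : cdiff (fun x => 1 - x : cplx R) (z 0 ord0).
  apply: cdiffD; first exact: cdiff_cst.
  have -> : -%R = (fun x : cplx R => -1 * x) by apply/funext => x; rewrite mulN1r.
  by apply: cdiffM; [exact: cdiff_cst|exact: cdiff_id].
have d2 := cdiff_comp d1 (cdiff_croot j z0).
have [_ r0] := crootP j z0.
have rn : croot j (1 - z 0 ord0) != 0.
  by rewrite -cabs_gt0; exact: lt_le_trans (cre_le_cabs _).
have d3 := cdiff_comp d2 (cdiffV rn).
have E : ((fun x : cplx R => (x - 0)^-1) \o (croot j \o (fun x : cplx R => 1 - x))) = (fun x => (croot j (1 - x))^-1).
  by apply/funext => x /=; rewrite subr0.
rewrite E in d3; elim: a => [|a IH].
  rewrite (_ : (fun _ => _) = (fun=> 1)); first exact: cdiff_cst.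
  by apply/funext => x; rewrite expr0.
rewrite (_ : (fun _ => _) = (fun x => (croot j (1 - x))^-1 * (croot j (1 - x))^-1 ^+ a)).
  by apply: cdiffM.
by apply/funext => x; rewrite exprS.
Qed.

Lemma cabs_pole_fun w j a (z : Cn) : ball z ->
  cabs (pole_fun w j a z) = cabs w * (pole z)^-1 `^ (a%:R / 2 ^+ j).
Proof.
move=> zb; rewrite /pole_fun cabsM cabsX cabsV; congr (_ * _).
have [rE r0] := crootP j (re_coord_lt1 zb); have x0 := lt_le_trans r0 (cre_le_cabs _).
have -> : pole z = cabs (croot j (1 - z 0 ord0)) ^+ (2 ^ j) by rewrite -cabsX rE.
set x := cabs _ in x0 *; have -> : (x ^+ (2 ^ j))^-1 = x^-1 `^ (2 ^+ j).
  by rewrite -exprVn -natrX powR_mulrn// invr_ge0 ltW.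
rewrite -powRrM mulrCA divff ?mulr1; last first.
  by rewrite gt_eqF// exprn_gt0.
by rewrite powR_mulrn// invr_ge0 ltW.
Qed.

Lemma dyadic_between (x y : R) : 0 <= x -> x < y -> exists j a : nat,
  x < a%:R / 2 ^+ j /\ a%:R / 2 ^+ j < y.
Proof.
move=> x0 xy; have d0 : 0 < y - x by rewrite subr_gt0.
pose j := Num.truncn ((y - x)^-1); exists j, (Num.truncn (2 ^+ j * x)).+1.
have p0 : 0 < 2 ^+ j :> R by exact: exprn_gt0.
rewrite ltr_pdivlMr// ltr_pdivrMr// mulrC truncnS_gt; split=> //.
have t1 : (Num.truncn (2 ^+ j * x))%:R <= 2 ^+ j * x by rewrite truncn_le// mulr_ge0// ltW.
have j1 : (y - x)^-1 < j.+1%:R by exact: truncnS_gt.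
have j2 : j.+1%:R <= 2 ^+ j :> R by rewrite -natrX ler_nat ltn_expl.
have : (y - x)^-1 < 2 ^+ j := lt_le_trans j1 j2.
rewrite -[_^-1]mul1r ltr_pdivrMr// -natr1; nra.
Qed.

End test_functions.

(** * The symbol is a polynomial; the growth bound on its degree *)

Section entire.
Context {R : realType} {n : nat}.
Notation Cn := (Cn R n.+1).
Notation ball := (@cball R n.+1).
Variables (p q alpha t s beta : R) (phi : cplx R -> cplx R).
Hypotheses (p0 : 0 < p) (q0 : 0 < q) (a0 : 0 < alpha + n.+2%:R).
Hypotheses (t0 : 0 < t) (s0 : 0 < s) (b0 : 0 < beta + n.+2%:R).
Hypothesis maps : HT_maps p q alpha t s beta (@superposition R n.+1 phi).
Let k0 := (alpha + n.+2%:R) / q.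
Let K0 := n.+1%:R / p + k0.
Let K1 := n.+1%:R / t + (beta + n.+2%:R) / s.

Let k0_gt0 : 0 < k0. Proof. by rewrite divr_gt0. Qed.
Let k0K0 : k0 < K0. Proof. by rewrite ltrDr divr_gt0. Qed.
Let K1_gt0 : 0 < K1. Proof. by rewrite addr_gt0// divr_gt0. Qed.

Let pole_le2 (z : Cn) : ball z -> pole z <= 2.
Proof.
move=> zb; apply: le_trans (cabs_triangle _ _) _; rewrite cabsN cabs1.
by have := coord_le z ord0; have := ltW (zb : enorm z < 1); lra.
Qed.

Lemma HT_maps_entire (w : cplx R) : cdiff phi w.
Proof.
pose b := cabs w + 1; have w0 := cabs_ge0 w; have b_gt0 : 0 < b by rewrite /b; lra.
pose f (z : 'rV[cplx R]_n.+1) : cplx R := cr b * z 0 ord0.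
have hf : holomorphic_ball f.
  move=> z _; apply: (@cdiff_coord_differentiable _ _ (fun x => cr b * x)).
  by apply: cdiffM; [exact: cdiff_cst|exact: cdiff_id].
have [c [kc cK]] : exists c, k0 < c /\ c < K0 by exists ((k0 + K0) / 2); split; have := k0K0; lra.
have c0 : 0 < c := lt_trans k0_gt0 kc.
have fHT : HT p q alpha f.
  (* A bounded function is dominated by a pole: pole z <= 2, so 1 <= 2^c (pole z)^-c. *)
  apply: (@pole_HT R n p q alpha c (b * 2 `^ c) f p0 q0 a0 kc cK) => //.
    by rewrite mulr_ge0 ?powR_ge0// ltW.
  move=> z zb; have pz := pole_gt0 zb; rewrite /f cabsM cabs_cr ger0_norm ?(ltW b_gt0)// -mulrA.
  apply: ler_wpM2l; first exact: ltW.
  apply: (@le_trans _ _ 1); first by apply: le_trans (coord_le z ord0) _; exact: ltW.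
  rewrite -powRM ?invr_ge0 ?(ltW pz)//; apply: powR_ge1; last exact: ltW.
  by rewrite ler_pdivlMr// mul1r pole_le2.
have [hphi _] := maps fHT.
pose k := w / cr b; have bn : cr b != 0 by rewrite -cabs_eq0 cabs_cr normr_eq0 gt_eqF.
have kb : ball (k *: e1 : Cn).
  rewrite /cball /= enormZ [enorm e1]enorm_e1 mulr1 cabsM cabsV cabs_cr ger0_norm ?(ltW b_gt0)//.
  by rewrite ltr_pdivrMr// mul1r /b; lra.
have d1 : cdiff (fun x : cplx R => superposition phi f (0 + x *: e1)) k.
  by apply: differentiable_line; rewrite add0r; exact: hphi.
have E : (fun x : cplx R => superposition phi f (0 + x *: e1)) = (fun x => phi (cr b * x)).
  by apply/funext => x; rewrite /superposition /f /= add0r !mxE eqxx mulr1.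
rewrite E in d1.
have d2 : cdiff (fun x : cplx R => (cr b)^-1 * x) w.
  by apply: cdiffM; [exact: cdiff_cst|exact: cdiff_id].
have kE : (cr b)^-1 * w = k by rewrite mulrC.
rewrite -kE in d1; have := cdiff_comp d2 d1.
by rewrite (_ : _ \o _ = phi)//; apply/funext => x /=; rewrite mulVKf.
Qed.

Let pole_fun_HT w j a : k0 < a%:R / 2 ^+ j -> a%:R / 2 ^+ j < K0 -> HT p q alpha (pole_fun (n := n) w j a).
Proof.
move=> h1 h2; apply: (pole_HT p0 q0 a0 h1 h2 (cabs_ge0 w)).
  exact: pole_fun_holomorphic.
by move=> z zb; rewrite cabs_pole_fun.
Qed.

Let growth w j a : k0 < a%:R / 2 ^+ j -> a%:R / 2 ^+ j < K0 ->
  exists2 C : R, 0 <= C & forall z : Cn, ball z -> cabs (phi (pole_fun w j a z)) <= C * hgt z `^ (- K1).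
Proof. by move=> h1 h2; apply: HT_growth => //; exact: maps (pole_fun_HT w h1 h2). Qed.

(** The hypothesis gives one growth constant per test function. A common constant exists for
    finitely many coefficients w, so the values needed below must be reached with a finite list. *)
Let growth_seq (L : seq (cplx R)) j a : k0 < a%:R / 2 ^+ j -> a%:R / 2 ^+ j < K0 ->
  exists2 C : R, 0 <= C & forall w, w \in L -> forall z : Cn, ball z ->
    cabs (phi (pole_fun w j a z)) <= C * hgt z `^ (- K1).
Proof.
move=> h1 h2; elim: L => [|w L [C C0 IH]]; first by exists 0.
have [D D0 HD] := growth w h1 h2; exists (C + D); first exact: addr_ge0.
move=> u; rewrite inE => /orP[/eqP->|uL] z zb; rewrite mulrDl.
  by apply: le_trans (HD z zb) _; rewrite lerDr mulr_ge0 ?powR_ge0.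
by apply: le_trans (IH u uL z zb) _; rewrite lerDl mulr_ge0 ?powR_ge0.
Qed.

Lemma unity_roots (N : nat) : (0 < N)%N -> exists L : seq (cplx R), forall w, w ^+ N = 1 -> w \in L.
Proof.
move=> N0; have [L HL] := closed_field_poly_normal ('X^N - 1 : {poly cplx R}).
exists L => w wN; rewrite -root_prod_XsubC.
have : root ('X^N - 1 : {poly cplx R}) w by rewrite /root !hornerE wN subrr.
rewrite HL rootZ// lead_coef_eq0 -size_poly_gt0 size_XnsubC//.
Qed.

(** A quarter turn brings v into the sector where |Im| <= Re, and there the modulus is at most twice
    the real part. Using fourth roots of unity keeps the list of test functions finite. *)
Lemma rotate_right (v : cplx R) : exists u : cplx R,
  [/\ u ^+ 4 = 1, cabs u = 1 & cabs v <= 2 * cre (u * v)].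
Proof.
have h := cabs_le_re_im v.
have [c1|c1] := leP `|cim v| `|cre v|.
  have [c2|c2] := leP 0 (cre v).
    exists 1; rewrite expr1n cabs1 mul1r; split=> //; rewrite (ger0_norm c2) in c1 h; lra.
  exists (-1); rewrite cabsN cabs1 mulN1r cE; split=> //; first by ring.
  rewrite (ltr0_norm c2) in c1 h; lra.
have [c2|c2] := leP 0 (cim v).
  exists (mkc 0 (-1)); split.
  - by apply: ceq; rewrite !exprS expr0 !cE /=; ring.
  - by rewrite cabs_def /= expr0n/= add0r sqrrN expr1n sqrtr1.
  by rewrite cE /=; rewrite (ger0_norm c2) in c1 h; lra.
exists (mkc 0 1); split.
- by apply: ceq; rewrite !exprS expr0 !cE /=; ring.
- by rewrite cabs_def /= expr0n/= add0r expr1n sqrtr1.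
by rewrite cE /=; rewrite (ltr0_norm c2) in c1 h; lra.
Qed.

(** Every large w is a value eta^a (1 - z_1)^(-a / 2^j) with eta a root of unity of order dividing 4
    * 2^j, at a point z of height comparable to |1 - z_1|. The growth bound at z then reads |phi(w)|
    <= C |w|^(2^j (K + 1)). *)
Lemma HT_maps_polynomial : exists P : {poly cplx R}, forall z, phi z = P.[z].
Proof.
have [j [a [h1 h2]]] := dyadic_between (ltW k0_gt0) k0K0.
have a_gt0 : (0 < a)%N.
  by case: a h1 {h2} => //; rewrite mul0r => /(lt_trans k0_gt0); rewrite ltxx.
have N_gt0 : (0 < 2 ^ j * 4)%N by rewrite muln_gt0 expn_gt0.
have [L HL] := unity_roots N_gt0.
have [C C0 HC] := growth_seq [seq w ^+ a | w <- L] h1 h2.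
pose K := Num.truncn K1; have K1K : K1 <= (a * K.+1)%:R.
  apply: (@le_trans _ _ K.+1%:R); first exact/ltW/truncnS_gt.
  by rewrite ler_nat leq_pmull.
apply: (@liouville_poly R (2 ^ j * K.+1) phi [::]).
- by move=> z; apply: cdiff_cvg; exact: HT_maps_entire.
- by move=> z _; exact: HT_maps_entire.
exists (C * 2 `^ K1), (2 ^+ a) => w wM.
have w1 : 1 <= cabs w by apply: le_trans wM; rewrite exprn_ege1// ler1n.
have wn : w != 0 by rewrite -cabs_gt0; lra.
(* With mu^a = 1 / w, the number v = u mu^(2^j) is turned into the right half-plane by u and its
   root rho satisfies (rho / mu)^(2^j) = u, a fourth root of unity. *)
pose mu := a.-root (w^-1); have muE : mu ^+ a = w^-1 by rewrite rootCK.
have [u [u4 u1 uv]] := rotate_right (mu ^+ (2 ^ j)).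
set v := u * _ in uv.
have cv : cabs v = cabs mu ^+ (2 ^ j) by rewrite cabsM u1 mul1r cabsX.
have cmu : cabs mu ^+ a = (cabs w)^-1 by rewrite -cabsX muE cabsV.
have mu_le : cabs mu <= 2^-1.
  rewrite -(ler_pXn2r a_gt0) ?nnegrE ?cabs_ge0 ?invr_ge0 ?ler0n// cmu exprVn.
  by rewrite lef_pV2 ?posrE ?exprn_gt0//; exact: lt_le_trans w1.
have mu_gt0 : 0 < cabs mu.
  rewrite cabs_gt0; apply/eqP => m0; move: muE; rewrite m0 expr0n (gtn_eqF a_gt0) => /eqP.
  by rewrite eq_sym invr_eq0 (negPf wn).
have v_le : cabs v <= 2^-1.
  apply: le_trans (mu_le); rewrite cv -[leRHS]expr1; apply: ler_wiXn2l; rewrite ?expn_gt0 ?cabs_ge0//.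
  by apply: le_trans (mu_le) _; atom_lra.
have v_gt0 : 0 < cabs v by rewrite cv exprn_gt0.
have rev : 0 < cre v by move: uv; rewrite cabsX -cv; atom_lra.
have uv' : cabs v <= 2 * cre v by move: uv; rewrite cabsX -cv.
have [rE r0] := crootP j rev; set rho := croot j v in rE r0.
have rn : rho != 0 by rewrite -cabs_gt0; exact: lt_le_trans (cre_le_cabs _).
have mun : mu != 0 by rewrite -cabs_gt0.
pose eta := rho / mu.
have etaL : eta ^+ a \in [seq w ^+ a | w <- L].
  apply: map_f; apply: HL; rewrite exprM expr_div_n rE /v mulfK ?u4//.
  by rewrite expf_neq0.
(* At this point 1 - z_1 = v, so the test function with coefficient eta^a equals eta^a rho^-a =
   mu^-a = w. Its height is 2 Re v - |v|^2, at least |v| / 2. *)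
pose z : Cn := (1 - v) *: e1.
have z0 : z 0 ord0 = 1 - v by rewrite !mxE eqxx mulr1.
have nz : enorm z ^+ 2 = 1 - 2 * cre v + cabs v ^+ 2.
  by rewrite enormZ [enorm e1]enorm_e1 mulr1 !cabs2 !cE; ring.
have hz : hgt z = 2 * cre v - cabs v ^+ 2 by rewrite /hgt nz; ring.
have hv : cabs v / 2 <= hgt z by rewrite hz; atom_nra.
have zb : ball z.
  rewrite /cball /= -(@ltr_sqr R) ?nnegrE ?enorm_ge0// expr1n -subr_gt0 -/(hgt z).
  by apply: lt_le_trans (hv); rewrite divr_gt0.
have fz : pole_fun (eta ^+ a) j a z = w.
  rewrite /pole_fun z0 opprB addrCA subrr addr0 -/rho -exprMn /eta mulrAC divff// mul1r.
  by rewrite exprVn muE invrK.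
have := HC _ etaL z zb; rewrite fz => /le_trans; apply; rewrite -mulrA.
apply: ler_wpM2l => //; apply: (@le_trans _ _ ((cabs v / 2) `^ (- K1))).
  rewrite !powRN lef_pV2 ?posrE ?powR_gt0 ?divr_gt0//; last apply: lt_le_trans (hv); rewrite ?divr_gt0//.
  apply: ge0_ler_powR; rewrite ?nnegrE ?(ltW K1_gt0) ?divr_ge0 ?(ltW v_gt0)//.
  by apply: le_trans hv; rewrite divr_ge0// ltW.
have -> : (cabs v / 2) `^ (- K1) = 2 `^ K1 * (cabs v)^-1 `^ K1.
  rewrite -powRM ?invr_ge0 ?(ltW v_gt0)// -[X in _ = X `^ _]invf_div -[(_ / 2)^-1]powR_inv1 ?divr_ge0 ?(ltW v_gt0)//.
  by rewrite -powRrM mulN1r.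
apply: ler_wpM2l; first exact: powR_ge0.
have vi : 1 <= (cabs v)^-1 by rewrite -[leLHS]invr1 lef_pV2 ?posrE//; atom_lra.
apply: (@le_trans _ _ ((cabs v)^-1 `^ (a * K.+1)%:R)).
  exact: ler_powR.
rewrite powR_mulrn ?invr_ge0 ?(ltW v_gt0)// cv -exprVn -exprM.
have -> : (2 ^ j * (a * K.+1) = a * (2 ^ j * K.+1))%N by rewrite mulnCA.
rewrite exprM exprVn cmu invrK; apply: lerXn2r; rewrite ?nnegrE; atom_lra.
Qed.

(** If N K0 > K1, some dyadic c < K0 still has c N > K1. At z = (1 - x) e_1 the test function has
    modulus x^-c, and c1 x^(-c N) <= C x^(-K1) fails as x tends to 0. *)
Lemma HT_maps_degree (P : {poly cplx R}) : (forall z, phi z = P.[z]) ->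
  ((size P).-1)%:R * K0 <= K1.
Proof.
move=> HP; have [->|P0] := eqVneq P 0; first by rewrite size_poly0 mul0r ltW.
have [c1 [M [c10 M0 Hc]]] := horner_ge P0; set N := (size P).-1 in Hc *.
rewrite leNgt; apply/negP => NK.
have N0 : 0 < N%:R :> R by rewrite -(pmulr_lgt0 _ (lt_trans k0_gt0 k0K0)); exact: lt_trans NK.
have m0 : Num.max k0 (K1 / N%:R) < K0 by rewrite gt_max k0K0/= ltr_pdivrMr// mulrC.
have mk0 : 0 <= Num.max k0 (K1 / N%:R) by rewrite le_max (ltW k0_gt0).
have [j [a []]] := dyadic_between mk0 m0; rewrite gt_max => /andP[h1 h3] h2.
set c := a%:R / 2 ^+ j in h1 h2 h3.
have c0 : 0 < c := lt_trans k0_gt0 h1.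
have d0 : 0 < c * N%:R - K1 by rewrite subr_gt0 -ltr_pdivrMr.
have [C C0 HC] := growth 1 h1 h2.
have key (x : R) : 0 < x -> x <= 2^-1 -> M <= x^-1 `^ c -> c1 <= C * x `^ (c * N%:R - K1).
  move=> x0 x1 xM; pose z : Cn := cr (1 - x) *: e1.
  have z0 : z 0 ord0 = cr (1 - x) by rewrite !mxE eqxx mulr1.
  have nz : enorm z = 1 - x.
    by rewrite enormZ [enorm e1]enorm_e1 mulr1 cabs_cr ger0_norm//; atom_lra.
  have zb : ball z by rewrite /cball /= nz; atom_lra.
  have pz : pole z = x by rewrite /pole z0 -cr1 -crB cabs_cr opprB addrCA subrr addr0 gtr0_norm.
  have hx : x <= hgt z by rewrite /hgt nz; atom_nra.
  have fz : cabs (pole_fun 1 j a z) = x^-1 `^ c by rewrite cabs_pole_fun// cabs1 mul1r pz.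
  have := HC z zb; rewrite HP => H1.
  have H2 : c1 * x^-1 `^ c ^+ N <= C * x `^ (- K1).
    apply: (@le_trans _ _ (cabs P.[pole_fun 1 j a z])); first by rewrite -fz; apply: Hc; rewrite fz.
    apply: le_trans H1 _; apply: ler_wpM2l => //.
    rewrite !powRN lef_pV2 ?posrE ?powR_gt0 ?(lt_le_trans x0 hx)//.
    by apply: ge0_ler_powR; rewrite ?nnegrE ?(ltW K1_gt0) ?(ltW x0) ?(le_trans (ltW x0) hx).
  have xc : 0 < x `^ (c * N%:R) by rewrite powR_gt0.
  rewrite powRD ?(gt_eqF x0) ?implybT// mulrCA mulrC -ler_pdivrMr//.
  have E : x^-1 `^ c ^+ N = (x `^ (c * N%:R))^-1; last by rewrite E in H2.
  by rewrite -powR_mulrn ?powR_ge0// -powRrM -powR_inv1 ?(ltW x0)// -powRrM mulN1r powRN.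
pose D := C + 1; have D0 : 0 < D by rewrite /D; atom_lra.
pose x1 := (c1 / (2 * D)) `^ (c * N%:R - K1)^-1.
pose x2 := (M + 1)^-1 `^ c^-1.
have M1 : 0 < M + 1 by atom_lra.
have x10 : 0 < x1 by rewrite powR_gt0// divr_gt0// mulr_gt0.
have x20 : 0 < x2 by rewrite powR_gt0// invr_gt0.
pose x := Num.min 2^-1 (Num.min x1 x2).
have x0 : 0 < x by rewrite !lt_min invr_gt0 ltr0n x10.
have xx1 : x <= x1 by rewrite !ge_min lexx orbT.
have xx2 : x <= x2 by rewrite !ge_min lexx !orbT.
have := key x x0; rewrite ge_min lexx /= => /(_ isT).
have Mx : M <= x^-1 `^ c.
  apply: (@le_trans _ _ (x2^-1 `^ c)).
    rewrite /x2 -powR_inv1 ?powR_ge0// -!powRrM mulrCA mulVf ?gt_eqF// mulr1.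
    by rewrite powR_inv1 ?invr_ge0 ?(ltW M1)// invrK; atom_lra.
  apply: ge0_ler_powR; rewrite ?nnegrE ?invr_ge0 ?(ltW c0) ?(ltW x0) ?(ltW x20)//.
  by rewrite lef_pV2 ?posrE.
move=> /(_ Mx).
have : x `^ (c * N%:R - K1) <= c1 / (2 * D).
  apply: (@le_trans _ _ (x1 `^ (c * N%:R - K1))).
    by apply: ge0_ler_powR; rewrite ?nnegrE ?(ltW x0) ?(ltW x10) ?(ltW d0).
  by rewrite /x1 -powRrM mulVf ?gt_eqF// powRr1// divr_ge0 ?(ltW c10)// mulr_ge0// ltW.
move=> h; apply/negP; rewrite -ltNge; apply: (@le_lt_trans _ _ (C * (c1 / (2 * D)))).
  exact: ler_wpM2l.
have -> : C * (c1 / (2 * D)) = c1 * (C / (2 * D)) by ring.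
by rewrite -[ltRHS]mulr1 ltr_pM2l// ltr_pdivrMr ?mulr_gt0// /D; atom_lra.
Qed.

End entire.
(** * Necessity: lacunary series *)

Section gaussian_sums.
Context {R : realType}.
Implicit Types (c r x : R) (i j K : nat).

Definition ndist i j : nat := ((i - j) + (j - i))%N.

(** Induction on K against [T], which exceeds (1 - r) times the partial sum by exactly r^(j + 1). *)
Lemma geometric_sum_away r j K : 0 <= r -> r < 1 ->
  \sum_(i < K | (i : nat) != j) r ^+ ndist i j <= 2 * r / (1 - r).
Proof.
move=> r0 r1; have d0 : 0 < 1 - r by rewrite subr_gt0.
pose T (k : nat) : R := if (k <= j)%N then r * r ^+ (j - k) else 2 * r - r ^+ (k - j).
suff H : \sum_(i < K | (i : nat) != j) r ^+ ndist i j * (1 - r) <= T K.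
  rewrite ler_pdivlMr// mulr_suml; apply: (le_trans H); rewrite /T; case: ifP => _.
    have : r ^+ (j - K) <= 1 by rewrite exprn_ile1// ltW.
    nra.
  by rewrite gerBl exprn_ge0.
elim: K => [|K IH].
  by rewrite big_ord0 /T leq0n mulr_ge0 ?exprn_ge0.
rewrite big_mkcond big_ord_recr /= -big_mkcond /=.
suff st : (if K != j then r ^+ ndist K j * (1 - r) else 0) <= T K.+1 - T K.
  by apply: le_trans (lerD IH st) _; rewrite addrC subrK.
rewrite /T /ndist; case: (ltngtP K j) => Kj /=.
- have -> : (K - j = 0)%N by lia.
  have -> : (j - K = (j - K.+1).+1)%N by lia.
  by rewrite add0n exprS; nra.
- have -> : (j - K = 0)%N by lia.
  have -> : (K.+1 - j = (K - j).+1)%N by lia.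
  by rewrite addn0 exprS; nra.
by rewrite Kj subnn subSnn expr0 expr1; lra.
Qed.

(** j is the nearest natural number: for i != j the distance |x - i| is at least 1/2, so that |i -
    j| <= 2 |x - i|. *)
Lemma near_nat x : exists j, forall i, (ndist i j)%:R / 2 <= `|x - i%:R|.
Proof.
have [x0|x0] := leP 0 x; last first.
  exists 0%N => i; rewrite /ndist subn0 sub0n addn0 ltr0_norm ?opprB; last by have := ler0n R i; lra.
  by have := ler0n R i; lra.
pose t := Num.truncn x; have /andP[t1 t2] : t%:R <= x < t.+1%:R by rewrite /t truncn_le x0 truncnS_gt.
rewrite -natr1 in t2.
have [h|h] := leP (x - t%:R) 2^-1.
  exists t => i; rewrite /ndist; case: (leqP i t) => it.
    rewrite (_ : i - t = 0)%N ?add0n; last by lia.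
    rewrite natrB//; have := ler_norm (x - i%:R); have : i%:R <= t%:R :> R by rewrite ler_nat.
    lra.
  rewrite (_ : t - i = 0)%N ?addn0; last by lia.
  rewrite natrB ?(ltnW it)// distrC; have := ler_norm (i%:R - x).
  have : t.+1%:R <= i%:R :> R by rewrite ler_nat.
  by rewrite -natr1; lra.
exists t.+1 => i; rewrite /ndist; case: (leqP i t) => it.
  rewrite (_ : i - t.+1 = 0)%N ?add0n; last by lia.
  rewrite natrB ?(leqW it)// -natr1; have := ler_norm (x - i%:R); have : i%:R <= t%:R :> R by rewrite ler_nat.
  lra.
rewrite (_ : t.+1 - i = 0)%N ?addn0; last by lia.
rewrite natrB// distrC; have := ler_norm (i%:R - x).
have : t.+1%:R <= i%:R :> R by rewrite ler_nat.
by rewrite -natr1; lra.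
Qed.

Lemma near_natW x j : `|x - j%:R| <= 2^-1 -> forall i, (ndist i j)%:R / 2 <= `|x - i%:R|.
Proof.
move=> xj i; have [->|ij] := eqVneq i j; first by rewrite /ndist subnn mul0r normr_ge0.
have d1 : 1 <= (ndist i j)%:R :> R by rewrite ler1n /ndist; lia.
have : (ndist i j)%:R <= `|x - i%:R| + `|x - j%:R|.
  rewrite addrC [X in X <= _](_ : _ = `|j%:R - i%:R :> R|).
    by apply: le_trans (ler_distD x _ _) _; rewrite (distrC j%:R).
  rewrite /ndist; case: (leqP i j) => h.
    rewrite (_ : i - j = 0)%N ?add0n ?natrB//; last by lia.
    by rewrite ger0_norm// subr_ge0 ler_nat.
  rewrite (_ : j - i = 0)%N ?addn0 ?natrB ?(ltnW h)//; last by lia.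
  by rewrite distrC ger0_norm// subr_ge0 ler_nat ltnW.
lra.
Qed.

Definition gauss c x (i : nat) : R := expR (- (c * (x - i%:R) ^+ 2)).

Lemma gauss_ge0 c x i : 0 <= gauss c x i. Proof. exact: expR_ge0. Qed.

(** For d = |i - j| >= 1 the square (x - i)^2 is at least d^2 / 4 >= d / 4, so the Gaussian sum is
    dominated by a geometric one of ratio exp(- c / 4). *)
Lemma gauss_sum_away c x j K : 0 < c -> (forall i, (ndist i j)%:R / 2 <= `|x - i%:R|) ->
  \sum_(i < K | (i : nat) != j) gauss c x i <= 2 * expR (- c / 4) / (1 - expR (- c / 4)).
Proof.
move=> c0 H; have r1 : expR (- c / 4) < 1 by rewrite -[ltRHS]expR0 ltr_expR; lra.
apply: le_trans (geometric_sum_away j K (expR_ge0 _) r1).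
apply: ler_sum => i ij; rewrite /gauss -expRM_natl ler_expR.
have d1 : 1 <= (ndist i j)%:R :> R by rewrite ler1n /ndist; lia.
have := H i; rewrite -real_normK ?num_real//.
move: (ndist i j)%:R `|_| d1 => d y d1 dy.
have h : d / 4 <= y ^+ 2 by nra.
have := ler_wpM2l (ltW c0) h; lra.
Qed.

Definition gauss_tail c : R := 2 * expR (- c / 4) / (1 - expR (- c / 4)).

Lemma gauss_sum c x K : 0 < c -> gauss_tail c <= 1 -> \sum_(i < K) gauss c x i <= 2.
Proof.
move=> c0 c1; have [j Hj] := near_nat x; have h := le_trans (gauss_sum_away K c0 Hj) c1.
have e1 i : gauss c x i <= 1.
  by rewrite -[leRHS]expR0 ler_expR oppr_le0 mulr_ge0 ?(ltW c0)// sqr_ge0.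
have [jK|jK] := ltnP j K.
  rewrite (bigD1 (Ordinal jK))//=; have := e1 j.
  rewrite [X in _ + X](eq_bigl (fun i : 'I_K => (i : nat) != j))//; lra.
rewrite (eq_bigl (fun i : 'I_K => (i : nat) != j)); first by apply: le_trans h _; rewrite ler1n.
by move=> i; rewrite neq_ltn (leq_trans (ltn_ord i) jK).
Qed.

(** The sum over the lattice of a product over coordinates is the product of the one-dimensional
    sums, each at most 2. *)
Lemma gauss_lattice_sum (I : finType) c (x : I -> R) K : 0 < c -> gauss_tail c <= 1 ->
  \sum_(g : {ffun I -> 'I_K}) \prod_k gauss c (x k) (g k) <= 2 ^+ #|I|.
Proof.
move=> c0 c1; rewrite -(bigA_distr_bigA (fun k (i : 'I_K) => gauss c (x k) i)).
rewrite -[leRHS]prodr_const; apply: ler_prod => k _; rewrite gauss_sum// sumr_ge0// => i _.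
exact: gauss_ge0.
Qed.

(** A lattice point other than g0 differs from it in some coordinate k. Summing over k, the k-th
    factor is only a tail and the other factors are at most 2. *)
Lemma gauss_lattice_away (I : finType) c (x : I -> R) K (g0 : {ffun I -> 'I_K}) : 0 < c ->
  gauss_tail c <= 1 -> (forall k, `|x k - (g0 k)%:R| <= 2^-1) ->
  \sum_(g | g != g0) \prod_k gauss c (x k) (g k) <= #|I|%:R * (gauss_tail c * 2 ^+ #|I|).
Proof.
move=> c0 c1 x0.
(* The weight with the term of g0 removed in the coordinate k; the lattice sum still factorises. *)
pose E (k : I) (j : I) (i : 'I_K) : R := if (j == k) && (i == g0 k) then 0 else gauss c (x j) i.
have E0 (k j : I) (i : 'I_K) : 0 <= E k j i by rewrite /E; case: ifP => _; rewrite ?gauss_ge0.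
apply: (@le_trans _ _ (\sum_(g : {ffun I -> 'I_K}) \sum_k \prod_j E k j (g j))).
  rewrite big_mkcond /=; apply: ler_sum => g _; case: ifP => [gg|_]; last first.
    by apply: sumr_ge0 => k _; apply: prodr_ge0 => j _.
  have [k gk] : exists k, g k != g0 k.
    by apply/existsP; rewrite -negb_forall; apply: contra gg => /forallP h; apply/eqP/ffunP => k; exact/eqP.
  rewrite [leRHS](bigD1 k)//= -[leLHS]addr0; apply: lerD; last first.
    by apply: sumr_ge0 => k' _; apply: prodr_ge0 => j _.
  rewrite le_eqVlt; apply/orP; left; apply/eqP; apply: eq_bigr => j _; rewrite /E.
  by case: eqVneq => //= ->; rewrite (negPf gk).
rewrite exchange_big /=; apply: (@le_trans _ _ (\sum_(k : I) gauss_tail c * 2 ^+ #|I|)); last first.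
  by rewrite sumr_const -[_ *+ _]mulr_natl.
apply: ler_sum => k _; rewrite -(bigA_distr_bigA (E k)) (bigD1 k)//=.
have t0 : 0 <= gauss_tail c.
  rewrite divr_ge0 ?mulr_ge0 ?expR_ge0// subr_ge0 -[leRHS]expR0 ler_expR; lra.
apply: ler_pM; rewrite ?prodr_ge0 ?sumr_ge0//.
- by move=> j _; apply: sumr_ge0.
- apply: le_trans (gauss_sum_away K c0 (near_natW (x0 k))); rewrite [leRHS]big_mkcond /=.
  by apply: ler_sum => i _; rewrite /E eqxx -(inj_eq val_inj) /=; case: eqP.
apply: (@le_trans _ _ (\prod_(j | j != k) 2)).
  apply: ler_prod => j jk; rewrite sumr_ge0//=.
  by under eq_bigr do rewrite /E (negPf jk) /=; exact: gauss_sum.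
rewrite prodr_const; apply: ler_weXn2l; first by rewrite ler1n.
exact: max_card.
Qed.

End gaussian_sums.

(** * Sums of peaking powers over a lattice of directions *)

Section peak_sums.
Context {R : realType} {n : nat}.
Notation Cn := (Cn R n.+1).
Notation ball := (@cball R n.+1).
Notation I := ('I_n * bool)%type.

(** (2 l + 1)^2 points per complex direction are at most 9 M for M = (A l)^2; the number of peaks is
    thus polynomial in the exponent. *)
Lemma odd_square_le (A l : nat) : (0 < A)%N -> (0 < l)%N -> (l.*2.+1 ^ 2 <= 9 * (A * l) ^ 2)%N.
Proof.
move=> A0 l0; have h := leq_pmull l A0.
have -> : (9 * (A * l) ^ 2 = (3 * (A * l)) ^ 2)%N by rewrite [RHS]expnMn.
by rewrite leq_sqr; move: (A * l)%N h => m; lia.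
Qed.

Lemma expR_beats_power (c : R) (k : nat) : 0 < c -> exists2 C : R, 0 < C &
  forall x : R, 0 <= x -> x ^+ k * expR (- (c * x)) <= C.
Proof.
move=> c0; pose d := k.+1%:R / c; have d0 : 0 < d by rewrite divr_gt0.
exists (d ^+ k) => [|x x0]; first exact: exprn_gt0.
have h : x <= d * expR (c * x / k.+1%:R).
  rewrite mulrC -ler_pdivrMr//; apply: le_trans (expR_ge1Dx _).
  have -> : x / d = c * x / k.+1%:R by rewrite /d invf_div mulrCA mulrA.
  by rewrite lerDr.
rewrite expRN ler_pdivrMr ?expR_gt0//; apply: (@le_trans _ _ (d ^+ k * expR (c * x / k.+1%:R) ^+ k)).
  by rewrite -exprMn; apply: lerXn2r; rewrite // nnegrE// (le_trans x0 h).
apply: ler_wpM2l; first by rewrite exprn_ge0// ltW.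
rewrite -expRM_natl ler_expR mulrCA ler_piMr ?mulr_ge0 ?(ltW c0)//.
by rewrite ler_pdivrMr// mul1r ler_nat.
Qed.

Lemma bernoulli (x : R) k : 0 <= x -> x <= 1 -> 1 - k%:R * x <= (1 - x) ^+ k.
Proof.
move=> x0 x1; elim: k => [|k IH]; first by rewrite mul0r subr0.
have h : 0 <= k%:R :> R := ler0n R k.
rewrite exprS -natr1; have := ler_wpM2l (_ : 0 <= 1 - x) IH; rewrite subr_ge0 => /(_ x1).
have := mulr_ge0 h (sqr_ge0 x); rewrite expr2.
by move: (_ ^+ k) => y; lra.
Qed.

Lemma perp_dist_le (z e : 'rV[cplx R]_n.+1) (k : cplx R) : enorm e = 1 ->
  enorm z ^+ 2 - cabs (cdot z e) ^+ 2 <= enorm (z - k *: e) ^+ 2.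
Proof.
move=> e1; rewrite enormB2 enormZ e1 mulr1 cdotZr.
have h := cre_le_cabs (k^* * cdot z e); rewrite cabsM cabsJ in h.
have := sqr_ge0 (cabs k - cabs (cdot z e)); rewrite sqrrB.
lra.
Qed.

(** Let w be the component of z orthogonal to b. As b_1 = 1, the vector z - z_1 b equals w - w_1 b,
    of norm at most |w| (1 + |b|) <= 2 |b| |w|. *)
Lemma perp_dist_ge (z b : 'rV[cplx R]_n.+1) : b 0 ord0 = 1 ->
  enorm (z - z 0 ord0 *: b) ^+ 2 <=
  4 * enorm b ^+ 2 * (enorm z ^+ 2 - cabs (cdot z (cr (enorm b)^-1 *: b)) ^+ 2).
Proof.
move=> b0; set e := cr _ *: b.
have b1 : 1 <= enorm b by have := coord_le b ord0; rewrite b0 cabs1.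
have bn : 0 < enorm b by lra.
have e1 : enorm e = 1.
  by rewrite enormZ cabs_cr ger0_norm ?invr_ge0 ?(ltW bn)// mulVf// gt_eqF.
rewrite -(enorm_perp z e1); set w := z - cdot z e *: e.
have -> : z - z 0 ord0 *: b = w - w 0 ord0 *: b.
  rewrite /w !mxE b0 mulr1 scalerBl opprB addrA -[RHS]addrA -[RHS]addrA; congr (_ + _).
  by rewrite /e scalerA addrA addNr add0r.
have w0 := enorm_ge0 w; have ww := coord_le w ord0; have wc := cabs_ge0 (w 0 ord0).
have t : enorm (w - w 0 ord0 *: b) <= enorm w * (2 * enorm b).
  apply: le_trans (enorm_triangle _ _) _; rewrite enormN enormZ.
  have := ler_wpM2r (ltW bn) ww; nra.
have t0 := enorm_ge0 (w - w 0 ord0 *: b).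
have : enorm (w - w 0 ord0 *: b) ^+ 2 <= (enorm w * (2 * enorm b)) ^+ 2.
  by apply: lerXn2r; rewrite ?nnegrE ?mulr_ge0 ?(ltW bn).
by move=> h; apply: (le_trans h); rewrite !exprMn; atom_lra.
Qed.

(** The index set ['I_n * bool] enumerates the 2 n real coordinates, [true] standing for imaginary
    parts. *)
Definition ccoord (w : cplx R) (b : bool) : R := if b then cim w else cre w.

Lemma cabs2_ccoord (w : cplx R) : cabs w ^+ 2 = \sum_b ccoord w b ^+ 2.
Proof. by rewrite big_bool cabs2 addrC. Qed.

Lemma ccoordB (w z : cplx R) b : ccoord (w - z) b = ccoord w b - ccoord z b.
Proof. by case: b; rewrite /ccoord !cE. Qed.

Lemma ccoord_le (w : cplx R) b : `|ccoord w b| <= cabs w.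
Proof. by case: b; [exact: cim_le|exact: cre_le]. Qed.

(* The points (1, v) with v in a square lattice of mesh 1/l in the cube of side 2 centred at 0,
   translated by a multiple sh of 1/(l (Q + 1)). *)
Definition lattice_coord (l Q i s : nat) : R := (i%:R + s%:R / Q.+1%:R - l%:R) / l%:R.

Lemma lattice_coord_le l Q i s : (0 < l)%N -> (i < l.*2.+1)%N -> (s < Q.+1)%N ->
  lattice_coord l Q i s ^+ 2 <= 4.
Proof.
rewrite -(ltr0n R) ltnS -(ler_nat R) -mul2n natrM => l0 gi sQ.
have s1 : s%:R / Q.+1%:R <= 1 :> R by rewrite ler_pdivrMr// mul1r ler_nat ltnW.
have s0 : 0 <= s%:R / Q.+1%:R :> R by rewrite divr_ge0.
have g0 : 0 <= i%:R :> R := ler0n _ _.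
have l1 : 1 <= l%:R :> R by rewrite ler1n -(ltr0n R).
rewrite /lattice_coord; move: (i%:R) (_ / Q.+1%:R) (l%:R) l0 l1 gi s0 s1 g0 => x y w w0 w1 h1 h2 h3 h4.
have t2 : (x + y - w) / w <= 2 by rewrite ler_pdivrMr//; lra.
have t1 : -2 <= (x + y - w) / w by rewrite ler_pdivlMr//; lra.
move: (_ / w) t1 t2 => t; nra.
Qed.

Definition lattice_point l Q (sh : {ffun I -> 'I_Q.+1}) (g : {ffun I -> 'I_(l.*2).+1}) :
    'rV[cplx R]_n.+1 :=
  \row_j if unlift ord0 j is Some k then
    mkc (lattice_coord l Q (g (k, false)) (sh (k, false)))
        (lattice_coord l Q (g (k, true)) (sh (k, true))) else 1.

Definition unit_lattice_point l Q (sh : {ffun I -> 'I_Q.+1}) (g : {ffun I -> 'I_(l.*2).+1}) :=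
  cr (enorm (lattice_point sh g))^-1 *: lattice_point sh g.

(** With exponent M = (A l)^2 each peak has width about M^(-1/2) = 1 / (A l) across, while the mesh
    is 1 / l; a large A therefore separates neighbouring peaks. *)
Definition peak_sum A l Q (sh : {ffun I -> 'I_Q.+1}) (z : 'rV[cplx R]_n.+1) : cplx R :=
  \sum_(g : {ffun I -> 'I_(l.*2).+1}) cdot z (unit_lattice_point sh g) ^+ ((A * l) ^ 2).

(** The squared distance from z to the line of the lattice direction: |<z, xi>|^2 = 1 - (hgt z +
    defect). *)
Let defect l Q (sh : {ffun I -> 'I_Q.+1}) (g : {ffun I -> 'I_(l.*2).+1}) (z : 'rV[cplx R]_n.+1) : R :=
  enorm z ^+ 2 - cabs (cdot z (unit_lattice_point sh g)) ^+ 2.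

Section lattice.
Variables (l Q : nat) (l0 : (0 < l)%N) (sh : {ffun I -> 'I_Q.+1}).
Implicit Types (g : {ffun I -> 'I_(l.*2).+1}) (z : 'rV[cplx R]_n.+1).

Let lR : 0 < l%:R :> R. Proof. by rewrite ltr0n. Qed.

Let lattice_point0 g : lattice_point sh g 0 ord0 = 1.
Proof. by rewrite mxE unlift_none. Qed.

Let ccoord_lattice_point g k b :
  ccoord (lattice_point sh g 0 (lift ord0 k)) b = lattice_coord l Q (g (k, b)) (sh (k, b)).
Proof. by rewrite mxE liftK; case: b. Qed.

Lemma lattice_point_norm g : 1 <= enorm (lattice_point sh g) /\
  enorm (lattice_point sh g) ^+ 2 <= (1 + 8 * n)%:R.
Proof.
split; first by have := coord_le (lattice_point sh g) ord0; rewrite lattice_point0 cabs1.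
rewrite enorm2_split lattice_point0 cabs1 expr1n natrD lerD2l.
apply: (@le_trans _ _ (\sum_(k < n) 8)); last by rewrite sumr_const card_ord -[_ *+ _]mulr_natr natrM.
apply: ler_sum => k _; rewrite cabs2_ccoord big_bool !ccoord_lattice_point.
have key b := lattice_coord_le l0 (ltn_ord (g (k, b))) (ltn_ord (sh (k, b))).
by rewrite (_ : 8 = 4 + 4 :> R); [apply: lerD; exact: key|ring].
Qed.

Lemma unit_lattice_point_norm g : enorm (unit_lattice_point sh g) = 1.
Proof.
have [b1 _] := lattice_point_norm g; have bn : 0 < enorm (lattice_point sh g) by lra.
by rewrite enormZ cabs_cr ger0_norm ?invr_ge0 ?(ltW bn)// mulVf// gt_eqF.
Qed.

Lemma defect_ge0 g z : 0 <= defect sh g z.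
Proof.
rewrite subr_ge0; apply: lerXn2r; rewrite ?nnegrE ?cabs_ge0 ?enorm_ge0//.
by apply: le_trans (cauchy_schwarz _ _) _; rewrite unit_lattice_point_norm mulr1.
Qed.

Lemma peak_le g z M : cabs (cdot z (unit_lattice_point sh g)) ^+ M <=
  expR (- (M%:R * (hgt z + defect sh g z) / 2)).
Proof.
set x := cabs _; have x0 : 0 <= x := cabs_ge0 _.
have x2 : x ^+ 2 <= expR (- (hgt z + defect sh g z)).
  by apply: le_trans (expR_ge1Dx _); rewrite /hgt /defect -/x; lra.
rewrite -ler_sqr ?nnegrE ?exprn_ge0 ?expR_ge0// exprAC; apply: (@le_trans _ _ (expR (- (hgt z + defect sh g z)) ^+ M)).
  by apply: lerXn2r; rewrite ?nnegrE ?expR_ge0 ?exprn_ge0.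
by rewrite -!expRM_natl ler_expR; lra.
Qed.

Lemma defect_le g z : defect sh g z <= enorm (z - z 0 ord0 *: lattice_point sh g) ^+ 2.
Proof.
have [b1 _] := lattice_point_norm g; have bn : 0 < enorm (lattice_point sh g) by lra.
have -> : z 0 ord0 *: lattice_point sh g =
    (z 0 ord0 * cr (enorm (lattice_point sh g))) *: unit_lattice_point sh g.
  rewrite /unit_lattice_point scalerA -mulrA -crM divff ?gt_eqF//.
  by rewrite cr1 mulr1.
by apply: perp_dist_le; exact: unit_lattice_point_norm.
Qed.

Lemma defect_ge g z : enorm (z - z 0 ord0 *: lattice_point sh g) ^+ 2 <=
  4 * (1 + 8 * n)%:R * defect sh g z.
Proof.
apply: le_trans (perp_dist_ge _ (lattice_point0 g)) _; apply: ler_wpM2r; first exact: defect_ge0.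
by rewrite ler_pM2l//; have [] := lattice_point_norm g.
Qed.

(** The affine coordinate of z_k / z_1 in units of the mesh, after the translation; lattice points
    are at the integers. *)
Definition lattice_pos z (k : I) : R :=
  l%:R * ccoord (z 0 (lift ord0 k.1) / z 0 ord0) k.2 + l%:R - (sh k)%:R / Q.+1%:R.

Lemma lattice_dist g z : z 0 ord0 != 0 ->
  enorm (z - z 0 ord0 *: lattice_point sh g) ^+ 2 =
  cabs (z 0 ord0) ^+ 2 / l%:R ^+ 2 * \sum_k (lattice_pos z k - (g k)%:R) ^+ 2.
Proof.
move=> z0; rewrite enorm2_split !mxE unlift_none mulr1 subrr cabs0 expr0n add0r mulr_sumr.
rewrite (eq_bigr (fun k : I => (fun k b => cabs (z 0 ord0) ^+ 2 / l%:R ^+ 2 *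
  (lattice_pos z (k, b) - (g (k, b))%:R) ^+ 2) k.1 k.2)); last by case.
rewrite -(pair_bigA _ (fun k b => cabs (z 0 ord0) ^+ 2 / l%:R ^+ 2 *
  (lattice_pos z (k, b) - (g (k, b))%:R) ^+ 2)) /=; apply: eq_bigr => k _.
have -> : (z - z 0 ord0 *: lattice_point sh g) 0 (lift ord0 k) =
    z 0 ord0 * (z 0 (lift ord0 k) / z 0 ord0 - lattice_point sh g 0 (lift ord0 k)).
  by rewrite !mxE mulrBr mulrCA divff// mulr1.
rewrite cabsM exprMn [X in _ * X = _]cabs2_ccoord mulr_sumr; apply: eq_bigr => b _.
rewrite ccoordB.
rewrite ccoord_lattice_point -[RHS]mulrA; congr (_ * _); rewrite /lattice_pos /lattice_coord /=.
by field; rewrite gt_eqF//= gt_eqF.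
Qed.

End lattice.

(** 1 + 8 n bounds the squared norm of a lattice point, whose 2 n real coordinates have squares at
    most 4. Below, [eta] is the threshold on |z_1| that separates Gaussian decay in the lattice from
    uniform smallness. *)
Let V : R := 4 * (1 + 8 * n)%:R.
Let eta : R := (4 * (1 + 8 * n)%:R)^-1.

Let n1 : 1 <= (1 + 8 * n)%:R :> R. Proof. by rewrite ler1n. Qed.
Let eta_gt0 : 0 < eta. Proof. by rewrite invr_gt0 mulr_gt0// (lt_le_trans ltr01 n1). Qed.
Let eta_le : eta <= 4^-1.
Proof. by rewrite /eta lef_pV2 ?posrE ?mulr_gt0 ?(lt_le_trans ltr01 n1)// -[leLHS]mulr1 ler_pM2l. Qed.

(** The defect controls the distance to z_1 times the lattice point, which is |z_1| / l times the
    distance of the lattice positions; the lower bound on |z_1| makes the Gaussian rate independent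
    of l and z. *)
Lemma peak_gauss A l Q (sh : {ffun I -> 'I_Q.+1}) (g : {ffun I -> 'I_(l.*2).+1}) (z : 'rV[cplx R]_n.+1) :
  (0 < l)%N -> eta <= cabs (z 0 ord0) ->
  cabs (cdot z (unit_lattice_point sh g)) ^+ ((A * l) ^ 2) <=
  expR (- (((A * l) ^ 2)%:R * hgt z / 2)) *
  \prod_k gauss (A%:R ^+ 2 * eta ^+ 2 / (2 * V)) (lattice_pos l sh z k) (g k).
Proof.
move=> l0 z0; have lR : 0 < l%:R :> R by rewrite ltr0n.
have zn : z 0 ord0 != 0 by rewrite -cabs_gt0; exact: lt_le_trans z0.
have P := peak_le sh g z ((A * l) ^ 2); apply: (le_trans P); rewrite /gauss -expR_sum -expRD ler_expR sumrN -mulr_sumr.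
have := defect_ge l0 sh g z; rewrite lattice_dist// -/V; set D := defect _ _ _; set X := \sum_k _ => H.
have X0 : 0 <= X by apply: sumr_ge0 => k _; exact: sqr_ge0.
have V0 : 0 < V by rewrite mulr_gt0//; lra.
have e2 : eta ^+ 2 <= cabs (z 0 ord0) ^+ 2.
  by apply: lerXn2r; rewrite ?nnegrE ?cabs_ge0 ?(ltW eta_gt0).
have l2 : 0 < l%:R ^+ 2 :> R by rewrite exprn_gt0.
have H2 : eta ^+ 2 * X <= l%:R ^+ 2 * (V * D).
  apply: (le_trans (ler_wpM2r X0 e2)).
  have -> : cabs (z 0 ord0) ^+ 2 * X = l%:R ^+ 2 * (cabs (z 0 ord0) ^+ 2 / l%:R ^+ 2 * X).
    by rewrite mulrA mulrCA divff ?mulr1// gt_eqF.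
  by apply: ler_wpM2l => //; exact: ltW.
rewrite natrX natrM exprMn.
have A2 : 0 <= A%:R ^+ 2 :> R by exact: sqr_ge0.
have : A%:R ^+ 2 * eta ^+ 2 / (2 * V) * X <= A%:R ^+ 2 * l%:R ^+ 2 * D / 2.
  have -> : A%:R ^+ 2 * eta ^+ 2 / (2 * V) * X = A%:R ^+ 2 * (eta ^+ 2 * X) / (2 * V) by ring.
  rewrite ler_pdivrMr ?mulr_gt0//.
  have := ler_wpM2l A2 H2; move: (_ ^+ 2) (_ ^+ 2) => a b; atom_lra.
by move: (_ / (2 * V) * X) => y; atom_lra.
Qed.

Let lattice_rate A : R := A%:R ^+ 2 * eta ^+ 2 / (2 * V).

Let V_ge4 : 4 <= V. Proof. by rewrite /V -[leLHS]mulr1 ler_pM2l. Qed.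
Let V_gt0 : 0 < V. Proof. by apply: lt_le_trans V_ge4. Qed.

Lemma gauss_tail_small (d : R) : 0 < d -> exists2 c0 : R, 0 < c0 &
  forall c : R, c0 <= c -> gauss_tail c <= d.
Proof.
move=> d0; exists (4 * (2 + d) / d) => [|c cc]; first by rewrite divr_gt0// mulr_gt0//; lra.
have c0 : 0 < c by apply: lt_le_trans cc; rewrite divr_gt0// mulr_gt0//; lra.
have r1 : expR (- c / 4) * (1 + c / 4) <= 1.
  have := ler_wpM2l (expR_ge0 (- c / 4)) (expR_ge1Dx (c / 4)).
  by rewrite -expRD (_ : - c / 4 + c / 4 = 0); [rewrite expR0|lra].
have r0 : 0 < expR (- c / 4) := expR_gt0 _; rewrite ler_pdivrMr// in cc.
rewrite /gauss_tail; move: (expR _) r0 r1 => r r0 r1.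
have h : r * (2 + d) <= d by nra.
by rewrite ler_pdivrMr; nra.
Qed.

(** A is chosen to make the Gaussian tails small, and then Q so that the rounding error 1 / (Q + 1)
    remains small after multiplication by A. *)
Lemma lattice_parameters : exists A Q : nat, [/\ (8 <= A)%N,
  gauss_tail (lattice_rate A) <= 1,
  #|{: I}|%:R * (gauss_tail (lattice_rate A) * 2 ^+ #|{: I}|) <= 8^-1,
  Q.+1%:R^-1 <= 2^-1 :> R & A%:R ^+ 2 * (#|{: I}|%:R * Q.+1%:R^-1 ^+ 2) <= 8^-1 :> R].
Proof.
set m : R := #|{: I}|%:R; have m0 : 0 <= m := ler0n _ _.
have p0 : 1 <= 2 ^+ #|{: I}| :> R by rewrite exprn_ege1// ler1n.
have [c0 c00 Hc] : exists2 c0 : R, 0 < c0 & forall c : R, c0 <= c -> gauss_tail c <= (8 * ((m + 1) * 2 ^+ #|{: I}|))^-1.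
  by apply: gauss_tail_small; rewrite invr_gt0 !mulr_gt0//; lra.
have e0 : 0 < eta ^+ 2 / (2 * V) by rewrite divr_gt0 ?exprn_gt0 ?mulr_gt0.
pose A := (Num.truncn (c0 / (eta ^+ 2 / (2 * V)))).+1 + 8.
have A8 : (8 <= A)%N by rewrite leq_addl.
have Ac : c0 <= lattice_rate A.
  rewrite /lattice_rate -mulrA -ler_pdivrMr//; apply: (@le_trans _ _ A%:R).
    apply: le_trans (ltW (truncnS_gt _)) _; by rewrite ler_nat leq_addr.
  by rewrite expr2 ler_peMr ?ler1n.
have tl := Hc _ Ac; move: (2 ^+ _) p0 tl => p p0 tl.
have tl0 : 0 <= gauss_tail (lattice_rate A).
  have lr : 0 < lattice_rate A by exact: lt_le_trans Ac.
  rewrite divr_ge0 ?mulr_ge0 ?expR_ge0// subr_ge0 -[leRHS]expR0 ler_expR; lra.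
have mp : 0 < (m + 1) * p by rewrite mulr_gt0//; atom_lra.
have tl8 : gauss_tail (lattice_rate A) * ((m + 1) * p) <= 8^-1.
  rewrite -ler_pdivlMr//; apply: le_trans tl _; by rewrite invfM.
pose Q := (Num.truncn (8 * (A%:R ^+ 2 * m))).+2; exists A, Q; split => //.
- have mp1 : 1 <= (m + 1) * p by nra.
  by move: (gauss_tail _) (_ * p) mp1 tl0 tl8 => u w; atom_nra.
- by move: (gauss_tail _) tl0 tl8 => u; atom_nra.
- by rewrite lef_pV2 ?posrE// ler_nat.
have Q0 : 0 < Q.+1%:R :> R by [].
have h : 8 * (A%:R ^+ 2 * m) <= Q.+1%:R by apply: le_trans (ltW (truncnS_gt _)) _; rewrite ler_nat; exact/leqW/leqW.
have q1 : 1 <= Q.+1%:R :> R by rewrite ler1n.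
rewrite mulrA exprVn ler_pdivrMr ?exprn_gt0//; move: (A%:R ^+ 2 * m) Q.+1%:R h q1 Q0 => x y h q1 _; atom_nra.
Qed.

(** If |z_1| >= eta, the Gaussian sum is at most 2^(2 n). Otherwise z is far from every lattice
    direction or from the boundary, each term carries an extra factor exp(- c0 M / 2), and this
    beats the number of terms. *)
Lemma peak_sum_le : exists2 CW : R, 0 < CW & forall A l Q (sh : {ffun I -> 'I_Q.+1}) (z : 'rV[cplx R]_n.+1),
  (0 < A)%N -> (0 < l)%N -> gauss_tail (lattice_rate A) <= 1 -> ball z ->
  cabs (peak_sum A l sh z) <= CW * expR (- (((A * l) ^ 2)%:R * hgt z / 4)).
Proof.
pose c0 : R := (16 * V)^-1; have V16 : 0 < 16 * V by rewrite mulr_gt0.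
have c00 : 0 < c0 / 2 by rewrite divr_gt0// invr_gt0.
have [C C0 HC] := expR_beats_power n c00.
exists (2 ^+ #|{: I}| + 9 ^+ n * C); first by rewrite addr_gt0 ?exprn_gt0 ?mulr_gt0 ?exprn_gt0.
move=> A l Q sh z A0 l0 At zb; have h0 := ltW (hgt_gt0 zb).
set M := ((A * l) ^ 2)%N; have M0 : 0 <= M%:R :> R := ler0n _ _.
have lr0 : 0 < lattice_rate A by rewrite divr_gt0 ?mulr_gt0 ?exprn_gt0 ?ltr0n.
rewrite mulrDl; apply: (@le_trans _ _ (\sum_(g : {ffun I -> 'I_(l.*2).+1}) cabs (cdot z (unit_lattice_point sh g)) ^+ M)).
  by apply: le_trans (cabs_sum _ _ _) _; apply: ler_sum => g _; rewrite cabsX.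
have [z0|z0] := leP eta (cabs (z 0 ord0)).
  apply: (@le_trans _ _ (2 ^+ #|{: I}| * expR (- (M%:R * hgt z / 4)))); last first.
    by rewrite lerDl !mulr_ge0 ?expR_ge0 ?exprn_ge0// ltW.
  apply: (@le_trans _ _ (\sum_(g : {ffun I -> 'I_(l.*2).+1}) expR (- (M%:R * hgt z / 2)) * \prod_k gauss (lattice_rate A) (lattice_pos l sh z k) (g k))).
    by apply: ler_sum => g _; exact: peak_gauss.
  rewrite -mulr_sumr mulrC; apply: ler_pM; rewrite ?expR_ge0 ?sumr_ge0//.
  - by move=> g _; apply: prodr_ge0 => k _; exact: gauss_ge0.
  - exact: gauss_lattice_sum.
  by rewrite ler_expR; have := mulr_ge0 M0 h0; lra.
apply: (@le_trans _ _ (9 ^+ n * C * expR (- (M%:R * hgt z / 4)))); last first.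
  by rewrite lerDr mulr_ge0 ?expR_ge0 ?exprn_ge0.
(* If the height is below 1/2 then |z| >= 1/2, while z_1 times the lattice point has norm at most
   1/4; so the defect is bounded below. *)
have key (g : {ffun I -> 'I_(l.*2).+1}) : c0 <= hgt z / 2 + defect sh g z.
  have D0 := defect_ge0 l0 sh g z.
  have [hz|hz] := leP 2^-1 (hgt z).
    have : c0 <= 4^-1 by rewrite lef_pV2 ?posrE//; have := V_ge4; atom_lra.
    by move: (defect _ _ _) D0 => D; atom_lra.
  have [b1 b2] := lattice_point_norm l0 sh g; have H := defect_ge l0 sh g z.
  have zz : 2^-1 <= enorm z.
    by move: hz; rewrite /hgt; have := enorm_ge0 z; atom_nra.
  have tri : enorm z <= enorm (z - z 0 ord0 *: lattice_point sh g) + cabs (z 0 ord0) * enorm (lattice_point sh g).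
    rewrite -enormZ; apply: le_trans (enorm_triangle _ _); by rewrite subrK.
  have z04 : cabs (z 0 ord0) * enorm (lattice_point sh g) <= 4^-1.
    have -> : 4^-1 = eta * (1 + 8 * n)%:R by rewrite /eta invfM mulrVK// unitfE gt_eqF// (lt_le_trans ltr01 n1).
    apply: ler_pM; rewrite ?cabs_ge0 ?enorm_ge0 ?(ltW z0)//; apply: le_trans b2; atom_nra.
  have d4 : 4^-1 <= enorm (z - z 0 ord0 *: lattice_point sh g) by atom_lra.
  have d16 : 16^-1 <= V * defect sh g z.
    by apply: le_trans H; move: (enorm _) d4 => d d4; atom_nra.
  have : c0 <= defect sh g z by rewrite /c0 invfM ler_pdivrMr// mulrC.
  by move: (defect _ _ _) => D; atom_lra.
apply: (@le_trans _ _ (\sum_(g : {ffun I -> 'I_(l.*2).+1}) expR (- (M%:R * hgt z / 4)) * expR (- (c0 / 2 * M%:R)))).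
  apply: ler_sum => g _; apply: (le_trans (peak_le sh g z M)).
  rewrite -expRD ler_expR; have := ler_wpM2l M0 (key g).
  by move: (defect _ _ _) => D; lra.
rewrite sumr_const -[_ *+ _]mulr_natl mulrCA mulrC; apply: ler_wpM2r; first exact: expR_ge0.
apply: (@le_trans _ _ (9 ^+ n * (M%:R ^+ n * expR (- (c0 / 2 * M%:R))))); last first.
  by apply: ler_wpM2l; [exact: exprn_ge0|exact: HC].
rewrite mulrA -exprMn; apply: ler_wpM2r; first exact: expR_ge0.
rewrite card_ffun card_prod !card_ord card_bool mulnC expnM natrX -natrM.
apply: lerXn2r; rewrite ?nnegrE ?ler0n// ler_nat /M.
exact: odd_square_le.
Qed.

(** For the translate that puts a lattice point within 1 / (Q + 1) of the position of z, that single
    term is at least 5/8 and all the others together are at most 1/8. *)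
Lemma peak_sum_ge A l Q (z : 'rV[cplx R]_n.+1) :
  (0 < A)%N -> (0 < l)%N -> gauss_tail (lattice_rate A) <= 1 ->
  #|{: I}|%:R * (gauss_tail (lattice_rate A) * 2 ^+ #|{: I}|) <= 8^-1 ->
  Q.+1%:R^-1 <= 2^-1 :> R -> A%:R ^+ 2 * (#|{: I}|%:R * Q.+1%:R^-1 ^+ 2) <= 8^-1 :> R ->
  ball z -> enorm (z - e1) <= 5^-1 -> ((A * l) ^ 2)%:R * hgt z <= 4^-1 ->
  exists sh : {ffun I -> 'I_Q.+1}, 2^-1 <= cabs (peak_sum A l sh z).
Proof.
move=> A0 l0 t1 t2 Q2 AQ zb ze Mh; set M := ((A * l) ^ 2)%N in Mh.
have lR : 0 < l%:R :> R by rewrite ltr0n.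
have M0 : 0 <= M%:R :> R := ler0n _ _.
have lr0 : 0 < lattice_rate A by rewrite divr_gt0 ?mulr_gt0 ?exprn_gt0 ?ltr0n.
have z1 : 4 / 5 <= cabs (z 0 ord0).
  have := coord_le (z - e1) ord0; rewrite !mxE eqxx => h.
  by have := cabs_leB 1 (1 - z 0 ord0); rewrite cabs1 opprB addrCA subrr addr0 cabsB; atom_lra.
have zn : z 0 ord0 != 0 by rewrite -cabs_gt0; atom_lra.
have zl1 : cabs (z 0 ord0) <= 1 by apply: le_trans (coord_le z ord0) (ltW _).
have yk (k : I) : `|ccoord (z 0 (lift ord0 k.1) / z 0 ord0) k.2| <= 4^-1.
  apply: le_trans (ccoord_le _ _) _; rewrite cabsM cabsV ler_pdivrMr; last atom_lra.
  have := coord_le (z - e1) (lift ord0 k.1); rewrite !mxE /= subr0; atom_lra.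
pose x (k : I) : R := l%:R * ccoord (z 0 (lift ord0 k.1) / z 0 ord0) k.2 + l%:R.
have x0 k : 0 <= x k /\ x k <= 2 * l%:R by have := yk k; rewrite ler_norml => /andP[? ?]; rewrite /x; split; atom_nra.
(* The position splits into its integer part, the index of the peak, and a fraction rounded down to
   a multiple of 1 / (Q + 1), the translate. *)
pose i k := Num.truncn (x k).
have ik k : (i k)%:R <= x k /\ x k < (i k)%:R + 1.
  by have [x1 _] := x0 k; rewrite /i truncn_le// natr1 truncnS_gt.
have il k : (i k < l.*2.+1)%N.
  rewrite ltnS -(ler_nat R) -mul2n natrM; have [_ h] := x0 k; have [h' _] := ik k; exact: le_trans h.
pose s k := Num.truncn (Q.+1%:R * (x k - (i k)%:R)).
have Q0 : 0 < Q.+1%:R :> R by [].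
have sk0 k : 0 <= Q.+1%:R * (x k - (i k)%:R) by have [h _] := ik k; rewrite mulr_ge0 ?subr_ge0// ltW.
have sQ k : (s k < Q.+1)%N.
  rewrite -(ltr_nat R); apply: (@le_lt_trans _ _ (Q.+1%:R * (x k - (i k)%:R))); first by rewrite truncn_le.
  by have [_ h] := ik k; rewrite -[ltRHS]mulr1 ltr_pM2l//; atom_lra.
pose sh : {ffun I -> 'I_Q.+1} := [ffun k => Ordinal (sQ k)].
pose g0 : {ffun I -> 'I_(l.*2).+1} := [ffun k => Ordinal (il k)].
have pos k : `|lattice_pos l sh z k - (g0 k)%:R| <= Q.+1%:R^-1.
  rewrite /lattice_pos -/(x k) !ffunE /=.
  have a1 : (s k)%:R <= Q.+1%:R * (x k - (i k)%:R) by rewrite truncn_le.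
  have a2 : Q.+1%:R * (x k - (i k)%:R) < (s k)%:R + 1 by rewrite natr1 truncnS_gt.
  have -> : x k - (s k)%:R / Q.+1%:R - (i k)%:R = (Q.+1%:R * (x k - (i k)%:R) - (s k)%:R) / Q.+1%:R.
    by field; rewrite gt_eqF.
  by rewrite normrM normfV (ger0_norm (ltW Q0)) ler_pdivrMr// mulVf ?gt_eqF// ger0_norm; atom_lra.
pose W0 := cdot z (unit_lattice_point sh g0) ^+ M.
pose W1 := \sum_(g : {ffun I -> 'I_(l.*2).+1} | g != g0) cdot z (unit_lattice_point sh g) ^+ M.
exists sh; have -> : peak_sum A l sh z = W0 + W1 by rewrite /peak_sum (bigD1 g0).
have W18 : cabs W1 <= 8^-1.
  apply: le_trans (cabs_sum _ _ _) _; apply: le_trans t2.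
  apply: le_trans (gauss_lattice_away lr0 t1 (x := lattice_pos l sh z) (g0 := g0) _); last first.
    by move=> k; apply: le_trans (pos k) Q2.
  apply: ler_sum => g _; rewrite cabsX; apply: le_trans (peak_gauss _ _ _ l0 _) _.
    by have := eta_le; atom_lra.
  apply: ler_piMl; first by apply: prodr_ge0 => k _; exact: gauss_ge0.
  by rewrite -[leRHS]expR0 ler_expR oppr_le0 divr_ge0// mulr_ge0// ltW// hgt_gt0.
pose D := defect sh g0 z; have D0 : 0 <= D by exact: defect_ge0.
have MD : M%:R * D <= 8^-1.
  apply: le_trans AQ; have := defect_le l0 sh g0 z; rewrite lattice_dist// -/D => H.
  rewrite /M natrX natrM exprMn -mulrA; apply: ler_wpM2l; first exact: sqr_ge0.
  rewrite mulrC -ler_pdivlMr ?exprn_gt0//; apply: (le_trans H); rewrite mulrAC.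
  apply: ler_wpM2r; first by rewrite invr_ge0 sqr_ge0.
  rewrite -[leRHS]mul1r; apply: ler_pM; rewrite ?sqr_ge0 ?sumr_ge0//.
  - by move=> k _; exact: sqr_ge0.
  - by rewrite -[leRHS](expr1n _ 2); apply: lerXn2r; rewrite ?nnegrE ?cabs_ge0.
  rewrite mulr_natl -sumr_const; apply: ler_sum => k _.
  by rewrite -real_normK ?num_real//; apply: lerXn2r; rewrite ?nnegrE ?invr_ge0 ?(ltW Q0).
(* By Bernoulli's inequality |<z, e>|^(2 M) = (1 - (hgt z + D))^M >= 1 - 1/4 - 1/8, and |<z, e>|^M
   is larger still. *)
have W05 : 5 / 8 <= cabs W0.
  rewrite cabsX; set c := cabs _; have c0 : 0 <= c := cabs_ge0 _.
  have cD : c ^+ 2 = 1 - (hgt z + D) by rewrite /hgt /D /defect -/c; ring.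
  have hD1 : 0 <= hgt z + D by have := hgt_gt0 zb; atom_lra.
  have c1 : c <= 1 by rewrite -ler_sqr ?nnegrE// expr1n cD; atom_lra.
  have hDc : hgt z + D <= 1 by have := sqr_ge0 c; rewrite cD; atom_lra.
  apply: (@le_trans _ _ ((c ^+ 2) ^+ M)).
    by rewrite cD; apply: le_trans (bernoulli M hD1 hDc); rewrite mulrDr; atom_lra.
  by apply: lerXn2r; rewrite ?nnegrE ?sqr_ge0// expr2 ler_piMl.
have := cabs_leD W0 W1; atom_lra.
Qed.

Lemma peak_family : exists (A Q : nat) (CW : R), [/\ (8 <= A)%N, 0 < CW,
  forall l (sh : {ffun I -> 'I_Q.+1}) (z : 'rV[cplx R]_n.+1), (0 < l)%N -> ball z ->
    cabs (peak_sum A l sh z) <= CW * expR (- (((A * l) ^ 2)%:R * hgt z / 4)) &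
  forall l (z : 'rV[cplx R]_n.+1), (0 < l)%N -> ball z -> enorm (z - e1) <= 5^-1 ->
    ((A * l) ^ 2)%:R * hgt z <= 4^-1 ->
    exists sh : {ffun I -> 'I_Q.+1}, 2^-1 <= cabs (peak_sum A l sh z)].
Proof.
have [A [Q [A8 t1 t2 Q2 AQ]]] := lattice_parameters; have [CW CW0 HW] := peak_sum_le.
have A0 : (0 < A)%N by apply: leq_trans A8.
exists A, Q, CW; split => // [l sh z l0 zb|l z l0 zb z1 zM]; first exact: HW.
exact: (peak_sum_ge A0 l0 t1 t2 Q2 AQ zb z1 zM).
Qed.

End peak_sums.

(** * Differentiation of series term by term *)

Section complex_series.
Context {R : realType}.
Implicit Types (u v : nat -> cplx R) (s : cplx R).

Definition has_csum u s := forall e : R, 0 < e -> exists K0 : nat, forall K : nat, (K0 <= K)%N ->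
  cabs (s - \sum_(k < K) u k) <= e.

Lemma has_csum_le u s (B : R) : has_csum u s ->
  (forall K : nat, cabs (\sum_(k < K) u k) <= B) -> cabs s <= B.
Proof.
move=> Hs HB; apply/ler_addgt0Pr => e /Hs[K HK].
have := cabs_triangle (s - \sum_(k < K) u k) (\sum_(k < K) u k); rewrite subrK.
have := HK K (leqnn K); have := HB K; lra.
Qed.

Lemma has_csumB u v s1 s2 : has_csum u s1 -> has_csum v s2 -> has_csum (fun k => u k - v k) (s1 - s2).
Proof.
move=> H1 H2 e e0; have e2 : 0 < e / 2 by rewrite divr_gt0.
have [K1 HK1] := H1 _ e2; have [K2 HK2] := H2 _ e2; exists (maxn K1 K2) => K.
rewrite geq_max => /andP[k1 k2]; rewrite sumrB.
rewrite (_ : _ - _ = (s1 - \sum_(k < K) u k) - (s2 - \sum_(k < K) v k)); last by ring.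
apply: le_trans (cabs_triangle _ _) _; rewrite cabsN.
have := HK1 K k1; have := HK2 K k2; lra.
Qed.

Lemma real_series_cvg (v : nat -> R) (T : R) : (forall K : nat, \sum_(k < K) `|v k| <= T) ->
  exists s : R, forall e, 0 < e -> exists K0 : nat, forall K : nat, (K0 <= K)%N ->
  `|s - \sum_(k < K) v k| <= e.
Proof.
move=> H; have cv : cvgn (series v).
  apply: normed_cvg; apply: nondecreasing_is_cvgn.
    by apply: nondecreasing_series => k _ _; exact: normr_ge0.
  by exists T => _ [K _ <-]; have := H K; rewrite -(big_mkord xpredT (fun k => `|v k|)).
exists (limn (series v)) => e e0.
move/cvgrPdist_le : cv => /(_ e e0)[K0 _ HK]; exists K0 => K K0K.
by have := HK K K0K; rewrite /series /= big_mkord.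
Qed.

Lemma csum_exists u (T : R) : (forall K : nat, \sum_(k < K) cabs (u k) <= T) ->
  exists s, has_csum u s.
Proof.
move=> H.
have [a Ha] : exists a : R, forall e, 0 < e -> exists K0 : nat, forall K : nat, (K0 <= K)%N ->
    `|a - \sum_(k < K) cre (u k)| <= e.
  by apply: (@real_series_cvg (fun k => cre (u k)) T) => K; apply: le_trans (H K); apply: ler_sum => k _; exact: cre_le.
have [b Hb] : exists b : R, forall e, 0 < e -> exists K0 : nat, forall K : nat, (K0 <= K)%N ->
    `|b - \sum_(k < K) cim (u k)| <= e.
  by apply: (@real_series_cvg (fun k => cim (u k)) T) => K; apply: le_trans (H K); apply: ler_sum => k _; exact: cim_le.
exists (mkc a b) => e e0; have e2 : 0 < e / 2 by rewrite divr_gt0.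
have [K1 HK1] := Ha _ e2; have [K2 HK2] := Hb _ e2; exists (maxn K1 K2) => K.
rewrite geq_max => /andP[k1 k2]; apply: le_trans (cabs_le_re_im _) _; rewrite !cE cre_sum.
have -> : cim (\sum_(k < K) u k) = \sum_(k < K) cim (u k).
  by elim/big_rec2: _ => // i x y _ <-; rewrite cimD.
have := HK1 K k1; have := HK2 K k2; rewrite /=; atom_lra.
Qed.

(** The second-order Taylor bound for x^M, by induction on M. The factor r^2 on the left stands for
    the exponent M - 2 on the right and avoids truncated subtraction. *)
Lemma pow_remainder (x y : cplx R) (r : R) M : 0 <= r -> cabs x <= r -> cabs y <= r ->
  r ^+ 2 * cabs (x ^+ M - y ^+ M - M%:R * y ^+ M.-1 * (x - y)) <=
  M%:R ^+ 2 * r ^+ M * cabs (x - y) ^+ 2.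
Proof.
move=> r0 xr yr; have d0 := cabs_ge0 (x - y); elim: M => [|M IH].
  by rewrite !expr0 !mul0r subrr subr0 cabs0 mulr0 expr0n !mul0r.
have -> : x ^+ M.+1 - y ^+ M.+1 - M.+1%:R * y ^+ M.+1.-1 * (x - y) =
    x * (x ^+ M - y ^+ M - M%:R * y ^+ M.-1 * (x - y)) + M%:R * y ^+ M.-1 * (x - y) ^+ 2.
  rewrite /= -natr1 exprS; case: M {IH} => [|M]; first by rewrite !expr0 !mul0r expr1; ring.
  by rewrite /= !exprS; ring.
have E1 := cabs_triangle (x * (x ^+ M - y ^+ M - M%:R * y ^+ M.-1 * (x - y))) (M%:R * y ^+ M.-1 * (x - y) ^+ 2).
have r2 : 0 <= r ^+ 2 by exact: exprn_ge0.
apply: (le_trans (ler_wpM2l r2 E1)); rewrite mulrDr.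
have h1 : r ^+ 2 * cabs (x * (x ^+ M - y ^+ M - M%:R * y ^+ M.-1 * (x - y))) <=
    M%:R ^+ 2 * r ^+ M.+1 * cabs (x - y) ^+ 2.
  rewrite cabsM [r ^+ M.+1]exprS mulrCA; move: IH; move: (cabs (_ - _ - _)) (cabs_ge0 (x ^+ M - y ^+ M - M%:R * y ^+ M.-1 * (x - y))) => E E0 IH.
  rewrite [leRHS](_ : _ = r * (M%:R ^+ 2 * r ^+ M * cabs (x - y) ^+ 2)); last by ring.
  by apply: ler_pM; rewrite ?cabs_ge0 ?mulr_ge0.
have h2 : r ^+ 2 * cabs (M%:R * y ^+ M.-1 * (x - y) ^+ 2) <= M%:R * r ^+ M.+1 * cabs (x - y) ^+ 2.
  have cM : cabs (M%:R : cplx R) = M%:R.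
    have -> : (M%:R : cplx R) = cr M%:R by rewrite /cr rmorph_nat.
    by rewrite cabs_cr ger0_norm.
  rewrite !cabsM !cabsX cM; case: M {IH h1 E1 cM} => [|M]; first by rewrite !mul0r mulr0.
  rewrite /= (_ : r ^+ 2 * _ = (M.+1%:R * r ^+ 2 * cabs (x - y) ^+ 2) * cabs y ^+ M); last by ring.
  rewrite [leRHS](_ : _ = (M.+1%:R * r ^+ 2 * cabs (x - y) ^+ 2) * r ^+ M); last by rewrite !exprS; ring.
  apply: ler_wpM2l; first by rewrite !mulr_ge0// sqr_ge0.
  by apply: lerXn2r; rewrite ?nnegrE ?cabs_ge0.
apply: (le_trans (lerD h1 h2)); rewrite -mulrDl -mulrDl.
apply: ler_wpM2r; first exact: sqr_ge0.
apply: ler_wpM2r; first exact: exprn_ge0.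
by rewrite -natr1; have := ler0n R M; atom_nra.
Qed.

End complex_series.

Section series_differentiable.
Context {R : realType} {n : nat}.
Notation V := 'rV[cplx R]_n.

Lemma has_csum_lin_form (d : nat -> V) (a : V) (w : V) :
  (forall j, has_csum (fun k => d k 0 j) (a 0 j)) ->
  has_csum (fun k => lin_form (d k) w) (lin_form a w).
Proof.
move=> H e e0; pose c : R := n%:R * enorm w + 1.
have c0 : 0 < c by rewrite /c; have := mulr_ge0 (ler0n R n) (enorm_ge0 w); lra.
have /choice[K0 HK] : forall j, exists K0 : nat, forall K : nat, (K0 <= K)%N ->
  cabs (a 0 j - \sum_(k < K) d k 0 j) <= e / c by move=> j; apply: H; rewrite divr_gt0.
exists (\max_j K0 j) => K K0K; rewrite /lin_form exchange_big /= -sumrB.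
apply: le_trans (cabs_sum _ _ _) _; apply: (@le_trans _ _ (\sum_(j < n) enorm w * (e / c))).
  apply: ler_sum => j _; rewrite -mulr_sumr -mulrBr cabsM; apply: ler_pM; rewrite ?cabs_ge0 ?coord_le//.
  by apply: HK; apply: leq_trans K0K; exact: leq_bigmax.
rewrite sumr_const card_ord -[_ *+ _]mulr_natl mulrA mulrCA ler_piMr ?(ltW e0)//.
by rewrite ler_pdivrMr// mul1r /c; lra.
Qed.

(** Quadratic bounds on the remainders of the terms add up to a quadratic bound for the sum, so its
    derivative is the sum of the linear forms; no uniform convergence of derivatives near z0 is
    involved. *)
Lemma series_differentiable (F : nat -> V -> cplx R) (f : V -> cplx R) (d : nat -> V) (a z0 : V) (r T : R) :
  0 < r -> (forall z, enorm (z - z0) < r -> has_csum (F^~ z) (f z)) ->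
  (forall j, has_csum (fun k => d k 0 j) (a 0 j)) ->
  (forall (K : nat) z, enorm (z - z0) < r ->
    \sum_(k < K) cabs (F k z - F k z0 - lin_form (d k) (z - z0)) <= T * enorm (z - z0) ^+ 2) ->
  differentiable f z0.
Proof.
move=> r0 HF Hd HT; apply: (@frechet_differentiable _ _ f z0 a) => e e0.
have T1 : 0 < `|T| + 1 by have := normr_ge0 T; lra.
exists (Num.min r (e / (`|T| + 1))) => [|w]; first by rewrite lt_min r0 divr_gt0.
rewrite lt_min ltr_pdivlMr// => /andP[w1 w2].
have z00 : enorm (z0 - z0) < r by rewrite subrr enorm0.
have S := has_csumB (has_csumB (HF w w1) (HF z0 z00)) (has_csum_lin_form (w - z0) Hd).
apply: (@le_trans _ _ (T * enorm (w - z0) ^+ 2)).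
  by apply: (has_csum_le S) => K; apply: le_trans (cabs_sum _ _ _) (HT K w w1).
have w0 := enorm_ge0 (w - z0); rewrite expr2 mulrA; apply: ler_wpM2r => //.
apply: le_trans (ltW w2); rewrite mulrC; apply: ler_wpM2l => //.
by have := ler_norm T; atom_lra.
Qed.

End series_differentiable.

(** * Lacunary series of peak sums *)

Section lacunary.
Context {R : realType} {n : nat}.
Notation Cn := (Cn R n.+1).
Notation V := 'rV[cplx R]_n.+1.
Notation ball := (@cball R n.+1).
Notation I := ('I_n * bool)%type.

Lemma geometric_le (C r : R) K : 0 <= C -> 0 <= r -> r < 1 -> \sum_(k < K) C * r ^+ k <= C / (1 - r).
Proof.
move=> C0 r0 r1; have d0 : 0 < 1 - r by rewrite subr_gt0.
rewrite ler_pdivlMr// -mulr_sumr -mulrA.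
have -> : (\sum_(k < K) r ^+ k) * (1 - r) = 1 - r ^+ K by rewrite mulrC -opprB mulNr -subrX1 opprB.
by rewrite ler_piMr// gerBl exprn_ge0.
Qed.

(** The exponent (A l)^2 of a peak sum at l = L^k; successive exponents have ratio L^2. *)
Definition lacunary_exponent A L k : nat := ((A * L ^ k) ^ 2)%N.

Definition lacunary_coef (c g : R) A L (k : nat) : R :=
  (lacunary_exponent A L k)%:R `^ c * k.+1%:R `^ (- g).

Section exponent.
Variables (A L : nat).
Hypotheses (A0 : (0 < A)%N) (L2 : (2 <= L)%N).
Let M := lacunary_exponent A L.
Let Lam : R := L%:R ^+ 2.

Let L0 : (0 < L)%N. Proof. exact: leq_trans L2. Qed.

Lemma lacunary_exponentS k : (M k.+1)%:R = Lam * (M k)%:R :> R.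
Proof. by rewrite /M /lacunary_exponent /Lam -natrX -natrM; congr (_%:R); rewrite [(L ^ k.+1)%N]expnS mulnCA expnMn. Qed.

Lemma lacunary_exponentD k i : (M (k + i))%:R = Lam ^+ i * (M k)%:R :> R.
Proof. by elim: i => [|i IH]; rewrite ?addn0 ?mul1r// addnS lacunary_exponentS IH exprS mulrA. Qed.

Lemma lacunary_exponent_ge k : (2 ^ k <= M k)%N.
Proof.
apply: (@leq_trans (L ^ k)); first by elim: k => // k IH; rewrite !expnS leq_mul.
rewrite /M /lacunary_exponent expnMn -mulnn -[leqLHS]mul1n; apply: leq_mul.
  by rewrite muln_gt0 A0.
by rewrite expnS expn1 leq_pmulr// expn_gt0 L0.
Qed.

Lemma lacunary_exponent_gt0 k : 0 < (M k)%:R :> R.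
Proof. by rewrite ltr0n; apply: leq_trans (lacunary_exponent_ge k); rewrite expn_gt0. Qed.

End exponent.

Section coef.
Variables (c g : R) (A L : nat).
Hypotheses (c0 : 0 < c) (g0 : 0 <= g) (A0 : (0 < A)%N) (L2 : (2 <= L)%N).
Let M := lacunary_exponent A L.
Let a := lacunary_coef c g A L.
Let Lam : R := L%:R ^+ 2.

Let Lam_gt0 : 0 < Lam. Proof. by rewrite exprn_gt0 ?ltr0n// (leq_trans _ L2). Qed.

Lemma lacunary_coef_gt0 k : 0 < a k.
Proof. by rewrite mulr_gt0 ?powR_gt0 ?lacunary_exponent_gt0//. Qed.

Lemma lacunary_coef_up k i : a (k + i) <= (Lam `^ c) ^+ i * a k.
Proof.
elim: i => [|i IH]; first by rewrite addn0 mul1r.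
rewrite addnS exprS -mulrA; apply: (@le_trans _ _ (Lam `^ c * a (k + i))); last first.
  by apply: ler_wpM2l => //; exact: powR_ge0.
rewrite /a /lacunary_coef lacunary_exponentS powRM ?ler0n ?(ltW Lam_gt0)// -!mulrA.
apply: ler_wpM2l; first exact: powR_ge0.
apply: ler_wpM2l; first exact: powR_ge0.
rewrite !powRN lef_pV2 ?posrE ?powR_gt0//.
by apply: ge0_ler_powR; rewrite ?nnegrE ?ler0n// ler_nat.
Qed.

(** Each step multiplies the coefficient by at least Lam^c / 2^g, the loss 2^g coming from (k + 2)
    <= 2 (k + 1). With [lacunary_coef_up] the coefficients behave like a geometric sequence. *)
Lemma lacunary_coef_down k i : a k <= (2 `^ g / Lam `^ c) ^+ i * a (k + i).
Proof.
elim: i => [|i IH]; first by rewrite addn0 mul1r.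
apply: (le_trans IH); rewrite addnS exprSr -mulrA; apply: ler_wpM2l.
  by rewrite exprn_ge0// divr_ge0 ?powR_ge0.
have lc : 0 < Lam `^ c by rewrite powR_gt0.
rewrite /a /lacunary_coef lacunary_exponentS powRM ?ler0n ?(ltW Lam_gt0)//.
rewrite [leRHS](_ : _ = (M (k + i))%:R `^ c * (2 `^ g * (k + i).+2%:R `^ (- g))); last first.
  by field; rewrite gt_eqF.
apply: ler_wpM2l; first exact: powR_ge0.
rewrite !powRN ler_pdivlMr ?powR_gt0// mulrC ler_pdivrMr ?powR_gt0// -powRM//.
by apply: ge0_ler_powR; rewrite ?nnegrE ?mulr_ge0 ?ler0n// -natrM ler_nat; lia.
Qed.

(** The factor of a_k dominates, up to negative powers of r, the k-th peak sum, its gradient and its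
    quadratic remainder on |z| <= r. *)
Lemma lacunary_summable (r : R) : 0 < r -> r < 1 -> exists2 C : R, 0 <= C & forall k,
  a k * ((9 * (M k)%:R) ^+ n * (M k)%:R ^+ 2 * r ^+ M k) <= C * 2^-1 ^+ k.
Proof.
move=> r0 r1; pose E := (Num.truncn c).+1.
have d0 : 0 < 1 - r by rewrite subr_gt0.
have [C C0 HC] := expR_beats_power (E + n + 3) d0.
exists (9 ^+ n * C) => [|k]; first by rewrite mulr_ge0 ?exprn_ge0// ltW.
have m0 := lacunary_exponent_gt0 A0 L2 k; set m : R := (M k)%:R in m0 *.
have m1 : 1 <= m by rewrite ler1n -(ltr0n R).
have m2 : 2 ^+ k <= m by rewrite -natrX ler_nat lacunary_exponent_ge//.
have ak : a k <= m ^+ E.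
  rewrite -[leRHS]mulr1; apply: ler_pM; rewrite ?powR_ge0//.
    by rewrite -powR_mulrn ?(ltW m0)//; apply: ler_powR => //; apply/ltW/truncnS_gt.
  by rewrite powRN invf_le1 ?powR_gt0//; apply: powR_ge1; rewrite // ler1n.
have rm : r ^+ M k <= expR (- ((1 - r) * m)).
  rewrite (_ : - ((1 - r) * m) = m * (r - 1)); last by ring.
  rewrite /m expRM_natl; apply: lerXn2r; rewrite ?nnegrE ?expR_ge0 ?(ltW r0)//.
  by have := expR_ge1Dx (r - 1); rewrite addrC subrK.
have H := HC m (ltW m0).
apply: (@le_trans _ _ (m ^+ E * ((9 * m) ^+ n * m ^+ 2 * expR (- ((1 - r) * m))))).
  apply: ler_pM => //; rewrite ?(ltW (lacunary_coef_gt0 k))//.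
    by rewrite !mulr_ge0 ?exprn_ge0 ?mulr_ge0 ?(ltW m0) ?(ltW r0).
  by apply: ler_wpM2l => //; rewrite !mulr_ge0 ?exprn_ge0 ?mulr_ge0 ?(ltW m0).
have -> : m ^+ E * ((9 * m) ^+ n * m ^+ 2 * expR (- ((1 - r) * m))) =
    9 ^+ n * (m ^+ (E + n + 3) * expR (- ((1 - r) * m))) / m.
  by rewrite exprMn !exprD; field; rewrite gt_eqF.
rewrite ler_pdivrMr// -!mulrA; apply: ler_wpM2l; first exact: exprn_ge0.
apply: (le_trans H); rewrite -[leLHS]mulr1; apply: ler_wpM2l; first exact: ltW.
by rewrite exprVn mulrC ler_pdivlMr ?exprn_gt0// mul1r.
Qed.

End coef.

(** At height at least 1 / (8 M_j) the terms k < j are small because the coefficients grow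
    geometrically, and the terms k > j because the peaks decay exponentially; a large ratio L makes
    both decay like 9^-|k - j|. *)
Lemma lacunary_tail (c g CW : R) : 0 < c -> 0 <= g -> 0 < CW -> exists2 L : nat, (2 <= L)%N &
  forall A k j (x : R), (0 < A)%N -> k != j -> (8 * (lacunary_exponent A L j)%:R)^-1 <= x ->
  lacunary_coef c g A L k * (CW * expR (- ((lacunary_exponent A L k)%:R * x / 4))) <=
  lacunary_coef c g A L j * 9^-1 ^+ ndist k j.
Proof.
move=> c0 g0 CW0; pose D := CW + 1; have D1 : 1 <= D by rewrite /D; lra.
have d0 : 0 < 32^-1 :> R by rewrite invr_gt0.
have [C C0 HC] := expR_beats_power (Num.truncn c).+2 d0.
(* The first entry serves k > j, where exponential decay must absorb the growth of the coefficients;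
   the second serves k < j. *)
pose X := Num.max (9 * D * (C + 1)) ((9 * D * 2 `^ g) `^ c^-1).
have X0 : 0 < X by rewrite lt_max !mulr_gt0//; lra.
pose L := (Num.truncn X).+2; have L2 : (2 <= L)%N by [].
have LX : X <= L%:R ^+ 2.
  apply: (@le_trans _ _ L%:R); last by rewrite expr2 ler_peMr ?ler1n.
  by apply: le_trans (ltW (truncnS_gt _)) _; rewrite ler_nat.
exists L => // A k j x A0 kj xj.
have m0 := lacunary_exponent_gt0 A0 L2.
have aj := lacunary_coef_gt0 c g A0 L2.
set Lam : R := L%:R ^+ 2 in LX; have Lam0 : 0 < Lam by exact: lt_le_trans LX.
have Lam1 : 1 <= Lam by rewrite exprn_ege1 ?ler1n.
have x0 : 0 < x by apply: lt_le_trans xj; rewrite invr_gt0 mulr_gt0.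
have lc : 0 < Lam `^ c by rewrite powR_gt0.
have [lt|gt|E] := ltngtP k j; last by rewrite E eqxx in kj.
  pose i := (j - k)%N; have jE : j = (k + i)%N by rewrite /i subnKC// ltnW.
  have i0 : (0 < i)%N by rewrite subn_gt0.
  have -> : ndist k j = i by rewrite /ndist (eqP (ltnW lt : (k - j == 0)%N)).
  have h := lacunary_coef_down c0 g0 A0 L2 k i; rewrite -jE -/Lam in h.
  have e1 : expR (- ((lacunary_exponent A L k)%:R * x / 4)) <= 1.
    by rewrite -[leRHS]expR0 ler_expR oppr_le0 divr_ge0// mulr_ge0// ltW.
  have t9 : D * (2 `^ g / Lam `^ c) <= 9^-1.
    rewrite mulrA ler_pdivrMr//.
    have : 9 * D * 2 `^ g <= Lam `^ c.
      have b0 : 0 <= 9 * D * 2 `^ g by rewrite mulr_ge0 ?powR_ge0// mulr_ge0//; atom_lra.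
      have {1}-> : 9 * D * 2 `^ g = ((9 * D * 2 `^ g) `^ c^-1) `^ c.
        by rewrite -powRrM mulVf ?gt_eqF// powRr1.
      apply: ge0_ler_powR; rewrite ?nnegrE ?powR_ge0 ?(ltW c0) ?(ltW Lam0)//.
      by apply: le_trans LX; rewrite le_max lexx orbT.
    by atom_lra.
  set th := 2 `^ g / Lam `^ c in h t9; have th0 : 0 <= th by rewrite divr_ge0 ?powR_ge0.
  apply: (@le_trans _ _ (th ^+ i * lacunary_coef c g A L j * D ^+ i)).
    apply: ler_pM => //; rewrite ?mulr_ge0 ?expR_ge0 ?(ltW CW0) ?(ltW (aj k))//.
    apply: (@le_trans _ _ D); first by rewrite -[leRHS]mulr1; apply: ler_pM; rewrite ?expR_ge0 ?(ltW CW0)// lerDl.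
    by rewrite -[leLHS]expr1; apply: ler_weXn2l.
  rewrite mulrAC -exprMn mulrC; apply: ler_wpM2l; first exact: ltW.
  have Dth : 0 <= D * th by rewrite mulr_ge0// (le_trans ler01 D1).
  by rewrite [th * D]mulrC; apply: lerXn2r; rewrite ?nnegrE ?Dth ?invr_ge0.
pose i := (k - j)%N; have kE : k = (j + i)%N by rewrite /i subnKC// ltnW.
have i0 : (0 < i)%N by rewrite subn_gt0.
have -> : ndist k j = i by rewrite /ndist (eqP (ltnW gt : (j - k == 0)%N)) addn0.
have h := lacunary_coef_up c A g0 L2 j i; rewrite -kE -/Lam in h.
pose Y := Lam ^+ i; have Y1 : 1 <= Y by rewrite exprn_ege1.
have Y0 : 0 < Y by atom_lra.
have ex : expR (- ((lacunary_exponent A L k)%:R * x / 4)) <= expR (- (32^-1 * Y)).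
  rewrite ler_expR kE lacunary_exponentD// -/Lam -/Y.
  move: xj; rewrite invfM -ler_pdivlMr ?invr_gt0// invrK => xj.
  have := ler_wpM2l (ltW Y0) xj; atom_lra.
have hc : (Lam `^ c) ^+ i <= Y ^+ (Num.truncn c).+1.
  rewrite -powR_mulrn ?powR_ge0// -powRrM mulrC powRrM powR_mulrn ?(ltW Lam0)// -/Y.
  by rewrite -powR_mulrn ?(ltW Y0)//; apply: ler_powR => //; exact/ltW/truncnS_gt.
have HY := HC Y (ltW Y0); rewrite exprS in HY.
have k1 : (Lam `^ c) ^+ i * (CW * expR (- (32^-1 * Y))) <= D * (C + 1) / Y.
  rewrite ler_pdivlMr//; apply: (@le_trans _ _ (D * (Y * Y ^+ (Num.truncn c).+1 * expR (- (32^-1 * Y))))).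
    have -> : D * (Y * Y ^+ (Num.truncn c).+1 * expR (- (32^-1 * Y))) =
       Y ^+ (Num.truncn c).+1 * (D * expR (- (32^-1 * Y))) * Y by ring.
    apply: ler_wpM2r; first exact: ltW.
    apply: ler_pM; rewrite ?mulr_ge0 ?expR_ge0 ?exprn_ge0 ?powR_ge0 ?(ltW CW0)//.
    by apply: ler_wpM2r; rewrite ?expR_ge0// lerDl.
  by apply: ler_wpM2l; [rewrite (le_trans ler01 D1)|apply: (le_trans HY); rewrite lerDl].
apply: (@le_trans _ _ ((Lam `^ c) ^+ i * lacunary_coef c g A L j * (CW * expR (- (32^-1 * Y))))).
  apply: ler_pM => //; rewrite ?mulr_ge0 ?expR_ge0 ?(ltW CW0) ?(ltW (aj k))//.
  by rewrite ler_wpM2l// ltW.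
rewrite mulrAC [leRHS]mulrC; apply: ler_wpM2r; first exact: ltW.
apply: (le_trans k1); rewrite ler_pdivrMr//.
have e0 : 1 <= D * (C + 1) by atom_nra.
have e1 : 9 * (D * (C + 1)) <= Lam by apply: le_trans LX; rewrite le_max mulrA lexx.
rewrite /Y -exprMn; apply: (@le_trans _ _ ((9^-1 * Lam) ^+ 1)); first by rewrite expr1; atom_lra.
apply: ler_weXn2l => //; atom_lra.
Qed.

Definition peak_grad A l Q (sh : {ffun I -> 'I_Q.+1}) (z : V) : V :=
  \row_j \sum_(g : {ffun I -> 'I_(l.*2).+1}) ((A * l) ^ 2)%:R *
    cdot z (unit_lattice_point sh g) ^+ ((A * l) ^ 2).-1 * (unit_lattice_point sh g 0 j)^*.

Section peak_bounds.
Variables (A l Q : nat) (sh : {ffun I -> 'I_Q.+1}) (r : R).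
Hypotheses (A0 : (0 < A)%N) (l0 : (0 < l)%N) (r0 : 0 < r).
Let M := ((A * l) ^ 2)%N.
Implicit Types z w : V.

Lemma lattice_card : #|{ffun I -> 'I_(l.*2).+1}|%:R <= (9 * M%:R) ^+ n :> R.
Proof.
rewrite card_ffun card_prod !card_ord card_bool mulnC expnM natrX -natrM.
by apply: lerXn2r; rewrite ?nnegrE ?ler0n// ler_nat; exact: odd_square_le.
Qed.

Let dot_le z g : enorm z <= r -> cabs (cdot z (unit_lattice_point (l := l) sh g)) <= r.
Proof.
by move=> zr; apply: le_trans (cauchy_schwarz _ _) _; rewrite unit_lattice_point_norm// mulr1.
Qed.

Let lattice_sum_le (u : {ffun I -> 'I_(l.*2).+1} -> R) (B : R) : 0 <= B -> (forall g, u g <= B) ->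
  \sum_g u g <= (9 * M%:R) ^+ n * B.
Proof.
move=> B0 uB; apply: (@le_trans _ _ (\sum_(g : {ffun I -> 'I_(l.*2).+1}) B)); first exact: ler_sum.
by rewrite sumr_const -[_ *+ _]mulr_natl; apply: ler_wpM2r => //; exact: lattice_card.
Qed.

Lemma peak_sum_pow_le z : enorm z <= r -> cabs (peak_sum A l sh z) <= (9 * M%:R) ^+ n * r ^+ M.
Proof.
move=> zr; apply: le_trans (cabs_sum _ _ _) _; apply: lattice_sum_le => [|g].
  by rewrite exprn_ge0// ltW.
by rewrite cabsX; apply: lerXn2r; rewrite ?nnegrE ?cabs_ge0 ?dot_le// ltW.
Qed.

Let natC (k : nat) : cabs (k%:R : cplx R) = k%:R.
Proof.
have -> : (k%:R : cplx R) = cr k%:R by rewrite /cr rmorph_nat.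
by rewrite cabs_cr ger0_norm.
Qed.

Let M0 : (0 < M)%N. Proof. by rewrite expn_gt0 muln_gt0 A0 l0. Qed.

Lemma peak_grad_le z j : enorm z <= r ->
  r * cabs (peak_grad A l sh z 0 j) <= (9 * M%:R) ^+ n * (M%:R * r ^+ M).
Proof.
move=> zr; rewrite mxE -ler_pdivlMl//; apply: le_trans (cabs_sum _ _ _) _.
rewrite mulrCA; apply: lattice_sum_le => [|g]; first by rewrite !mulr_ge0 ?invr_ge0 ?exprn_ge0// ltW.
have e1 : cabs (unit_lattice_point (R := R) sh g 0 j) <= 1.
  by apply: le_trans (coord_le _ _) _; rewrite unit_lattice_point_norm.
have c1 : cabs (cdot z (unit_lattice_point sh g)) ^+ M.-1 <= r ^+ M.-1.
  by apply: lerXn2r; rewrite ?nnegrE ?cabs_ge0 ?dot_le// ltW.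
have -> : r^-1 * (M%:R * r ^+ M) = M%:R * r ^+ M.-1 * 1.
  by rewrite -[X in r ^+ X](prednK M0) exprS; field; rewrite gt_eqF.
rewrite !cabsM natC cabsJ cabsX; apply: ler_pM; rewrite ?mulr_ge0 ?exprn_ge0 ?cabs_ge0//.
exact: ler_wpM2l.
Qed.

Lemma peak_sum_remainder z w : enorm z <= r -> enorm w <= r ->
  r ^+ 2 * cabs (peak_sum A l sh w - peak_sum A l sh z - lin_form (peak_grad A l sh z) (w - z)) <=
  (9 * M%:R) ^+ n * (M%:R ^+ 2 * r ^+ M) * enorm (w - z) ^+ 2.
Proof.
move=> zr wr; pose e (g : {ffun I -> 'I_(l.*2).+1}) : V := unit_lattice_point sh g.
have -> : lin_form (peak_grad A l sh z) (w - z) =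
    \sum_g M%:R * cdot z (e g) ^+ M.-1 * cdot (w - z) (e g).
  rewrite /lin_form (eq_bigr (fun j => \sum_g (w - z) 0 j * (M%:R * cdot z (e g) ^+ M.-1 * (e g 0 j)^*))).
    rewrite exchange_big /=; apply: eq_bigr => g _; rewrite [cdot (w - z) _]/cdot mulr_sumr.
    by apply: eq_bigr => j _; ring.
  by move=> j _; rewrite [peak_grad _ _ _ _ _ _]mxE mulr_sumr.
rewrite /peak_sum -!sumrB -ler_pdivlMl ?exprn_gt0//; apply: le_trans (cabs_sum _ _ _) _.
rewrite -[in leRHS]mulrA mulrCA; apply: lattice_sum_le => [|g].
  by rewrite !mulr_ge0 ?invr_ge0 ?exprn_ge0 ?enorm_ge0// ltW.
rewrite ler_pdivlMl ?exprn_gt0// cdotBl.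
apply: le_trans (pow_remainder _ (ltW r0) (dot_le g wr) (dot_le g zr)) _.
apply: ler_wpM2l; first by rewrite mulr_ge0 ?exprn_ge0 ?ler0n// ltW.
apply: lerXn2r; rewrite ?nnegrE ?cabs_ge0 ?enorm_ge0// -cdotBl.
by apply: le_trans (cauchy_schwarz _ _) _; rewrite unit_lattice_point_norm// mulr1.
Qed.

End peak_bounds.

(** On |z| <= r < 1 the terms, gradients and remainders are all bounded by multiples of 2^-k, so the
    series converges and is differentiable at every point of the ball. *)
Lemma lacunary_series (c g : R) A L Q (sh : {ffun I -> 'I_Q.+1}) :
  0 < c -> 0 <= g -> (0 < A)%N -> (2 <= L)%N ->
  exists2 f : V -> cplx R, holomorphic_ball f & forall z, ball z ->
    has_csum (fun k => cr (lacunary_coef c g A L k) * peak_sum A (L ^ k) sh z) (f z).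
Proof.
move=> c0 g0 A0 L2; pose a := lacunary_coef c g A L; pose M := lacunary_exponent A L.
have a0 k : 0 < a k := lacunary_coef_gt0 c g A0 L2 k.
have ca k : cabs (cr (a k)) = a k by rewrite cabs_cr gtr0_norm.
have Lk k : (0 < L ^ k)%N by rewrite expn_gt0 (leq_trans _ L2).
have M1 k : 1 <= (M k)%:R :> R by rewrite ler1n -(ltr0n R) lacunary_exponent_gt0.
have sm := lacunary_summable c g0 A0 L2.
have half K (C : R) : 0 <= C -> \sum_(k < K) C * 2^-1 ^+ k <= 2 * C.
  move=> C0; have h0 : 0 <= 2^-1 :> R by rewrite invr_ge0.
  have h1 : 2^-1 < 1 :> R by lra.
  by apply: (le_trans (geometric_le K C0 h0 h1)); rewrite ler_pdivrMr; atom_lra.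
have ex z : ball z -> exists s, has_csum (fun k => cr (a k) * peak_sum A (L ^ k) sh z) s.
  move=> zb; pose r : R := (1 + enorm z) / 2; have z1 : enorm z < 1 := zb.
  have z0 := enorm_ge0 z.
  have r0 : 0 < r by rewrite /r; lra.
  have r1 : r < 1 by rewrite /r; lra.
  have zr : enorm z <= r by rewrite /r; lra.
  have [C C0 HC] := sm r r0 r1; apply: (@csum_exists _ _ (2 * C)) => K.
  apply: le_trans (half K C C0); apply: ler_sum => k _; apply: le_trans (HC k).
  rewrite cabsM ca; apply: ler_wpM2l; first exact: ltW.
  apply: (le_trans (peak_sum_pow_le sh A0 (Lk k) r0 zr)); rewrite -mulrA; apply: ler_wpM2l.
    by rewrite exprn_ge0// mulr_ge0.
  by rewrite -[leLHS]mul1r; apply: ler_wpM2r; [rewrite exprn_ge0// ltW|rewrite exprn_ege1].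
have /choice[f Hf] : forall z : V, exists s, ball z -> has_csum (fun k => cr (a k) * peak_sum A (L ^ k) sh z) s.
  by move=> z; have [/ex[s Hs]|nz] := pselect (ball z); [exists s|exists 0].
exists f => // z0 z0b; pose r : R := (1 + enorm z0) / 2; have z1 : enorm z0 < 1 := z0b.
have zz0 := enorm_ge0 z0.
have r0 : 0 < r by rewrite /r; lra.
have r1 : r < 1 by rewrite /r; lra.
have zr : enorm z0 <= r by rewrite /r; lra.
have [C C0 HC] := sm r r0 r1.
have wr w : enorm (w - z0) < r - enorm z0 -> enorm w <= r.
  by move=> h; have := enorm_triangle (w - z0) z0; rewrite subrK; atom_lra.
pose d k : V := cr (a k) *: peak_grad A (L ^ k) sh z0.
have /choice[b Hb] : forall j, exists s, has_csum (fun k => d k 0 j) s.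
  move=> j; apply: (@csum_exists _ _ (2 * (C / r))) => K.
  apply: le_trans (half K (C / r) _); last by rewrite divr_ge0// ltW.
  apply: ler_sum => k _; rewrite mxE cabsM ca [leRHS]mulrAC ler_pdivlMr// -mulrA.
  apply: le_trans (HC k); apply: ler_wpM2l; first exact: ltW.
  rewrite mulrC; apply: (le_trans (peak_grad_le sh A0 (Lk k) r0 j zr)); rewrite -mulrA; apply: ler_wpM2l.
    by rewrite exprn_ge0// mulr_ge0.
  apply: ler_wpM2r; first by rewrite exprn_ge0// ltW.
  by rewrite expr2 ler_peMr// (le_trans ler01 (M1 k)).
apply: (@series_differentiable _ _ (fun k z => cr (a k) * peak_sum A (L ^ k) sh z) f d (\row_j b j) z0
  (r - enorm z0) (2 * (C / r ^+ 2))).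
- by rewrite /r; atom_lra.
- move=> z /wr zr'; apply: Hf; exact: le_lt_trans zr' r1.
- by move=> j; rewrite mxE; exact: Hb.
move=> K z /wr zr'; rewrite -[leRHS]mulrC.
have cc : 0 <= C / r ^+ 2 by rewrite divr_ge0 ?sqr_ge0.
apply: (@le_trans _ _ (enorm (z - z0) ^+ 2 * \sum_(k < K) C / r ^+ 2 * 2^-1 ^+ k)); last first.
  by apply: ler_wpM2l; [exact: sqr_ge0|exact: half].
rewrite mulr_sumr; apply: ler_sum => k _.
have -> : lin_form (d k) (z - z0) = cr (a k) * lin_form (peak_grad A (L ^ k) sh z0) (z - z0).
  by rewrite /lin_form mulr_sumr; apply: eq_bigr => j _; rewrite !mxE; ring.
rewrite -!mulrBr cabsM ca [C / _ * _]mulrAC mulrA ler_pdivlMr ?exprn_gt0//.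
rewrite -mulrA [cabs _ * _]mulrC; apply: (le_trans (ler_wpM2l (ltW (a0 k)) (peak_sum_remainder sh A0 (Lk k) r0 zr zr'))).
rewrite -/(lacunary_exponent A L k) -/(M k).
apply: (@le_trans _ _ (enorm (z - z0) ^+ 2 * (a k * ((9 * (M k)%:R) ^+ n * (M k)%:R ^+ 2 * r ^+ M k)))).
  by rewrite le_eqVlt; apply/orP; left; apply/eqP; ring.
by apply: ler_wpM2l; [exact: sqr_ge0|exact: HC].
Qed.

End lacunary.

(** * Size of the lacunary functions and membership in the domain *)

Section lacunary_functions.
Context {R : realType} {n : nat}.
Notation Cn := (Cn R n.+1).
Notation V := 'rV[cplx R]_n.+1.
Notation ball := (@cball R n.+1).
Notation S := (@csphere R n.+1).
Notation sigma := (@sphere_measure R n.+1).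
Notation v := (@ball_measure R n.+1).
Notation I := ('I_n * bool)%type.

(** At heights about 1 / M_j the j-th term dominates: for a suitable translate it is at least a_j /
    2, while the others add up to at most a_j / 4, the sum of 9^-|k - j| over k != j being at most
    1/4. *)
Lemma lacunary_family (c g : R) : 0 < c -> 0 <= g ->
  exists (A L Q : nat) (C amin : R) (f : {ffun I -> 'I_Q.+1} -> V -> cplx R),
  let M k : R := (lacunary_exponent A L k)%:R in let a := lacunary_coef c g A L in
  [/\ (8 <= A)%N, (2 <= L)%N, 0 <= C & 0 < amin] /\
  [/\ forall sh, holomorphic_ball (f sh), forall j, amin <= a j,
    forall sh z j, ball z -> (8 * M j)^-1 <= hgt z -> cabs (f sh z) <= C * a j &
    forall z j, ball z -> enorm (z - e1) <= 5^-1 -> (8 * M j)^-1 <= hgt z ->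
      M j * hgt z <= 4^-1 -> exists sh, a j / 4 <= cabs (f sh z)].
Proof.
move=> c0 g0; have [A [Q [CW [A8 CW0 Hup Hlow]]]] := @peak_family R n.
have [L L2 Ht] := lacunary_tail c0 g0 CW0.
have A0 : (0 < A)%N by apply: leq_trans A8.
have /choice[f Hf] : forall sh : {ffun I -> 'I_Q.+1}, exists f : V -> cplx R, holomorphic_ball f /\
    forall z, ball z -> has_csum (fun k => cr (lacunary_coef c g A L k) * peak_sum A (L ^ k) sh z) (f z).
  by move=> sh; have [f h1 h2] := lacunary_series sh c0 g0 A0 L2; exists f.
pose M k : R := (lacunary_exponent A L k)%:R; pose a := lacunary_coef c g A L.
have a0 k : 0 < a k := lacunary_coef_gt0 c g A0 L2 k.
have M0 k : 0 < M k := lacunary_exponent_gt0 A0 L2 k.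
have Lk k : (0 < L ^ k)%N by rewrite expn_gt0 (leq_trans _ L2).
pose F (sh : {ffun I -> 'I_Q.+1}) (z : V) (k : nat) : cplx R := cr (a k) * peak_sum A (L ^ k) sh z.
have ca k : cabs (cr (a k)) = a k by rewrite cabs_cr gtr0_norm.
have Fle sh z k : ball z -> cabs (F sh z k) <= a k * (CW * expR (- (M k * hgt z / 4))).
  by move=> zb; rewrite /F cabsM ca; apply: ler_wpM2l; [exact: ltW|exact: Hup].
have tail sh z j (K : nat) : ball z -> (8 * M j)^-1 <= hgt z ->
    \sum_(k < K | (k : nat) != j) cabs (F sh z k) <= a j / 4.
  move=> zb zj; apply: (@le_trans _ _ (a j * \sum_(k < K | (k : nat) != j) 9^-1 ^+ ndist k j)).
    rewrite mulr_sumr; apply: ler_sum => k kj; apply: le_trans (Fle _ _ _ zb) _.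
    exact: Ht.
  apply: ler_wpM2l; first exact: ltW.
  have h0 : 0 <= 9^-1 :> R by rewrite invr_ge0.
  have h1 : 9^-1 < 1 :> R by lra.
  apply: (le_trans (geometric_sum_away j K h0 h1)).
  by rewrite (_ : 2 * 9^-1 / (1 - 9^-1) = 4^-1 :> R); [|field].
(* A positive lower bound for the coefficients, from the tail estimate for k = 0 at height 1 / (8
   M_j), where the exponential is at least exp(-1). *)
exists A, L, Q, (CW + 4^-1), (Num.min (a 0%N) (a 0%N * (CW * expR (- 1)))), f; split.
  by split => //; [lra|rewrite lt_min a0 /=; exact: mulr_gt0 (a0 _) (mulr_gt0 CW0 (expR_gt0 _))].
split => [sh|j|sh z j zb zj|z j zb ze zj zM].
- by have [] := Hf sh.
- have [->|j0] := eqVneq j 0%N; first by rewrite ge_min lexx.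
  rewrite ge_min; apply/orP; right.
  have x1 : (8 * M j)^-1 <= 1 * (8 * M j)^-1 by rewrite mul1r.
  have h := Ht A 0%N j _ A0 (_ : 0%N != j) (lexx _); rewrite eq_sym j0 in h.
  apply: (@le_trans _ _ (a 0%N * (CW * expR (- (M 0%N * (8 * M j)^-1 / 4))))).
    apply: ler_wpM2l; first exact: ltW.
    apply: ler_wpM2l; first exact: ltW.
    rewrite ler_expR lerN2.
    have M01 : M 0%N <= M j.
      have := lacunary_exponentD A L (R := R) 0 j; rewrite add0n /M => ->.
      by rewrite ler_peMl ?ler0n// exprn_ege1// exprn_ege1// ler1n (leq_trans _ L2).
    have : M 0%N * (8 * M j)^-1 <= 1 by rewrite ler_pdivrMr ?mulr_gt0// mul1r; have := M0 j; atom_lra.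
    lra.
  apply: (le_trans (h isT)); rewrite ler_piMr ?(ltW (a0 j))//.
  by rewrite exprn_ile1 ?invr_ge0// invf_le1// ler1n.
- have [_ Hs] := Hf sh; apply: (has_csum_le (Hs z zb)) => K.
  apply: le_trans (cabs_sum _ _ _) _; rewrite (bigID (fun k : 'I_K => (k : nat) == j)) /= mulrDl.
  apply: lerD; last by rewrite mulrC; exact: tail.
  have Fj : cabs (F sh z j) <= CW * a j.
    apply: le_trans (Fle sh z j zb) _; rewrite mulrC; apply: ler_wpM2r; first exact: ltW.
    rewrite -[leRHS]mulr1; apply: ler_wpM2l; first exact: ltW.
    rewrite -[leRHS]expR0 ler_expR oppr_le0 divr_ge0// mulr_ge0// ltW//.
    exact: hgt_gt0.
  have [jK|jK] := ltnP j K.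
    by rewrite (big_pred1 (Ordinal jK)).
  rewrite big_pred0 ?mulr_ge0 ?(ltW CW0) ?(ltW (a0 j))// => k.
  by apply/negbTE; rewrite neq_ltn (leq_trans (ltn_ord k) jK).
have [sh Hsh] := Hlow (L ^ j)%N z (Lk j) zb ze zM; exists sh.
have [_ Hs] := Hf sh; apply/ler_addgt0Pr => e /(Hs z zb)[K0 HK].
pose K := maxn K0 j.+1; have he := HK K (leq_maxl _ _).
have jK : (j < K)%N by rewrite /K leq_max ltnSn orbT.
have tl := tail sh z j K zb zj.
pose rest := \sum_(i < K | i != Ordinal jK) F sh z i.
have sE : \sum_(k < K) cr (lacunary_coef c g A L k) * peak_sum A (L ^ k) sh z = F sh z j + rest.
  by rewrite (bigD1 (Ordinal jK)).
rewrite sE in he.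
have tr : cabs rest <= a j / 4.
  apply: le_trans (cabs_sum _ _ _) _; apply: le_trans tl.
  by rewrite (eq_bigl (fun i : 'I_K => (i : nat) != j)).
have Fj : a j / 2 <= cabs (F sh z j) by rewrite /F cabsM ca; apply: ler_wpM2l => //; exact: ltW.
have t1 := cabs_leD (F sh z j) rest.
have t2 := cabs_leB (F sh z j + rest) (f sh z).
by rewrite cabsB in he; rewrite -/(a j); atom_lra.
Qed.

(** In the layer of heights about 1 / M_j the function is at most C a_j, and the layer has measure
    of order M_j^-(n.+2) in each Koranyi region. Summing the layers bounds the area integral
    uniformly on the sphere. *)
Lemma lacunary_HT (p q alpha c g C : R) A L (f : V -> cplx R) : 0 < p -> 0 < q -> (0 < A)%N -> (2 <= L)%N ->
  0 <= C -> holomorphic_ball f ->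
  (forall z j, ball z -> (8 * (lacunary_exponent A L j)%:R)^-1 <= hgt z ->
    cabs (f z) <= C * lacunary_coef c g A L j) ->
  (exists B : R, forall J, \sum_(0 <= j < J) (lacunary_exponent A L j)%:R `^ (c * q - (alpha + n.+2%:R)) *
     j.+1%:R `^ (- (g * q)) <= B) ->
  HT p q alpha f.
Proof.
move=> p0 q0 A0 L2 C0 hf Hf [B HB]; apply/(@HTP R n p q alpha f p0); split => //.
pose M k : R := (lacunary_exponent A L k)%:R; pose a := lacunary_coef c g A L.
have a0 k : 0 < a k := lacunary_coef_gt0 c g A0 L2 k.
have M0 k : 0 < M k := lacunary_exponent_gt0 A0 L2 k.
pose dl k : R := (8 * M k)^-1; have dl0 k : 0 < dl k by rewrite invr_gt0 mulr_gt0.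
(* L^2 is the ratio of consecutive heights, so the layers from dl j to G dl j cover; the term 16 M_0
   makes the layer j = 0 reach above height 1. *)
pose G : R := L%:R ^+ 2 + 16 * M 0%N; have G1 : 1 < G.
  have : 1 <= L%:R ^+ 2 :> R by rewrite exprn_ege1// ler1n (leq_trans _ L2).
  by have := M0 0%N; rewrite /G; lra.
have G0 : 0 < G by lra.
pose W j : R := C `^ q * a j `^ q * (G `^ `|alpha| * dl j `^ alpha).
have W0 j : 0 <= W j by rewrite !mulr_ge0 ?powR_ge0.
pose E (xi : Cn) j : set Cn := koranyi xi `&` [set z : Cn | (hgt z < G * dl j)%R].
have mE xi j : measurable (E xi j).
  by apply: measurableI; [exact: measurable_koranyi|apply: measurable_lt_set; exact: measurable_hgt].
have shell_of (z : Cn) : ball z -> exists2 j, dl j <= hgt z & hgt z < G * dl j.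
  move=> zb; have h0 := hgt_gt0 zb; have h1 := hgt_le1 z.
  have ex : exists j, dl j <= hgt z.
    exists (Num.truncn ((hgt z)^-1)).+1; rewrite /dl -[leRHS]invrK lef_pV2 ?posrE ?mulr_gt0 ?invr_gt0//.
    apply: (le_trans (ltW (truncnS_gt _))); set k := _.+1.
    have h : (k <= lacunary_exponent A L k)%N by apply: leq_trans (lacunary_exponent_ge A0 L2 k); rewrite ltnW// ltn_expl.
    have : k%:R <= M k by rewrite ler_nat.
    by have := M0 k; lra.
  case: (ex_minnP ex) => j hj mj; exists j => //; case: j hj mj => [_ _|j _ mj].
    apply: (le_lt_trans h1); rewrite /dl /G mulrDl; apply: (@lt_le_trans _ _ (16 * M 0%N * (8 * M 0%N)^-1)).
      by rewrite ltr_pdivlMr ?mulr_gt0//; have := M0 0%N; lra.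
    by rewrite lerDr; exact: (mulr_ge0 (sqr_ge0 _) (ltW (dl0 0%N))).
  have : hgt z < dl j by rewrite ltNge; apply/negP => /mj; rewrite ltnn.
  move=> /lt_le_trans; apply; rewrite /dl /M lacunary_exponentS -/(M j) /G.
  rewrite [leRHS]mulrDl; apply: (@le_trans _ _ (L%:R ^+ 2 * (8 * (L%:R ^+ 2 * M j))^-1)).
    have l0 : L%:R != 0 :> R by rewrite pnatr_eq0 -lt0n (leq_trans _ L2).
    by rewrite [8 * (_ * _)]mulrCA [(_ * (8 * _))^-1]invfM mulrA divff ?mul1r// expf_neq0.
  rewrite lerDl !mulr_ge0 ?invr_ge0 ?mulr_ge0 ?sqr_ge0//; exact: ltW.
have dens_W (z : Cn) j : ball z -> dl j <= hgt z -> hgt z < G * dl j -> dens q alpha (fun z => cabs (f z)) z <= W j.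
  move=> zb z1 z2; have h0 := hgt_gt0 zb; rewrite /dens /W; apply: ler_pM; rewrite ?powR_ge0//.
    rewrite -powRM ?(ltW (a0 j))//; apply: ge0_ler_powR; rewrite ?nnegrE ?cabs_ge0 ?mulr_ge0 ?(ltW q0) ?(ltW (a0 j))//.
    exact: Hf.
  have [al|al] := leP 0 alpha.
    rewrite (ger0_norm al) -powRM ?(ltW G0) ?(ltW (dl0 j))//.
    by apply: ge0_ler_powR; rewrite ?nnegrE ?mulr_ge0 ?(ltW h0) ?(ltW G0) ?(ltW (dl0 j)) ?(ltW z2).
  apply: (@le_trans _ _ (dl j `^ alpha)).
    rewrite -[alpha]opprK !(powRN _ (- alpha)) lef_pV2 ?posrE ?powR_gt0//.
    by apply: ge0_ler_powR; rewrite ?nnegrE ?oppr_ge0 ?(ltW al) ?(ltW h0) ?(ltW (dl0 j)).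
  by rewrite -[leLHS]mul1r; apply: ler_wpM2r; [exact: powR_ge0|apply: powR_ge1; rewrite ?normr_ge0// ltW].
pose D : R := C `^ q * G `^ `|alpha| * Ksmall (R := R) (n := n) 0 * G `^ n.+2%:R * 8^-1 `^ (alpha + n.+2%:R).
have K0 : 0 <= Ksmall (R := R) (n := n) 0 by apply: Ksmall_ge0; rewrite add0r.
have D0 : 0 <= D by rewrite /D mulr_ge0 ?powR_ge0// mulr_ge0 ?powR_ge0// mulr_ge0 ?K0// mulr_ge0 ?powR_ge0.
have tent_le (xi : Cn) : S xi -> (tent (dens q alpha (fun z => cabs (f z))) xi <= (D * B)%:E)%E.
  move=> xS; pose T j (z : Cn) : \bar R := ((W j)%:E * (\1_(E xi j) z : R)%:E)%E.
  have T0 j z : (0 <= T j z)%E by rewrite /T -EFinM lee_fin mulr_ge0.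
  have mT j : measurable_fun (koranyi xi) (T j).
    apply: emeasurable_funM; first exact: measurable_cst.
    by apply/measurable_EFinP; apply: measurable_indic; exact: mE.
  apply: (@le_trans _ _ (\int[v]_(z in koranyi xi) \sum_(0 <= j <oo) T j z)%E).
    apply: le_ge0_integral => [//|z _|z zk|z _]; first by rewrite lee_fin dens_ge0.
      have [zb _] := zk; have [j j1 j2] := shell_of z zb.
      apply: le_trans (nneseries_lim_ge j.+1 (fun k _ _ => T0 k z)).
      rewrite big_nat_recr//=; apply: (@le_trans _ _ (T j z)); last by rewrite leeDr// sume_ge0.
      rewrite /T indicE mem_set ?mule1; last by split.
      by rewrite lee_fin; exact: dens_W.
    by apply: nneseries_ge0 => k _ _.
  rewrite integral_nneseries//; last exact: measurable_koranyi.
  pose w j : R := D * (M j `^ (c * q - (alpha + n.+2%:R)) * j.+1%:R `^ (- (g * q))).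
  have w0 j : 0 <= w j by rewrite /w; exact: (mulr_ge0 D0 (mulr_ge0 (powR_ge0 _ _) (powR_ge0 _ _))).
  apply: (@le_trans _ _ (\sum_(0 <= j <oo) (w j)%:E)%E).
    apply: lee_nneseries => [k _ _|k _]; first by apply: integral_ge0 => z _; exact: T0.
    have mk := @measurable_koranyi R n xi.
    have m1 : measurable_fun (koranyi xi) (fun z : Cn => (\1_(E xi k) z : R)%:E).
      by apply/measurable_EFinP; apply: measurable_indic; exact: mE.
    have p1 (z : Cn) : koranyi xi z -> (0 <= (\1_(E xi k) z : R)%:E)%E by move=> _; rewrite lee_fin.
    rewrite /T (integralZ_ge0 _ mk m1 p1 (W0 k)) integral_indic// (_ : E xi k `&` koranyi xi = E xi k); last first.
      by apply/seteqP; split => z; [case|move=> h; split => //; case: h].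
    have vE : (v (E xi k) <= (1 * (Ksmall (R := R) (n := n) 0 * (G * dl k) `^ (0 + n.+2%:R)))%:E)%E.
      rewrite -[v _]mul1e -(integral_cst v (mE xi k) 1%E).
      apply: (@koranyi_small_dom _ _ xi (E xi k) (fun=> 1) 1 0) => //.
      - by rewrite mulr_gt0.
      - by move=> z [].
      - by move=> z [].
      by move=> z _; rewrite powRr0 mulr1.
    rewrite mul1r add0r in vE.
    have W0' : (0 <= (W k)%:E)%E by rewrite lee_fin.
    apply: (le_trans (lee_wpmul2l W0' vE)); rewrite -EFinM lee_fin le_eqVlt; apply/orP; left; apply/eqP.
    rewrite /W /w /D powRM ?(ltW G0) ?(ltW (dl0 k))//.
    have -> : a k `^ q = M k `^ (c * q) * k.+1%:R `^ (- (g * q)).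
      by rewrite powRM ?powR_ge0// -!powRrM mulNr.
    have dE : dl k `^ alpha * dl k `^ n.+2%:R = 8^-1 `^ (alpha + n.+2%:R) * M k `^ (- (alpha + n.+2%:R)).
      rewrite -powRD ?(gt_eqF (dl0 k)) ?implybT// /dl invfM powRM ?invr_ge0 ?(ltW (M0 k))//.
      by congr (_ * _); rewrite -[(M k)^-1]powR_inv1 ?(ltW (M0 k))// -powRrM mulN1r.
    rewrite [M k `^ (c * q - _)]powRD ?(gt_eqF (M0 k)) ?implybT//.
    transitivity (C `^ q * G `^ `|alpha| * Ksmall (R := R) (n := n) 0 * G `^ n.+2%:R *
      (M k `^ (c * q) * k.+1%:R `^ (- (g * q))) * (dl k `^ alpha * dl k `^ n.+2%:R)); first by ring.
    by rewrite dE; ring.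
  apply: lime_le; first by apply: is_cvg_nneseries => k _ _; rewrite lee_fin.
  apply: nearW => J; rewrite sumEFin lee_fin /w -mulr_sumr; apply: ler_wpM2l => //; exact: HB.
have B0 : 0 <= B by have := HB 0%N; rewrite big_geq.
apply: (@le_lt_trans _ _ ((D * B) `^ (p / q))%:E); last exact: ltry.
apply: (@le_trans _ _ (\int[sigma]_(xi in S) cst ((D * B) `^ (p / q))%:E xi)%E).
  apply: le_ge0_integral => [//|x _|x xS|x _]; first exact: poweR_ge0.
    rewrite /cst -poweR_EFin; apply: le_poweR; first by rewrite divr_ge0 ?(ltW p0) ?(ltW q0).
      by apply: tent_ge0 => z _; exact: dens_ge0.
    exact: tent_le.
  by rewrite lee_fin powR_ge0.
rewrite integral_cst; last exact: measurable_csphere.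
rewrite -[leRHS]mule1; apply: lee_wpmul2l; first by rewrite lee_fin powR_ge0.
by apply: probability_le1; exact: measurable_csphere.
Qed.

End lacunary_functions.

(** * Divergence of area integrals near a boundary point *)

Section divergence.
Context {R : realType} {n : nat}.
Notation Cn := (Cn R n.+1).
Notation V := 'rV[cplx R]_n.+1.
Notation ball := (@cball R n.+1).
Notation S := (@csphere R n.+1).
Notation sigma := (@sphere_measure R n.+1).
Notation v := (@ball_measure R n.+1).

Lemma harmonic_series_pinfty (k : R) : 0 < k -> (\sum_(0 <= j <oo) (k / j.+1%:R)%:E = +oo)%E.
Proof.
move=> k0; apply/eqP; rewrite eq_le leey /= leNgt; apply/negP => lt.
have nn (j : nat) : (0 <= (k / j.+1%:R)%:E)%E by rewrite lee_fin divr_ge0 ?(ltW k0).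
apply: (@dvg_harmonic R); apply: nondecreasing_is_cvgn.
  by apply: nondecreasing_series => j _ _; exact: harmonic_ge0.
pose G := fine (\sum_(0 <= j <oo) (k / j.+1%:R)%:E)%E.
have GE : (\sum_(0 <= j <oo) (k / j.+1%:R)%:E = G%:E)%E.
  by rewrite fineK// ge0_fin_numE//; apply: nneseries_ge0 => j _ _; exact: nn.
exists (G / k) => _ [J _ <-]; rewrite /series /= ler_pdivlMr// mulr_suml -lee_fin -GE.
rewrite -sumEFin; apply: le_trans (nneseries_lim_ge J (fun j _ _ => nn j)).
by apply: lee_sum => j _; rewrite /harmonic /= mulrC.
Qed.

Lemma koranyi_near_e1 (xi z : Cn) : S xi -> pole xi <= 200^-1 -> koranyi xi z ->
  hgt z <= 200^-1 -> enorm (z - e1) <= 5^-1.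
Proof.
move=> xS px [zb zk] hz; have x1 : enorm xi = 1 := xS.
have z1 : enorm z < 1 := zb; have z0 := enorm_ge0 z.
have d1 : enorm (z - xi) ^+ 2 <= 100^-1.
  rewrite enormB2 x1 expr1n.
  have := cre_le_cabs (1 - cdot z xi); rewrite creB cre1; move: zk; rewrite -/(hgt z); nra.
have d2 : enorm (xi - e1) ^+ 2 <= 100^-1.
  rewrite enormB2 x1 [enorm e1]enorm_e1 expr1n.
  have := cre_le_cabs (1 - cdot xi e1); rewrite creB cre1 -pole_cdot; lra.
have h1 : enorm (z - xi) <= 10^-1 by have := enorm_ge0 (z - xi); nra.
have h2 : enorm (xi - e1) <= 10^-1 by have := enorm_ge0 (xi - e1); nra.
have -> : z - e1 = (z - xi) + (xi - e1) by rewrite addrA subrK.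
by apply: le_trans (enorm_triangle _ _) _; lra.
Qed.

(** Which of the finitely many functions has infinite area integral may vary with xi; but if all the
    norms were finite, their sum would be too, although it is infinite on a cap of positive
    measure. *)
Lemma tent_int_sum_pinfty (t s beta : R) (I : finType) (u : I -> Cn -> R) (d : R) :
  0 < t -> 0 < s -> 0 < d -> d <= 1 -> (forall i, measurable_fun ball (u i)) ->
  (forall xi : Cn, S xi -> pole xi < d -> (\sum_i tent (dens s beta (u i)) xi = +oo)%E) ->
  exists i, tent_int t s beta (u i) = +oo%E.
Proof.
move=> t0 s0 d0 d1 mu H; apply: contrapT => N.
have ts : 0 < t / s by rewrite divr_gt0.
have fin i : (tent_int t s beta (u i) < +oo)%E.
  by rewrite ltNge leye_eq; apply/negP => /eqP E; apply: N; exists i.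
have tn i xi : (0 <= tent (dens s beta (u i)) xi)%E by apply: tent_ge0 => z _; exact: dens_ge0.
have mS := @measurable_csphere R n.+1.
have mT i : measurable_fun S (fun x => (tent (dens s beta (u i)) x `^ (t / s))%E).
  apply: measurable_funTS; apply: (measurableT_comp (@measurable_poweR R (t / s))).
  by apply: measurable_tent; [exact: measurable_dens|move=> z _; exact: dens_ge0].
have : (\sum_i tent_int t s beta (u i) < +oo)%E by apply: lte_sum_pinfty => i _; exact: fin.
rewrite -(ge0_integral_sum sigma mS mT (fun i x _ => poweR_ge0 _ _)).
apply/negP; rewrite -leNgt leye_eq; apply/eqP/eqP; rewrite -leye_eq.
have mc := @measurable_cap_sphere R n e1 d.
have cpos : (0 < sigma (cap e1 d `&` S))%E.
  apply: lt_le_trans (cap_sphere_ge enorm_e1 d0 d1).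
  by rewrite lte_fin mulr_gt0 ?exprn_gt0 ?Clow_gt0.
apply: (@le_trans _ _ (\int[sigma]_(x in cap e1 d `&` S) cst +oo x)%E).
  by rewrite integral_cst// gt0_mulye.
apply: le_ge0_integral => [x [_ ?]//|x _|x [xc xS]|x _]; first by rewrite leey.
  have px : pole x < d by rewrite pole_cdot.
  have := H x xS px; have [[i Hi] _|none] := pselect (exists i, tent (dens s beta (u i)) x = +oo%E).
    rewrite (bigD1 i)//= Hi poweRyr ?gt_eqF// addye//.
    by rewrite gt_eqF// (lt_le_trans (ltNyr 0))// sume_ge0// => k _; exact: poweR_ge0.
  move=> E; exfalso; have : (\sum_i tent (dens s beta (u i)) x < +oo)%E.
    apply: lte_sum_pinfty => i _; rewrite ltNge leye_eq; apply/negP => /eqP Ei.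
    by apply: none; exists i.
  by rewrite E.
by apply: sume_ge0 => i _; exact: poweR_ge0.
Qed.

(** On the shell of heights between dl j and 2 dl j one of the functions is at least kap a_j^N. The
    shells are disjoint, and under the two inequalities on c and g the j-th one contributes at least
    a fixed multiple of 1 / (j + 1): the harmonic series. *)
Lemma lacunary_tent_pinfty (s beta c g kap : R) A L (I : finType) (u : I -> Cn -> R) (N : nat) (xi : Cn) :
  0 < s -> 0 < kap -> (8 <= A)%N -> (2 <= L)%N -> (forall i, measurable_fun ball (u i)) ->
  beta + n.+2%:R <= c * (N%:R * s) -> g * (N%:R * s) <= 1 -> S xi -> pole xi < 200^-1 ->
  (forall z j, ball z -> enorm (z - e1) <= 5^-1 -> (8 * (lacunary_exponent A L j)%:R)^-1 <= hgt z ->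
    (lacunary_exponent A L j)%:R * hgt z <= 4^-1 ->
    exists i, kap * lacunary_coef c g A L j ^+ N <= u i z) ->
  (\sum_i tent (dens s beta (u i)) xi = +oo)%E.
Proof.
move=> s0 kap0 A8 L2 mu bN gN xS px Hu; have A0 : (0 < A)%N by apply: leq_trans A8.
pose M k : R := (lacunary_exponent A L k)%:R; pose a := lacunary_coef c g A L.
have a0 k : 0 < a k := lacunary_coef_gt0 c g A0 L2 k.
have M0 k : 0 < M k := lacunary_exponent_gt0 A0 L2 k.
pose dl k : R := (8 * M k)^-1; have dl0 k : 0 < dl k by rewrite invr_gt0 mulr_gt0.
have Mk k : 64 <= M k.
  rewrite /M ler_nat /lacunary_exponent (_ : 64 = 8 ^ 2)%N// leq_sqr.
  by apply: leq_trans A8 _; rewrite leq_pmulr// expn_gt0 (leq_trans _ L2).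
have dl1 k : dl k <= 8^-1 * 64^-1.
  by rewrite /dl invfM ler_pM2l ?invr_gt0// lef_pV2 ?posrE.
(* A ratio of at least 4 between consecutive heights keeps the shells, which span a factor 2,
   disjoint. *)
have dlS k : 4 * dl k.+1 <= dl k.
  have L4 : 4 <= L%:R ^+ 2 :> R by rewrite -natrX ler_nat (_ : 4 = 2 ^ 2)%N// leq_sqr.
  have -> : dl k.+1 = (L%:R ^+ 2)^-1 * dl k by rewrite /dl /M lacunary_exponentS mulrCA invfM.
  rewrite mulrA ler_piMl ?(ltW (dl0 k))// ler_pdivrMr ?mul1r//.
  exact: lt_le_trans L4.
have dl_mono j k : (j < k)%N -> 4 * dl k <= dl j.
  elim: k => // k IH; rewrite ltnS leq_eqVlt => /orP[/eqP->//|/IH h].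
  by apply: le_trans (dlS k) _; have := dl0 k; lra.
pose U (z : Cn) : R := \sum_i dens s beta (u i) z.
have U0 z : 0 <= U z by apply: sumr_ge0 => i _; exact: dens_ge0.
have mk := @measurable_koranyi R n xi.
have kb : koranyi xi `<=` ball by move=> z [].
have mD i : measurable_fun (koranyi xi) (fun z => (dens s beta (u i) z)%:E).
  by apply/measurable_EFinP; apply: (measurable_funS (@measurable_cball R n.+1) kb); exact: measurable_dens.
have -> : (\sum_i tent (dens s beta (u i)) xi = \int[v]_(z in koranyi xi) (U z)%:E)%E.
  rewrite /tent -(ge0_integral_sum v mk mD (fun i z _ => _)); last by move=> i z _; rewrite lee_fin dens_ge0.
  by apply: eq_integral => z _; rewrite sumEFin.
pose E j : set Cn := koranyi xi `&` shell (dl j) (2 * dl j).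
have mE j : measurable (E j) by apply: measurableI => //; exact: measurable_shell.
have tE : trivIset setT E.
  apply/trivIsetP => j k _ _; wlog jk : j k / (j < k)%N.
    by move=> W; rewrite neq_lt => /orP[h|h]; [|rewrite setIC]; apply: W; rewrite // lt_eqF.
  move=> _; apply/seteqP; split => // z [[_ /andP[h1 _]] [_ /andP[_ h2]]].
  by have := dl_mono j k jk; have := dl0 k; lra.
pose K := kap `^ s * (2 `^ (- `|beta|) * Clow (R := R) (n := n)) * 8^-1 `^ (beta + n.+2%:R).
have K0 : 0 < K.
  by rewrite /K mulr_gt0 ?powR_gt0 ?invr_gt0// mulr_gt0 ?powR_gt0// mulr_gt0 ?powR_gt0 ?Clow_gt0.
have EU j (z : Cn) : E j z -> kap `^ s * a j `^ (N%:R * s) * (2 `^ (- `|beta|) * dl j `^ beta) <= U z.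
  move=> [zk /andP[h1 h2]]; have [zb _] := zk; have h0 := hgt_gt0 zb.
  have zn : enorm (z - e1) <= 5^-1.
    by apply: (koranyi_near_e1 xS (ltW px) zk); have := dl1 j; atom_lra.
  have Mh : M j * hgt z <= 4^-1.
    have : M j * hgt z <= M j * (2 * dl j) by apply: ler_wpM2l => //; exact: ltW.
    have dM : dl j * (8 * M j) = 1 by rewrite mulVf// gt_eqF// mulr_gt0.
    by move: (dl j) (M j) (hgt z) dM => x y w dM; atom_lra.
  have [i Hi] := Hu z j zb zn h1 Mh.
  apply: (@le_trans _ _ (dens s beta (u i) z)); last first.
    by rewrite /U (bigD1 i)//= lerDl sumr_ge0// => k _; exact: dens_ge0.
  rewrite /dens; apply: ler_pM; rewrite ?mulr_ge0 ?powR_ge0//.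
    rewrite [a j `^ _]powRrM powR_mulrn ?(ltW (a0 j))// -powRM ?exprn_ge0 ?(ltW kap0) ?(ltW (a0 j))//.
    have k0 : 0 <= kap * a j ^+ N by rewrite mulr_ge0 ?exprn_ge0 ?(ltW kap0) ?(ltW (a0 j)).
    by apply: ge0_ler_powR; rewrite ?nnegrE ?(ltW s0)// (le_trans k0 Hi).
  have [be|be] := leP 0 beta.
    apply: (@le_trans _ _ (dl j `^ beta)).
      by rewrite ler_piMl ?powR_ge0// powRN invf_le1 ?powR_gt0//; apply: powR_ge1; rewrite ?normr_ge0// ler1n.
    by apply: ge0_ler_powR; rewrite ?nnegrE ?(ltW h0) ?(ltW (dl0 j)).
  rewrite (ltr0_norm be) opprK -powRM ?(ltW (dl0 j))// -[beta]opprK !(powRN _ (- beta)).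
  rewrite lef_pV2 ?posrE ?powR_gt0 ?mulr_gt0//.
  by apply: ge0_ler_powR; rewrite ?nnegrE ?oppr_ge0 ?mulr_ge0 ?(ltW be) ?(ltW h0) ?(ltW (dl0 j)).
have mU : measurable_fun (\bigcup_j E j) (fun z => (U z)%:E).
  apply: (@measurable_funS _ _ _ _ (koranyi xi)) => //; first by move=> z [j _ []].
  rewrite (_ : (fun z => (U z)%:E) = (fun z => \sum_i (dens s beta (u i) z)%:E)%E).
    by apply: emeasurable_sum => i _; exact: mD.
  by apply/funext => z; rewrite sumEFin.
apply/eqP; rewrite eq_le leey /= -(harmonic_series_pinfty K0).
apply: (@le_trans _ _ (\int[v]_(z in \bigcup_j E j) (U z)%:E)%E); last first.
  apply: le_ge0_integral => [z [j _ []]//|z _|z _|z _] //; by rewrite lee_fin U0.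
rewrite ge0_integral_bigcup//; last by move=> z _; rewrite lee_fin U0.
apply: lee_nneseries => [j _ _|j _]; first by rewrite lee_fin divr_ge0 ?(ltW K0).
apply: (@le_trans _ _ (\int[v]_(z in E j) cst (kap `^ s * a j `^ (N%:R * s) * (2 `^ (- `|beta|) * dl j `^ beta))%:E z)%E); last first.
  apply: le_ge0_integral => // z zE; rewrite ?lee_fin ?mulr_ge0 ?powR_ge0 ?U0//; exact: EU.
rewrite integral_cst//.
have c1 : (0 <= (kap `^ s * a j `^ (N%:R * s) * (2 `^ (- `|beta|) * dl j `^ beta))%:E)%E.
  by rewrite lee_fin !mulr_ge0 ?powR_ge0.
have d2 : dl j <= 1 / 2 by have := dl1 j; lra.
apply: le_trans (lee_wpmul2l c1 (shell_ge xS (dl0 j) d2)); rewrite -EFinM lee_fin.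
have Ma : a j `^ (N%:R * s) = M j `^ (c * (N%:R * s)) * j.+1%:R `^ (- (g * (N%:R * s))).
  by rewrite powRM ?powR_ge0// -!powRrM mulNr.
have dE : dl j `^ beta * dl j ^+ n.+2 = 8^-1 `^ (beta + n.+2%:R) * M j `^ (- (beta + n.+2%:R)).
  rewrite powR_natD// /dl invfM powRM ?invr_ge0 ?(ltW (M0 j))//.
  by congr (_ * _); rewrite -[(M j)^-1]powR_inv1 ?(ltW (M0 j))// -powRrM mulN1r.
have -> : kap `^ s * a j `^ (N%:R * s) * (2 `^ (- `|beta|) * dl j `^ beta) * (Clow (R := R) (n := n) * dl j ^+ n.+2) =
   K * (M j `^ (c * (N%:R * s)) * M j `^ (- (beta + n.+2%:R)) * j.+1%:R `^ (- (g * (N%:R * s)))).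
  transitivity (kap `^ s * a j `^ (N%:R * s) * 2 `^ (- `|beta|) * Clow (R := R) (n := n) * (dl j `^ beta * dl j ^+ n.+2)); first by ring.
  by rewrite dE Ma /K; ring.
apply: ler_wpM2l; first exact: ltW.
rewrite -powRD ?(gt_eqF (M0 j)) ?implybT// -[leLHS]mul1r; apply: ler_pM; rewrite ?invr_ge0//.
  by apply: powR_ge1; [have := Mk j; lra|rewrite subr_ge0].
by rewrite powRN lef_pV2 ?posrE ?powR_gt0// -[leRHS]powRr1//; apply: ler_powR; rewrite // ler1n.
Qed.

End divergence.

(** * The bound on the degree from area integrals *)

Section shell_degree.
Context {R : realType} {n : nat}.
Notation Cn := (Cn R n.+1).
Notation V := 'rV[cplx R]_n.+1.
Notation ball := (@cball R n.+1).

Lemma powR_natX (e : R) j : 2 `^ e ^+ j = (2 ^ j)%:R `^ e.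
Proof. by rewrite powR_exprn// natrX. Qed.

(* Cauchy condensation. *)
Lemma riemann_sum_bounded (b : R) : 1 < b -> exists B : R, forall J : nat,
  \sum_(0 <= j < J) j.+1%:R `^ (- b) <= B.
Proof.
move=> b1; pose r : R := 2 `^ (1 - b).
have r0 : 0 <= r by exact: powR_ge0.
have r1 : r < 1.
  rewrite /r -[1 - b]opprB powRN invf_lt1 ?powR_gt0//.
  by apply: powR_gt1_base; rewrite subr_gt0.
have dy K : \sum_(0 <= j < 2 ^ K) j.+1%:R `^ (- b) <= 1 + \sum_(k < K) 1 * r ^+ k.
  elim: K => [|K IH]; first by rewrite expn0 big_nat1 big_ord0 addr0 powR1.
  rewrite (big_cat_nat _ (n := 2 ^ K)) ?leq_exp2l//= big_ord_recr /= addrA; apply: lerD => //.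
  rewrite mul1r; apply: (@le_trans _ _ (\sum_(2 ^ K <= j < 2 ^ K.+1) (2 ^ K)%:R `^ (- b))).
    apply: ler_sum_nat => j /andP[j1 _]; rewrite !powRN lef_pV2 ?posrE ?powR_gt0 ?ltr0n ?expn_gt0//.
    by apply: ge0_ler_powR; rewrite ?nnegrE ?ler0n ?(le_trans ler01 (ltW b1))// ler_nat ltnW.
  rewrite sumr_const_nat expnS mul2n -addnn addnK -[_ *+ _]mulr_natl.
  have p2 : 0 < (2 ^ K)%:R :> R by rewrite ltr0n expn_gt0.
  rewrite /r powR_natX -{1}[(2 ^ K)%:R]powRr1 ?(ltW p2)// -powRD//.
  by rewrite (gt_eqF p2) implybT.
exists (1 + 1 / (1 - r)) => J; apply: (@le_trans _ _ (\sum_(0 <= j < 2 ^ J) j.+1%:R `^ (- b))).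
  rewrite [leRHS](big_cat_nat _ (n := J)) ?(ltnW (ltn_expl _ _))//= lerDl.
  by apply: sumr_ge0 => j _; exact: powR_ge0.
by apply: (le_trans (dy J)); rewrite lerD2l; exact: geometric_le.
Qed.

Variables (p q alpha t s beta : R) (P : {poly cplx R}).
Hypotheses (p0 : 0 < p) (q0 : 0 < q) (a0 : 0 < alpha + n.+2%:R).
Hypotheses (t0 : 0 < t) (s0 : 0 < s) (b0 : 0 < beta + n.+2%:R).
Hypothesis maps : HT_maps p q alpha t s beta (@superposition R n.+1 (horner P)).
Let N := (size P).-1.

(** The summability hypothesis puts the lacunary functions in the domain, while the last two
    inequalities make the area integrals of their images diverge. Only the finite family of
    translates is tested. *)
Let lacunary_contradiction (c g : R) : (0 < N)%N -> 0 < c -> 0 <= g ->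
  (forall A L, (0 < A)%N -> (2 <= L)%N -> exists B : R, forall J,
     \sum_(0 <= j < J) (lacunary_exponent A L j)%:R `^ (c * q - (alpha + n.+2%:R)) *
       j.+1%:R `^ (- (g * q)) <= B) ->
  beta + n.+2%:R <= c * (N%:R * s) -> g * (N%:R * s) <= 1 -> False.
Proof.
move=> N0 c0 g0 HB bN gN; have [A [L [Q [C [am [f [[A8 L2 C0 am0] [hf Ha Hup Hlow]]]]]]]] := @lacunary_family R n c g c0 g0.
have A0 : (0 < A)%N by apply: leq_trans A8.
have Pn : P != 0 by apply: contraTneq N0 => P0; rewrite /N P0 size_poly0.
have [c1 [M0 [c10 M00 HP]]] := horner_ge Pn; rewrite -/N in HP.
(* Scaling by [Rc] lifts the function above the threshold M0 wherever it was at least a_j / 4, so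
   that the leading term bounds P from below there. *)
pose Rc := 4 * (M0 + 1) / am; have Rc0 : 0 < Rc by rewrite divr_gt0// mulr_gt0//; lra.
have cRc : cabs (cr Rc) = Rc by rewrite cabs_cr gtr0_norm.
pose F sh (z : V) : cplx R := cr Rc * f sh z.
have hF sh : holomorphic_ball (F sh) by exact: holomorphicZ.
have FHT sh : HT p q alpha (F sh).
  apply: (@lacunary_HT R n p q alpha c g (Rc * C) A L) => //; first by rewrite mulr_ge0// ltW.
    move=> z j zb zj; rewrite cabsM cRc -mulrA; apply: ler_wpM2l; first exact: ltW.
    exact: Hup.
  exact: HB.
pose u sh (z : Cn) : R := cabs (superposition (horner P) (F sh) z).
have mu sh : measurable_fun ball (u sh) by apply: holomorphic_measurable; have [] := maps (FHT sh).
have d0 : 0 < 200^-1 :> R by rewrite invr_gt0.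
have d1 : 200^-1 <= 1 :> R by rewrite invf_le1// ler1n.
pose kap := c1 * (Rc / 4) ^+ N.
have kap0 : 0 < kap by rewrite mulr_gt0// exprn_gt0// divr_gt0.
have [xi xS px|sh E] := tent_int_sum_pinfty (beta := beta) t0 s0 d0 d1 mu.
  apply: (lacunary_tent_pinfty s0 kap0 A8 L2 mu bN gN xS px) => z j zb ze zj zM.
  have [sh Hsh] := Hlow z j zb ze zj zM; exists sh.
  set a := lacunary_coef c g A L j in Hsh *; have aj : am <= a := Ha j.
  have Fz : Rc / 4 * a <= cabs (F sh z).
    by rewrite cabsM cRc; have := ler_wpM2l (ltW Rc0) Hsh; atom_lra.
  have R4 : 0 <= Rc / 4 * a := mulr_ge0 (divr_ge0 (ltW Rc0) (ler0n _ 4)) (ltW (lt_le_trans am0 aj)).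
  have FM : M0 <= cabs (F sh z).
    apply: le_trans Fz; have : Rc / 4 * am <= Rc / 4 * a by apply: ler_wpM2l => //; rewrite divr_ge0// ltW.
    have -> : Rc / 4 * am = M0 + 1 by rewrite /Rc; field; rewrite gt_eqF.
    atom_lra.
  rewrite /u /superposition /=; apply: le_trans (HP _ FM).
  rewrite /kap -mulrA -exprMn; apply: ler_wpM2l; first exact: ltW.
  by apply: lerXn2r; rewrite ?nnegrE ?cabs_ge0.
have [_ ] := (@HTP R n t s beta _ t0).1 (maps (FHT sh)).
by rewrite -/(u sh) E.
Qed.

(** If N k0 > k1, an exponent c with k1 / N < c < k0 and g = 0 leads to a contradiction. In the case
    of equality take c = k0 and g = 1 / (N s): then g q > 1 exactly when q > N s. *)
Lemma HT_maps_shell_degree : (0 < N)%N ->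
  N%:R * ((alpha + n.+2%:R) / q) <= (beta + n.+2%:R) / s /\
  (N%:R * ((alpha + n.+2%:R) / q) = (beta + n.+2%:R) / s -> q <= N%:R * s).
Proof.
move=> N0; have NR : 0 < N%:R :> R by rewrite ltr0n.
set k0 := (alpha + _) / q; set k1 := (beta + _) / s.
have k00 : 0 < k0 by rewrite divr_gt0.
have k10 : 0 < k1 by rewrite divr_gt0.
have kq : k0 * q = alpha + n.+2%:R by rewrite divfK// gt_eqF.
have ks : k1 * s = beta + n.+2%:R by rewrite divfK// gt_eqF.
split=> [|E].
  rewrite leNgt; apply/negP => lt; pose c := (k1 / N%:R + k0) / 2.
  have lt' : k1 / N%:R < k0 by rewrite ltr_pdivrMr// mulrC.
  have kN : 0 < k1 / N%:R by rewrite divr_gt0.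
  have c0 : 0 < c by rewrite /c; lra.
  have ck : c < k0 by rewrite /c; lra.
  have kc : k1 <= c * N%:R by rewrite -ler_pdivrMr// /c; lra.
  apply: (@lacunary_contradiction c 0 N0 c0 (lexx 0)); last 2 first.
  - by rewrite -ks mulrA; apply: ler_wpM2r => //; exact: ltW.
  - by rewrite mul0r.
  move=> A L A0 L2; pose e := c * q - (alpha + n.+2%:R).
  have e0 : e < 0 by rewrite /e -kq subr_lt0 ltr_pM2r.
  pose r : R := 2 `^ e; have r0 : 0 <= r by exact: powR_ge0.
  have r1 : r < 1.
    rewrite /r -[e]opprK powRN invf_lt1 ?powR_gt0//.
    by apply: powR_gt1_base; rewrite oppr_gt0.
  exists (1 / (1 - r)) => J; rewrite big_mkord; apply: le_trans (geometric_le J ler01 r0 r1).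
  apply: ler_sum => j _; rewrite mul0r oppr0 powRr0 mulr1 mul1r -/e.
  have m0 := lacunary_exponent_gt0 (R := R) A0 L2 j.
  rewrite /r powR_natX -[e]opprK !(powRN _ (- e)) lef_pV2 ?posrE ?(powR_gt0 _ m0) ?powR_gt0 ?ltr0n ?expn_gt0//.
  by apply: ge0_ler_powR; rewrite ?nnegrE ?ler0n ?oppr_ge0 ?(ltW e0)// ler_nat lacunary_exponent_ge.
rewrite leNgt; apply/negP => lt.
have Ns : 0 < N%:R * s by rewrite mulr_gt0.
apply: (@lacunary_contradiction k0 (N%:R * s)^-1 N0 k00); rewrite ?invr_ge0 ?(ltW Ns)//.
- move=> A L A0 L2; rewrite kq subrr mulrC.
  have [B HB] : exists B : R, forall J : nat, \sum_(0 <= j < J) j.+1%:R `^ (- (q / (N%:R * s))) <= B.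
    by apply: riemann_sum_bounded; rewrite ltr_pdivlMr// mul1r.
  by exists B => J; under eq_bigr do rewrite powRr0 mul1r.
- by rewrite mulrCA -/k0 mulrA E ks.
- by rewrite mulVf ?gt_eqF.
Qed.

End shell_degree.

(** * Translation into the numerical conditions *)

Lemma growth_degreeE (R : realType) (p q s t a b m N : R) :
  0 < p -> 0 < q -> 0 < s -> 0 < t -> 0 < a -> 0 < b -> 0 < m ->
  (N <= p * q * (t * b + m * s) / (s * t * (p * a + m * q))) =
  (N * (m / p + a / q) <= m / t + b / s).
Proof.
move=> p0 q0 s0 t0 a0 b0 m0; have K0 : 0 < m / p + a / q by rewrite addr_gt0 ?divr_gt0.
have d0 : 0 < m * q + a * p by rewrite addr_gt0 ?mulr_gt0.
rewrite -[RHS]ler_pdivlMr//; congr (_ <= _); field.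
by rewrite !gt_eqF.
Qed.

Lemma cross_mul (R : realType) (N a b q s : R) : 0 < q -> 0 < s -> N * (a / q) = b / s ->
  N * s * a = q * b.
Proof.
move=> q0 s0 E; have -> : N * s * a = N * (a / q) * (q * s) by field; rewrite gt_eqF.
by rewrite E; field; rewrite gt_eqF.
Qed.

Section superposition_characterization.
Context {R : realType} {n : nat}.
Variables (p q s t alpha beta : R).
Hypotheses (p0 : 0 < p) (q0 : 0 < q) (s0 : 0 < s) (t0 : 0 < t).
Let a := alpha + n.+2%:R.
Let b := beta + n.+2%:R.
Let m : R := n.+1%:R.
Hypotheses (a0 : 0 < a) (b0 : 0 < b).

(** The conditions of the theorem in dimension n.+1, with a, b and m for n + 1 + alpha, n + 1 + beta
    and n. *)
Definition degree_condition (N : R) : Prop := [/\ p * a / q < t * b / s ->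
    N <= p * q * (t * b + m * s) / (s * t * (p * a + m * q)),
  p * a / q >= t * b / s -> alpha <= beta -> N <= q * b / (s * a) &
  p * a / q >= t * b / s -> alpha > beta -> N < q * b / (s * a)].

Let m0 : 0 < m. Proof. by rewrite ltr0n. Qed.

Let shell_degreeE : q * b / (s * a) = (b / s) / (a / q).
Proof. by rewrite invf_div mulf_div mulrC [q * b]mulrC [b * q]mulrC mulrC. Qed.

Let a_q : 0 < a / q. Proof. exact: divr_gt0. Qed.
Let b_s : 0 < b / s. Proof. exact: divr_gt0. Qed.

Lemma degree_condition_sufficient (P : {poly cplx R}) : degree_condition ((size P).-1)%:R ->
  [/\ HT_maps p q alpha t s beta (@superposition R n.+1 (horner P)),
    HT_bounded_op p q alpha t s beta (@superposition R n.+1 (horner P)) &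
    HT_continuous_op p q alpha t s beta (@superposition R n.+1 (horner P))].
Proof.
move=> [H1 H2 H3]; have [N0|N0] := posnP (size P).-1.
  (* For a constant any exponent above 0 is allowed; this one makes both t nu <= p and nu kappa <
     kappa' hold, the strict alternative of [emb_cond]. *)
  pose nu := Num.min (p / t) (b / s / (a / q) / 2).
  have nu0 : 0 < nu by rewrite lt_min !divr_gt0.
  apply: (@poly_superposition R n p q s t alpha beta nu P) => //; last 2 first.
  - by rewrite N0 ltW.
  - by left.
  apply: Or32; split; first by rewrite mulrC -ler_pdivlMr// ge_min lexx.
  rewrite -/a -/b invfM mulrA ltr_pdivlMr// mulrC -ltr_pdivlMr//.
  have h : nu <= b / s / (a / q) / 2 by rewrite ge_min lexx orbT.
  have : 0 < b / s / (a / q) by rewrite divr_gt0.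
  lra.
set N : R := ((size P).-1)%:R in H1 H2 H3; have NR : 0 < N by rewrite ltr0n.
apply: (@poly_superposition R n p q s t alpha beta N P) => //; last by right.
rewrite growth_degreeE// in H1; rewrite shell_degreeE in H2 H3.
have bsN : (beta + n.+2%:R) / (s * N) = b / s / N by rewrite invfM mulrA.
(* Equality of the area exponents reads N s a = q b, so q <= s N is equivalent to a <= b. *)
have crit : alpha <= beta -> N * (a / q) = b / s -> q <= s * N.
  move=> ab E; have ab' : a <= b by rewrite lerD2r.
  have E' : N * s * a = q * b.
    exact: cross_mul E.
  rewrite -(ler_pM2r a0) [s * N]mulrC E' ler_pM2l//.
rewrite /emb_cond bsN -/a -/m.
rewrite [N <= _]ler_pdivlMr// in H2; rewrite [N < _]ltr_pdivlMr// in H3.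
rewrite -(mulrA p) -(mulrA t) in H1 H2 H3.
move: (a / q) a_q (b / s) b_s H1 H2 H3 crit => A A0 B B0 H1 H2 H3 crit {bsN}.
have weak : t * B <= p * A -> N * A <= B.
  by move=> h; have [ab|ab] := leP alpha beta; [exact: H2|exact/ltW/H3].
have [pT|pT] := ltP p (t * N).
  (* Only case (i) is possible here: p A >= t B would give N A <= B, hence p A < t N A <= t B. *)
  apply: Or31; split => //; have [h|h] := ltP (p * A) (t * B); last first.
    exfalso; have h1 : p * A < t * N * A by rewrite ltr_pM2r.
    have := ler_wpM2l (ltW t0) (weak h); lra.
  rewrite invfM mulrA -mulrDl ler_pdivlMr// mulrC addrC; exact: H1.
(* Now t N <= p. In case (i), t N A <= p A < t B already yields N A < B; otherwise (ii) or (iii) is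
   used directly. *)
have [h|h] := ltP (p * A) (t * B).
  apply: Or32; split => //; rewrite ltr_pdivlMr//.
  have : t * (N * A) < t * B by apply: le_lt_trans h; rewrite mulrA ler_pM2r.
  by rewrite ltr_pM2l// mulrC.
have [ab|ab] := leP alpha beta; last first.
  by apply: Or32; split => //; rewrite ltr_pdivlMr// mulrC H3.
have := H2 h ab; rewrite le_eqVlt => /orP[/eqP E|lt].
  by apply: Or33; split => //; [rewrite -E mulrC mulKf// gt_eqF|exact: crit].
by apply: Or32; split => //; rewrite ltr_pdivlMr// mulrC.
Qed.

Lemma degree_condition_necessary (phi : cplx R -> cplx R) :
  HT_maps p q alpha t s beta (@superposition R n.+1 phi) ->
  exists2 P : {poly cplx R}, phi = horner P & degree_condition ((size P).-1)%:R.
Proof.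
move=> maps; have [P HP] := HT_maps_polynomial p0 q0 a0 t0 s0 b0 maps.
have phiE : phi = horner P by apply/funext.
exists P => //; have growth := HT_maps_degree p0 q0 a0 t0 s0 b0 maps HP.
rewrite phiE in maps.
rewrite /degree_condition growth_degreeE// shell_degreeE.
have q_a : 0 < b / s / (a / q) by rewrite divr_gt0.
have [N0|N0] := posnP (size P).-1; first by rewrite N0 in growth *; split=> // _ _; exact: ltW.
have [h1 h2] := HT_maps_shell_degree p0 q0 a0 t0 s0 b0 maps N0.
set N : R := ((size P).-1)%:R in growth h1 h2 *.
rewrite -/a -/b in h1 h2.
split=> // _ ab; first by rewrite ler_pdivlMr.
(* Equality of the area exponents would give N s a = q b < q a when beta < alpha, hence N s < q,
   against the second half of [HT_maps_shell_degree]. *)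
rewrite ltr_pdivlMr// lt_neqAle h1 andbT; apply/eqP => E; have := h2 E; apply/negP; rewrite -ltNge.
have E' : N * s * a = q * b.
  exact: cross_mul E.
by rewrite -(ltr_pM2r a0) E' ltr_pM2l// ltrD2r.
Qed.

End superposition_characterization.
Unset Implicit Arguments.

Theorem theorem1p3 (R : realType) (n : nat) (p q s t alpha beta : R)
    (phi : cplx R -> cplx R)
    (n_ge1 : (1 <= n)%N)
    (p_gt0 : 0 < p) (q_gt0 : 0 < q) (s_gt0 : 0 < s) (t_gt0 : 0 < t)
    (alpha_gt : - n%:R - 1 < alpha) (beta_gt : - n%:R - 1 < beta) :
  (HT_maps p q alpha t s beta (@superposition R n phi) <->
   exists P : {poly cplx R}, (forall z, phi z = P.[z]) /\
     let N : R := ((size P).-1)%:R in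
     [/\ p * (n%:R + 1 + alpha) / q < t * (n%:R + 1 + beta) / s ->
           N <= p * q * (t * (n%:R + 1 + beta) + n%:R * s)
                / (s * t * (p * (n%:R + 1 + alpha) + n%:R * q)),
         p * (n%:R + 1 + alpha) / q >= t * (n%:R + 1 + beta) / s ->
         alpha <= beta ->
           N <= q * (n%:R + 1 + beta) / (s * (n%:R + 1 + alpha)) &
         p * (n%:R + 1 + alpha) / q >= t * (n%:R + 1 + beta) / s ->
         alpha > beta ->
           N < q * (n%:R + 1 + beta) / (s * (n%:R + 1 + alpha))]) /\
  (HT_maps p q alpha t s beta (@superposition R n phi) ->
   HT_bounded_op p q alpha t s beta (@superposition R n phi) /\
   HT_continuous_op p q alpha t s beta (@superposition R n phi)).
Proof.
case: n n_ge1 alpha_gt beta_gt => // n _.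
have E x : n.+1%:R + 1 + x = x + n.+2%:R by rewrite natr1 addrC.
move=> alpha_gt beta_gt; rewrite !E.
have a0 : 0 < alpha + n.+2%:R by rewrite -E; lra.
have b0 : 0 < beta + n.+2%:R by rewrite -E; lra.
split; first split => [maps|[P [/funext -> cond]]].
- have [P phiE cond] := degree_condition_necessary p_gt0 q_gt0 s_gt0 t_gt0 a0 b0 maps.
  by exists P; split=> // z; rewrite phiE.
- by have [] := degree_condition_sufficient p_gt0 q_gt0 s_gt0 t_gt0 a0 b0 cond.
move=> maps; have [P -> cond] := degree_condition_necessary p_gt0 q_gt0 s_gt0 t_gt0 a0 b0 maps.
by have [] := degree_condition_sufficient p_gt0 q_gt0 s_gt0 t_gt0 a0 b0 cond.
Qed.
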